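(* For all real $p,q\ge 2$ there is a constant $C(p,q)$ depending only on $p$ and $q$ such that the following holds. Let $m\ge 2$ and $n\ge 1$ be integers, let $Y_1,\dots,Y_m$ be i.i.d. isotropic log-concave random vectors in $\mathbb{R}^n$, let $A=(A_{ij})$ be a deterministic real $m\times n$ matrix, and let $X$ be the $m\times n$ random matrix with entries $X_{ij}=A_{ij}Y_{ij}$, where $Y_{ij}$ is the $j$-th coordinate of $Y_i$. Then $$\mathbb{E}\|X\|_{p',q}\le C(p,q)\Bigl[(\log m)^{1/q}\max_{1\le i\le m}\|A_i\|_p+\max_{1\le j\le n}\|A^{(j)}\|_q+(\log m)^{1+\frac1q}\,\mathbb{E}\max_{1\le i\le m,\,1\le j\le n}|X_{ij}|\Bigr].$$
   Context: A random vector $Z$ in $\mathbb{R}^d$ is log-concave if $\mathbb{P}(Z\in\lambda K+(1-\lambda)L)\ge\mathbb{P}(Z\in K)^{\lambda}\mathbb{P}(Z\in L)^{1-\lambda}$ for all nonempty compact $K,L\subset\mathbb{R}^d$ and $\lambda\in[0,1]$. It is isotropic if $\mathbb{E}Z=0$ and $\operatorname{Cov}Z=\mathrm{Id}$. For $x\in\mathbb{R}^d$, $\|x\|_r=(\sum_i|x_i|^r)^{1/r}$. $A_i\in\mathbb{R}^n$ denotes the $i$-th row and $A^{(j)}\in\mathbb{R}^m$ the $j$-th column of the $m\times n$ matrix $A$. $p'$ is the Hölder conjugate of $p$, $\frac1p+\frac1{p'}=1$. $\|X\|_{p',q}=\sup\{\|Xt\|_q:\ t\in\mathbb{R}^n,\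 \|t\|_{p'}\le1\}$ is the operator norm from $\ell_{p'}^n$ to $\ell_q^m$. *)

(* Defs.v *)
From HB Require Import structures.
From mathcomp Require Import all_boot all_order all_algebra.
From mathcomp Require Import all_classical all_reals all_analysis.

Set Implicit Arguments.
Unset Strict Implicit.
Unset Printing Implicit Defensive.

Import Order.TTheory GRing.Theory Num.Theory.
Import numFieldNormedType.Exports.

Local Open Scope classical_set_scope.
Local Open Scope ring_scope.

(* R^n is 'rV[R]_n, equipped with its Borel sigma-algebra. *)
Notation borel_rV R n := (g_sigma_algebraType (@open 'rV[R]_n)).

Section random_vectors.
Context {R : realType} {d : measure_display} {T : measurableType d}.
Variable P : probability T R.

Definition coord n (Z : T -> 'rV[R]_n) (j : 'I_n) : T -> R :=
  fun w => Z w 0 j.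

Definition log_concave n (Z : {RV P >-> borel_rV R n}) : Prop :=
  forall (K L : set 'rV[R]_n) (lam : R),
    compact K -> compact L -> K !=set0 -> L !=set0 -> 0 <= lam <= 1 ->
    (distribution P Z K `^ lam * distribution P Z L `^ (1 - lam) <=
     distribution P Z
       [set lam *: x + (1 - lam) *: y | x in K & y in L]%R)%E.

Definition isotropic n (Z : {RV P >-> borel_rV R n}) : Prop :=
  (forall j, 'E_P[coord Z j] = 0)%E /\
  (forall j k, covariance P (coord Z j) (coord Z k) = ((j == k)%:R)%:E).

Definition identically_distributed m n (Y : 'I_m -> {RV P >-> borel_rV R n}) :
    Prop :=
  forall (i k : 'I_m) (B : set (borel_rV R n)), measurable B ->
    distribution P (Y i) B = distribution P (Y k) B.

Definition independent m n (Y : 'I_m -> {RV P >-> borel_rV R n}) : Prop :=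
  forall (I : {set 'I_m}) (B : 'I_m -> set (borel_rV R n)),
    (forall i, measurable (B i)) ->
    P (\bigcap_(i in [set` I]) (Y i @^-1` B i)) =
    (\prod_(i in I) P (Y i @^-1` B i))%E.

Definition weighted_matrix m n (A : 'M[R]_(m, n))
    (Y : 'I_m -> {RV P >-> borel_rV R n}) (w : T) : 'M[R]_(m, n) :=
  \matrix_(i, j) (A i j * coord (Y i) j w).

End random_vectors.

Definition lnorm (R : realType) (r : R) n (x : 'rV[R]_n) : R :=
  (\sum_(i < n) `|x 0 i| `^ r) `^ r^-1.

(* Norm of X : l_r^n -> l_s^m. As vectors are rows, X t is t *m X^T. *)
Definition opnorm (R : realType) (r s : R) m n (X : 'M[R]_(m, n)) : R :=
  sup [set lnorm s (t *m X^T) | t in [set t : 'rV[R]_n | lnorm r t <= 1]].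

(* The maxima below are over nonnegative reals, so 0 is a neutral default. *)
Definition max_row_lnorm (R : realType) (r : R) m n (A : 'M[R]_(m, n)) : R :=
  \big[Num.max/0]_(i < m) lnorm r (row i A).

Definition max_col_lnorm (R : realType) (r : R) m n (A : 'M[R]_(m, n)) : R :=
  \big[Num.max/0]_(j < n) lnorm r (col j A)^T.

Definition max_entry (R : realType) m n (A : 'M[R]_(m, n)) : R :=
  \big[Num.max/0]_(ij : 'I_m * 'I_n) `|A ij.1 ij.2|.

(* Main.v *)
(** Let F(t) be the sum over i of |<X_i, t>|^q, X_i the rows of X, and kappa the maximum of the
    norms ||X_i||_p. Up to a constant ||X||_{p',q}^q is the maximum of F over a finite subset of
    the unit ball of l_{p'}.

    Symmetrization. Take an independent copy of X and exchange the two copies of each row at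
    random. With the rows frozen, every t in the ball is predicted on all rows by a p-norm
    perceptron after few updates (2-smoothness of the p-norm); the predictors are therefore
    indexed by few update sequences, and a union bound gives
    E max F <= C (max_t E F(t) + log m E kappa^q). By moment comparison E F(t) is at most
    C max_j ||A^(j)||_q^q.

    Row norms. Paouris' inequality E (sum_J Y_j^2)^s <= (C (|J| + s^2))^s bounds the conditional
    variances of the coordinates on events of probability at least e^-s. If the event
    E = {sum_j |a_j Y_j|^p >= tau} were too likely, restricting successively to half-spaces on
    which one coordinate is large would increase the conditional probability of E beyond 1.
    Hence ||a Y||_p <= C (||a||_p + r max_j |a_j|) outside an event of probability e^-r, and
    max_j |a_j| is at most C E max |X_ij|.

    Paouris' inequality. Project Y by a random sign matrix to dimension s. By concentration on
    the cube the moments of order 2s of all one-dimensional marginals of the projection are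
    comparable. If they were large, the points around which the projection has a fixed mass
    would, by log-concavity, be dense in a large ball, and there would be too many disjoint
    cells of fixed mass. *)

Require Import Defs.
From HB Require Import structures.
From mathcomp Require Import all_boot all_order all_algebra.
From mathcomp Require Import all_classical all_reals all_analysis.
From mathcomp Require Import measurable_realfun ring lra zify.

Set Implicit Arguments.
Unset Strict Implicit.
Unset Printing Implicit Defensive.

Import Order.TTheory GRing.Theory Num.Theory.
Import numFieldNormedType.Exports.

Local Open Scope classical_set_scope.
Local Open Scope ring_scope.

(** * Real powers *)

Section sums.
Context {R : realType}.
Implicit Types x y a b p q : R.

(** A union bound over a net of the ball of l_{p'} would cost its dimension. An update sequence
    costs only its length times the logarithm of an alphabet of size 4 m (m + 1), and the lengths
    needed at the scales 2^-k, weighted by 4^-k, have a bounded sum. Since q >= 2, the level set at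
    height 2^-k, of weight 2^(-q k), can pay for them, and the finite subset of the ball may be as
    fine as desired. As [kappa] is of order max ||A_i||_p + log m max |A_ij|, the q-th root of log m
    kappa^q gives both powers of log m in the statement.

    Half-spaces keep the conditioning sets convex, which is what allows Borell's lemma to be used
    conditionally.

    In Paouris' inequality lattice points are counted instead of volume. The radius M of density and
    the cut-off radius b are both proportional to the quantity x to be bounded. Points of mass th
    arise by averaging with the origin with weight 1/4, so th is of order b^(-k/4) and there are
    about b^(k/2) pairs of cells. Hence M <= C b^(1/2), which bounds x; weight 1/2 would only give M
    <= C b. *)

Lemma expR_le_inv x : x < 1 -> expR x <= (1 - x)^-1.
Proof.
move=> x1; rewrite -[x in expR x]opprK expRN lef_pV2 ?posrE ?expR_gt0//; last lra.
by have := expR_ge1Dx (- x).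
Qed.

Lemma powR_amgm (th a b : R) : 0 <= a -> 0 <= b -> 0 < th < 1 ->
  a `^ th * b `^ (1 - th) <= th * a + (1 - th) * b.
Proof.
move=> a0 b0 /andP[t0 t1].
have := @conjugate_powR R (a `^ th) (b `^ (1 - th)) th^-1 (1 - th)^-1
  (powR_ge0 _ _) (powR_ge0 _ _).
have t1' : 0 < 1 - th by lra.
rewrite !invr_gt0 t0 t1' !invrK => /(_ erefl erefl) /(_ _)/wrap[]; first lra.
rewrite -!powRrM mulfV ?gt_eqF// mulfV ?gt_eqF// !powRr1// => h.
by apply: (le_trans h); rewrite mulrC [_ * (1 - th)]mulrC.
Qed.

(** Weighted AM-GM for [u] and 1. *)
Lemma powR_bernoulli (al u : R) : 0 <= u -> 0 < al <= 1 -> u `^ al <= 1 + al * (u - 1).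
Proof.
move=> u0 /andP[a0]; rewrite le_eqVlt => /predU1P[->|a1].
  by rewrite powRr1//; lra.
have := @powR_amgm al u 1 u0 ler01; rewrite a0 a1 powR1 mulr1 => /(_ isT); lra.
Qed.

Lemma ler_powRl (r x y : R) : 0 <= r -> 0 <= x -> x <= y -> x `^ r <= y `^ r.
Proof.
by move=> r0 x0 xy; apply: ge0_ler_powR; rewrite ?nnegrE// (le_trans x0).
Qed.

Lemma eq_ler (x y : R) : x = y -> x <= y.
Proof. by move->. Qed.

Lemma powR_expR (x y : R) : 0 < x -> x `^ y = expR (y * ln x).
Proof. by move=> x0; rewrite /powR gt_eqF. Qed.

Lemma powR_1l (y : R) : 1 `^ y = 1 :> R.
Proof. by rewrite powR1. Qed.

Lemma hoelder_sum (I : finType) (a b : I -> R) (p q : R) : 0 < p -> 0 < q ->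
  p^-1 + q^-1 = 1 -> (forall i, 0 <= a i) -> (forall i, 0 <= b i) ->
  \sum_i a i * b i <= (\sum_i a i `^ p) `^ p^-1 * (\sum_i b i `^ q) `^ q^-1.
Proof.
move=> p0 q0 pq a0 b0.
set A := \sum_i a i `^ p; set B := \sum_i b i `^ q.
have A0 : 0 <= A by apply: sumr_ge0 => i _; exact: powR_ge0.
have B0 : 0 <= B by apply: sumr_ge0 => i _; exact: powR_ge0.
have z (c : I -> R) (r : R) : 0 < r -> (forall i, 0 <= c i) ->
    \sum_i c i `^ r = 0 -> forall i, c i = 0.
  move=> r0 c0 /eqP; rewrite psumr_eq0 => [/allP h i|i _]; last exact: powR_ge0.
  by have := h i (mem_index_enum _) => /eqP/powR_eq0_eq0.
have [A1|A1] := eqVneq A 0.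
  rewrite big1 => [|i _]; first by rewrite mulr_ge0 ?powR_ge0.
  by rewrite (z a p) ?mul0r.
have [B1|B1] := eqVneq B 0.
  rewrite big1 => [|i _]; first by rewrite mulr_ge0 ?powR_ge0.
  by rewrite (z b q) ?mulr0.
have {}A0 : 0 < A by rewrite lt_def A1 A0.
have {}B0 : 0 < B by rewrite lt_def B1 B0.
have A2 : 0 < A `^ p^-1 by exact: powR_gt0.
have B2 : 0 < B `^ q^-1 by exact: powR_gt0.
have AE : \sum_i a i `^ p = A by [].
have BE : \sum_i b i `^ q = B by [].
clearbody A B.
rewrite -[leRHS]mul1r -ler_pdivrMr; last exact: mulr_gt0.
rewrite mulr_suml.
have E c C r : 0 <= c -> 0 < C -> 0 < r -> (c / C `^ r^-1) `^ r = c `^ r / C.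
  move=> c0 C0 r0; rewrite powRM ?invr_ge0 ?powR_ge0// -powRN -powRrM mulNr.
  by rewrite mulVf ?gt_eqF// powRN powRr1 ?ltW.
apply: (@le_trans _ _ (\sum_i (p^-1 * (a i `^ p / A) + q^-1 * (b i `^ q / B)))).
  apply: ler_sum => i _.
  rewrite invfM mulrACA.
  have := @conjugate_powR R (a i / A `^ p^-1) (b i / B `^ q^-1) p q.
  rewrite !divr_ge0 ?powR_ge0// => /(_ isT isT p0 q0 pq) h; apply: (le_trans h).
  rewrite !E//.
  by rewrite mulrC [_ / q]mulrC.
rewrite big_split/= -!mulr_sumr -!mulr_suml AE BE mulfV// mulfV// !mulr1 pq.
by [].
Qed.

Lemma powR_addl (a b q : R) : 0 <= a -> 0 <= b -> 1 <= q ->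
  (a + b) `^ q <= 2 `^ q * (a `^ q + b `^ q).
Proof.
move=> a0 b0 q1.
wlog ab : a b a0 b0 / a <= b.
  by move=> h; have [/h->//|/ltW/h] := leP a b; rewrite addrC [b `^ q + _]addrC; apply.
apply: (@le_trans _ _ ((2 * b) `^ q)).
  by apply: ge0_ler_powR; rewrite ?nnegrE; lra.
by rewrite powRM//; apply: ler_wpM2l; rewrite ?powR_ge0// lerDr powR_ge0.
Qed.

Lemma ln_le_subr1 x : 0 < x -> ln x <= x - 1.
Proof. by move=> x0; have := expR_ge1Dx (ln x); rewrite lnK ?posrE//; lra. Qed.

Lemma ln2_ge_half : 1 / 2 <= ln 2 :> R.
Proof.
rewrite -ler_expR lnK ?posrE//; apply: (le_trans (expR_le_inv _)); first lra.
by apply: eq_ler; field.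
Qed.

Lemma ln_ge_half (m : nat) : (2 <= m)%N -> 1 <= 2 * ln m%:R :> R.
Proof.
move=> m2; have h := ln2_ge_half.
have : ln 2 <= ln m%:R :> R by rewrite ler_ln ?posrE ?ltr0n ?(leq_trans _ m2)// ler_nat.
by lra.
Qed.

End sums.

Local Opaque powR.

(* Locked because conversion tests that unfold [powR] are expensive. *)
HB.lock Definition nrm (R : realType) (p : R) (I : finType) (y : I -> R) : R :=
  (\sum_i `|y i| `^ p) `^ p^-1.

(** * The p-norm and the 2-smoothness of its square *)

Section smooth.
Context {R : realType}.
Implicit Types (p : R).

Lemma nrmE p (I : finType) (y : I -> R) : nrm p y = (\sum_i `|y i| `^ p) `^ p^-1.
Proof. by rewrite nrm.unlock. Qed.

Lemma nrm_ge0 p (I : finType) (y : I -> R) : 0 <= nrm p y.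
Proof. by rewrite nrmE powR_ge0. Qed.

Lemma sum_powR_ge0 p (I : finType) (y : I -> R) : 0 <= \sum_i `|y i| `^ p.
Proof. by apply: sumr_ge0 => i _; exact: powR_ge0. Qed.

Lemma nrm_powR p (I : finType) (y : I -> R) : 0 < p -> nrm p y `^ p = \sum_i `|y i| `^ p.
Proof. by move=> p0; rewrite nrmE -powRrM mulVf ?gt_eqF// powRr1// sum_powR_ge0. Qed.

Lemma nrm_eq0 p (I : finType) (y : I -> R) : 0 < p -> nrm p y = 0 -> forall i, y i = 0.
Proof.
move=> p0; rewrite nrmE => /powR_eq0_eq0 /eqP; rewrite psumr_eq0 => [/allP h i|i _]; last exact: powR_ge0.
by have := h i (mem_index_enum _) => /eqP/powR_eq0_eq0/normr0P/eqP.
Qed.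

Lemma nrm_hoelder p p' (I : finType) (y t : I -> R) : 0 < p -> 0 < p' ->
  p^-1 + p'^-1 = 1 -> `|\sum_i y i * t i| <= nrm p y * nrm p' t.
Proof.
move=> p0 p0' pp; apply: (le_trans (ler_norm_sum _ _ _)).
under eq_bigr do rewrite normrM.
rewrite !nrmE; exact: hoelder_sum.
Qed.

(* Split at [|p b| = 1/2]: below, use [exp x <= 1/(1-x)]; above, [|b|^p] dominates. *)
Lemma powR_taylor2_1 p (b : R) : 2 <= p ->
  `|1 + b| `^ p <= 1 + p * b + ((2 * p + 1) `^ p + 2 * p ^+ 2) * (b ^+ 2 + `|b| `^ p).
Proof.
move=> p2; set C1 := (2 * p + 1) `^ p.
have C10 : 0 <= C1 by exact: powR_ge0.
have [pb|pb] := leP (`|p * b|) (1 / 2).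
  have pb2 : -(1/2) <= p * b <= 1/2 by rewrite -ler_norml.
  have b2 : -(1/2) <= b <= 1/2.
    rewrite -ler_norml; apply: le_trans pb; rewrite normrM ler_peMl//.
    by apply: le_trans (ler_norm _); lra.
  rewrite ger0_norm; last lra.
  have -> : (1 + b) `^ p = expR (p * ln (1 + b)) by apply: powR_expR; lra.
  have h1 : expR (p * ln (1 + b)) <= expR (p * b).
    by rewrite ler_expR ler_wpM2l//; [lra|have := @ln_le_subr1 R (1 + b); lra].
  apply: (le_trans h1).
  have h2 : expR (p * b) <= (1 - p * b)^-1 by apply: expR_le_inv; lra.
  apply: (le_trans h2).
  apply: (@le_trans _ _ (1 + p * b + 2 * (p * b) ^+ 2)).
    rewrite -[leLHS]mul1r ler_pdivrMr; last lra.
    by rewrite expr2; nra.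
  rewrite lerD2l exprMn mulrA.
  apply: (@le_trans _ _ ((C1 + 2 * p ^+ 2) * b ^+ 2)).
    by rewrite ler_wpM2r ?sqr_ge0//; lra.
  rewrite ler_wpM2l//; last by rewrite lerDl powR_ge0.
  by rewrite addr_ge0// mulr_ge0// sqr_ge0.
have pb' : 1 / 2 < p * `|b| by move: pb; rewrite normrM ger0_norm//; lra.
have b0 : 0 < `|b|.
  have p0 : 0 < p by lra.
  by rewrite -(pmulr_rgt0 _ p0); lra.
have h1 : `|1 + b| `^ p <= C1 * `|b| `^ p.
  rewrite /C1 -powRM//; last lra.
  apply: ge0_ler_powR; rewrite ?nnegrE ?mulr_ge0//; try lra.
  by apply: (le_trans (ler_normD _ _)); rewrite normr1; lra.
apply: (le_trans h1).
have h2 : 0 <= 1 + p * b + 2 * p ^+ 2 * b ^+ 2.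
  rewrite (_ : _ + _ = (4 * (p * b) + 1) ^+ 2 / 8 + 7 / 8); last by field.
  by rewrite addr_ge0 ?divr_ge0 ?sqr_ge0.
have h4 : 0 <= `|b| `^ p by exact: powR_ge0.
have h5 : 0 <= b ^+ 2 by exact: sqr_ge0.
have h6 : 0 <= p ^+ 2 by exact: sqr_ge0.
by nra.
Qed.

(** By homogeneity: factor out [a] and apply the case [a = 1] to [b / a]. *)
Lemma powR_taylor2 p (a b : R) : 2 <= p ->
  `|a + b| `^ p <= `|a| `^ p + p * (`|a| `^ (p - 2) * a * b)
      + ((2 * p + 1) `^ p + 2 * p ^+ 2) * (`|a| `^ (p - 2) * b ^+ 2 + `|b| `^ p).
Proof.
move=> p2; set C := _ + 2 * _.
have C1 : 1 <= C.
  have : 0 <= (2 * p + 1) `^ p by exact: powR_ge0.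
  have h4 : 4 <= p ^+ 2 by rewrite expr2; nra.
  by rewrite /C; lra.
have [->|a0] := eqVneq a 0.
  rewrite add0r normr0 powR0 ?gt_eqF//; last lra.
  rewrite mulr0 mul0r mulr0 !add0r.
  have h : 0 <= 0 `^ (p - 2) * b ^+ 2 by rewrite mulr_ge0 ?powR_ge0 ?sqr_ge0.
  have h' : 0 <= `|b| `^ p by exact: powR_ge0.
  by nra.
have an : 0 < `|a| by rewrite normr_gt0.
have E : `|a| `^ p = `|a| `^ (p - 2) * a ^+ 2.
  rewrite -[a ^+ 2]real_normK ?num_real// -powR_mulrn// -powRD; first by congr powR; lra.
  by rewrite (gt_eqF an) implybT.
have -> : a + b = a * (1 + b / a) by field.
rewrite normrM powRM//.
apply: (le_trans (ler_wpM2l (powR_ge0 _ _) (powR_taylor2_1 (b / a) p2))).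
rewrite -/C normrM powRM// normfV.
have F : `|a| `^ p * (`|a|^-1 `^ p) = 1.
  by rewrite -powRM ?invr_ge0// mulfV ?gt_eqF// powR1.
rewrite mulrDr mulrDr mulr1 !mulrDr lerD//; last first.
  rewrite lerD//.
    by rewrite E le_eqVlt; apply/orP; left; apply/eqP; field.
  rewrite le_eqVlt; apply/orP; left; apply/eqP.
  transitivity (C * `|b| `^ p * (`|a| `^ p * (`|a|^-1 `^ p))); first by ring.
  by rewrite F mulr1.
by rewrite lerD2l E le_eqVlt; apply/orP; left; apply/eqP; field.
Qed.

(** The gradient at [y] of half the square of the p-norm. *)
Definition dual_map p (I : finType) (y : I -> R) i :=
  nrm p y `^ (2 - p) * `|y i| `^ (p - 2) * y i.

Lemma sum_pow1 p (I : finType) (y h : I -> R) : 2 <= p ->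
  \sum_i `|y i| `^ (p - 1) * `|h i| <= nrm p y `^ (p - 1) * nrm p h.
Proof.
move=> p2.
have q0 : 0 < p / (p - 1) by rewrite divr_gt0//; lra.
have p0 : 0 < p by lra.
have E0 : (p / (p - 1))^-1 + p^-1 = 1 by field; lra.
have E1 : (p - 1) * (p / (p - 1)) = p by field; lra.
have E2 : (p / (p - 1))^-1 = p^-1 * (p - 1) by field; lra.
rewrite !nrmE; apply: (le_trans (hoelder_sum q0 p0 E0 (fun i => powR_ge0 _ _) (fun i => normr_ge0 _))).
apply: ler_wpM2r; first exact: powR_ge0.
under eq_bigr do rewrite -powRrM E1.
by rewrite -powRrM E2.
Qed.

Lemma sum_pow2 p (I : finType) (y h : I -> R) : 2 <= p ->
  \sum_i `|y i| `^ (p - 2) * (h i) ^+ 2 <= nrm p y `^ (p - 2) * nrm p h ^+ 2.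
Proof.
move=> p2'; have [<-|p2n] := eqVneq 2 p.
  rewrite subrr powRr0 mul1r !nrmE -powR_mulrn ?powR_ge0// -powRrM mulVf// powRr1; last first.
    exact: sum_powR_ge0.
  by apply: ler_sum => i _; rewrite powRr0 mul1r powR_mulrn// real_normK ?num_real.
have p2 : 2 < p by rewrite lt_def eq_sym p2n.
have q0 : 0 < p / (p - 2) by rewrite divr_gt0//; lra.
have p0 : 0 < p / 2 by lra.
have E0 : (p / (p - 2))^-1 + (p / 2)^-1 = 1 by field; lra.
have E1 : (p - 2) * (p / (p - 2)) = p by field; lra.
have E2 : (p / (p - 2))^-1 = p^-1 * (p - 2) by field; lra.
have E3 : 2 * (p / 2) = p by lra.
have E4 : (p / 2)^-1 = p^-1 * 2 by field; lra.
rewrite !nrmE; apply: (le_trans (hoelder_sum q0 p0 E0 (fun i => powR_ge0 _ _) (fun i => sqr_ge0 _))).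
rewrite le_eqVlt; apply/orP; left; apply/eqP.
congr (_ * _).
  under eq_bigr do rewrite -powRrM E1.
  by rewrite -powRrM E2.
under eq_bigr => i _ do rewrite -[h i ^+ 2]real_normK ?num_real// -powR_mulrn// -powRrM E3.
by rewrite -powR_mulrn ?powR_ge0// -powRrM E4.
Qed.

Lemma dual_map_le p (I : finType) (y h : I -> R) : 2 <= p ->
  `|\sum_i dual_map p y i * h i| <= nrm p y * nrm p h.
Proof.
move=> p2; have [y0|y0] := eqVneq (nrm p y) 0.
  rewrite y0 mul0r big1 ?normr0// => i _.
  by rewrite /dual_map (nrm_eq0 _ y0) ?mulr0 ?mul0r//; lra.
have yp : 0 < nrm p y by rewrite lt_def y0 nrm_ge0.
apply: (le_trans (ler_norm_sum _ _ _)).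
apply: (@le_trans _ _ (nrm p y `^ (2 - p) * (\sum_i `|y i| `^ (p - 1) * `|h i|))).
  rewrite mulr_sumr; apply: ler_sum => i _.
  rewrite /dual_map !normrM !(ger0_norm (powR_ge0 _ _)) -!mulrA ler_wpM2l ?powR_ge0//.
  rewrite mulrA ler_wpM2r//.
  rewrite -(@mulr_powRB1 _ _ (p - 1)) ?normr_ge0//; last lra.
  by rewrite mulrC (_ : p - 1 - 1 = p - 2)//; lra.
apply: (le_trans (ler_wpM2l (powR_ge0 _ _) (sum_pow1 y h p2))).
rewrite mulrA -powRD; last by rewrite y0 implybT.
by rewrite (_ : 2 - p + (p - 1) = 1) ?powRr1 ?nrm_ge0//; lra.
Qed.

(** The summands serve the two cases of [nrm_smooth]: 18 = 16 + 2 when [h] is longer than [y], and 4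
    times the constant of [powR_taylor2] otherwise. *)
Definition smooth_cst p : R := 18 + 4 * ((2 * p + 1) `^ p + 2 * p ^+ 2).

Lemma smooth_cst_gt0 p : 2 <= p -> 0 < smooth_cst p.
Proof.
move=> p2; have h1 : 0 <= (2 * p + 1) `^ p by exact: powR_ge0.
have h2 : 0 <= p ^+ 2 by exact: sqr_ge0.
by rewrite /smooth_cst; lra.
Qed.

(** Summing [powR_taylor2] over the coordinates expands the p-th power of the norm, with a remainder
    controlled by [sum_pow2]; the exponent [2 / p <= 1] is then applied through Bernoulli's
    inequality. *)
Lemma nrm_smooth p (I : finType) (y h : I -> R) : 2 <= p ->
  nrm p (y \+ h) ^+ 2 <=
  nrm p y ^+ 2 + 2 * (\sum_i dual_map p y i * h i) + smooth_cst p * nrm p h ^+ 2.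
Proof.
move=> p2; have p0 : 0 < p by lra.
set K := (2 * p + 1) `^ p + 2 * p ^+ 2.
have K0 : 0 <= K by rewrite addr_ge0 ?powR_ge0// mulr_ge0 ?sqr_ge0.
have SC : smooth_cst p = 18 + 4 * K by [].
have TY (a b : R) : `|a + b| `^ p <= `|a| `^ p + p * (`|a| `^ (p - 2) * a * b)
      + K * (`|a| `^ (p - 2) * b ^+ 2 + `|b| `^ p) by exact: powR_taylor2.
clearbody K.
have C1 : 1 <= smooth_cst p by rewrite SC; move: K0; clear; lra.
have H2 : 0 <= nrm p h ^+ 2 by exact: sqr_ge0.
have [y0|y0] := eqVneq (nrm p y) 0.
  have yi := nrm_eq0 p0 y0.
  rewrite y0 expr0n/= add0r big1 => [|i _]; last by rewrite /dual_map yi mulr0 mul0r.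
  rewrite mulr0 add0r (_ : nrm p (y \+ h) = nrm p h).
    by rewrite ler_peMl.
  by rewrite !nrmE; congr powR; apply: eq_bigr => i _; rewrite /= yi add0r.
have yp : 0 < nrm p y by rewrite lt_def y0 nrm_ge0.
have dm := dual_map_le y h p2.
(* If [h] is longer than [y], a crude triangle inequality suffices: the squared norm of the sum is
   at most 16 times that of [h], and the linear term costs 2 more. *)
have [hy|hy] := ltP (nrm p y) (nrm p h).
  have h1 : nrm p (y \+ h) <= 4 * nrm p h.
    have E : nrm p (y \+ h) `^ p <= (4 * nrm p h) `^ p.
      rewrite nrm_powR// powRM ?nrm_ge0//.
      apply: (@le_trans _ _ (\sum_i 2 `^ p * (`|y i| `^ p + `|h i| `^ p))).
        apply: ler_sum => i _; apply: (@le_trans _ _ ((`|y i| + `|h i|) `^ p)).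
          apply: ler_powRl; [exact: ltW|exact: normr_ge0|exact: ler_normD].
        by apply: powR_addl => //; apply: le_trans p2; rewrite ler1n.
      rewrite -mulr_sumr big_split/= -!nrm_powR//.
      have -> : (4 : R) = 2 * 2 by clear; lra.
      rewrite powRM// -mulrA; apply: ler_wpM2l; first exact: powR_ge0.
      have h2 : nrm p y `^ p <= nrm p h `^ p.
        apply: ler_powRl; [exact: ltW|exact: nrm_ge0|exact: ltW].
      have h3 : 2 <= 2 `^ p :> R.
        by apply: le1r_powR; [rewrite ler1n|apply: le_trans p2; rewrite ler1n].
      have h4 : 0 <= nrm p h `^ p by exact: powR_ge0.
      by apply: le_trans (ler_wpM2r h4 h3); rewrite mulr_natl mulr2n lerD2r.
    rewrite leNgt; apply/negP => h2.
    have : (4 * nrm p h) `^ p < nrm p (y \+ h) `^ p.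
      by apply: gt0_ltr_powR; rewrite ?nnegrE ?mulr_ge0 ?nrm_ge0.
    by rewrite ltNge E.
  have h0 := nrm_ge0 p (y \+ h).
  move: dm; rewrite ler_norml => /andP[dm _].
  have C18 : 18 <= smooth_cst p by rewrite SC; move: K0; clear; lra.
  move: dm hy h1 h0 H2 C18 yp; clear.
  move: (\sum_i _) (nrm p (y \+ h)) (nrm p y) (nrm p h) (smooth_cst p) => s n1 n2 n3 c.
  move=> dm hy h1 h0 H2 C18 yp.
  rewrite !expr2 in H2 *.
  have : n1 * n1 <= 16 * (n3 * n3) by nra.
  have : n2 * n3 <= n3 * n3 by nra.
  have : 18 * (n3 * n3) <= c * (n3 * n3) by nra.
  have : 0 <= n2 * n2 by nra.
  by lra.
set S := \sum_i `|y i| `^ p.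
have SE : S = nrm p y `^ p by rewrite nrm_powR.
have Sp : 0 < S by rewrite SE; exact: powR_gt0.
set D := \sum_i `|y i| `^ (p - 2) * y i * h i.
set S' := \sum_i `|(y \+ h) i| `^ p.
have S'le : S' <= S + p * D + 2 * K * (nrm p y `^ (p - 2) * nrm p h ^+ 2).
  apply: (@le_trans _ _ (S + p * D + K * ((\sum_i `|y i| `^ (p - 2) * h i ^+ 2) + \sum_i `|h i| `^ p))).
    rewrite /S /D -big_split/= !mulr_sumr -!big_split/=; apply: ler_sum => i _.
    exact: TY.
  rewrite lerD2l [2 * K]mulrC -mulrA ler_wpM2l//.
  have h1 := sum_pow2 y h p2.
  have h2 : \sum_i `|h i| `^ p <= nrm p y `^ (p - 2) * nrm p h ^+ 2.
    apply: (le_trans (eq_ler (esym (nrm_powR h p0)))).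
    have [hn0|hn0] := eqVneq (nrm p h) 0.
      have -> : nrm p h `^ p = 0 by rewrite hn0 powR0// gt_eqF.
      exact: mulr_ge0 (powR_ge0 _ _) H2.
    have E : nrm p h `^ p = nrm p h `^ (p - 2) * nrm p h ^+ 2.
      rewrite -powR_mulrn; last exact: nrm_ge0.
      by rewrite -powRD; [rewrite subrK|rewrite hn0 implybT].
    apply: (le_trans (eq_ler E)); apply: ler_wpM2r; first exact: H2.
    by apply: ler_powRl; [rewrite subr_ge0|exact: nrm_ge0|exact: hy].
  by move: h1 h2; rewrite /=; clear; move: (\sum_i _) (\sum_i _) (_ * _) => u v w; lra.
have S'0 : 0 <= S' by exact: sum_powR_ge0.
have -> : nrm p (y \+ h) ^+ 2 = S' `^ (2 / p).
  by rewrite -powR_mulrn ?nrm_ge0// nrmE -powRrM mulrC.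
have N2 : S `^ (2 / p) = nrm p y ^+ 2.
  by rewrite -powR_mulrn ?nrm_ge0// nrmE -powRrM mulrC.
have -> : S' `^ (2 / p) = S `^ (2 / p) * (S' / S) `^ (2 / p).
  rewrite -powRM; [|exact: ltW|by rewrite divr_ge0// ltW].
  by congr powR; rewrite mulrC divfK// gt_eqF.
have be : (S' / S) `^ (2 / p) <= 1 + 2 / p * (S' / S - 1).
  apply: powR_bernoulli; first by rewrite divr_ge0// ltW.
  by rewrite divr_gt0// ler_pdivrMr// mul1r.
rewrite N2; apply: (le_trans (ler_wpM2l (sqr_ge0 _) be)).
have DE : \sum_i dual_map p y i * h i = nrm p y `^ (2 - p) * D.
  by rewrite /D mulr_sumr; apply: eq_bigr => i _; rewrite /dual_map !mulrA.
have SI : nrm p y ^+ 2 / S = nrm p y `^ (2 - p).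
  rewrite SE -powR_mulrn ?nrm_ge0// -powRN -powRD; first by [].
  by rewrite y0 implybT.
have PP : nrm p y `^ (2 - p) * nrm p y `^ (p - 2) = 1.
  rewrite -powRD; last by rewrite y0 implybT.
  by rewrite addrA subrK subrr powRr0.
apply: (@le_trans _ _ (nrm p y ^+ 2 + 2 / p * (nrm p y ^+ 2 / S * (p * D + 2 * K * (nrm p y `^ (p - 2) * nrm p h ^+ 2))))).
  rewrite mulrDr mulr1 lerD2l mulrCA ler_wpM2l ?divr_ge0 ?(ltW p0)//.
  rewrite -mulrA ler_wpM2l ?sqr_ge0//.
  rewrite lerBlDl [S^-1 * _]mulrC ler_pdivrMr// mulrDl mul1r divfK ?gt_eqF//.
  by rewrite addrA.
rewrite SI DE -[leRHS]addrA lerD2l mulrDr mulrDr.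
rewrite -/D; move: PP p0 p2 K0 H2; rewrite SC; clear.
move: (nrm p y `^ (2 - p)) (nrm p y `^ (p - 2)) (nrm p h ^+ 2) => u v w PP p0 p2 K0 w0.
have -> : 2 / p * (u * (p * D)) = 2 * (u * D) by field; rewrite gt_eqF.
rewrite lerD2l.
have -> : 2 / p * (u * (2 * K * (v * w))) = 4 * K / p * (u * v) * w.
  by field; rewrite gt_eqF.
rewrite PP mulr1 ler_wpM2r// ler_pdivrMr//; nra.
Qed.

End smooth.

(** The step length [d / (4 * K)] is the [eta] that maximizes the net gain: a prediction error of at
    least [d / 4] gains [eta * d / 4], and smoothness costs [K * eta ^ 2 / 2]. *)
Lemma potential_step_num (R : realType) (n1 n2 n3 a b c d sg K : R) : 0 < K -> 0 < d ->
  n3 ^+ 2 <= (d / (4 * K)) ^+ 2 -> d / 4 <= sg * (a - b) ->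
  n1 ^+ 2 <= n2 ^+ 2 + 2 * (sg * (d / (4 * K)) * b) + K * n3 ^+ 2 ->
  n1 ^+ 2 / 2 - (c + sg * (d / (4 * K)) * a) <= n2 ^+ 2 / 2 - c - d ^+ 2 / (32 * K).
Proof.
move=> K0 d0 nh v H.
have E1 : (d / (4 * K)) ^+ 2 = d ^+ 2 / (16 * K ^+ 2) by field; rewrite gt_eqF.
have h1 : K * n3 ^+ 2 <= d ^+ 2 / (16 * K).
  apply: (le_trans (ler_wpM2l (ltW K0) nh)); rewrite E1.
  by apply: eq_ler; field; rewrite gt_eqF.
have h2 : d ^+ 2 / (16 * K) <= sg * (d / (4 * K)) * a - sg * (d / (4 * K)) * b.
  have -> : sg * (d / (4 * K)) * a - sg * (d / (4 * K)) * b = d / (4 * K) * (sg * (a - b)).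
    by ring.
  have -> : d ^+ 2 / (16 * K) = d / (4 * K) * (d / 4) by field; rewrite gt_eqF.
  by rewrite ler_wpM2l// divr_ge0 ?mulr_ge0// ltW.
have -> : d ^+ 2 / (32 * K) = d ^+ 2 / (16 * K) / 2 by field; rewrite gt_eqF.
move: h1 h2 H; move: (d ^+ 2 / (16 * K)) (sg * (d / (4 * K)) * a) (sg * (d / (4 * K)) * b).
by move=> u v' w h1 h2 H; lra.
Qed.

(** * Prediction by a p-norm perceptron *)

Section perceptron.
Context {R : realType}.
Variables (p p' : R) (I J : finType) (K : nat) (x : I -> J -> R).
Hypotheses (p2 : 2 <= p) (pp' : p^-1 + p'^-1 = 1) (x1 : forall i, nrm p (x i) <= 1).

Definition dot (a b : J -> R) : R := \sum_j a j * b j.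
Definition del (k : nat) : R := 2^-1 ^+ k.

Lemma del_gt0 k : 0 < del k. Proof. by rewrite exprn_gt0. Qed.

Lemma delS k : del k.+1 = del k / 2. Proof. by rewrite /del exprS mulrC. Qed.

Notation update := (I * bool * 'I_K.+1)%type.
Notation C := (smooth_cst p).

Let p0 : 0 < p. Proof. by apply: lt_le_trans p2. Qed.

Lemma conj_gt0 : 0 < p'.
Proof.
have h : p'^-1 = 1 - p^-1 by rewrite -pp' addrC addKr.
by rewrite -invr_gt0 h subr_gt0 invf_lt1//; apply: lt_le_trans p2; rewrite ltr1n.
Qed.

Let C_gt0 : 0 < C. Proof. exact: smooth_cst_gt0. Qed.

(** [u.1.1] is the mispredicted row, [u.1.2] the sign of the error and [u.2] the scale at which it
    was detected. *)
Definition direction (u : update) : J -> R :=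
  fun j => (if u.1.2 then 1 else -1) * (del u.2 / (4 * C)) * x u.1.1 j.

Fixpoint state (s : seq update) : J -> R :=
  if s is u :: s' then state s' \+ direction u else fun=> 0.

Definition predictor (s : seq update) : J -> R := dual_map p (state s).

(** Up to a term depending on [t] only, the Fenchel-Young gap between the state and [t]; hence it is
    bounded below. *)
Definition potential (t : J -> R) s := nrm p (state s) ^+ 2 / 2 - dot (state s) t.

Definition weight (s : seq update) : R := \sum_(u <- s) del u.2 ^+ 2.

Lemma nrmZ (c : R) (y : J -> R) : nrm p (fun j => c * y j) = `|c| * nrm p y.
Proof.
rewrite !nrmE; under eq_bigr do rewrite normrM powRM//.
rewrite -mulr_sumr powRM ?powR_ge0//; last exact: sum_powR_ge0.
by rewrite -powRrM mulfV ?gt_eqF// powRr1.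
Qed.

Lemma dotDl a b t : dot (a \+ b) t = dot a t + dot b t.
Proof. by rewrite /dot -big_split/=; apply: eq_bigr => j _; rewrite mulrDl. Qed.

Lemma dotZl c a t : dot (fun j => c * a j) t = c * dot a t.
Proof. by rewrite /dot mulr_sumr; apply: eq_bigr => j _; rewrite mulrA. Qed.

Lemma dotC a b : dot a b = dot b a.
Proof. by apply: eq_bigr => j _; rewrite mulrC. Qed.

Lemma dot_le t i : nrm p' t <= 1 -> `|dot (x i) t| <= 1.
Proof.
move=> t1; apply: (le_trans (nrm_hoelder _ _ p0 conj_gt0 pp')).
rewrite -[leRHS]mulr1; apply: ler_pM; [exact: nrm_ge0|exact: nrm_ge0|exact: x1|exact: t1].
Qed.

Lemma potential_ge t s : nrm p' t <= 1 -> - (1 / 2) <= potential t s.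
Proof.
move=> t1; rewrite /potential.
have h : dot (state s) t <= nrm p (state s).
  apply: (le_trans (ler_norm _)); apply: (le_trans (nrm_hoelder _ _ p0 conj_gt0 pp')).
  by rewrite -[leRHS]mulr1 ler_wpM2l// nrm_ge0.
move: h; move: (dot _ _) (nrm _ _) => a b ab.
have : 0 <= (b - 1) ^+ 2 by exact: sqr_ge0.
by rewrite !expr2; lra.
Qed.

(** An update is made on a row whose prediction is wrong by at least [del k / 4], in the direction
    of the error; smoothness turns this into a decrease proportional to [del k ^ 2]. *)
Lemma potential_step t s i (e : bool) (k : 'I_K.+1) :
  del k / 4 <= (if e then 1 else -1) * (dot (x i) t - dot (x i) (predictor s)) ->
  potential t ((i, e, k) :: s) <= potential t s - del k ^+ 2 / (32 * C).
Proof.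
move=> v; rewrite /potential /=.
set h := direction (i, e, k).
have := nrm_smooth (state s) h p2.
have -> : \sum_j dual_map p (state s) j * h j = dot h (predictor s) by rewrite dotC.
rewrite dotDl.
set sg : R := (if e then 1 else -1) in v.
have hE : h = fun j => (sg * (del k / (4 * C))) * x i j by [].
have nh : nrm p h ^+ 2 <= (del k / (4 * C)) ^+ 2.
  rewrite hE nrmZ exprMn -[leRHS]mulr1; apply: ler_pM; [exact: sqr_ge0|exact: sqr_ge0| |].
    rewrite normrM (_ : `|sg| = 1) ?mul1r ?real_normK ?num_real//.
    by rewrite /sg; case: (e); rewrite ?normrN normr1.
  by rewrite expr_le1// nrm_ge0.
have d1 : dot h t = sg * (del k / (4 * C)) * dot (x i) t by rewrite hE dotZl.
have d2 : dot h (predictor s) = sg * (del k / (4 * C)) * dot (x i) (predictor s).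
  by rewrite hE dotZl.
rewrite d1 d2 => H.
by have := potential_step_num (dot (state s) t) C_gt0 (del_gt0 k) nh v H.
Qed.

Definition close t k s :=
  forall i, `|dot (x i) t - dot (x i) (predictor s)| <= del k / 4.

Lemma weight_le t s : nrm p' t <= 1 ->
  potential t s <= - (weight s / (32 * C)) -> weight s <= 16 * C.
Proof.
move=> t1 h; have := le_trans (potential_ge s t1) h; rewrite lerN2.
by rewrite ler_pdivrMr ?mulr_gt0 ?C_gt0//; lra.
Qed.

(** Update as long as some row is mispredicted. Each update adds [del k ^ 2] to the weight, which
    stays below [16 * C], so the process stops. *)
Lemma run_level t (k : 'I_K.+1) s : nrm p' t <= 1 ->
  potential t s <= - (weight s / (32 * C)) ->
  exists s' u, [/\ potential t s' <= - (weight s' / (32 * C)), close t k s',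
    size s' = (size s + u)%N & weight s' = weight s + u%:R * del k ^+ 2].
Proof.
move=> t1.
have d0 : 0 < del k ^+ 2 by rewrite exprn_gt0// del_gt0.
(* [N] bounds the number of updates still possible and serves as fuel for the induction. *)
have [N hN] : exists N : nat, 16 * C - weight s < N%:R * del k ^+ 2.
  exists (Num.bound `|(16 * C - weight s) / del k ^+ 2|).
  by rewrite -ltr_pdivrMr//; exact: le_lt_trans (ler_norm _) (archi_boundP (normr_ge0 _)).
elim: N s hN => [|N IH] s hN ps.
  by have := weight_le t1 ps; move: hN; rewrite mul0r; lra.
have [cl|] := pselect (close t k s).
  by exists s, 0%N; split=> //; rewrite ?addn0// mul0r addr0.
move=> /existsNP[i /negP]; rewrite -ltNge => vi.
pose e := 0 <= dot (x i) t - dot (x i) (predictor s).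
have ve : del k / 4 <= (if e then 1 else -1) * (dot (x i) t - dot (x i) (predictor s)).
  move: vi; rewrite /e; have [h|h] := leP 0 (dot (x i) t - dot (x i) (predictor s)).
    by rewrite ger0_norm// mul1r => /ltW.
  by rewrite ltr0_norm// mulN1r => /ltW.
have W : weight ((i, e, k) :: s) = weight s + del k ^+ 2.
  by rewrite /weight big_cons addrC.
have [] := IH ((i, e, k) :: s).
- by rewrite W; move: hN; rewrite -natr1 mulrDl mul1r; lra.
- rewrite W mulrDl opprD; apply: (le_trans (potential_step ve)); exact: lerD.
move=> s' [u [h1 h2 h3 h4]]; exists s', u.+1; split=> //.
  by rewrite h3 /= addnS addSn.
by rewrite h4 W -natr1 mulrDl mul1r; lra.
Qed.

Lemma run_all t : nrm p' t <= 1 -> exists f : nat -> seq update,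
  [/\ forall k, (k <= K)%N -> close t k (f k),
      forall k, (k <= K)%N -> weight (f k) <= 16 * C &
      \sum_(k < K.+1) del k ^+ 2 * (size (f k))%:R <= 22 * C].
Proof.
move=> t1.
(* An update made at scale [k] is counted in the sizes at all scales [j >= k], with total weight at
   most 4/3 of [del k ^ 2]. The term with factor 1/3 in the invariant is what later scales can still
   charge. *)
suff [f [h1 h2 h3]] : exists f : nat -> seq update,
  [/\ forall k, (k <= K)%N -> close t k (f k) /\ weight (f k) <= 16 * C,
   potential t (f K) <= - (weight (f K) / (32 * C)) &
   \sum_(k < K.+1) del k ^+ 2 * (size (f k))%:R + 3^-1 * (del K ^+ 2 * (size (f K))%:R)
     <= 4 / 3 * weight (f K)].
  exists f; split => [k /h1[]//|k /h1[]//|].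
  have w := weight_le t1 h2; have C0 := C_gt0.
  have s0 : 0 <= del K ^+ 2 * (size (f K))%:R by rewrite mulr_ge0// sqr_ge0.
  move: h3 w C0 s0; move: (\sum_(k < _) _) (del K ^+ 2 * _) (weight _) (smooth_cst p).
  by move=> a1 a2 a3 a4 h3 w C0 s0; lra.
suff : forall k0, (k0 < K.+1)%N -> exists f : nat -> seq update,
  [/\ forall k, (k <= k0)%N -> close t k (f k) /\ weight (f k) <= 16 * C,
   potential t (f k0) <= - (weight (f k0) / (32 * C)) &
   \sum_(k < k0.+1) del k ^+ 2 * (size (f k))%:R + 3^-1 * (del k0 ^+ 2 * (size (f k0))%:R)
     <= 4 / 3 * weight (f k0)] by apply.
elim => [|k IH] kK.
  have [|s' [u [h1 h2 h3 h4]]] := @run_level t ord0 [::] t1.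
    rewrite /potential /weight big_nil mul0r oppr0 /= /dot big1 => [|j _]; last by rewrite mul0r.
    rewrite nrmE big1 => [|j _]; last by rewrite normr0 powR0// gt_eqF.
    by rewrite powR0 ?invr_eq0 ?gt_eqF// expr0n/= mul0r subr0.
  exists (fun=> s'); split => //.
    by move=> k; rewrite leqn0 => /eqP->; split=> //; exact: weight_le h1.
  rewrite big_ord1 h4 h3 /weight big_nil add0n /= expr1n !mul1r mulr1 add0r.
  by lra.
have [f [h1 h2 h3]] := IH (ltnW kK).
have [s' [u [g1 g2 g3 g4]]] := @run_level t (Ordinal kK) (f k) t1 h2.
exists (fun j => if j == k.+1 then s' else f j); split.
- move=> j; rewrite leq_eqVlt => /predU1P[->|jk]; first by rewrite eqxx; split=> //; exact: weight_le g1.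
  by rewrite (ltn_eqF jk); exact: h1.
- by rewrite eqxx.
rewrite big_ord_recr/= eqxx; under eq_bigr => j _ do rewrite (ltn_eqF (ltn_ord j)).
rewrite g4 g3 natrD /= delS.
have s0 : 0 <= del k ^+ 2 * (size (f k))%:R by rewrite mulr_ge0// sqr_ge0.
have u0 : 0 <= (del k / 2) ^+ 2 * u%:R by rewrite mulr_ge0// sqr_ge0.
rewrite !expr2 in h3 s0 u0 *.
move: h3 s0 u0; move: (\sum_(i < _) _) (size (f k))%:R (del k) (weight (f k)) (u%:R : R).
by move=> a b c d e h3 s0 u0; lra.
Qed.

End perceptron.

(** With [leq_pow6], turns the logarithms of the number of scales and of the alphabet size into
    multiples of [ln m]. *)
Lemma leq_double_cube m : (2 <= m)%N -> (2 * m.+1 <= m ^ 3)%N.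
Proof. by move=> m2; rewrite !expnS expn0 muln1; nia. Qed.

Lemma leq_pow6 m : (2 <= m)%N -> (2 * (4 * m * m.+1) <= m ^ 6)%N.
Proof.
move=> m2; have -> : (2 * (4 * m * m.+1) = (4 * m) * (2 * m.+1))%N by lia.
rewrite (_ : 6 = 3 + 3)%N// expnD leq_mul ?leq_double_cube//.
by rewrite !expnS expn0 muln1; nia.
Qed.

(** * Random exchange of two samples *)

Section swap.
Context {R : realType}.

(** The rows are independent, so the sum factors. The weight 3 on the other copy makes each factor
    at most 2; the critical case is exp(1/4) + exp(-3/4) <= 4/3 + 4/7. With equal weights the factor
    would be a hyperbolic cosine and exceed 2. *)
Lemma avg_swap m (b : 'I_m -> bool -> bool) :
  \sum_(s : {ffun 'I_m -> bool})
    expR (4^-1 * (\sum_i (b i (s i))%:R - 3 * \sum_i (b i (~~ s i))%:R)) <= 2 ^+ m :> R.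
Proof.
have E (s : {ffun 'I_m -> bool}) :
    expR (4^-1 * (\sum_i (b i (s i))%:R - 3 * \sum_i (b i (~~ s i))%:R)) =
    \prod_i expR (4^-1 * ((b i (s i))%:R - 3 * (b i (~~ s i))%:R)) :> R.
  by rewrite -expR_sum -mulr_sumr big_split/= mulr_sumr -sumrN.
under eq_bigr do rewrite E.
rewrite -(bigA_distr_bigA (fun i c => expR (4^-1 * ((b i c)%:R - 3 * (b i (~~ c))%:R)))).
have -> : 2 ^+ m = \prod_(i < m) (2 : R) by rewrite prodr_const card_ord.
apply: ler_prod => i _; rewrite big_bool/=; apply/andP; split.
  by rewrite addr_ge0 ?expR_ge0.
have h1 : expR (4^-1 : R) <= 4 / 3.
  have -> : 4 / 3 = (1 - 4^-1)^-1 :> R by field.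
  by apply: expR_le_inv; lra.
have h2 : expR (- (3 / 4) : R) <= 4 / 7.
  rewrite expRN -[4 / 7]invf_div lef_pV2 ?posrE ?expR_gt0//.
  by have := @expR_ge1Dx R (3 / 4); lra.
have h3 : expR (- (1 / 2) : R) <= 1 by rewrite expR_le1; lra.
case: (b i true) (b i false) => [] [] /=.
- by rewrite (_ : 4^-1 * (1 - 3 * 1) = - (1 / 2) :> R); [lra|field].
- rewrite (_ : 4^-1 * (1 - 3 * 0) = 4^-1 :> R); last by field.
  rewrite (_ : 4^-1 * (0 - 3 * 1) = - (3 / 4) :> R); last by field.
  by lra.
- rewrite (_ : 4^-1 * (1 - 3 * 0) = 4^-1 :> R); last by field.
  rewrite (_ : 4^-1 * (0 - 3 * 1) = - (3 / 4) :> R); last by field.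
  by lra.
- by rewrite mulr0 subr0 mulr0 expR0.
Qed.

Variables (q : R).
Hypothesis q2 : 2 <= q.
Notation dq k := (del k `^ q : R).

Let q0 : 0 < q. Proof. exact: lt_le_trans q2. Qed.

Lemma dq0 : dq 0 = 1. Proof. by rewrite /del expr0 powR1. Qed.

Lemma dqS k : dq k.+1 = 2 `^ (- q) * dq k.
Proof.
rewrite delS powRM ?invr_ge0//; last by rewrite ltW// del_gt0.
by rewrite mulrC powRN -[2^-1]powR_inv1// -powRrM mulN1r powRN.
Qed.

Lemma dq_le k : dq k <= del k ^+ 2.
Proof.
have d0 := @del_gt0 R k; rewrite -powR_mulrn; last exact: ltW.
by apply: ger_powR => //; rewrite d0 exprn_ile1// invf_le1// ler1n.
Qed.

Lemma sum_del2 K : \sum_(k < K) del k ^+ 2 <= 4 / 3 :> R.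
Proof.
suff : \sum_(k < K) del k ^+ 2 = 4 / 3 * (1 - del K ^+ 2) :> R.
  by move=> ->; have := sqr_ge0 (@del R K); lra.
elim: K => [|K IH]; first by rewrite big_ord0 /del expr0 expr1n; lra.
by rewrite big_ord_recr/= IH delS !expr2; lra.
Qed.

(** Dyadic layer cake: the largest level below [a] already carries a^q up to the factor 2^q. *)
Lemma layer_le K (a : R) : 0 <= a <= 1 ->
  a `^ q <= dq K + 2 `^ q * \sum_(k < K.+1) dq k * (del k <= a)%R%:R.
Proof.
move=> /andP[a0 a1].
have P0 k : 0 <= dq k * (del k <= a)%R%:R by rewrite mulr_ge0 ?powR_ge0.
have T : 0 <= 2 `^ q :> R by exact: powR_ge0.
elim: K => [|K IH].
  rewrite dq0; apply: (@le_trans _ _ 1).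
    by rewrite -(powR_1l q); apply: ler_powRl => //; exact: ltW.
  by rewrite lerDl mulr_ge0// big_ord1.
have [h|h] := leP a (del K.+1).
  apply: (@le_trans _ _ (dq K.+1)); first by apply: ler_powRl => //; exact: ltW.
  by rewrite lerDl mulr_ge0// sumr_ge0.
apply: (le_trans IH); rewrite [X in _ <= _ + _ * X]big_ord_recr/= (ltW h) mulr1 mulrDr.
rewrite [X in _ <= _ + (_ + X)](_ : _ = dq K); last first.
  by rewrite dqS mulrA -powRD ?subrr ?powRr0 ?mul1r// pnatr_eq0 implybT.
have := powR_ge0 (del K.+1 : R) q.
by move: (dq K.+1) (dq K) (2 `^ q * _) => u v w; lra.
Qed.

(** The levels below [c] form a geometric series; doubling [c] shifts the levels by one, which
    drives the induction. *)
Lemma layer_ge K (c : R) : 0 <= c ->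
  \sum_(k < K) dq k * (del k <= c)%R%:R <= 2 * c `^ q.
Proof.
elim: K c => [|K IH] c c0; first by rewrite big_ord0 mulr_ge0 ?powR_ge0.
have [c1|c1] := leP 1 c.
  apply: (@le_trans _ _ (\sum_(k < K.+1) del k ^+ 2)).
    apply: ler_sum => k _; apply: le_trans (dq_le k).
    by rewrite ler_piMr ?powR_ge0// lern1 leq_b1.
  apply: (le_trans (sum_del2 _)).
  have : 1 <= c `^ q by rewrite -(powR_1l q); apply: ler_powRl => //; exact: ltW.
  by lra.
have d0 : (del 0 <= c) = false by rewrite /del expr0 leNgt c1.
rewrite big_ord_recl /= d0 mulr0 add0r.
apply: (@le_trans _ _ (2 `^ (- q) * \sum_(k < K) dq k * (del k <= 2 * c)%R%:R)).
  rewrite mulr_sumr; apply: ler_sum => k _.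
  by rewrite /bump /= add1n dqS -mulrA delS ler_pdivrMr// [c * 2]mulrC.
apply: (le_trans (ler_wpM2l (powR_ge0 _ _) (IH _ _))); first by rewrite mulr_ge0.
apply: eq_ler; rewrite powRM// mulrCA; congr (_ * _).
by rewrite mulrA -powRD ?addNr ?powRr0 ?mul1r// pnatr_eq0 implybT.
Qed.

Definition power_sum m (J : finType) (x : bool * 'I_m -> J -> R) (s : {ffun 'I_m -> bool})
  (t : J -> R) : R := \sum_i `|dot (x (s i, i)) t| `^ q.

Definition flip m (s : {ffun 'I_m -> bool}) : {ffun 'I_m -> bool} := [ffun i => ~~ s i].

Definition exceed m (J : finType) (x : bool * 'I_m -> J -> R) (c : R) (t : J -> R)
  (s : {ffun 'I_m -> bool}) : R := \sum_i (c <= `|dot (x (s i, i)) t|)%R%:R.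

Lemma exceed_le m (J : finType) (x : bool * 'I_m -> J -> R) (c c' : R) (t t' : J -> R) s :
  (forall i, `|dot (x i) t - dot (x i) t'| <= c - c') ->
  exceed x c t s <= exceed x c' t' s.
Proof.
move=> h; apply: ler_sum => i _.
have := h (s i, i); move: (dot _ _) (dot _ _) => b a ab.
have [ca|_] := boolP (c <= `|a|); last exact: ler0n.
suff -> : c' <= `|b| by [].
have := ler_normD (a - b) b; rewrite subrK => ab'.
by move: ab ab' ca; move: `|a - b| `|a| `|b| => u v w; lra.
Qed.

Lemma power_sum_le m (J : finType) (x : bool * 'I_m -> J -> R) K s t :
  (forall i, `|dot (x i) t| <= 1) ->
  power_sum x s t <= m%:R * dq K + 2 `^ q * \sum_(k < K.+1) dq k * exceed x (del k) t s.
Proof.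
move=> h1.
apply: (@le_trans _ _ (\sum_(i < m) (dq K + 2 `^ q *
    \sum_(k < K.+1) dq k * (del k <= `|dot (x (s i, i)) t|)%R%:R))).
  by apply: ler_sum => i _; apply: layer_le; rewrite normr_ge0 h1.
rewrite big_split/= sumr_const card_ord -[dq K *+ m]mulr_natl lerD2l -mulr_sumr.
rewrite ler_wpM2l ?powR_ge0// exchange_big/=; apply: ler_sum => k _.
by rewrite -mulr_sumr.
Qed.

Lemma exceed_power_sum m (J : finType) (x : bool * 'I_m -> J -> R) K s t :
  \sum_(k < K) dq k * exceed x (del k / 2) t s <= 2 * 2 `^ q * power_sum x s t.
Proof.
under eq_bigr do rewrite mulr_sumr.
rewrite exchange_big/= mulr_sumr; apply: ler_sum => i _.
rewrite -mulrA -powRM//; apply: le_trans (layer_ge K _); last by rewrite mulr_ge0.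
by apply: ler_sum => k _; rewrite ler_pdivrMr// [_ * 2]mulrC.
Qed.

(** 2 absorbs the remainder of the layer cake and 4/3 is the sum of the squared scales. In the
    notation of [swap_finite_unit], 5 comes from [1 + ln M <= 5 * ln m], and 132 = 22 * 6 from
    [run_all] and [L <= 6 * ln m]. *)
Definition swap_cst (p : R) : R := 2 + 2 `^ q * (4 * (4 / 3 * 5 + 132 * smooth_cst p)).

(* The predictor run on both copies of the rows takes few values, each of which is compared
   on the two copies by [avg_swap]. *)
Lemma swap_finite_unit (p p' : R) m (J : finType) (x : bool * 'I_m -> J -> R) :
  2 <= p -> p^-1 + p'^-1 = 1 -> (2 <= m)%N -> (forall i, nrm p (x i) <= 1) ->
  exists B : {ffun 'I_m -> bool} -> R, [/\ forall s, 0 <= B s,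
    forall s t, nrm p' t <= 1 ->
      power_sum x s t <= 6 * (2 `^ q * 2 `^ q) * power_sum x (flip s) t + B s &
    \sum_s B s <= 2 ^+ m * (swap_cst p * ln m%:R)].
Proof.
move=> p2 pp' m2 x1.
have C0 := smooth_cst_gt0 p2.
have m0 : 0 < m%:R :> R by rewrite ltr0n (leq_trans _ m2).
pose U : finType := ((bool * 'I_m) * bool * 'I_m.+1)%type.
pose L : R := ln (2 * #|U|%:R).
have cU : #|U| = (4 * m * m.+1)%N.
  by rewrite !card_prod card_bool !card_ord; lia.
have U0 : 0 < #|U|%:R :> R by rewrite cU ltr0n; lia.
(* Every update down to scale [m] weighs at least [del m ^ 2], so the bound on the weight bounds the
   length of all sequences that occur. *)
have [umax humax] : exists u : nat, 16 * smooth_cst p < u%:R * del m ^+ 2 :> R.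
  exists (Num.bound `|16 * smooth_cst p / del m ^+ 2|).
  rewrite -ltr_pdivrMr ?exprn_gt0 ?del_gt0//.
  exact: le_lt_trans (ler_norm _) (archi_boundP (normr_ge0 _)).
pose term (s : {ffun 'I_m -> bool}) (l : seq U) (k : nat) : R :=
  expR (4^-1 * (exceed x (3 / 4 * del k) (predictor p x l) s -
    3 * exceed x (3 / 4 * del k) (predictor p x l) (flip s))).
(* [Z] collects all sequences and scales. Discounting a sequence of length [u] by [(2 * #|U|) ^- u]
   leaves total mass at most 2 per scale, and costs [u * L] once logarithms are taken. *)
pose Z s := \sum_(u < umax.+1) \sum_(l : u.-tuple U) \sum_(k < m.+1)
  (2 * #|U|%:R) ^- u * term s l k.
pose M : R := 2 * m.+1%:R.
have M1 : 1 <= M by rewrite /M; have := ler1n R m.+1; rewrite ltn0Sn; lra.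
have ZM : \sum_s Z s <= 2 ^+ m * M.
  rewrite exchange_big/=.
  apply: (@le_trans _ _ (\sum_(u < umax.+1) 2 ^+ m * (m.+1%:R * 2 ^- u))).
    apply: ler_sum => u _; rewrite exchange_big/=.
    apply: (@le_trans _ _ (\sum_(l : u.-tuple U) \sum_(k < m.+1) (2 * #|U|%:R) ^- u * 2 ^+ m)).
      apply: ler_sum => l _; rewrite exchange_big/=; apply: ler_sum => k _.
      rewrite -mulr_sumr ler_wpM2l ?invr_ge0 ?exprn_ge0 ?mulr_ge0//.
      rewrite /term /exceed.
      pose b i c := (3 / 4 * del k <= `|dot (x (c, i)) (predictor p x l)|)%R.
      apply: le_trans (avg_swap b); apply: ler_sum => s _; rewrite ler_expR.
      by under [X in _ - _ * X]eq_bigr do rewrite ffunE.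
    rewrite sumr_const sumr_const card_ord card_tuple.
    move: U0; move: (#|U|) => N N0; move: (2 ^+ m : R) (m.+1) => a c.
    rewrite -[_ *+ c]mulr_natl -[_ *+ (N ^ u)]mulr_natl natrX exprMn.
    apply: eq_ler; have V0 : N%:R ^+ u != 0 :> R by rewrite expf_neq0// gt_eqF.
    have T0 : 2 ^+ u != 0 :> R by rewrite expf_neq0.
    by field; rewrite V0 T0.
  rewrite -mulr_sumr ler_wpM2l ?exprn_ge0// -mulr_sumr /M [2 * _]mulrC ler_wpM2l//.
  have : \sum_(u < umax.+1) 2 ^- u = 2 - 2 ^- umax :> R.
    elim: (umax) => [|n IH]; first by rewrite big_ord1 expr0 invr1; lra.
    by rewrite big_ord_recr/= IH exprS invfM; lra.
  move=> ->; have : 0 <= 2 ^- umax :> R by rewrite invr_ge0 exprn_ge0.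
  by lra.
have term0 s l k : 0 <= term s l k by exact: expR_ge0.
have w0 u : 0 < (2 * #|U|%:R) ^- u :> R by rewrite invr_gt0 exprn_gt0// mulr_gt0.
have termZ s (l : seq U) k : (size l <= umax)%N -> (k <= m)%N ->
    (2 * #|U|%:R) ^- size l * term s l k <= Z s.
  move=> lu km; rewrite /Z (bigD1 (Ordinal (lu : (size l < umax.+1)%N)))//=.
  rewrite (bigD1 (in_tuple l))//= (bigD1 (Ordinal (km : (k < m.+1)%N)))//= -!addrA lerDl.
  rewrite !addr_ge0 ?sumr_ge0// => *; rewrite ?mulr_ge0 ?(ltW (w0 _))//.
    by apply: sumr_ge0 => *; rewrite mulr_ge0 ?(ltW (w0 _)).
  by apply: sumr_ge0 => *; apply: sumr_ge0 => *; rewrite mulr_ge0 ?(ltW (w0 _)).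
have Z0 s : 0 < Z s.
  by apply: lt_le_trans (termZ s [::] 0%N _ _) => //; rewrite mulr_gt0 ?expR_gt0.
have L0 : 0 <= L.
  apply: ln_ge0; have : 1 <= #|U|%:R :> R by rewrite ler1n -(ltr0n R).
  by lra.
(* A majorant of [ln (Z s)] that is linear in [Z s], so that it can be averaged over [s]
   directly. *)
pose b s := Z s / M + ln M.
have b0 s : 0 <= b s by rewrite addr_ge0 ?ln_ge0// divr_ge0 ?ltW//; lra.
have lnZ s : ln (Z s) <= b s.
  have M0 : 0 < M by lra.
  have -> : ln (Z s) = ln (Z s / M) + ln M.
    by rewrite -lnM ?posrE ?divr_gt0// divfK// gt_eqF.
  rewrite /b lerD2r; apply: (le_trans (ln_le_subr1 _)); first by rewrite divr_gt0.
  by lra.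
pose B s := m%:R * dq m + 2 `^ q * (4 * (4 / 3 * b s + 22 * smooth_cst p * L)).
have T0 : 0 <= 2 `^ q :> R by exact: powR_ge0.
exists B; split.
- move=> s; apply: addr_ge0; first by rewrite mulr_ge0 ?powR_ge0.
  apply: mulr_ge0 => //; apply: mulr_ge0 => //; apply: addr_ge0; first by rewrite mulr_ge0.
  by rewrite mulr_ge0// mulr_ge0// ltW.
- move=> s t t1.
  have [f [f1 f2 f3]] := run_all m p2 pp' x1 t1.
  apply: (le_trans (power_sum_le m s (fun i => dot_le p2 pp' x1 i t1))).
  rewrite /B [leRHS]addrCA lerD2l.
  (* The thresholds [del k], [3 / 4 * del k] and [del k / 2] leave [del k / 4] for the prediction
     error on both sides. The middle count depends on [t] only through the sequence [f k], hence is
     covered by [Z]. *)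
  have key (k : 'I_m.+1) : exceed x (del k) t s <=
      3 * exceed x (del k / 2) t (flip s) + 4 * (b s + (size (f k))%:R * L).
    have km : (k <= m)%N by rewrite -ltnS.
    have e1 : exceed x (del k) t s <= exceed x (3 / 4 * del k) (predictor p x (f k)) s.
      apply: exceed_le => i; apply: (le_trans (f1 k km i)).
      by have := del_gt0 k; lra.
    have e2 : exceed x (3 / 4 * del k) (predictor p x (f k)) (flip s) <=
        exceed x (del k / 2) t (flip s).
      apply: exceed_le => i; rewrite distrC; apply: (le_trans (f1 k km i)).
      by have := del_gt0 k; lra.
    have sz : (size (f k) <= umax)%N.
      rewrite -(ler_nat R).
      have dm : 0 < del m ^+ 2 :> R by rewrite exprn_gt0// del_gt0.
      rewrite -(ler_pM2r dm); apply: le_trans (ltW humax).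
      apply: le_trans (f2 k km); rewrite /weight -sum1_size natr_sum mulr_suml.
      apply: ler_sum => u _; rewrite mul1r.
      apply: lerXn2r; rewrite ?nnegrE; [exact/ltW/del_gt0|exact/ltW/del_gt0|].
      by apply: ler_wiXn2l => //; [rewrite invf_le1// ler1n|rewrite -ltnS].
    have := termZ s (f k) k sz km.
    rewrite -ler_ln ?posrE ?mulr_gt0 ?expR_gt0// lnM ?posrE ?expR_gt0// expRK.
    rewrite lnV ?posrE ?exprn_gt0 ?mulr_gt0// lnXn ?mulr_gt0// -/L -[L *+ size _]mulr_natl.
    move=> h; have h2 := le_trans h (lnZ s).
    have aux (a1 a2 a3 a4 a5 a6 : R) : - a6 + 4^-1 * (a3 - 3 * a4) <= a5 -> a1 <= a3 ->
      a4 <= a2 -> a1 <= 3 * a2 + 4 * (a5 + a6) by lra.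
    exact: aux h2 e1 e2.
  apply: (@le_trans _ _ (2 `^ q * \sum_(k < m.+1) dq k *
      (3 * exceed x (del k / 2) t (flip s) + 4 * (b s + (size (f k))%:R * L)))).
    rewrite ler_wpM2l//; apply: ler_sum => k _; rewrite ler_wpM2l ?powR_ge0//.
  have -> : 6 * (2 `^ q * 2 `^ q) * power_sum x (flip s) t +
      2 `^ q * (4 * (4 / 3 * b s + 22 * smooth_cst p * L)) =
      2 `^ q * (6 * 2 `^ q * power_sum x (flip s) t + 4 * (4 / 3 * b s + 22 * smooth_cst p * L)).
    by ring.
  rewrite ler_wpM2l//.
  (* Here [q >= 2] enters: [dq k <= del k ^ 2], so the lengths of the sequences are summed by the
     last bound of [run_all]. *)
  apply: (@le_trans _ _ (3 * (\sum_(k < m.+1) dq k * exceed x (del k / 2) t (flip s)) +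
     4 * ((\sum_(k < m.+1) del k ^+ 2) * b s +
     (\sum_(k < m.+1) del k ^+ 2 * (size (f k))%:R) * L))).
    rewrite mulrDr [in leRHS]mulr_suml [in leRHS]mulr_suml !mulr_sumr -!big_split/=.
    apply: ler_sum => k _; rewrite mulrDr mulrCA lerD2l mulrCA -mulrDr ler_wpM2l//.
    rewrite -mulrA -mulrDr ler_wpM2r ?dq_le// addr_ge0// mulr_ge0//.
  apply: lerD.
    have := exceed_power_sum x m.+1 (flip s) t.
    by move: (\sum_(k < _) _) (power_sum _ _ _) (2 `^ q) => a1 a2 a3; lra.
  by rewrite ler_wpM2l// lerD// ler_wpM2r// sum_del2.
have csum (c : R) : \sum_(s : {ffun 'I_m -> bool}) c = 2 ^+ m * c.
  by rewrite sumr_const card_ffun card_bool card_ord -[c *+ _]mulr_natl natrX.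
have -> : \sum_s B s = 2 ^+ m * (m%:R * dq m) +
    2 `^ q * (4 * (4 / 3 * (\sum_s b s) + 2 ^+ m * (22 * smooth_cst p * L))).
  by rewrite /B big_split/= csum -!mulr_sumr big_split/= -mulr_sumr csum.
have sb : \sum_s b s <= 2 ^+ m * (1 + ln M).
  rewrite /b big_split/= -mulr_suml csum.
  by rewrite mulrDr lerD2r mulr1 ler_pdivrMr//; lra.
have lm : 1 <= 2 * ln m%:R :> R by exact: ln_ge_half.
have lM : ln M <= 3 * ln m%:R :> R.
  rewrite mulr_natl -lnXn// ler_ln ?posrE ?exprn_gt0//; last by lra.
  by rewrite /M -natrX -natrM ler_nat leq_double_cube.
have lL : L <= 6 * ln m%:R :> R.
  rewrite /L [6 * _]mulr_natl -lnXn// ler_ln ?posrE ?exprn_gt0// ?mulr_gt0//.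
  by rewrite -natrX -natrM ler_nat cU leq_pow6.
(* The layer cake is cut at scale 2^-m, where all [m] rows together contribute at most 1. *)
have dm1 : m%:R * dq m <= 1 :> R.
  apply: (@le_trans _ _ (m%:R * del m)).
    rewrite ler_wpM2l//; apply: (le_trans (dq_le m)); rewrite expr2 ler_piMl ?(ltW (del_gt0 _))//.
    by rewrite exprn_ile1// invf_le1// ler1n.
  rewrite /del exprVn ler_pdivrMr ?exprn_gt0// mul1r -natrX ler_nat.
  exact/ltnW/ltn_expl.
have P : 0 < 2 ^+ m :> R by rewrite exprn_gt0.
apply: (@le_trans _ _ (2 ^+ m * (1 + 2 `^ q * (4 * (4 / 3 * (1 + ln M) + 22 * smooth_cst p * L))))).
  rewrite [leRHS]mulrDr lerD ?ler_wpM2l ?(ltW P)//.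
  rewrite [leRHS]mulrCA ler_wpM2l// [leRHS]mulrCA ler_wpM2l// [leRHS]mulrDr.
  by rewrite lerD2r [leRHS]mulrCA ler_wpM2l//; lra.
rewrite ler_wpM2l ?(ltW P)// /swap_cst.
have h : 4 / 3 * (1 + ln M) + 22 * smooth_cst p * L <= (4 / 3 * 5 + 132 * smooth_cst p) * ln m%:R.
  have : smooth_cst p * L <= smooth_cst p * (6 * ln m%:R) by rewrite ler_wpM2l// ltW.
  by lra.
rewrite [leRHS]mulrDl; apply: lerD => //.
by rewrite -[leRHS]mulrA ler_wpM2l// -[leRHS]mulrA ler_wpM2l.
Qed.

End swap.

(** * Concentration on the discrete cube *)

Section cube.
Context {R : realType}.
Implicit Types (x y z : nat -> R) (F G f g : (nat -> R) -> R).

Definition set_coord x N (s : R) : nat -> R := fun i => if i == N then s else x i.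

(* The coordinates of index at least [N] are read off [x]. *)
Fixpoint cube_avg N F x : R :=
  if N is N'.+1 then (cube_avg N' F (set_coord x N' 1) + cube_avg N' F (set_coord x N' (-1))) / 2 else F x.

Definition signs N x z :=
  (forall i, (i < N)%N -> z i = 1 \/ z i = -1) /\ (forall i, (N <= i)%N -> z i = x i).

Lemma cube_avg_le N F G x : (forall z, signs N x z -> F z <= G z) -> cube_avg N F x <= cube_avg N G x.
Proof.
elim: N x => [|N IH] x h /=.
  by apply: h; split.
rewrite ler_pM2r// lerD//; apply: IH => z [h1 h2]; apply: h; split=> i.
- by rewrite ltnS leq_eqVlt => /predU1P[->|/h1//]; rewrite h2// /set_coord eqxx; left.
- by move=> Ni; rewrite (h2 _ (ltnW Ni)) /set_coord gtn_eqF.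
- by rewrite ltnS leq_eqVlt => /predU1P[->|/h1//]; rewrite h2// /set_coord eqxx; right.
- by move=> Ni; rewrite (h2 _ (ltnW Ni)) /set_coord gtn_eqF.
Qed.

Lemma cube_avg_eq N F G x : (forall z, signs N x z -> F z = G z) -> cube_avg N F x = cube_avg N G x.
Proof.
by move=> h; apply/eqP; rewrite eq_le; apply/andP; split; apply: cube_avg_le => z /h->.
Qed.

Lemma cube_avgD N F G x : cube_avg N (fun z => F z + G z) x = cube_avg N F x + cube_avg N G x.
Proof. by elim: N x => //= N IH x; rewrite !IH; field. Qed.

Lemma cube_avgZ N c F x : cube_avg N (fun z => c * F z) x = c * cube_avg N F x.
Proof. by elim: N x => //= N IH x; rewrite !IH; field. Qed.

Lemma cube_avg_cst N c x : cube_avg N (fun=> c) x = c.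
Proof. by elim: N x => //= N IH x; rewrite !IH; field. Qed.

Lemma cube_avg_sum N (I : finType) (F : I -> (nat -> R) -> R) x :
  cube_avg N (fun z => \sum_i F i z) x = \sum_i cube_avg N (F i) x.
Proof.
by elim: N x => //= N IH x; rewrite !IH -big_split/= mulr_suml.
Qed.

Lemma cube_avg_gt0 N F x : (forall z, 0 < F z) -> 0 < cube_avg N F x.
Proof. by move=> h; elim: N x => //= N IH x; rewrite divr_gt0 ?addr_gt0. Qed.

Lemma cube_avg_ge0 N F x : (forall z, 0 <= F z) -> 0 <= cube_avg N F x.
Proof. by move=> h; elim: N x => //= N IH x; rewrite divr_ge0 ?addr_ge0. Qed.

Lemma cube_avg_exists N F x c : cube_avg N F x < c -> exists2 z, signs N x z & F z < c.
Proof.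
move=> h; apply: contrapT => /forall2NP H; move: h; apply/negP; rewrite -leNgt.
rewrite -[leLHS](cube_avg_cst N _ x); apply: cube_avg_le => z sz.
by rewrite leNgt; apply/negP; case: (H z).
Qed.

Lemma set_coord_id x N : set_coord x N (x N) = x.
Proof. by apply/funext => i; rewrite /set_coord; case: eqP => // ->. Qed.

Lemma set_coordC x N M s t : N != M -> set_coord (set_coord x N s) M t = set_coord (set_coord x M t) N s.
Proof.
move=> NM; apply/funext => i; rewrite /set_coord; case: eqP => [->|//].
by rewrite eq_sym (negbTE NM).
Qed.

Lemma cube_avg_set_coord N M F x s : (N <= M)%N ->
  cube_avg N (fun z => F (set_coord z M s)) x = cube_avg N F (set_coord x M s).
Proof.
elim: N x => //= N IH x NM; rewrite !IH ?(ltnW NM)//.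
by rewrite !(@set_coordC x N M)// neq_ltn NM.
Qed.

Lemma expR_conv (th a b : R) : 0 <= th <= 1 ->
  expR ((1 - th) * a + th * b) <= (1 - th) * expR a + th * expR b.
Proof.
move=> /andP[t0 t1].
have [->|t0'] := eqVneq th 0; first by rewrite subr0 !mul1r !mul0r !addr0.
have [->|t1'] := eqVneq th 1; first by rewrite subrr !mul1r !mul0r !add0r.
have := @powR_amgm R th (expR b) (expR a) (expR_ge0 _) (expR_ge0 _).
rewrite lt0r t0' t0 lt_neqAle t1' t1 => /(_ isT).
by rewrite -!expRM -expRD addrC [b * _]mulrC [a * _]mulrC [leRHS]addrC.
Qed.

(** Hoelder's inequality in exponential form: the logarithm of the average of [expR \o f] is convex
    in [f]. *)
Lemma cube_avg_hoelder N (th : R) f g x : 0 <= th <= 1 ->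
  cube_avg N (fun z => expR ((1 - th) * f z + th * g z)) x <=
  expR ((1 - th) * ln (cube_avg N (expR \o f) x) + th * ln (cube_avg N (expR \o g) x)).
Proof.
move=> th01; set A := cube_avg N (expR \o f) x; set B := cube_avg N (expR \o g) x.
have A0 : 0 < A by apply: cube_avg_gt0 => z; exact: expR_gt0.
have B0 : 0 < B by apply: cube_avg_gt0 => z; exact: expR_gt0.
set E := expR _; rewrite -[leRHS]mulr1.
have E0 : 0 < E by exact: expR_gt0.
rewrite mulrC -ler_pdivrMr// mulrC -cube_avgZ.
apply: (@le_trans _ _ (cube_avg N (fun z => (1 - th) / A * expR (f z) + th / B * expR (g z)) x)).
  apply: cube_avg_le => z _; rewrite /E -expRN -expRD.
  have -> : - ((1 - th) * ln A + th * ln B) + ((1 - th) * f z + th * g z) =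
    (1 - th) * (f z - ln A) + th * (g z - ln B) by ring.
  apply: (le_trans (expR_conv _ _ th01)); rewrite !expRB !lnK ?posrE//.
  by apply: eq_ler; rewrite -!mulrA [A^-1 * _]mulrC [B^-1 * _]mulrC.
rewrite cube_avgD !cube_avgZ -/A -/B -!mulrA !mulVf ?gt_eqF// !mulr1; lra.
Qed.

Definition cvx f := forall x y (th : R), 0 <= th <= 1 ->
  f (fun i => (1 - th) * x i + th * y i) <= (1 - th) * f x + th * f y.

(* The two-point inequality behind the infimum-convolution induction. *)
Lemma two_point (a b : R) : 0 < b -> b <= a -> exists2 th, 0 <= th <= 1 &
  (a^-1 + expR ((1 - th) * - ln b + th * - ln a + th ^+ 2 / 16)) * (a + b) <= 4.
Proof.
move=> b0 ba; have a0 : 0 < a by exact: lt_le_trans ba.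
pose x := 1 - b / a.
have bE : b = (1 - x) * a by rewrite /x; field; rewrite gt_eqF.
have x01 : 0 <= x < 1.
  by rewrite /x subr_ge0 ler_pdivrMr// mul1r ba gtrBl divr_gt0.
have bx : ln b = ln (1 - x) + ln a by rewrite {1}bE lnM ?posrE//; lra.
suff [th t01 h] : exists2 th, 0 <= th <= 1 &
    expR ((1 - th) * - ln (1 - x) + th ^+ 2 / 16) <= (2 + x) / (2 - x).
  exists th => //.
  have -> : (1 - th) * - ln b + th * - ln a + th ^+ 2 / 16 =
      - ln a + ((1 - th) * - ln (1 - x) + th ^+ 2 / 16) by rewrite bx; ring.
  rewrite expRD expRN lnK ?posrE// bE; set e := expR _ in h *.
  have -> : (a^-1 + a^-1 * e) * (a + (1 - x) * a) = (1 + e) * (2 - x).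
    by field; rewrite gt_eqF.
  apply: (@le_trans _ _ ((1 + (2 + x) / (2 - x)) * (2 - x))).
    by rewrite ler_wpM2r//; [lra|rewrite lerD2l].
  by apply: eq_ler; field; lra.
(* A shift [th] proportional to [x] suffices: it is [2 * x] up to [x = 1/2], and 1 from there on. *)
have [x2|x2] := leP (1/2) x.
  exists 1; first by rewrite ler01 lexx.
  rewrite subrr mul0r add0r expr1n mul1r.
  apply: (le_trans (expR_le_inv _)); first lra.
  have -> : (1 - 16^-1)^-1 = 16 / 15 :> R by field.
  by rewrite ler_pdivlMr; lra.
exists (2 * x); first by apply/andP; split; lra.
have l1 : - ln (1 - x) <= x / (1 - x).
  rewrite -lnV ?posrE; last lra.
  apply: (le_trans (ln_le_subr1 _)); first by rewrite invr_gt0; lra.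
  by apply: eq_ler; field; lra.
have l2 : (1 - 2 * x) * - ln (1 - x) <= x - x ^+ 2.
  apply: (@le_trans _ _ ((1 - 2 * x) * (x / (1 - x)))).
    by rewrite ler_wpM2l//; lra.
  rewrite mulrA ler_pdivrMr; last lra.
  by rewrite expr2; nra.
apply: (@le_trans _ _ (expR (x - 3 / 4 * x ^+ 2))).
  by rewrite ler_expR exprMn; lra.
apply: (le_trans (expR_le_inv _)); first by rewrite expr2; nra.
rewrite ler_pdivlMr; last lra.
rewrite mulrC ler_pdivrMr; last by rewrite expr2; nra.
by rewrite expr2; nra.
Qed.

Lemma two_point_sym (a b : R) : 0 < a -> 0 < b -> exists th th',
  [/\ 0 <= th <= 1, 0 <= th' <= 1 &
   (expR ((1 - th) * - ln a + th * - ln b + th ^+ 2 / 16) +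
    expR ((1 - th') * - ln b + th' * - ln a + th' ^+ 2 / 16)) * (a + b) <= 4].
Proof.
have E (c d : R) : 0 < c -> expR ((1 - 0) * - ln c + 0 * - ln d + 0 ^+ 2 / 16) = c^-1.
  by move=> c0; rewrite subr0 mul1r !mul0r expr0n/= mul0r !addr0 expRN lnK.
move=> a0 b0; have [ba|ab] := leP b a.
  have [th t01 h] := two_point b0 ba.
  by exists 0, th; split; rewrite ?lexx ?ler01// E.
have [th t01 h] := two_point a0 (ltW ab).
by exists th, 0; split; rewrite ?lexx ?ler01// E// addrC [a + b]addrC.
Qed.

(** Maurey's infimum-convolution property of the cube for convex functions. [g] stands for the
    infimum convolution of [f] with the squared distance over 64, but needs no infimum: it only has
    to dominate the value at some [y]. Moving the last coordinate of [y] from a sign towards the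
    opposite one by the fraction [th] costs [(2 * th) ^ 2 / 64 = th ^ 2 / 16], the term in
    [two_point]. *)
Lemma cube_convolution N f x : cvx f -> exists2 g,
  cube_avg N (expR \o g) x * cube_avg N (fun z => expR (- f z)) x <= 1 &
  forall z, signs N x z -> exists2 y, f y + (\sum_(i < N) (z i - y i) ^+ 2) / 64 <= g z &
    forall i, (N <= i)%N -> y i = z i.
Proof.
move=> cf; elim: N x => [|N IH] x.
  exists f; first by rewrite /= -expRD subrr expR0.
  by move=> z _; exists z => //; rewrite big_ord0 mul0r addr0.
set xp := set_coord x N 1; set xm := set_coord x N (-1).
have xpm : set_coord xp N (-1) = xm by apply/funext => i; rewrite /xp /xm /set_coord; case: eqP.
have xmp : set_coord xm N 1 = xp by apply/funext => i; rewrite /xp /xm /set_coord; case: eqP.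
have [gp hp yp] := IH xp; have [gm hm ym] := IH xm.
set Bp := cube_avg N (fun z => expR (- f z)) xp in hp.
set Bm := cube_avg N (fun z => expR (- f z)) xm in hm.
set Ap := cube_avg N (expR \o gp) xp in hp; set Am := cube_avg N (expR \o gm) xm in hm.
have Bp0 : 0 < Bp by apply: cube_avg_gt0 => z; exact: expR_gt0.
have Bm0 : 0 < Bm by apply: cube_avg_gt0 => z; exact: expR_gt0.
have Ap0 : 0 < Ap by apply: cube_avg_gt0 => z; exact: expR_gt0.
have Am0 : 0 < Am by apply: cube_avg_gt0 => z; exact: expR_gt0.
have lnA (A B : R) : 0 < A -> 0 < B -> A * B <= 1 -> ln A <= - ln B.
  move=> A0 B0; rewrite -ler_pdivlMr// mul1r => AB.
  by rewrite -lnV ?posrE// ler_ln ?posrE ?invr_gt0.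
have lp := lnA _ _ Ap0 Bp0 hp; have lm := lnA _ _ Am0 Bm0 hm.
have [th [th' [t01 t01' H]]] := two_point_sym Bp0 Bm0.
(* For each value of the last sign, [g] interpolates between the functions found on its own face and
   on the opposite face; convexity of [f] makes the interpolated [y] admissible. *)
pose g z := if z N == 1 then (1 - th) * gp z + th * gm (set_coord z N (-1)) + th ^+ 2 / 16
  else (1 - th') * gm z + th' * gp (set_coord z N 1) + th' ^+ 2 / 16.
have N1 : (-1 == 1 :> R) = false by rewrite eq_sym gt_eqF.
exists g.
  have cp : cube_avg N (expR \o g) xp <= expR ((1 - th) * - ln Bp + th * - ln Bm + th ^+ 2 / 16).
    rewrite (@cube_avg_eq _ _ (fun z => expR (th ^+ 2 / 16) *
        expR ((1 - th) * gp z + th * gm (set_coord z N (-1))))).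
      rewrite cube_avgZ [leRHS]expRD mulrC ler_wpM2r ?expR_ge0//.
      apply: (le_trans (cube_avg_hoelder _ _ _ _ t01)).
      rewrite ler_expR (cube_avg_set_coord (expR \o gm) xp (-1) (leqnn N)) xpm.
      by move/andP: t01 => [t0 t1]; apply: lerD; rewrite ler_wpM2l// subr_ge0.
    by move=> z [_ h]; rewrite /= /g h// /xp /set_coord eqxx eqxx expRD mulrC.
  have cm : cube_avg N (expR \o g) xm <= expR ((1 - th') * - ln Bm + th' * - ln Bp + th' ^+ 2 / 16).
    rewrite (@cube_avg_eq _ _ (fun z => expR (th' ^+ 2 / 16) *
        expR ((1 - th') * gm z + th' * gp (set_coord z N 1)))).
      rewrite cube_avgZ [leRHS]expRD mulrC ler_wpM2r ?expR_ge0//.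
      apply: (le_trans (cube_avg_hoelder _ _ _ _ t01')).
      rewrite ler_expR (cube_avg_set_coord (expR \o gp) xm 1 (leqnn N)) xmp.
      by move/andP: t01' => [t0 t1]; apply: lerD; rewrite ler_wpM2l// subr_ge0.
    by move=> z [_ h]; rewrite /= /g h// /xm /set_coord eqxx N1 expRD mulrC.
  rewrite /= -/xp -/xm -/Bp -/Bm; move: H cp cm Bp0 Bm0; clear.
  move: (cube_avg N _ xp) (cube_avg N _ xm) (expR _) (expR _) => a b c d H ac bd B0 B0'.
  have h : (a + b) * (Bp + Bm) <= (d + c) * (Bp + Bm).
    by apply: ler_wpM2r; [apply: addr_ge0; exact: ltW|exact: lerD].
  lra.
have conv_case (u : R) (t : R) ga gb z : u = 1 \/ u = -1 -> 0 <= t <= 1 -> z N = u ->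
    (exists2 y, f y + (\sum_(i < N) (z i - y i) ^+ 2) / 64 <= ga z &
      forall i, (N <= i)%N -> y i = z i) ->
    (exists2 y, f y + (\sum_(i < N) (set_coord z N (- u) i - y i) ^+ 2) / 64 <= gb (set_coord z N (- u)) &
      forall i, (N <= i)%N -> y i = set_coord z N (- u) i) ->
    exists2 y, f y + (\sum_(i < N.+1) (z i - y i) ^+ 2) / 64 <=
      (1 - t) * ga z + t * gb (set_coord z N (- u)) + t ^+ 2 / 16 &
      forall i, (N < i)%N -> y i = z i.
  move=> u1 t01'' zu [ya h1 h2] [yb h3 h4].
  exists (fun i => (1 - t) * ya i + t * yb i); last first.
    by move=> i Ni; rewrite h2 ?(ltnW Ni)// h4 ?(ltnW Ni)// /set_coord gtn_eqF//; ring.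
  have c := cf ya yb t t01''; move/andP: t01'' => [t0 t1].
  have D : \sum_(i < N.+1) (z i - ((1 - t) * ya i + t * yb i)) ^+ 2 <=
      (1 - t) * (\sum_(i < N) (z i - ya i) ^+ 2) +
      t * (\sum_(i < N) (set_coord z N (- u) i - yb i) ^+ 2) + 4 * t ^+ 2.
    rewrite big_ord_recr/= !mulr_sumr -big_split/=; apply: lerD.
      apply: ler_sum => i _; rewrite /set_coord ltn_eqF//.
      move: (z i) (ya i) (yb i) => c1 c2 c3; rewrite !expr2.
      have := mulr_ge0 (mulr_ge0 t0 (sqr_ge0 (c2 - c3))) (_ : 0 <= 1 - t).
      by rewrite subr_ge0 t1 expr2 => /(_ isT); lra.
    rewrite h2// h4// /set_coord eqxx zu.
    by case: u1 => ->; rewrite !expr2; lra.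
  have h1' : (1 - t) * (f ya + (\sum_(i < N) (z i - ya i) ^+ 2) / 64) <= (1 - t) * ga z.
    by rewrite ler_wpM2l// subr_ge0.
  have h3' := ler_wpM2l t0 h3.
  move: c D h1' h3'; move: (f _) (f ya) (f yb) (\sum_(i < N.+1) _) (\sum_(i < N) _) (\sum_(i < N) _).
  by move=> a1 a2 a3 a4 a5 a6 c D h1' h3'; lra.
move=> z [z1 z2].
have sg : forall i, (i < N)%N -> z i = 1 \/ z i = -1 by move=> i iN; apply: z1; exact: leqW.
have up u : signs N (set_coord x N u) (set_coord z N u).
  split=> i iN; first by rewrite /set_coord ltn_eqF//; exact: sg.
  by rewrite /set_coord; case: eqP => // iN'; apply: z2; rewrite ltn_neqAle iN andbT eq_sym; apply/eqP.
have id u : z N = u -> set_coord z N u = z by move=> <-; rewrite set_coord_id.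
case: (z1 N (ltnSn N)) => zN; rewrite /g zN ?eqxx ?N1.
  apply: (@conv_case 1 th gp gm z) => //; first by left.
    by apply: yp; rewrite -(id _ zN); exact: up.
  by apply: ym; exact: up.
have := @conv_case (-1) th' gm gp z (or_intror erefl) t01' zN; rewrite opprK; apply.
  by apply: ym; rewrite -(id _ zN); exact: up.
by apply: yp; exact: up.
Qed.

(** The growth condition says that [f - c] lies below the infimum convolution of [f], hence below
    the [g] of [cube_convolution] on the cube. *)
Lemma cube_concentration N f c x : cvx f ->
  (forall z y, f z <= f y + c + (\sum_(i < N) (z i - y i) ^+ 2) / 64) ->
  cube_avg N (expR \o f) x * cube_avg N (fun z => expR (- f z)) x <= expR c.
Proof.
move=> cf lf; have [g h1 h2] := cube_convolution N x cf.
have B0 : 0 <= cube_avg N (fun z => expR (- f z)) x by apply: cube_avg_ge0 => z; exact: expR_ge0.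
apply: (@le_trans _ _ (expR c * (cube_avg N (expR \o g) x * cube_avg N (fun z => expR (- f z)) x))).
  rewrite mulrA ler_wpM2r// -cube_avgZ; apply: cube_avg_le => z /h2[y hy _].
  rewrite /= -expRD ler_expR; have := lf z y; lra.
by rewrite -[leRHS]mulr1 ler_wpM2l ?expR_ge0.
Qed.

Lemma cosh_le (u : R) : (expR u + expR (- u)) / 2 <= expR (2 * u ^+ 2).
Proof.
have [u1|u1] := leP (1 / 2) `|u|.
  have h : `|u| <= 2 * u ^+ 2.
    by rewrite -real_normK ?num_real// expr2; nra.
  have h1 : expR u <= expR (2 * u ^+ 2) by rewrite ler_expR (le_trans (ler_norm _)).
  have h2 : expR (- u) <= expR (2 * u ^+ 2).
    by rewrite ler_expR (le_trans (ler_norm _))// normrN.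
  by lra.
have u2 : -(1/2) < u < 1/2 by rewrite -ltr_norml.
have h (v : R) : -(1/2) < v < 1/2 -> expR v <= 1 + v + 2 * v ^+ 2.
  move=> v2; apply: (le_trans (expR_le_inv _)); first lra.
  rewrite -[leLHS]mul1r ler_pdivrMr; last lra.
  by rewrite expr2; nra.
apply: (@le_trans _ _ (1 + 2 * u ^+ 2)); last exact: expR_ge1Dx.
have h1 := h u u2.
have h2 : expR (- u) <= 1 + - u + 2 * u ^+ 2.
  by rewrite -(sqrrN u); apply: h; lra.
by lra.
Qed.

Definition lin (a : nat -> R) N z : R := \sum_(i < N) a i * z i.

Lemma linS a N z : lin a N.+1 z = lin a N z + a N * z N.
Proof. by rewrite /lin big_ord_recr. Qed.

Lemma cube_avg_lin_ext (a : nat -> R) N (phi : R -> R) x s :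
  cube_avg N (fun z => phi (lin a N.+1 z)) (set_coord x N s) =
  cube_avg N (fun z => phi (lin a N z + a N * s)) (set_coord x N s).
Proof. by apply: cube_avg_eq => z [_ h]; rewrite linS h// /set_coord eqxx. Qed.

Lemma cube_avg_lin_any (a : nat -> R) N (phi : R -> R) x y :
  cube_avg N (fun z => phi (lin a N z)) x = cube_avg N (fun z => phi (lin a N z)) y.
Proof.
elim: N phi x y => [|N IH] phi x y /=; first by rewrite /lin !big_ord0.
rewrite !cube_avg_lin_ext !(IH (fun u => phi (u + a N * 1)) _ (set_coord y N 1)).
by rewrite !(IH (fun u => phi (u + a N * -1)) _ (set_coord y N (-1))).
Qed.

Lemma cube_avg_linS (a : nat -> R) N (phi : R -> R) x :
  cube_avg N.+1 (fun z => phi (lin a N.+1 z)) x =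
  cube_avg N (fun z => (phi (lin a N z + a N) + phi (lin a N z - a N)) / 2) x.
Proof.
rewrite /= !cube_avg_lin_ext mulr1 mulrN1.
rewrite (cube_avg_lin_any a N (fun u => phi (u + a N)) _ x).
rewrite (cube_avg_lin_any a N (fun u => phi (u - a N)) _ x).
rewrite -cube_avgD mulrC -cube_avgZ; apply: cube_avg_eq => z _; exact: mulrC.
Qed.

Lemma cube_avg_exp_lin (a : nat -> R) N x :
  cube_avg N (fun z => expR (lin a N z)) x <= expR (2 * \sum_(i < N) a i ^+ 2).
Proof.
elim: N x => [|N IH] x; first by rewrite /= /lin !big_ord0 mulr0.
rewrite (cube_avg_linS a N expR) big_ord_recr/= mulrDr expRD.
apply: (@le_trans _ _ (cube_avg N (fun z => expR (2 * a N ^+ 2) * expR (lin a N z)) x)).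
  apply: cube_avg_le => z _; rewrite !expRD -mulrDr mulrAC -mulrA mulrC ler_wpM2r ?expR_ge0//.
  by rewrite mulrC; have := cosh_le (a N); rewrite mulrC.
by rewrite cube_avgZ mulrC ler_wpM2r ?expR_ge0.
Qed.

Lemma expr_le_exp (n : nat) (u : R) : 0 <= u -> u ^+ n <= n%:R ^+ n * expR u.
Proof.
move=> u0; case: n => [|n]; first by rewrite !expr0 mul1r -expR0 ler_expR.
have h := expR_ge1Dxn n u0.
have f0 : 0 < (n.+1)`!%:R :> R by rewrite ltr0n fact_gt0.
apply: (@le_trans _ _ ((n.+1)`!%:R * expR u)).
  by rewrite mulrC -ler_pdivrMr//; apply: le_trans h; rewrite lerDr.
rewrite ler_wpM2r ?expR_ge0// -natrX ler_nat.
by elim: (n) => // k IH; rewrite factS expnS leq_mul// (leq_trans IH)// leq_exp2r.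
Qed.

Lemma expR1_le4 : expR 1 <= 4 :> R.
Proof.
have -> : 1 = 1 / 2 + 1 / 2 :> R by field.
rewrite expRD; have h : expR (1 / 2) <= 2 :> R.
  by apply: (le_trans (expR_le_inv _)); [lra|apply: eq_ler; field].
have := expR_ge0 (1 / 2 : R); nra.
Qed.

(** Khinchine's upper bound, from exponential moments of the form scaled by [la]; this scaling makes
    the exponent in [cube_avg_exp_lin] equal to [2 * s]. *)
Lemma cube_avg_lin_moment (a : nat -> R) N (s : nat) x : (0 < s)%N ->
  cube_avg N (fun z => lin a N z ^+ (2 * s)) x <= (128 * s%:R * \sum_(i < N) a i ^+ 2) ^+ s.
Proof.
move=> s0; have s0' : 0 < s%:R :> R by rewrite ltr0n.
set V := \sum_(i < N) a i ^+ 2.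
have V0 : 0 <= V by apply: sumr_ge0 => i _; exact: sqr_ge0.
have [V1|V1] := eqVneq V 0.
  have a0 i : (i < N)%N -> a i = 0.
    move=> iN; move/eqP: V1; rewrite psumr_eq0 => [/allP h|j _]; last exact: sqr_ge0.
    by have := h (Ordinal iN) (mem_index_enum _); rewrite /= sqrf_eq0 => /eqP.
  rewrite (_ : cube_avg _ _ _ = 0).
    by rewrite exprn_ge0// V1 mulr0.
  rewrite -[RHS](cube_avg_cst N _ x); apply: cube_avg_eq => z _.
  by rewrite /lin big1 ?expr0n ?muln_eq0 ?(gtn_eqF s0)// => i _; rewrite a0 ?mul0r.
have {V1}V0 : 0 < V by rewrite lt_def V1.
pose la := Num.sqrt (s%:R / V).
have la2 : la ^+ 2 = s%:R / V by rewrite sqr_sqrtr// divr_ge0// ltW.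
have la0 : 0 < la by rewrite sqrtr_gt0 divr_gt0.
pose K : R := (2 * s)%:R ^+ (2 * s) / la ^+ (2 * s).
have K0 : 0 < K by rewrite divr_gt0// exprn_gt0// ltr0n muln_gt0.
have P (u : R) : u ^+ (2 * s) <= K * (expR (la * u) + expR (- (la * u))).
  have -> : u ^+ (2 * s) = `|u| ^+ (2 * s) by rewrite !exprM real_normK ?num_real.
  have h := expr_le_exp (2 * s) (mulr_ge0 (ltW la0) (normr_ge0 u)).
  rewrite /K mulrAC ler_pdivlMr ?exprn_gt0// mulrC -exprMn.
  apply: (le_trans h); rewrite ler_wpM2l ?exprn_ge0//.
  have [u0|u0] := leP 0 u; first by rewrite ger0_norm// lerDl expR_ge0.
  by rewrite ltr0_norm// mulrN lerDr expR_ge0.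
apply: (@le_trans _ _ (cube_avg N (fun z => K * (expR (lin (fun i => la * a i) N z) +
    expR (lin (fun i => - la * a i) N z))) x)).
  apply: cube_avg_le => z _; apply: (le_trans (P _)); rewrite ler_wpM2l ?(ltW K0)//.
  rewrite /lin mulr_sumr -sumrN; apply: eq_ler; congr (expR _ + expR _).
    by apply: eq_bigr => i _; rewrite mulrA.
  by apply: eq_bigr => i _; rewrite mulrA !mulNr.
rewrite cube_avgZ cube_avgD.
have h1 := cube_avg_exp_lin (fun i => la * a i) N x.
have h2 := cube_avg_exp_lin (fun i => - la * a i) N x.
have E1 : 2 * (\sum_(i < N) (la * a i) ^+ 2) = (2 * s)%:R.
  under eq_bigr do rewrite exprMn.
  by rewrite -mulr_sumr -/V la2 divfK ?gt_eqF// natrM.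
have E2 : 2 * (\sum_(i < N) (- la * a i) ^+ 2) = (2 * s)%:R.
  by rewrite -E1; congr (_ * _); apply: eq_bigr => i _; rewrite mulNr sqrrN.
rewrite E1 in h1; rewrite E2 in h2.
have E3 : expR (2 * s)%:R <= 16 ^+ s :> R.
  rewrite -[(2 * s)%:R]mulr1 expRM_natl exprM ler_pXn2r ?nnegrE ?exprn_ge0 ?expR_ge0//.
  by have := expR1_le4; have := expR_ge0 (1 : R); rewrite expr2; nra.
apply: (@le_trans _ _ (K * (2 * 16 ^+ s))).
  by rewrite ler_wpM2l ?(ltW K0)//; lra.
have -> : K = (4 * s%:R * V) ^+ s.
  rewrite /K !exprM la2 natrM -expr_div_n; congr (_ ^+ _).
  by field; rewrite !gt_eqF.
apply: (@le_trans _ _ ((4 * s%:R * V) ^+ s * (2 ^+ s * 16 ^+ s))).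
  rewrite ler_wpM2l ?exprn_ge0 ?mulr_ge0 ?(ltW V0)// ler_wpM2r ?exprn_ge0//.
  by rewrite -[leLHS]expr1 ler_eXn2l// ltr1n.
rewrite -!exprMn ler_pXn2r ?nnegrE ?mulr_ge0 ?(ltW V0)//.
by apply: eq_ler; ring.
Qed.

(** The first two even terms of the binomial expansion; the coefficient of the second, (j + 1)(2 j +
    1), is at least (j + 1)^2. *)
Lemma even_moment_step (y a : R) (j : nat) :
  y ^+ (2 * j.+1) + (j.+1)%:R ^+ 2 * a ^+ 2 * y ^+ (2 * j) <=
  ((y + a) ^+ (2 * j.+1) + (y - a) ^+ (2 * j.+1)) / 2.
Proof.
have evN (u : R) k : (- u) ^+ (2 * k) = u ^+ (2 * k) by rewrite !exprM sqrrN.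
wlog y0 : y a / 0 <= y.
  move=> h; have [/h//|/ltW y0] := leP 0 y.
  have := h (- y) (- a); rewrite oppr_ge0 => /(_ y0).
  have -> : - y - a = - (y + a) by rewrite opprD.
  have -> : - y - - a = - (y - a) by rewrite opprD.
  by rewrite !evN sqrrN.
wlog a0 : a / 0 <= a.
  move=> h; have [/h//|/ltW a0] := leP 0 a.
  by have := h (- a); rewrite oppr_ge0 => /(_ a0); rewrite sqrrN opprK addrC [_ + (y + a) ^+ _]addrC.
(* Multiplication by [y + a] and [y - a] mixes the half-sum and the half-difference, so both are
   bounded in one induction. *)
have H n : y ^+ n.+2 + 'C(n.+2, 2)%:R * a ^+ 2 * y ^+ n <= ((y + a) ^+ n.+2 + (y - a) ^+ n.+2) / 2 /\
    (n.+2)%:R * a * y ^+ n.+1 <= ((y + a) ^+ n.+2 - (y - a) ^+ n.+2) / 2.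
  elim: n => [|n [IH1 IH2]].
    by rewrite binn expr0 expr1 !expr2; split; lra.
  set S := (y + a) ^+ n.+2 in IH1 IH2 *; set D := (y - a) ^+ n.+2 in IH1 IH2 *.
  rewrite [(y + a) ^+ _]exprS [(y - a) ^+ _]exprS -/S -/D.
  have h1 : y * (y ^+ n.+2 + 'C(n.+2, 2)%:R * a ^+ 2 * y ^+ n) <= y * ((S + D) / 2) by rewrite ler_wpM2l.
  have h2 : a * ((n.+2)%:R * a * y ^+ n.+1) <= a * ((S - D) / 2) by rewrite ler_wpM2l.
  have h3 : y * ((n.+2)%:R * a * y ^+ n.+1) <= y * ((S - D) / 2) by rewrite ler_wpM2l.
  have h4 : a * (y ^+ n.+2 + 'C(n.+2, 2)%:R * a ^+ 2 * y ^+ n) <= a * ((S + D) / 2) by rewrite ler_wpM2l.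
  have C : 'C(n.+3, 2)%:R = 'C(n.+2, 2)%:R + n.+2%:R :> R by rewrite binS bin1 natrD.
  have P : 0 <= 'C(n.+2, 2)%:R * a ^+ 2 * y ^+ n :> R by rewrite !mulr_ge0 ?exprn_ge0.
  split.
    rewrite C; rewrite [y ^+ n.+3]exprS [y ^+ n.+1]exprS in h1 h2 *.
    rewrite [a ^+ 2]expr2 in h1 *.
    by move: h1 h2; move: (y ^+ n) (y ^+ n.+2) ('C(_, _)%:R : R) (n.+2%:R : R) => u v c d h1 h2; lra.
  have P' : 0 <= a * ('C(n.+2, 2)%:R * a ^+ 2 * y ^+ n) by rewrite mulr_ge0.
  rewrite -[n.+3%:R]natr1; rewrite [y ^+ n.+2]exprS in h3 h4 *.
  by move: h3 h4 P'; move: (y ^+ n.+1) (n.+2%:R : R) (_ * y ^+ n) => u c d h3 h4 P'; lra.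
have -> : (2 * j.+1 = (2 * j).+2)%N by lia.
have [h _] := H (2 * j)%N; apply: le_trans h.
rewrite lerD2l ler_wpM2r ?exprn_ge0// ler_wpM2r ?sqr_ge0// -natrX ler_nat.
have -> : ('C((2 * j).+2, 2) = j.+1 * (2 * j).+1)%N.
  by rewrite bin2 (_ : (2 * j).+2 * (2 * j).+2.-1 = (j.+1 * (2 * j).+1).*2)%N ?doubleK//; lia.
by rewrite expnS expn1 leq_mul2l; lia.
Qed.

(** Each block of coefficients raises the degree by two and contributes a factor [j.+1 ^ 2 * v]. If
    every block carries the fraction 1/s of the square sum V, the result is of order (s V)^s, as for
    a Gaussian, and not merely V^s. *)
Lemma cube_avg_lin_lower (a : nat -> R) (B s : nat) (v : R) x :
  (forall l, (l < s)%N -> v <= \sum_(i < B) a (l * B + i)%N ^+ 2) -> 0 <= v ->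
  (s`!)%:R ^+ 2 * v ^+ s <= cube_avg (s * B) (fun z => lin a (s * B) z ^+ (2 * s)) x.
Proof.
move=> hv v0.
have E0 j N : 0 <= cube_avg N (fun z => lin a N z ^+ (2 * j)) x.
  by apply: cube_avg_ge0 => z; rewrite exprM exprn_ge0// sqr_ge0.
have step j N : cube_avg N (fun z => lin a N z ^+ (2 * j.+1)) x +
    j.+1%:R ^+ 2 * a N ^+ 2 * cube_avg N (fun z => lin a N z ^+ (2 * j)) x <=
    cube_avg N.+1 (fun z => lin a N.+1 z ^+ (2 * j.+1)) x.
  rewrite (cube_avg_linS a N (fun u => u ^+ (2 * j.+1))) -cube_avgZ -cube_avgD.
  by apply: cube_avg_le => z _; exact: even_moment_step.
have mono j N M : cube_avg N (fun z => lin a N z ^+ (2 * j)) x <=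
    cube_avg (N + M) (fun z => lin a (N + M) z ^+ (2 * j)) x.
  elim: M => [|M IH]; first by rewrite addn0.
  case: j IH => [|j] IH.
    by rewrite !(@cube_avg_eq _ _ (fun=> 1)) ?cube_avg_cst// => z _; rewrite muln0 expr0.
  rewrite addnS; apply: (le_trans IH); apply: le_trans (step j _).
  by rewrite lerDl mulr_ge0// mulr_ge0 ?sqr_ge0.
have steps j N M : j.+1%:R ^+ 2 * (\sum_(i < M) a (N + i)%N ^+ 2) *
    cube_avg N (fun z => lin a N z ^+ (2 * j)) x <=
    cube_avg (N + M) (fun z => lin a (N + M) z ^+ (2 * j.+1)) x.
  elim: M => [|M IH]; first by rewrite big_ord0 mulr0 mul0r addn0.
  rewrite big_ord_recr/= mulrDr mulrDl addnS; apply: le_trans (step j _).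
  rewrite lerD// ler_wpM2l ?mono//.
  by rewrite mulr_ge0 ?sqr_ge0.
suff H l : (l <= s)%N -> (l`!)%:R ^+ 2 * v ^+ l <=
    cube_avg (l * B) (fun z => lin a (l * B) z ^+ (2 * l)) x by exact: H.
elim: l => [|l IH] ls; first by rewrite /= muln0 fact0 !expr0 mulr1 expr1n.
rewrite mulSnr; apply: le_trans (steps l (l * B)%N B).
rewrite factS natrM exprMn [v ^+ l.+1]exprS.
rewrite [leLHS](_ : _ = l.+1%:R ^+ 2 * v * (l`!%:R ^+ 2 * v ^+ l)); last by ring.
apply: ler_pM; rewrite ?mulr_ge0 ?sqr_ge0 ?exprn_ge0//.
  by rewrite ler_wpM2l ?sqr_ge0// hv.
exact/IH/ltnW.
Qed.

Lemma fact_ge (s : nat) : s%:R ^+ s / 4 ^+ s <= (s`!)%:R :> R.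
Proof.
case: s => [|n]; first by rewrite !expr0 invr1 mulr1.
have h := @expR_ge1Dxn R n.+1%:R n (ler0n _ _).
have f0 : 0 < (n.+1)`!%:R :> R by rewrite ltr0n fact_gt0.
rewrite ler_pdivrMr ?exprn_gt0// mulrC -ler_pdivrMr//.
apply: (@le_trans _ _ (expR n.+1%:R)); first by apply: le_trans h; rewrite lerDr.
rewrite -[n.+1%:R]mulr1 expRM_natl ler_pXn2r ?nnegrE ?expR_ge0//.
exact: expR1_le4.
Qed.

End cube.

(** * Lattice points and separation *)

Section lattice.
Context {R : realType}.

Lemma sum_geom_dist (M c : nat) (x : R) : 0 < x < 1 ->
  \sum_(j < M) x ^+ ((j - c) + (c - j)) <= 2 / (1 - x).
Proof.
move=> /andP[x0 x1].
have X n : 0 <= x ^+ n by rewrite exprn_ge0 ?ltW.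
have d0 : 0 < 1 - x by rewrite subr_gt0.
have A n : (\sum_(j < n) (c <= j)%N%:R * x ^+ (j - c)) * (1 - x) <= 1 - x ^+ (n - c).
  elim: n => [|n IH]; first by rewrite big_ord0 mul0r sub0n expr0 subrr.
  rewrite big_ord_recr/= mulrDl; have [cn|nc] := leqP c n.
    by rewrite mul1r subSn// exprS; move: IH; move: (x ^+ _) (_ * _) => u v; lra.
  rewrite mul0r mul0r addr0; apply: (le_trans IH).
  have -> : (n - c = 0)%N by lia.
  by have -> : (n.+1 - c = 0)%N by lia.
have B n : (\sum_(j < n) (j < c)%N%:R * x ^+ (c - j)) * (1 - x) <= x ^+ (c - n).
  elim: n => [|n IH]; first by rewrite big_ord0 mul0r X.
  rewrite big_ord_recr/= mulrDl; have [nc|cn] := ltnP n c.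
    have E : (c - n = (c - n.+1).+1)%N by lia.
    rewrite mul1r E exprS in IH *; move: IH (X (c - n.+1)%N).
    move: (x ^+ _) (_ * _) => u v h1 h2.
    by have := mulr_ge0 h2 (sqr_ge0 (1 - x)); rewrite expr2; lra.
  rewrite mul0r mul0r addr0; apply: (le_trans IH).
  have -> : (c - n = 0)%N by lia.
  by have -> : (c - n.+1 = 0)%N by lia.
rewrite ler_pdivlMr//.
apply: (@le_trans _ _ ((\sum_(j < M) (c <= j)%N%:R * x ^+ (j - c)) * (1 - x) +
   (\sum_(j < M) (j < c)%N%:R * x ^+ (c - j)) * (1 - x))).
  rewrite -mulrDl ler_wpM2r ?(ltW d0)// -big_split/=; apply: ler_sum => j _.
  have [cj|jc] := leqP c j.
    have -> : (c - j = 0)%N by lia.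
    by rewrite mul1r mul0r addr0 addn0.
  have -> : (j - c = 0)%N by lia.
  by rewrite mul1r mul0r add0r add0n.
apply: (le_trans (lerD (A M) (B M))).
have h : x ^+ (c - M) <= 1 by rewrite exprn_ile1// ltW.
by have := X (M - c)%N; lra.
Qed.

(** The integer points of the cube of half-side [N], indexed by a finite type. *)
Definition lat k N (w : {ffun 'I_k -> 'I_(2 * N).+1}) (i : 'I_k) : R := (w i)%:R - N%:R.

Definition sqdist k (u v : 'I_k -> R) : R := \sum_i (u i - v i) ^+ 2.

Lemma sqdist_ge0 k (u v : 'I_k -> R) : 0 <= sqdist u v.
Proof. by apply: sumr_ge0 => i _; exact: sqr_ge0. Qed.

Lemma sqdistC k (u v : 'I_k -> R) : sqdist u v = sqdist v u.
Proof. by apply: eq_bigr => i _; rewrite -sqrrN opprB. Qed.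

(* Minkowski for two summands, scaled so that radii are multiples of [sqrt k]. *)
Lemma sqdist_trans k (u v w : 'I_k -> R) (a b : R) : 0 < a -> 0 < b ->
  sqdist u v <= a ^+ 2 * k%:R -> sqdist v w <= b ^+ 2 * k%:R -> sqdist u w <= (a + b) ^+ 2 * k%:R.
Proof.
move=> a0 b0 h1 h2.
have P (x y : R) : (x + y) ^+ 2 <= (1 + b / a) * x ^+ 2 + (1 + a / b) * y ^+ 2.
  rewrite -subr_ge0 (_ : _ - _ = a * b * (x / a - y / b) ^+ 2).
    by rewrite mulr_ge0 ?sqr_ge0// mulr_ge0// ltW.
  by field; rewrite !gt_eqF.
apply: (@le_trans _ _ ((1 + b / a) * sqdist u v + (1 + a / b) * sqdist v w)).
  rewrite /sqdist !mulr_sumr -big_split/=; apply: ler_sum => i _.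
  by rewrite (_ : u i - w i = (u i - v i) + (v i - w i)) ?P//; ring.
apply: (@le_trans _ _ ((1 + b / a) * (a ^+ 2 * k%:R) + (1 + a / b) * (b ^+ 2 * k%:R))).
  by apply: lerD; rewrite ler_wpM2l// addr_ge0// divr_ge0// ltW.
by apply: eq_ler; field; rewrite !gt_eqF.
Qed.

(** A point at squared distance at most s^2 k is at l_1 distance at most s k, and the sum over the
    lattice of [x] to the power of the l_1 distance factors into one-dimensional geometric sums. The
    choice of [x] bounds each of them by [2 * (s + 2)] and keeps [x ^ s] above 1/4. *)
Lemma lattice_count k N (c : {ffun 'I_k -> 'I_(2 * N).+1}) (s : nat) :
  #|[pred w : {ffun 'I_k -> 'I_(2 * N).+1} | sqdist (lat w) (lat c) <= s%:R ^+ 2 * k%:R]|%:R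
    <= (8 * (s%:R + 2)) ^+ k :> R.
Proof.
set S := [pred w | _].
pose x : R := s.+1%:R / s.+2%:R.
have s1 : 0 < s.+1%:R :> R by rewrite ltr0n.
have s2 : 0 < s.+2%:R :> R by rewrite ltr0n.
have x0 : 0 < x by rewrite divr_gt0.
have x1 : x < 1 by rewrite ltr_pdivrMr// mul1r ltr_nat.
have onex : 2 / (1 - x) = 2 * (s%:R + 2).
  have E : s.+2%:R = s%:R + 2 :> R by rewrite -natrD addn2.
  have E' : s.+1%:R = s%:R + 1 :> R by rewrite -natr1.
  rewrite /x E E'; have := ler0n R s; move: (s%:R : R) => u u0; field.
  by rewrite !gt_eqF//; lra.
pose d (w : {ffun 'I_k -> 'I_(2 * N).+1}) i := ((w i - c i) + (c i - w i))%N.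
have dE w i : (d w i)%:R = `|lat w i - lat c i| :> R.
  rewrite /lat /d (_ : _ - _ - _ = (w i)%:R - (c i)%:R :> R); last by ring.
  have [wc|cw] := leqP (w i) (c i).
    have -> : (w i - c i = 0)%N by lia.
    by rewrite add0n natrB// distrC ger0_norm// subr_ge0 ler_nat.
  have -> : (c i - w i = 0)%N by lia.
  by rewrite addn0 natrB ?(ltnW cw)// ger0_norm// subr_ge0 ler_nat ltnW.
have Sd w : w \in S -> (\sum_i d w i <= s * k)%N.
  rewrite inE /sqdist => h.
  have [s0|sp] := posnP s.
    rewrite s0 mul0n leqn0 sum_nat_eq0; apply/forallP => i; apply/implyP => _.
    rewrite -(eqr_nat R) dE normr_eq0 -sqrf_eq0.
    move: h; rewrite s0 expr0n/= mul0r => h.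
    have : \sum_i (lat w i - lat c i) ^+ 2 == 0 by rewrite eq_le h sqdist_ge0.
    by rewrite psumr_eq0 => [/allP/(_ i (mem_index_enum _))|j _]; [|exact: sqr_ge0].
  have sp' : 0 < s%:R :> R by rewrite ltr0n.
  rewrite -(ler_nat R) -(ler_pM2l sp') natrM natr_sum.
  apply: (@le_trans _ _ (\sum_i ((lat w i - lat c i) ^+ 2 + s%:R ^+ 2) / 2)).
    rewrite mulr_sumr; apply: ler_sum => i _; rewrite dE -[(lat w i - _) ^+ 2]real_normK ?num_real//.
    by have := sqr_ge0 (s%:R - `|lat w i - lat c i|); rewrite !expr2; lra.
  rewrite -mulr_suml big_split/= sumr_const card_ord -[_ *+ k]mulr_natr.
  by rewrite mulrA -expr2; lra.
have xs : x ^+ s * 4 >= 1.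
  have h : s.+2%:R / s.+1%:R <= expR (s.+1%:R^-1) :> R.
    apply: le_trans (expR_ge1Dx _).
    by rewrite -[s.+2%:R]natr1 mulrDl mulfV ?gt_eqF// mul1r.
  have h2 : (s.+2%:R / s.+1%:R) ^+ s <= 4 :> R.
    apply: le_trans expR1_le4; apply: (@le_trans _ _ (expR (s.+1%:R^-1) ^+ s)).
      by rewrite lerXn2r ?nnegrE ?expR_ge0 ?divr_ge0.
    by rewrite -expRM_natl ler_expR ler_pdivrMr// mul1r ler_nat.
  have -> : x ^+ s = ((s.+2%:R / s.+1%:R) ^+ s)^-1 by rewrite -exprVn invf_div.
  by rewrite mulrC -ler_pdivrMr ?mul1r ?invrK// invr_gt0 exprn_gt0// divr_gt0.
have key : #|S|%:R * x ^+ (s * k) <= (2 * (s%:R + 2)) ^+ k.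
  apply: (@le_trans _ _ (\sum_(w : {ffun 'I_k -> 'I_(2 * N).+1}) \prod_i x ^+ d w i)).
    rewrite mulr_natl -sumr_const [leRHS](bigID (mem S))/= -[leLHS]addr0.
    apply: lerD; last by apply: sumr_ge0 => w _; apply: prodr_ge0 => i _; rewrite exprn_ge0// ltW.
    by apply: ler_sum => w /Sd h; rewrite -expr_sum; apply: ler_wiXn2l; rewrite ?ltW.
  rewrite -(bigA_distr_bigA (fun i (j : 'I_(2 * N).+1) => x ^+ ((j - c i) + (c i - j)))).
  rewrite -[k in leRHS]card_ord -prodr_const; apply: ler_prod => i _.
  apply/andP; split; first by apply: sumr_ge0 => j _; rewrite exprn_ge0// ltW.
  by rewrite -onex; apply: sum_geom_dist; rewrite x0.
have x4 : 1 <= x ^+ (s * k) * 4 ^+ k by rewrite exprM -exprMn exprn_ege1.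
have -> : 8 * (s%:R + 2) = 2 * (s%:R + 2) * 4 :> R by ring.
rewrite exprMn; apply: (@le_trans _ _ (#|S|%:R * x ^+ (s * k) * 4 ^+ k)).
  by rewrite -mulrA ler_peMr.
by rewrite ler_wpM2r ?exprn_ge0.
Qed.

Lemma cauchy_schwarz k (u v : 'I_k -> R) : dot u v ^+ 2 <= dot u u * dot v v.
Proof.
have vv0 : 0 <= dot v v by apply: sumr_ge0 => i _; rewrite -expr2 sqr_ge0.
have [v0|vn] := eqVneq (dot v v) 0.
  have vi i : v i = 0.
    move/eqP: v0; rewrite psumr_eq0 => [/allP h|j _]; last by rewrite -expr2 sqr_ge0.
    by have := h i (mem_index_enum _); rewrite /= mulf_eq0 orbb => /eqP.
  by rewrite v0 mulr0 /dot big1 ?expr0n// => i _; rewrite vi mulr0.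
have vp : 0 < dot v v by rewrite lt_def vn.
set l := dot u v / dot v v.
have : 0 <= \sum_i (u i - l * v i) ^+ 2 by apply: sumr_ge0 => i _; exact: sqr_ge0.
have -> : \sum_i (u i - l * v i) ^+ 2 = dot u u - 2 * l * dot u v + l ^+ 2 * dot v v.
  rewrite /dot !mulr_sumr -sumrB -big_split/=; apply: eq_bigr => i _.
  by rewrite !expr2; ring.
have -> : dot u u - 2 * l * dot u v + l ^+ 2 * dot v v = dot u u - dot u v ^+ 2 / dot v v.
  by rewrite /l; field; rewrite vn.
by rewrite subr_ge0 ler_pdivrMr.
Qed.

(* A convex set whose support function is at least that of a ball is dense in the ball. *)
Lemma separation k (E : set ('I_k -> R)) (rho beta eta : R) (v : 'I_k -> R) :
  (forall u w th, 0 <= th <= 1 -> E u -> E w -> E (fun i => (1 - th) * u i + th * w i)) ->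
  E !=set0 -> (forall u, E u -> dot u u <= beta) -> 0 <= rho ->
  (forall t, exists2 u, E u & 0 <= dot u t /\ rho ^+ 2 * dot t t <= dot u t ^+ 2) ->
  dot v v <= rho ^+ 2 -> 0 < eta -> exists2 e, E e & sqdist v e <= eta.
Proof.
move=> cE [e0 Ee0] bE rho0 hE vr eta0; apply: contrapT => H.
have {}H e : E e -> eta < sqdist v e.
  by move=> Ee; rewrite ltNge; apply/negP => h; apply: H; exists e.
pose S := [set sqdist v e | e in E].
have S0 : has_inf S.
  by split; [exists (sqdist v e0); exists e0|exists 0 => _ [e _ <-]; exact: sqdist_ge0].
pose d := inf S.
have d0 : eta <= d.
  by apply: lb_le_inf; [case: S0|move=> _ [e /H/ltW ? <-]].
have dp : 0 < d by exact: lt_le_trans d0.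
have b0 : 0 <= beta by apply: le_trans (bE _ Ee0); apply: sumr_ge0 => i _; rewrite -expr2 sqr_ge0.
(* No nearest point is needed: an almost nearest [e], moved by the fraction [tau] towards [u], would
   come closer to [v] than the infimum [d]. *)
pose tau := d / (d + 4 * beta).
have db : 0 < d + 4 * beta by lra.
have tau0 : 0 < tau by rewrite divr_gt0.
have tau1 : tau <= 1 by rewrite ler_pdivrMr//; lra.
have [_ [e Ee <-] he] : exists2 y, S y & y < d + tau * d / 2.
  by apply: inf_adherent => //; rewrite divr_gt0// mulr_gt0.
pose t i := v i - e i.
have [u Eu [ut0 ut]] := hE t.
have tt : dot t t = sqdist v e by apply: eq_bigr => i _; rewrite expr2.
have td : d <= dot t t by rewrite tt; apply: (inf_lbound S0.2); exists e.
have uv : dot v t <= dot u t.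
  rewrite leNgt; apply/negP => h.
  have h2 : dot u t ^+ 2 < dot v t ^+ 2 by rewrite ltr_pXn2r ?nnegrE ?(ltW h)// (le_trans ut0)// ltW.
  have h3 := cauchy_schwarz v t.
  have h4 : dot v v * dot t t <= rho ^+ 2 * dot t t by rewrite ler_wpM2r// (le_trans (ltW dp)).
  by move: (lt_le_trans h2 (le_trans h3 (le_trans h4 ut))); rewrite ltxx.
have et : dot t t = dot v t - dot e t.
  by rewrite /dot -sumrB; apply: eq_bigr => i _; rewrite /t; ring.
pose e' i := (1 - tau) * e i + tau * u i.
have Ee' : E e' by apply: cE => //; rewrite (ltW tau0).
have le' : d <= sqdist v e' by apply: (inf_lbound S0.2); exists e'.
have E1 : sqdist v e' = dot t t - 2 * tau * (dot u t - dot e t) +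
    tau ^+ 2 * (\sum_i (u i - e i) ^+ 2).
  rewrite /sqdist /dot -sumrB !mulr_sumr -sumrB -big_split/=; apply: eq_bigr => i _.
  by rewrite /e' /t !expr2; ring.
have E2 : \sum_i (u i - e i) ^+ 2 <= 4 * beta.
  apply: (@le_trans _ _ (2 * dot u u + 2 * dot e e)).
    rewrite /dot !mulr_sumr -big_split/=; apply: ler_sum => i _.
    by have := sqr_ge0 (u i + e i); rewrite !expr2; lra.
  by have := bE _ Eu; have := bE _ Ee; lra.
have E3 : tau ^+ 2 * (\sum_i (u i - e i) ^+ 2) <= tau * d.
  apply: (@le_trans _ _ (tau ^+ 2 * (d + 4 * beta))).
    by rewrite ler_wpM2l ?sqr_ge0//; lra.
  by rewrite expr2 -mulrA /tau divfK ?gt_eqF.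
have E4 : 2 * tau * d <= 2 * tau * (dot u t - dot e t).
  by rewrite ler_wpM2l//; lra.
have tdp : 0 < tau * d by rewrite mulr_gt0.
by rewrite -tt in he; lra.
Qed.

End lattice.

(** * Moments of log-concave vectors *)

HB.lock Definition Ex d (T : measurableType d) (R : realType) (P : probability T R)
  (f : T -> R) : R := \int[P]_w f w.

Definition pr d (T : measurableType d) (R : realType) (P : probability T R) (A : set T) : R :=
  fine (P A).

Section expect.
Context {R : realType} {d : measure_display} {T : measurableType d}.
Variable P : probability T R.
Notation Ex := (Ex P).
Notation pr := (pr P).

Lemma prE A : measurable A -> (pr A)%:E = P A.
Proof. by move=> mA; rewrite fineK//; exact: fin_num_measure. Qed.

Lemma pr_ge0 A : 0 <= pr A.
Proof. exact: fine_ge0. Qed.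

Lemma pr_le A B : measurable A -> measurable B -> A `<=` B -> pr A <= pr B.
Proof. by move=> mA mB AB; rewrite -lee_fin !prE//; apply: le_measure => //; rewrite inE. Qed.

Lemma prT : pr setT = 1.
Proof. by rewrite /pr probability_setT. Qed.

Lemma pr_le1 A : measurable A -> pr A <= 1.
Proof. by move=> mA; rewrite -prT; apply: pr_le. Qed.

Lemma prD A B : measurable A -> measurable B -> pr A = pr (A `&` B) + pr (A `&` ~` B).
Proof.
move=> mA mB; apply/EFin_inj; rewrite EFinD !prE//; last 2 first.
- by apply: measurableI => //; exact: measurableC.
- exact: measurableI.
rewrite -measureU//; first by rewrite -setIUr setUv setIT.
- exact: measurableI.
- by apply: measurableI => //; exact: measurableC.
by rewrite setICA -setIA setICr !setI0.
Qed.

Lemma prU_le A B : measurable A -> measurable B -> pr (A `|` B) <= pr A + pr B.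
Proof.
by move=> mA mB; rewrite -lee_fin EFinD !prE//;[exact: measureU2|exact: measurableU].
Qed.

(** All moments finite: a class closed under sums, products and powers, so that integrability of the
    expressions below follows from their shape. *)
Definition allL (f : T -> R) := measurable_fun [set: T] f /\
  forall k, P.-integrable [set: T] (EFin \o (fun w => `|f w| ^+ k)).

Lemma integrable_dom (f g : T -> R) : measurable_fun [set: T] f ->
  (forall w, `|f w| <= g w) ->
  P.-integrable [set: T] (EFin \o g) -> P.-integrable [set: T] (EFin \o f).
Proof.
move=> mf fg; apply: le_integrable => //; first exact/measurable_EFinP.
by move=> w _; rewrite /= lee_fin (le_trans (fg w))// ler_norm.
Qed.

Lemma intD (f g : T -> R) : P.-integrable [set: T] (EFin \o f) ->
  P.-integrable [set: T] (EFin \o g) -> P.-integrable [set: T] (EFin \o (fun w => f w + g w)).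
Proof. by move=> hf hg; apply: eq_integrable (integrableD measurableT hf hg). Qed.

Lemma intZ c (f : T -> R) : P.-integrable [set: T] (EFin \o f) ->
  P.-integrable [set: T] (EFin \o (fun w => c * f w)).
Proof. by move=> hf; apply: eq_integrable (integrableZl measurableT c hf). Qed.

Lemma int_cst (c : R) : P.-integrable [set: T] (EFin \o (fun=> c)).
Proof. exact: finite_measure_integrable_cst. Qed.

Lemma allL_meas f : allL f -> measurable_fun [set: T] f.
Proof. by case. Qed.

Lemma allL_int f : allL f -> P.-integrable [set: T] (EFin \o f).
Proof. by case=> mf /(_ 1%N); apply: integrable_dom. Qed.

Lemma meas_absX (f : T -> R) k : measurable_fun [set: T] f ->
  measurable_fun [set: T] (fun w => `|f w| ^+ k).
Proof. by move=> mf; apply: measurable_funX; exact: measurableT_comp. Qed.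

Lemma allL_dom (f g : T -> R) : measurable_fun [set: T] f ->
  (forall w, `|f w| <= g w) -> allL g -> allL f.
Proof.
move=> mf fg [mg hg]; split=> // k; apply: integrable_dom (hg k); first exact: meas_absX.
move=> w; rewrite normrX normr_id; apply: lerXn2r; rewrite ?nnegrE//.
by apply: le_trans (fg w) (ler_norm _).
Qed.

Lemma allL_cst c : allL (fun=> c).
Proof. by split=> [|k]; [exact: measurable_cst|exact: int_cst]. Qed.

Lemma expr_addl (a b : R) k : 0 <= a -> 0 <= b -> (a + b) ^+ k <= 2 ^+ k * (a ^+ k + b ^+ k).
Proof.
move=> a0 b0; have h (u v : R) : 0 <= u -> u <= v -> (u + v) ^+ k <= 2 ^+ k * (u ^+ k + v ^+ k).
  move=> u0 uv; have v0 : 0 <= v := le_trans u0 uv.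
  have: (u + v) ^+ k <= (2 * v) ^+ k.
    by apply: lerXn2r; rewrite ?nnegrE ?addr_ge0 ?mulr_ge0//; lra.
  move/le_trans; apply; rewrite exprMn ler_wpM2l ?exprn_ge0// lerDr exprn_ge0//.
by case: (leP a b) => [/h|/ltW/h]; [|rewrite addrC [X in _ <= _ * X]addrC]; apply.
Qed.

Lemma allLD f g : allL f -> allL g -> allL (fun w => f w + g w).
Proof.
move=> [mf hf] [mg hg]; split=> [|k]; first exact: measurable_funD.
apply: (integrable_dom _ _ (intZ (2 ^+ k) (intD (hf k) (hg k)))).
  by apply: meas_absX; exact: measurable_funD.
move=> w; rewrite normrX normr_id; apply: le_trans (expr_addl k (normr_ge0 _) (normr_ge0 _)).
by apply: lerXn2r; rewrite ?nnegrE ?addr_ge0//; exact: ler_normD.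
Qed.

Lemma allLM f g : allL f -> allL g -> allL (fun w => f w * g w).
Proof.
move=> [mf hf] [mg hg]; split=> [|k]; first exact: measurable_funM.
apply: (integrable_dom _ _ (intD (hf (k * 2)%N) (hg (k * 2)%N))).
  by apply: meas_absX; exact: measurable_funM.
move=> w; rewrite normrX normr_id normrM exprMn !exprM.
move: (`|f w| ^+ k) (`|g w| ^+ k) (exprn_ge0 k (normr_ge0 (f w))) (exprn_ge0 k (normr_ge0 (g w))).
by move=> a b a0 b0; nra.
Qed.

Lemma allLZ c f : allL f -> allL (fun w => c * f w).
Proof. by move=> hf; apply: allLM => //; exact: allL_cst. Qed.

Lemma allLB f g : allL f -> allL g -> allL (fun w => f w - g w).
Proof.
move=> hf hg; apply: allLD => //.
by rewrite (_ : (fun w => _) = (fun w => -1 * g w)); [exact: allLZ|apply/funext => w; rewrite mulN1r].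
Qed.

Lemma allLX f k : allL f -> allL (fun w => f w ^+ k).
Proof.
move=> hf; elim: k => [|k IH]; first exact: allL_cst.
by rewrite (_ : (fun w => _) = (fun w => f w * f w ^+ k)); [exact: allLM|apply/funext => w; rewrite exprS].
Qed.

Lemma allL_abs f : allL f -> allL (fun w => `|f w|).
Proof.
move=> [mf hf]; split=> [|k]; first exact: measurableT_comp.
by apply: eq_integrable (hf k) => // w _; rewrite /= normr_id.
Qed.

Lemma allL_sum (I : finType) (f : I -> T -> R) : (forall i, allL (f i)) ->
  allL (fun w => \sum_i f i w).
Proof.
move=> hf; elim: (index_enum I) => [|i s IH].
  by under eq_fun do rewrite big_nil; exact: allL_cst.
by under eq_fun do rewrite big_cons; apply: allLD.
Qed.

Lemma allL_indic A : measurable A -> allL (\1_A : T -> R).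
Proof.
move=> mA; apply: (allL_dom _ _ (allL_cst 1)); first exact: measurable_indic.
by move=> w; rewrite indicE; case: (w \in A); rewrite ?normr1 ?normr0.
Qed.

Lemma allL_powR f (r : R) : 0 <= r -> allL f -> allL (fun w => `|f w| `^ r).
Proof.
move=> r0 hf; set k := (Num.truncn r).+1.
apply: (allL_dom _ _ (allLD (allL_cst 1) (allL_abs (allLX k hf)))).
  by apply: (measurableT_comp (measurable_powR _)); apply: measurableT_comp; case: hf.
have rk : r <= k%:R by apply/ltW; exact: truncnS_gt.
move=> w; rewrite ger0_norm ?powR_ge0// normrX.
move: (normr_ge0 (f w)); move: (`|f w|) => x x0.
have [x1|x1] := leP 1 x.
  apply: (@le_trans _ _ (x `^ k%:R)); first exact: ler_powR.
  by rewrite powR_mulrn//; lra.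
apply: (@le_trans _ _ 1); last by rewrite lerDl exprn_ge0.
by rewrite -(powR_1l r); apply: ler_powRl => //; exact: ltW.
Qed.

Lemma ExE f : P.-integrable [set: T] (EFin \o f) -> (Ex f)%:E = (\int[P]_w (f w)%:E)%E.
Proof. by move=> hf; rewrite unlock fineK//; exact: integrable_fin_num. Qed.

Lemma ExD f g : allL f -> allL g -> Ex (fun w => f w + g w) = Ex f + Ex g.
Proof. by move=> /allL_int hf /allL_int hg; rewrite unlock; exact: RintegralD. Qed.

Lemma ExZ c f : allL f -> Ex (fun w => c * f w) = c * Ex f.
Proof. by move=> /allL_int hf; rewrite unlock; exact: RintegralZl. Qed.

Lemma Ex_cst c : Ex (fun=> c) = c.
Proof. by rewrite unlock Rintegral_cst// /= -/(pr setT) prT mulr1. Qed.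

Lemma ExB f g : allL f -> allL g -> Ex (fun w => f w - g w) = Ex f - Ex g.
Proof. by move=> /allL_int hf /allL_int hg; rewrite unlock; exact: RintegralB. Qed.

Lemma Ex_ge0 f : (forall w, 0 <= f w) -> 0 <= Ex f.
Proof. by move=> h; rewrite unlock; apply: Rintegral_ge0. Qed.

Lemma Ex_le f g : allL f -> allL g -> (forall w, f w <= g w) -> Ex f <= Ex g.
Proof. by move=> /allL_int hf /allL_int hg h; rewrite unlock; apply: le_Rintegral. Qed.

Lemma Ex_sum (I : finType) (f : I -> T -> R) : (forall i, allL (f i)) ->
  Ex (fun w => \sum_i f i w) = \sum_i Ex (f i).
Proof.
move=> hf; suff [_ ->//] : allL (fun w => \sum_i f i w) /\ Ex (fun w => \sum_i f i w) = \sum_i Ex (f i).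
elim: (index_enum I) => [|i s [IH1 IH2]].
  by under eq_fun do rewrite big_nil; rewrite big_nil Ex_cst; split=> //; exact: allL_cst.
under eq_fun do rewrite big_cons; rewrite big_cons ExD//; split; last by rewrite IH2.
by apply: allLD.
Qed.

Lemma Ex_indic A : measurable A -> Ex \1_A = pr A.
Proof.
move=> mA; apply/EFin_inj; rewrite ExE; last exact/allL_int/allL_indic.
by rewrite integral_indic// setIT prE.
Qed.

Lemma indicM (A B : set T) : (fun w => \1_A w * \1_B w : R) = \1_(A `&` B).
Proof. by apply/funext => w; rewrite indicI. Qed.

Lemma Ex_indicM A B : measurable A -> measurable B ->
  Ex (fun w => \1_A w * \1_B w) = pr (A `&` B).
Proof. by move=> mA mB; rewrite indicM Ex_indic//; exact: measurableI. Qed.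

Lemma indic_bounds (A : set T) w : 0 <= (\1_A w : R) <= 1.
Proof. by rewrite indicE; case: (_ \in _); rewrite lexx ler01. Qed.

Lemma meas_ge (f : T -> R) c : measurable_fun [set: T] f -> measurable [set w | c <= f w].
Proof.
move=> mf; rewrite (_ : [set w | _] = [set: T] `&` f @^-1` `[c, +oo[); last first.
  by apply/seteqP; split=> [w /= h|w [_ /=]]; [split=> //|]; rewrite /= in_itv/= andbT.
exact: mf.
Qed.

Lemma ex_markov f c : allL f -> (forall w, 0 <= f w) -> 0 < c -> c * pr [set w | c <= f w] <= Ex f.
Proof.
move=> hf f0 c0; have mS := meas_ge c (allL_meas hf).
rewrite -Ex_indic// -ExZ; last exact: allL_indic.
apply: Ex_le => [||w]; [exact/allLZ/allL_indic|by []|].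
rewrite indicE; case: (boolP (w \in _)); first by rewrite inE /= mulr1.
by rewrite mulr0.
Qed.

Lemma ex_cauchy f g : allL f -> allL g ->
  Ex (fun w => f w * g w) ^+ 2 <= Ex (fun w => f w ^+ 2) * Ex (fun w => g w ^+ 2).
Proof.
move=> hf hg; set a := Ex _; set b := Ex _; set c := Ex _.
have a0 : 0 <= b by apply: Ex_ge0 => w; exact: sqr_ge0.
have c0 : 0 <= c by apply: Ex_ge0 => w; exact: sqr_ge0.
(* The second moment of [x * f - y * g]. At [(a, b)] it is [b] times the difference to be shown
   nonnegative; [b = 0] is settled by other choices. *)
have H x y : 0 <= x ^+ 2 * b + y ^+ 2 * c - 2 * x * y * a.
  have <- : Ex (fun w => (x * f w - y * g w) ^+ 2) = x ^+ 2 * b + y ^+ 2 * c - 2 * x * y * a.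
    rewrite /a /b /c -!ExZ; do ?[exact: allLX|exact: allLM].
    rewrite -ExD; do ?[exact/allLZ/allLX]; rewrite -ExB; do ?[exact/allLD/allLZ/allLX].
    - by apply: (f_equal Ex); apply/funext => w; ring.
    - by apply: allLD; apply: allLZ; apply: allLX.
    - by apply: allLZ; exact: allLM.
  by apply: Ex_ge0 => w; exact: sqr_ge0.
have := H a b; have := H c a; have := H a 1; have := H 1 a; move: H; move: (a) (b) (c) a0 c0 => {}a {}b {}c b0 c0 H H1 H2 H3 H4.
have [b00|bn0] := eqVneq b 0.
  rewrite b00 mul0r; have [c00|cn0] := eqVneq c 0; first by have := H a 1; rewrite b00 c00; nra.
  have := H c a; rewrite b00; have : 0 < c by rewrite lt_def cn0.
  by nra.
have b1 : 0 < b by rewrite lt_def bn0.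
have := H a b => K; rewrite -subr_ge0 -(pmulr_rge0 _ b1).
by apply: le_trans K (eq_ler _); ring.
Qed.

End expect.

(** * Moments from exponential tails *)

Section tails.
Context {R : realType} {d : measure_display} {T : measurableType d}.
Variable P : probability T R.
Notation Ex := (Ex P).
Notation pr := (pr P).

Lemma expR_half_num (N : nat) :
  \sum_(0 <= l < N) expR (- (l%:R / 2)) * expR (1 / 2) <= 5 :> R.
Proof.
set x : R := expR (- (1 / 2)).
have x0 : 0 < x by exact: expR_gt0.
have x23 : x <= 2 / 3.
  have := @expR_ge1Dx R (1 / 2); have : x * expR (1 / 2) = 1 by rewrite -expRD subrr expR0 || rewrite -expRD addNr expR0.
  by nra.
have x12 : 1 / 2 <= x by have := @expR_ge1Dx R (- (1 / 2)); rewrite -/x; lra.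
have xe : x * expR (1 / 2) = 1 by rewrite -expRD addNr expR0.
have h : (\sum_(0 <= l < N) expR (- (l%:R / 2))) * (1 - x) <= 1.
  have -> : (\sum_(0 <= l < N) expR (- (l%:R / 2))) * (1 - x) = 1 - x ^+ N.
    elim: N => [|N IH]; first by rewrite big_nil mul0r expr0 subrr.
    rewrite big_nat_recr//= mulrDl IH exprS.
    have -> : expR (- (N%:R / 2)) = x ^+ N by rewrite /x -expRM_natl; congr expR; lra.
    by ring.
  by rewrite lerBlDr lerDl exprn_ge0// ltW.
rewrite -mulr_suml; set S := \sum_(_ <= _ < _) _ in h *.
have S0 : 0 <= S by apply: sumr_ge0 => i _; exact: expR_ge0.
have e2 : expR (1 / 2) <= 2 :> R by nra.
have : 3 / 2 <= expR (1 / 2) :> R by have := @expR_ge1Dx R (1 / 2); lra.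
have : expR (1/2) ^+ 2 <= 4 :> R by rewrite expr2 -expRD; apply: le_trans expR1_le4; rewrite ler_expR; lra.
by move=> *; nra.
Qed.

(** Slice [f] at the integers: below [l + 1] the integrand is at most [expR ((l + 1) / 2)], and the
    resulting series is geometric with sum at most 5. The factor [al] is free because it is not
    always the mass of [D]: in [moment_double] it is exponential in the order of the moment. *)
Lemma exp_moment (D : set T) (f : T -> R) al : measurable D -> measurable_fun [set: T] f ->
  (forall w, 0 <= f w) -> (forall l, pr (D `&` [set w | l%:R <= f w]) <= al * expR (- l%:R)) ->
  (\int[P]_w (\1_D w * expR (f w / 2))%:E <= (5 * al)%:E)%E.
Proof.
move=> mD mf f0 h.
have mA l : measurable (D `&` [set w | l%:R <= f w]).
  by apply: measurableI => //; exact: meas_ge.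
pose g l w := (expR ((l%:R + 1) / 2) * \1_(D `&` [set w | l%:R <= f w]) w)%:E : \bar R.
have g0 l w : (0 <= g l w)%E by rewrite lee_fin mulr_ge0// expR_ge0.
have al0 : 0 <= al.
  by have := h 0%N; rewrite oppr0 expR0 mulr1; apply: le_trans; exact: pr_ge0.
apply: (@le_trans _ _ (\int[P]_w \sum_(0 <= l <oo) g l w)%E).
  apply: ge0_le_integral => //.
  - apply/measurable_EFinP/measurable_funM; first exact: measurable_indic.
    by apply: measurableT_comp => //; apply: measurable_funM.
  - apply: ge0_emeasurable_sum => // l _.
    by apply/measurable_EFinP/measurable_funM => //; exact: measurable_indic.
  move=> w _; have [Dw|nDw] := boolP (w \in D); last first.
    by rewrite indicE (negbTE nDw) mul0r; apply: nneseries_ge0.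
  set l := Num.truncn (f w).
  have /andP[l1 l2] := truncn_itv (f0 w).
  apply: le_trans (nneseries_lim_ge l.+1 _) => //.
  rewrite big_nat_recr//=; apply: (@le_trans _ _ (g l w)); last by apply: leeDr; apply: sume_ge0.
  rewrite lee_fin !indicE Dw mul1r mem_set ?mulr1; last by split; [rewrite inE in Dw|].
  by rewrite ler_expR ler_wpM2r// ltW// natr1.
rewrite integral_nneseries//; last first.
  by move=> l; apply/measurable_EFinP/measurable_funM => //; exact: measurable_indic.
apply: lime_le => [|]; first by apply: is_cvg_nneseries => l _ _; apply: integral_ge0.
near=> N.
apply: (@le_trans _ _ (\sum_(0 <= l < N) (al * (expR (- (l%:R / 2)) * expR (1 / 2)))%:E)%E).
  apply: lee_sum => l _; rewrite /g.
  rewrite (eq_integral (fun w => (expR ((l%:R + 1) / 2))%:E * (\1_(D `&` [set w | l%:R <= f w]) w)%:E)%E); last by move=> w _; rewrite EFinM.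
  rewrite ge0_integralZl//; last first.
    by apply/measurable_EFinP; exact: measurable_indic.
  rewrite -(ExE (allL_int (allL_indic P (mA l)))) Ex_indic// -EFinM lee_fin.
  apply: (@le_trans _ _ (expR ((l%:R + 1) / 2) * (al * expR (- l%:R)))).
    by rewrite ler_wpM2l// expR_ge0.
  by rewrite mulrCA -!expRD; apply: eq_ler; congr (_ * expR _); lra.
rewrite sumEFin lee_fin -mulr_sumr mulrC ler_wpM2r//; exact: expR_half_num.
Unshelve. all: by end_near.
Qed.

Lemma tail_moment (D : set T) (f : T -> R) al : measurable D -> measurable_fun [set: T] f ->
  (forall w, 0 <= f w) -> (forall l, pr (D `&` [set w | l%:R <= f w]) <= al * expR (- l%:R)) ->
  forall k, P.-integrable [set: T] (EFin \o (fun w => \1_D w * f w ^+ k)) /\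
    Ex (fun w => \1_D w * f w ^+ k) <= 5 * al * (2 * k%:R) ^+ k.
Proof.
move=> mD mf f0 h k; have H := exp_moment mD mf f0 h.
have m1 : measurable_fun [set: T] (fun w => \1_D w * expR (f w / 2)).
  apply/measurable_funM; first exact: measurable_indic.
  by apply: measurableT_comp => //; apply: measurable_funM.
have i1 : P.-integrable [set: T] (EFin \o (fun w => \1_D w * expR (f w / 2))).
  apply/integrableP; split; first exact/measurable_EFinP.
  rewrite (eq_integral (fun w => (\1_D w * expR (f w / 2))%:E)).
    exact: le_lt_trans H (ltry _).
  by move=> w _; rewrite /= ger0_norm// mulr_ge0// expR_ge0.
have m2 : measurable_fun [set: T] (fun w => \1_D w * f w ^+ k).
  apply/measurable_funM; first exact: measurable_indic.
  exact: measurable_funX.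
have b w : \1_D w * f w ^+ k <= (2 * k%:R) ^+ k * (\1_D w * expR (f w / 2)).
  rewrite mulrCA ler_wpM2l//.
  have := expr_le_exp k (_ : 0 <= f w / 2); rewrite divr_ge0// => /(_ isT) K.
  have {1}-> : f w = 2 * (f w / 2) by field.
  by rewrite exprMn [(2 * k%:R) ^+ k]exprMn -mulrA ler_wpM2l.
have i2 : P.-integrable [set: T] (EFin \o (fun w => \1_D w * f w ^+ k)).
  apply: (integrable_dom m2 _ (intZ ((2 * k%:R) ^+ k) i1)) => w.
  by rewrite ger0_norm// mulr_ge0// exprn_ge0.
split=> //; rewrite -lee_fin ExE//.
apply: (@le_trans _ _ (((2 * k%:R) ^+ k)%R%:E * (\int[P]_w (\1_D w * expR (f w / 2))%:E))%E); last first.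
  by rewrite [5 * al * _]mulrC EFinM lee_wpmul2l// lee_fin exprn_ge0// mulr_ge0.
rewrite -ge0_integralZl//; first last.
- exact/measurable_EFinP.
apply: ge0_le_integral => //.
- by move=> w _; rewrite lee_fin mulr_ge0// exprn_ge0.
- exact/measurable_EFinP.
- by apply/measurable_EFinP; apply: measurable_funM.
- by move=> w _; rewrite -EFinM lee_fin.
Qed.

End tails.

(** * Log-concavity for closed sets and Borell's lemma *)

Section logconcave.
Context {R : realType} {d : measure_display} {T : measurableType d}.
Variable P : probability T R.
Notation Ex := (Ex P).
Notation pr := (pr P).
Variables (n : nat) (Z : {RV P >-> borel_rV R n}).
Implicit Types (C K L M : set 'rV[R]_n).

Definition event C : set T := Z @^-1` C.

Lemma meas_event C : closed C -> measurable (event C).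
Proof.
move=> cC; have mC : measurable (C : set (borel_rV R n)).
  rewrite -(setCK C); apply: measurableC; apply: sub_sigma_algebra.
  exact: closed_openC.
by have := measurable_funPT Z measurableT _ mC; rewrite setTI.
Qed.

Definition box (N : nat) : set 'rV[R]_n := [set x | `|x| <= N%:R].

Lemma closed_box N : closed (box N).
Proof.
apply: (@preimage_closed _ _ (fun x : 'rV[R]_n => `|x|) [set x : R | x <= N%:R]); last exact: closed_le.
by move=> x _; exact: norm_continuous.
Qed.

Lemma compact_box C N : closed C -> compact (C `&` box N).
Proof.
move=> cC; apply: bounded_closed_compact; last exact: closedI cC (@closed_box N).
exists N%:R; split=> [|e Ne x [_ /= xN]]; first exact: realn.
by apply: le_trans xN (ltW Ne).
Qed.

(** Log-concavity is given for compact sets; intersecting a closed set with a large box loses an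
    arbitrarily small fraction of its mass. *)
Lemma pr_truncate C e : closed C -> 0 < e ->
  exists N, (1 - e) * pr (event C) <= pr (event (C `&` box N)).
Proof.
move=> cC e0; have [p0|pn0] := eqVneq (pr (event C)) 0.
  by exists 0%N; rewrite p0 mulr0; exact: pr_ge0.
have p0 : 0 < pr (event C) by rewrite lt_def pn0 pr_ge0.
have mF N : measurable (event (C `&` box N)) by apply: meas_event; exact: closedI cC (@closed_box N).
have UF : \bigcup_N event (C `&` box N) = event C.
  apply/seteqP; split=> [w [N _ []]//|w Cw].
  exists (Num.truncn `|Z w|).+1 => //; split=> //; rewrite /box/=.
  by apply/ltW; exact: truncnS_gt.
have /fine_cvgP [_] : P \o (fun N => event (C `&` box N)) @ \oo --> (pr (event C))%:E.
  rewrite prE; last exact: meas_event; rewrite -UF; apply: nondecreasing_cvg_mu => //.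
    by rewrite UF; exact: meas_event.
  move=> a b ab; apply/subsetPset => w [Cw /= bw]; split=> //.
  by apply: le_trans bw _; rewrite ler_nat.
move/cvgrPdist_lt => /(_ (e * pr (event C)) (mulr_gt0 e0 p0)) [N _ /(_ N (leqnn N))].
move=> /= h; exists N; move: h; rewrite /pr/= ltr_norml => /andP[_ h]; lra.
Qed.

Hypothesis HL : log_concave Z.

Lemma minkowski_compact K L (lam : R) : compact K -> compact L ->
  compact [set lam *: x + (1 - lam) *: y | x in K & y in L].
Proof.
move=> cK cL; rewrite (_ : [set _ | _ in K & _ in L] =
   (fun xy : 'rV[R]_n * 'rV[R]_n => lam *: xy.1 + (1 - lam) *: xy.2) @` (K `*` L)); last first.
  apply/seteqP; split=> [z [x Kx [y Ly <-]]|z [[x y] [Kx Ly] <-]].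
    by exists (x, y).
  by exists x => //; exists y.
apply: continuous_compact; last exact: compact_setX.
apply: continuous_subspaceT => xy.
apply: (@cvgD _ _ _ _ _ (fun xy : 'rV[R]_n * 'rV[R]_n => lam *: xy.1) (fun xy : 'rV[R]_n * 'rV[R]_n => (1 - lam) *: xy.2)).
- by apply: cvgZr; exact: cvg_fst.
- by apply: cvgZr; exact: cvg_snd.
Qed.

Lemma lc_compact K L M (lam : R) : compact K -> compact L -> closed M -> 0 < lam < 1 ->
  (forall x y, K x -> L y -> M (lam *: x + (1 - lam) *: y)) ->
  pr (event K) `^ lam * pr (event L) `^ (1 - lam) <= pr (event M).
Proof.
move=> cK cL cM /andP[l0 l1] sub.
have [->|/set0P K0] := eqVneq K set0.
  by rewrite /event preimage_set0 /pr measure0 /= powR0 ?mul0r ?pr_ge0// gt_eqF.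
have [->|/set0P L0] := eqVneq L set0.
  by rewrite /event preimage_set0 /pr measure0 /= (@powR0 _ (1 - lam)) ?mulr0 ?pr_ge0// gt_eqF// subr_gt0.
have lam01 : 0 <= lam <= 1 by rewrite !ltW.
have := HL cK cL K0 L0 lam01; rewrite /distribution /pushforward.
have hs : hausdorff_space 'rV[R]_n by exact: norm_hausdorff.
have mK := meas_event (compact_closed hs cK); have mL := meas_event (compact_closed hs cL).
have cC := compact_closed hs (minkowski_compact (lam := lam) cK cL).
rewrite -/(event K) -/(event L) -/(event _) -!prE//; last exact: meas_event.
rewrite !poweR_EFin -EFinM lee_fin => /le_trans; apply.
apply: pr_le; [exact: meas_event|exact: meas_event|].
by move=> w [x Kx [y Ly xy]]; rewrite /event/= -xy; exact: sub.
Qed.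

(** [M] is any closed set that contains the combinations, because the Minkowski combination of two
    closed sets need not be closed. *)
Lemma lc_closed K L M (lam : R) : closed K -> closed L -> closed M -> 0 < lam < 1 ->
  (forall x y, K x -> L y -> M (lam *: x + (1 - lam) *: y)) ->
  pr (event K) `^ lam * pr (event L) `^ (1 - lam) <= pr (event M).
Proof.
move=> cK cL cM l01 sub; have /andP[l0 l1] := l01.
have key (e : R) : 0 < e < 1 ->
  (1 - e) * (pr (event K) `^ lam * pr (event L) `^ (1 - lam)) <= pr (event M).
  move=> /andP[e0 e1]; have [N1 h1] := pr_truncate cK e0; have [N2 h2] := pr_truncate cL e0.
  have e1' : 0 <= 1 - e by rewrite subr_ge0 ltW.
  apply: le_trans (_ : _ <= pr (event (K `&` box N1)) `^ lam * pr (event (L `&` box N2)) `^ (1 - lam)) _; last first.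
    apply: (lc_compact (@compact_box _ N1 cK) (@compact_box _ N2 cL) cM l01).
    by move=> x y [Kx _] [Ly _]; exact: sub.
  apply: (@le_trans _ _ (((1 - e) * pr (event K)) `^ lam * ((1 - e) * pr (event L)) `^ (1 - lam))).
    rewrite !powRM ?pr_ge0// mulrACA -powRD; last by apply/implyP => _; rewrite gt_eqF// subr_gt0.
    by rewrite subrKC powRr1.
  apply: ler_pM; rewrite ?powR_ge0//; apply: ler_powRl => //; rewrite ?mulr_ge0 ?pr_ge0//.
    exact: ltW.
  by rewrite subr_ge0 ltW.
set X := _ `^ lam * _ in key *.
have X0 : 0 <= X by rewrite mulr_ge0// powR_ge0.
rewrite leNgt; apply/negP => MX; have M0 := pr_ge0 P (event M).
have Xp : 0 < X by exact: le_lt_trans MX.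
have := key ((X - pr (event M)) / (2 * X)).
have Eq : (X - pr (event M)) / (2 * X) * X = (X - pr (event M)) / 2 by field; rewrite gt_eqF.
have D1 : (X - pr (event M)) / (2 * X) < 1.
  rewrite ltr_pdivrMr; last by rewrite mulr_gt0.
  by rewrite mul1r; move: (pr _) MX M0 => m; lra.
have D0 : 0 < (X - pr (event M)) / (2 * X) by apply: divr_gt0; [rewrite subr_gt0|exact: mulr_gt0].
by rewrite D0 D1 => /(_ isT); rewrite mulrBl mul1r Eq; move: (pr _) MX M0 => m; lra.
Qed.

Definition convexC C := forall x y (th : R), 0 <= th <= 1 -> C x -> C y ->
  C (th *: x + (1 - th) *: y).

Definition lf (z : 'I_n -> R) (x : 'rV[R]_n) : R := \sum_j z j * x 0 j.

Definition ell (z : 'I_n -> R) (w : T) : R := lf z (Z w).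

Lemma cont_sum (I : finType) (f : I -> 'rV[R]_n -> R) : (forall i, continuous (f i)) ->
  continuous (fun x => \sum_i f i x).
Proof.
move=> hf; elim: (index_enum I) => [|i s IH].
  by under eq_fun do rewrite big_nil; exact: cst_continuous.
rewrite (_ : (fun x => _) = (fun x => f i x + \sum_(j <- s) f j x)); last first.
  by apply/funext => x; rewrite big_cons.
by move=> x; exact: (cvgD (hf i x) (IH x)).
Qed.

Lemma cont_lf z : continuous (lf z).
Proof.
apply: cont_sum => j x.
by apply: (cvg_comp (fun x : 'rV[R]_n => x 0 j) (fun t => z j * t)); [exact: coord_continuous|exact: mulrl_continuous].
Qed.

Lemma cont_abs_lf z : continuous (fun x => `|lf z x|).
Proof. by move=> x; apply: (cvg_comp (lf z)); [exact: cont_lf|exact: norm_continuous]. Qed.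

Lemma closed_ge (f : 'rV[R]_n -> R) c : continuous f -> closed [set x | c <= f x].
Proof. by move=> cf; apply: (@preimage_closed _ _ f [set x : R | c <= x]); [move=> x _; exact: cf|exact: closed_ge]. Qed.

Lemma closed_le (f : 'rV[R]_n -> R) c : continuous f -> closed [set x | f x <= c].
Proof. by move=> cf; apply: (@preimage_closed _ _ f [set x : R | x <= c]); [move=> x _; exact: cf|exact: closed_le]. Qed.

Lemma lfD z (x y : 'rV[R]_n) : lf z (x + y) = lf z x + lf z y.
Proof. by rewrite /lf -big_split; apply: eq_bigr => j _; rewrite mxE mulrDr. Qed.

Lemma lfZ z (c : R) (x : 'rV[R]_n) : lf z (c *: x) = c * lf z x.
Proof. by rewrite /lf mulr_sumr; apply: eq_bigr => j _; rewrite mxE mulrCA. Qed.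

Lemma borell_num (k l m p0 v u : R) : 0 < v -> 1 < u -> 0 <= k -> k <= m -> 0 <= m ->
  (1 + expR v) * m <= p0 -> p0 <= l + m ->
  k `^ (2 / (u + 1)) * l `^ (1 - 2 / (u + 1)) <= m ->
  k <= p0 * expR (- (v * (u + 1) / 2)).
Proof.
move=> v0 u1 k0 km m0 h1 h2 h3; have ev := expR_gt0 v.
have p00 : 0 <= p0 by apply: le_trans h1; rewrite mulr_ge0//; lra.
have [->|kn0] := eqVneq k 0; first by rewrite mulr_ge0// expR_ge0.
have kp : 0 < k by rewrite lt_def kn0.
have mp : 0 < m by exact: lt_le_trans km.
have lp : expR v * m <= l by lra.
have lgt : 0 < l by apply: lt_le_trans lp; rewrite mulr_gt0.
have ln1 : v + ln m <= ln l.
  rewrite -[X in X + _](expRK v) -lnM ?posrE ?expR_gt0//; rewrite ler_ln// posrE.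
  by rewrite mulr_gt0.
move: h3; rewrite !powR_expR// -expRD -[leRHS](lnK mp) ler_expR.
set lam := 2 / (u + 1); have lamE : lam * (u + 1) = 2 by rewrite /lam divfK// gt_eqF//; lra.
move=> h3; have : 2 * ln k + (u - 1) * ln l <= (u + 1) * ln m.
  have -> : 2 * ln k + (u - 1) * ln l = (u + 1) * (lam * ln k + (1 - lam) * ln l).
    rewrite (_ : (u + 1) * _ = lam * (u + 1) * ln k + (u + 1 - lam * (u + 1)) * ln l); last by ring.
    by rewrite lamE; ring.
  by rewrite ler_wpM2l//; lra.
move=> h4; have h5 : ln k <= ln m - v * (u - 1) / 2 by nra.
have mle : m * expR v <= p0 by lra.
apply: (@le_trans _ _ (m * expR (- (v * (u - 1) / 2)))).
  rewrite -[leLHS](lnK kp) -[X in X * _](lnK mp) -expRD ler_expR; lra.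
have -> : - (v * (u + 1) / 2) = - (v * (u - 1) / 2) - v by field.
rewrite expRD [leRHS]mulrCA [leLHS]mulrC ler_wpM2l ?expR_ge0//.
by rewrite expRN ler_pdivlMr.
Qed.

(** Borell's lemma relative to a convex set. With [lam = 2 / (u + 1)], combining a point at level
    [u * a] with one below [a] gives level at least [lam * u * a - (1 - lam) * a = a]; comparing the
    masses forces exponential decay in [u]. *)
Lemma borell C z (a v u : R) : closed C -> convexC C -> 0 < a -> 0 < v -> 1 <= u ->
  (1 + expR v) * pr (event C `&` [set w | a <= `|ell z w|]) <= pr (event C) ->
  pr (event C `&` [set w | u * a <= `|ell z w|]) <= pr (event C) * expR (- (v * (u + 1) / 2)).
Proof.
move=> cC xC a0 v0 u1 h.
pose K := C `&` [set x | u * a <= `|lf z x|].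
pose L := C `&` [set x | `|lf z x| <= a].
pose M := C `&` [set x | a <= `|lf z x|].
have cK : closed K by apply: closedI => //; apply/closed_ge/cont_abs_lf.
have cL : closed L by apply: closedI => //; apply/closed_le/cont_abs_lf.
have cM : closed M by apply: closedI => //; apply/closed_ge/cont_abs_lf.
change (pr (event K) <= pr (event C) * expR (- (v * (u + 1) / 2))).
have {}h : (1 + expR v) * pr (event M) <= pr (event C) by exact: h.
have M0 : 0 <= pr (event M) := pr_ge0 _ _.
move: u1; rewrite le_eqVlt => /predU1P[u1|u1].
  have -> : K = M by rewrite /K -u1 mul1r.
  have -> : - (v * (u + 1) / 2) = - v by rewrite -u1; field.
  rewrite expRN ler_pdivlMr ?expR_gt0//; apply: le_trans h.
  by rewrite mulrC ler_wpM2r// lerDr.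
apply: (@borell_num _ (pr (event L)) (pr (event M))) => //.
- exact: pr_ge0.
- apply: pr_le; [exact: meas_event|exact: meas_event|].
  move=> w [Cw /= uw]; split=> //=; apply: le_trans uw.
  by rewrite ler_pMl// ltW.
- apply: le_trans (prU_le _ (meas_event cL) (meas_event cM)).
  apply: pr_le; [exact: meas_event|by apply: measurableU; exact: meas_event|].
  move=> w Cw; case: (leP `|lf z (Z w)| a) => [|/ltW] aw; [by left|by right].
have lam01 : 0 < 2 / (u + 1) < 1.
  by rewrite divr_gt0 ?ltr_pdivrMr//; lra.
apply: lc_closed => // x y [Cx /= ux] [Cy /= yb]; split.
  by apply: xC => //; case/andP: lam01 => ? ?; rewrite !ltW.
rewrite /= lfD !lfZ; set lam := 2 / (u + 1) in lam01 *.
have lamE : lam * (u + 1) = 2 by rewrite /lam divfK// gt_eqF//; lra.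
have := lerB_normD (lam * lf z x) ((1 - lam) * lf z y).
case/andP: lam01 => l0 l1.
have -> : `|lam * lf z x| = lam * `|lf z x| by rewrite normrM gtr0_norm.
have -> : `|(1 - lam) * lf z y| = (1 - lam) * `|lf z y| by rewrite normrM gtr0_norm ?subr_gt0.
move=> hh; apply: le_trans hh; nra.
Qed.

End logconcave.

(** * Tails and moments of one-dimensional marginals *)

Section isotropic_moments.
Context {R : realType} {d : measure_display} {T : measurableType d}.
Variable P : probability T R.
Notation Ex := (Ex P).
Notation pr := (pr P).
Variables (n : nat) (Z : {RV P >-> borel_rV R n}).
Hypothesis HL : log_concave Z.
Hypothesis HI : isotropic Z.
Notation ell := (ell Z).
Notation event := (event Z).

Lemma meas_cont (f : 'rV[R]_n -> R) : continuous f -> measurable_fun [set: T] (fun w => f (Z w)).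
Proof.
move=> cf; apply: (measurability (@RGenCInfty.G R)) => [|/= _ [_] [r] -> <-].
  exact: RGenCInfty.measurableE.
rewrite setTI (_ : _ @^-1` _ = event [set x | r <= f x]).
  by apply: meas_event; exact: closed_ge.
by apply/seteqP; split=> w; rewrite /= in_itv/= andbT.
Qed.

Lemma meas_ell z : measurable_fun [set: T] (ell z).
Proof. exact: meas_cont (@cont_lf R n z). Qed.

Definition unitv (j : 'I_n) : 'I_n -> R := fun i => (i == j)%:R.

Lemma ell_unit j w : ell (unitv j) w = Z w 0 j.
Proof.
rewrite (_ : ell _ _ = \sum_i unitv j i * Z w 0 i)// (bigD1 j)//= /unitv eqxx mul1r big1 ?addr0// => i /negbTE ->.
by rewrite mul0r.
Qed.

Lemma int_cov j k : (\int[P]_w (Z w 0 j * Z w 0 k)%:E = ((j == k)%:R)%:E)%E.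
Proof.
have [H1 H2] := HI; rewrite -H2 covariance.unlock !H1 /= expectation.unlock.
by apply: eq_integral => w _; rewrite /GRing.mul /= /GRing.mul/= !subr0.
Qed.

Lemma int_sqr j : P.-integrable [set: T] (EFin \o (fun w => ell (unitv j) w ^+ 2)).
Proof.
apply/integrableP; split.
  by apply/measurable_EFinP; apply: measurable_funX; exact: meas_ell.
rewrite (eq_integral (fun w => (Z w 0 j * Z w 0 j)%:E)); last first.
  by move=> w _; rewrite /= ger0_norm ?sqr_ge0// ell_unit.
by rewrite int_cov ltry.
Qed.

Lemma tail_extend C z a : closed C -> 0 < a -> (forall u, 1 <= u ->
    pr (event C `&` [set w | u * a <= `|ell z w|]) <= pr (event C) * expR (- u)) ->
  forall l, pr (event C `&` [set w | l%:R <= `|ell z w| / a]) <= pr (event C) * expR (- l%:R).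
Proof.
move=> cC a0 h [|l].
  rewrite oppr0 expR0 mulr1; apply: pr_le; [|exact: meas_event|by move=> w []].
  apply: measurableI; first exact: meas_event.
  by apply: meas_ge; apply: measurable_funM => //; apply: measurableT_comp => //; exact: meas_ell.
apply: le_trans (h l.+1%:R _); last by rewrite ler1n.
apply: eq_ler; congr pr; apply/seteqP; split=> w [Cw] /=; split=> //=.
  by rewrite -ler_pdivlMr.
by rewrite ler_pdivlMr.
Qed.

Lemma meas_scaled z a : measurable_fun [set: T] (fun w => `|ell z w| / a).
Proof. by apply: measurable_funM => //; apply: measurableT_comp => //; exact: meas_ell. Qed.

Lemma expR2_17 : 1 + expR 2 <= 17 :> R.
Proof.
have := @expR1_le4 R; have := expR_ge0 (1 : R).
have -> : expR 2 = expR 1 ^+ 2 :> R by rewrite expr2 -expRD.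
by move: (expR 1) => e; nra.
Qed.

Lemma convexT : convexC [set: 'rV[R]_n]. Proof. by []. Qed.

Lemma eventT : event setT = setT. Proof. exact: preimage_setT. Qed.

Lemma pr_eventT : pr (event setT) = 1.
Proof. by rewrite eventT prT. Qed.

(** Only second moments are known at this point. Chebyshev leaves mass at most 1/25 beyond level 5,
    below the threshold [1 / (1 + expR 2)] of Borell's lemma, which yields exponential tails and
    with them all moments. *)
Lemma allL_unit j : allL P (ell (unitv j)).
Proof.
have m5 : 17 * pr (event setT `&` [set w | 5 <= `|ell (unitv j) w|]) <= 1.
  rewrite eventT setTI.
  have mA : measurable [set w | 5 <= `|ell (unitv j) w|].
    by apply: meas_ge; apply: measurableT_comp => //; exact: meas_ell.
  have := le_Rintegral measurableT (intZ 25 (allL_int (allL_indic P mA))) (int_sqr j).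
  have -> : (\int[P]_w (25 * \1_[set w | 5 <= `|ell (unitv j) w|] w) = 25 * pr [set w | 5 <= `|ell (unitv j) w|])%R.
    by have := ExZ 25 (allL_indic P mA); rewrite Ex_indic// Ex.unlock.
  have -> : (\int[P]_w (ell (unitv j) w ^+ 2) = 1)%R.
    rewrite /Rintegral (eq_integral (fun w => (Z w 0 j * Z w 0 j)%:E)); last first.
      by move=> w _; rewrite ell_unit.
    by rewrite int_cov eqxx.
  move=> h; have : 25 * pr [set w | 5 <= `|ell (unitv j) w|] <= 1.
    apply: h => w _; rewrite indicE; case: (boolP (w \in _)) => [|_]; last by rewrite mulr0 sqr_ge0.
    rewrite inE /= mulr1 -[ell _ w ^+ 2]real_normK ?num_real// => h.
    by rewrite (_ : 25 = 5 ^+ 2) ?lerXn2r ?nnegrE//; ring.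
  have := pr_ge0 P [set w | 5 <= `|ell (unitv j) w|]; move: (pr _) => x; lra.
have h u : 1 <= u -> pr (event setT `&` [set w | u * 5 <= `|ell (unitv j) w|]) <= pr (event setT) * expR (- u).
  move=> u1; apply: le_trans (borell HL closedT convexT (_ : 0 < 5) (_ : 0 < 2) u1 _) _ => //.
    by rewrite pr_eventT; apply: le_trans m5; rewrite ler_wpM2r ?pr_ge0//; exact: expR2_17.
  by rewrite ler_wpM2l ?pr_ge0// ler_expR; lra.
have := tail_moment (meas_event Z closedT) _ _ (tail_extend closedT (_ : 0 < 5) h) => H.
split=> [|k]; first exact: meas_ell.
have {H} [H _] := H (meas_scaled _ _) (fun w => divr_ge0 (normr_ge0 _) (ler0n _ _)) (ltr0Sn _ _) k.
apply: eq_integrable (intZ (5 ^+ k) H) => // w _ /=.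
by rewrite indicE mem_set// mul1r -exprMn mulrCA divff// mulr1.
Qed.

Lemma ellE z w : ell z w = \sum_j z j * ell (unitv j) w.
Proof. by apply: eq_bigr => j _; rewrite ell_unit. Qed.

Lemma allL_ell z : allL P (ell z).
Proof.
rewrite (_ : ell z = fun w => \sum_j z j * ell (unitv j) w); last exact/funext/ellE.
by apply: allL_sum => j; apply: allLZ; exact: allL_unit.
Qed.

Lemma Ex_unit j k : Ex (fun w => ell (unitv j) w * ell (unitv k) w) = (j == k)%:R.
Proof.
apply: (@EFin_inj R); rewrite ExE; last by apply: allL_int; apply: allLM; exact: allL_unit.
by rewrite -int_cov; apply: eq_integral => w _; rewrite !ell_unit.
Qed.

Lemma Ex_ell2 z : Ex (fun w => ell z w ^+ 2) = dot z z.
Proof.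
have -> : (fun w => ell z w ^+ 2) =
    (fun w => \sum_j \sum_k (z j * z k) * (ell (unitv j) w * ell (unitv k) w)).
  apply/funext => w; rewrite ellE expr2 mulr_suml; apply: eq_bigr => j _.
  by rewrite mulr_sumr; apply: eq_bigr => k _; ring.
have hL j k : allL P (fun w => (z j * z k) * (ell (unitv j) w * ell (unitv k) w)).
  by apply: allLZ; apply: allLM; exact: allL_unit.
rewrite Ex_sum; last by move=> j; apply: allL_sum.
apply: eq_bigr => j _; rewrite Ex_sum// (bigD1 j)//= big1 ?addr0.
  rewrite ExZ; last by apply: allLM; exact: allL_unit.
  by rewrite Ex_unit eqxx mulr1.
move=> k kj; rewrite ExZ; last by apply: allLM; exact: allL_unit.
by rewrite Ex_unit eq_sym (negbTE kj) mulr0.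
Qed.

(** Chebyshev for the second moment on [C] leaves at most 1/17 of the mass of [C] beyond [a], and
    [1 + expR 2 <= 17]. *)
Lemma cond_tail C z (v a : R) : closed C -> convexC C -> 0 < a -> 17 * v <= a ^+ 2 ->
  Ex (fun w => \1_(event C) w * ell z w ^+ 2) <= v * pr (event C) ->
  forall u, 1 <= u ->
    pr (event C `&` [set w | u * a <= `|ell z w|]) <= pr (event C) * expR (- u).
Proof.
move=> cC xC a0 va h u u1.
apply: le_trans (borell HL cC xC a0 (_ : 0 < 2) u1 _) _ => //; last first.
  by rewrite ler_wpM2l ?pr_ge0// ler_expR; lra.
have mC := meas_event Z cC.
have mA : measurable [set w | a <= `|ell z w|].
  by apply: meas_ge; apply: measurableT_comp => //; exact: meas_ell.
set x := pr (_ `&` _); have x0 : 0 <= x := pr_ge0 _ _.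
have p0 : 0 <= pr (event C) := pr_ge0 _ _.
have : a ^+ 2 * x <= v * pr (event C).
  apply: le_trans h; rewrite /x -Ex_indicM// -ExZ; last by apply: allLM; exact: allL_indic.
  apply: Ex_le => [||w].
  - by apply: allLZ; apply: allLM; exact: allL_indic.
  - by apply: allLM; [exact: allL_indic|apply: allLX; exact: allL_ell].
  rewrite mulrCA ler_wpM2l//; rewrite indicE; case: (boolP (w \in _)); last by rewrite mulr0 sqr_ge0.
  rewrite inE /= mulr1 -[ell _ w ^+ 2]real_normK ?num_real// => hh.
  by rewrite lerXn2r ?nnegrE// ltW.
have a20 : 0 < a ^+ 2 by rewrite exprn_gt0.
have := expR2_17; move: (expR 2) (pr (event C)) p0 (a ^+ 2) a20 va => E p p0 A A0 va E17 H.
have H1 : A * (17 * x) <= A * p by nra.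
by rewrite ler_pM2l// in H1; apply: le_trans H1; rewrite ler_wpM2r.
Qed.

Lemma cond_moment C z (v a : R) k : closed C -> convexC C -> 0 < a -> 17 * v <= a ^+ 2 ->
  Ex (fun w => \1_(event C) w * ell z w ^+ 2) <= v * pr (event C) ->
  Ex (fun w => \1_(event C) w * `|ell z w| ^+ k) <= 5 * pr (event C) * (2 * k%:R * a) ^+ k.
Proof.
move=> cC xC a0 va h; have mC := meas_event Z cC.
have f0 w : 0 <= `|ell z w| / a by rewrite divr_ge0// ltW.
have [_] := tail_moment mC (meas_scaled z a) f0 (tail_extend cC a0 (cond_tail cC xC a0 va h)) k.
have hL : allL P (fun w => \1_(event C) w * (`|ell z w| / a) ^+ k).
  apply: allLM; first exact: allL_indic.
  apply: allLX; apply: allLM; [apply: allL_abs; exact: allL_ell|exact: allL_cst].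
have -> : (fun w => \1_(event C) w * `|ell z w| ^+ k) =
    (fun w => a ^+ k * (\1_(event C) w * (`|ell z w| / a) ^+ k)).
  by apply/funext => w; rewrite mulrCA -exprMn mulrCA divff ?gt_eqF// mulr1.
rewrite ExZ// => H; rewrite [(2 * k%:R * a) ^+ k]exprMn [leRHS]mulrA [leRHS]mulrC.
by rewrite ler_wpM2l// exprn_ge0// ltW.
Qed.

Lemma moment_bound z (N : R) k : 0 < N -> dot z z <= N ^+ 2 ->
  Ex (fun w => `|ell z w| ^+ k) <= 5 * (10 * k%:R * N) ^+ k.
Proof.
move=> N0 zN; have := @cond_moment setT z (N ^+ 2) (5 * N) k closedT convexT.
have e f : (fun w => \1_(event setT) w * f w) = f :> (T -> R).
  by apply/funext => w; rewrite indicE mem_set// mul1r.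
rewrite !e pr_eventT !mulr1 Ex_ell2 => h; apply: le_trans (h _ _ _) _ => //.
- by rewrite mulr_gt0.
- by rewrite exprMn ler_wpM2r ?sqr_ge0//; lra.
by apply: eq_ler; congr (5 * _ ^+ k); ring.
Qed.

(** A reverse Hoelder inequality with a constant independent of [r]. Markov at order [r] leaves mass
    [(4 ^+ 3) ^- r] beyond [a], so Borell's lemma applies with [v] proportional to [r], and beyond
    [a] the tail decays at the scale [a / r]. *)
Lemma moment_double z (mu : R) r : (0 < r)%N -> 0 < mu ->
  Ex (fun w => `|ell z w| ^+ r) <= mu ^+ r ->
  Ex (fun w => `|ell z w| ^+ (2 * r)) <= (4 ^+ 6 * mu) ^+ (2 * r).
Proof.
move=> r0 mu0 h; pose a : R := 4 ^+ 3 * mu.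
have a0 : 0 < a by rewrite mulr_gt0// exprn_gt0.
have rR : 1 <= r%:R :> R by rewrite ler1n.
have mr : 0 < mu ^+ r by rewrite exprn_gt0.
have hL : allL P (fun w => `|ell z w| ^+ r) by apply/allLX/allL_abs/allL_ell.
have mA : measurable [set w | a <= `|ell z w|].
  by apply: meas_ge; apply: measurableT_comp => //; exact: meas_ell.
have h1 : (4 ^+ 3) ^+ r * pr [set w | a <= `|ell z w|] <= 1.
  rewrite -(ler_pM2l mr) mulr1 mulrA -exprMn [mu * _]mulrC -/a; apply: le_trans h.
  apply: le_trans (ex_markov (c := a ^+ r) hL _ _) => [|w|]; rewrite ?exprn_gt0 ?exprn_ge0//.
  rewrite ler_wpM2l ?exprn_ge0//; first exact: ltW.
  apply: pr_le => //; first by apply: meas_ge; case: hL.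
  by move=> w /= aw; rewrite lerXn2r ?nnegrE// ltW.
have h2 : (1 + expR (2 * r%:R)) * pr (event setT `&` [set w | a <= `|ell z w|]) <= pr (event setT).
  rewrite eventT setTI prT; apply: le_trans h1; rewrite ler_wpM2r ?pr_ge0//.
  have -> : expR (2 * r%:R) = (expR 1 ^+ 2) ^+ r :> R.
    by rewrite -exprM -expRM_natl natrM mulr1.
  have : (expR 1 ^+ 2) ^+ r <= (4 ^+ 2) ^+ r :> R.
    by rewrite lerXn2r ?nnegrE ?exprn_ge0 ?expR_ge0// lerXn2r ?nnegrE ?expR_ge0//; exact: expR1_le4.
  have -> : (4 ^+ 3) ^+ r = (4 ^+ 2) ^+ r * 4 ^+ r :> R by rewrite -exprMn -exprSr.
  have : 1 <= (4 ^+ 2) ^+ r :> R by rewrite exprn_ege1// exprn_ege1//; lra.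
  have : 2 <= 4 ^+ r :> R by case: (r) r0 => // r' _; rewrite exprS; have : 1 <= 4 ^+ r' :> R by [rewrite exprn_ege1//; lra]; lra.
  by move: ((4 ^+ 2) ^+ r) (4 ^+ r) ((expR 1 ^+ 2) ^+ r) => A B E; nra.
have h3 u : 1 <= u -> pr [set w | u * a <= `|ell z w|] <= expR (- (u * r%:R)).
  move=> u1; have := borell HL closedT convexT a0 (_ : 0 < 2 * r%:R) u1 h2.
  rewrite eventT setTI prT mul1r => H; apply: le_trans (H _) _; first by lra.
  by rewrite ler_expR; lra.
pose f w := `|ell z w| / (a / r%:R).
have ar0 : 0 < a / r%:R by rewrite divr_gt0//; lra.
(* Below [l = r] the factor [expR r] makes the bound trivial; it costs only a constant after a root
   of order [2 * r]. *)
have tl l : pr (event setT `&` [set w | l%:R <= f w]) <= expR r%:R * expR (- l%:R).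
  rewrite eventT setTI; have [lr|rl] := ltnP l r.
    apply: (@le_trans _ _ 1); first by apply: pr_le1; apply: meas_ge; exact: meas_scaled.
    by rewrite -expRD -[leLHS]expR0 ler_expR subr_ge0 ler_nat ltnW.
  apply: (@le_trans _ _ (expR (- l%:R))); last by rewrite ler_peMl ?expR_ge0// -[leLHS]expR0 ler_expR.
  have := h3 (l%:R / r%:R); rewrite divfK ?gt_eqF ?ltr0n// => H; apply: le_trans (H _); last first.
    by rewrite ler_pdivlMr ?ltr0n// mul1r ler_nat.
  have e : l%:R / r%:R * a = l%:R * (a / r%:R) by rewrite mulrAC -mulrA.
  by apply: eq_ler; congr pr; apply/seteqP; split=> w /=; rewrite /f ler_pdivlMr// e.
have f0 w : 0 <= f w by rewrite divr_ge0// ltW.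
have [_] := tail_moment (meas_event Z closedT) (meas_scaled z _) f0 tl (2 * r)%N.
have e g : (fun w => \1_(event setT) w * g w) = g :> (T -> R).
  by apply/funext => w; rewrite indicE mem_set// mul1r.
rewrite e => H.
have -> : (fun w => `|ell z w| ^+ (2 * r)) = (fun w => (a / r%:R) ^+ (2 * r) * f w ^+ (2 * r)).
  by apply/funext => w; rewrite -exprMn /f mulrCA divff ?gt_eqF// mulr1.
rewrite ExZ; last first.
  apply: allLX; apply: allLM; [apply: allL_abs; exact: allL_ell|exact: allL_cst].
apply: (@le_trans _ _ ((a / r%:R) ^+ (2 * r) * (5 * expR r%:R * (2 * (2 * r)%:R) ^+ (2 * r)))).
  by rewrite ler_wpM2l// exprn_ge0// ltW.
have -> : (a / r%:R) ^+ (2 * r) * (5 * expR r%:R * (2 * (2 * r)%:R) ^+ (2 * r)) =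
  (5 * expR r%:R) * (4 ^+ 4 * mu) ^+ (2 * r).
  rewrite mulrCA -exprMn; congr (_ * _ ^+ _); rewrite /a natrM; field.
  by rewrite gt_eqF//; lra.
have -> : 4 ^+ 6 * mu = 4 ^+ 2 * (4 ^+ 4 * mu) by ring.
rewrite [in leRHS]exprMn ler_wpM2r ?exprn_ge0 ?mulr_ge0 ?exprn_ge0//; first exact: ltW.
have -> : expR r%:R = expR 1 ^+ r :> R by rewrite -expRM_natl mulr1.
apply: (@le_trans _ _ (5 * 4 ^+ r)).
  by rewrite ler_wpM2l// lerXn2r ?nnegrE ?expR_ge0//; exact: expR1_le4.
have -> : (4 ^+ 2) ^+ (2 * r) = 4 ^+ (3 * r) * 4 ^+ r :> R.
  by rewrite -exprM -exprD; congr (_ ^+ _); ring.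
rewrite ler_wpM2r ?exprn_ge0//; case: (r) r0 => // r' _.
by rewrite mulnS exprD; have : 1 <= 4 ^+ (3 * r') :> R by [rewrite exprn_ege1//; lra]; move: (4 ^+ (3 * r')) => x; lra.
Qed.

(** Paley-Zygmund for the power [2 * s] of the marginal, whose second moment is controlled by
    [moment_double]. *)
Lemma small_ball z s (rho : R) : (0 < s)%N -> 0 <= rho ->
  0 < Ex (fun w => ell z w ^+ (2 * s)) ->
  (2 * rho) ^+ (2 * s) <= Ex (fun w => ell z w ^+ (2 * s)) ->
  (4 ^+ 25) ^- s <= pr [set w | rho <= `|ell z w|].
Proof.
move=> s0 rho0; set H := Ex _ => H0 hH.
have absX w k : `|ell z w| ^+ (2 * k) = ell z w ^+ (2 * k).
  by rewrite !exprM real_normK ?num_real.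
have s2 : (0 < 2 * s)%N by rewrite muln_gt0.
set mu := H `^ (2 * s)%:R^-1.
have mu0 : 0 < mu by exact: powR_gt0.
have muE : mu ^+ (2 * s) = H.
  by rewrite -powR_mulrn ?ltW// /mu -powRrM mulVf ?powRr1 ?ltW// pnatr_eq0 -lt0n.
have dbl := moment_double (z := z) s2 mu0.
have {}dbl : Ex (fun w => ell z w ^+ (2 * (2 * s))) <= (4 ^+ 6) ^+ (4 * s) * H ^+ 2.
  have -> : (4 ^+ 6) ^+ (4 * s) * H ^+ 2 = (4 ^+ 6 * mu) ^+ (2 * (2 * s)).
    have e : (2 * (2 * s) = 4 * s)%N by rewrite mulnA.
    rewrite e [RHS]exprMn; congr (_ * _); rewrite -e [(2 * _)%N]mulnC exprM muE //.
  have <- : (fun w => `|ell z w| ^+ (2 * (2 * s))) = (fun w => ell z w ^+ (2 * (2 * s))).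
    by apply/funext => w; rewrite absX.
  apply: dbl; apply: eq_ler; rewrite muE /H; apply: (f_equal Ex).
  by apply/funext => w; rewrite absX.
have mA : measurable [set w | rho <= `|ell z w|].
  by apply: meas_ge; apply: measurableT_comp => //; exact: meas_ell.
set A := [set w | _] in mA *.
have hl : allL P (fun w => ell z w ^+ (2 * s)) by apply/allLX/allL_ell.
have h1 : H <= rho ^+ (2 * s) + Ex (fun w => \1_A w * ell z w ^+ (2 * s)).
  rewrite -[X in X + _](Ex_cst P) -ExD; [|exact: allL_cst|by apply: allLM => //; exact: allL_indic].
  apply: Ex_le => // [|w]; first by apply: allLD; [exact: allL_cst|apply: allLM => //; exact: allL_indic].
  rewrite indicE; case: (boolP (w \in A)) => [_|]; first by rewrite mul1r lerDr exprn_ge0.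
  rewrite notin_setE /A /= mul0r addr0 => /negP; rewrite -ltNge => lt.
  by rewrite -absX lerXn2r ?nnegrE// ltW.
have h2 : (Ex (fun w => \1_A w * ell z w ^+ (2 * s))) ^+ 2 <= pr A * ((4 ^+ 6) ^+ (4 * s) * H ^+ 2).
  apply: le_trans (ex_cauchy (allL_indic P mA) hl) _.
  apply: ler_pM.
  - by apply: Ex_ge0 => w; exact: sqr_ge0.
  - by apply: Ex_ge0 => w; exact: sqr_ge0.
  - rewrite -Ex_indic//; apply: eq_ler; apply: (f_equal Ex); apply/funext => w.
    by rewrite indicE; case: (_ \in _); rewrite ?expr1n ?expr0n.
  apply: le_trans dbl; apply: eq_ler; apply: (f_equal Ex); apply/funext => w.
  by rewrite -exprM [(2 * s * 2)%N]mulnC.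
have h3 : rho ^+ (2 * s) <= H / 4.
  have : 4 * rho ^+ (2 * s) <= H; last by lra.
  apply: le_trans hH; rewrite exprMn ler_wpM2r ?exprn_ge0//.
  by rewrite exprM; case: (s) s0 => // s' _; rewrite exprS (_ : 2 ^+ 2 = 4 :> R) ?ler_pMr ?exprn_ege1//; [lra|ring].
set e := Ex _ in h1 h2; have h4 : 3 / 4 * H <= e by lra.
have p0 : 0 <= pr A := pr_ge0 _ _.
have h5 : 1 / 4 * H ^+ 2 <= pr A * (4 ^+ 6) ^+ (4 * s) * H ^+ 2.
  by rewrite -[leRHS]mulrA; apply: le_trans h2; nra.
rewrite ler_pM2r ?exprn_gt0// in h5.
have q0 : 0 < (4 ^+ 25) ^+ s :> R by rewrite !exprn_gt0.
rewrite -[leLHS]mul1r ler_pdivrMr//.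
have -> : (4 ^+ 25) ^+ s = (4 ^+ 6) ^+ (4 * s) * 4 ^+ s :> R.
  by rewrite exprM -exprMn; congr (_ ^+ s); rewrite -exprM -exprSr.
have : 4 <= 4 ^+ s :> R by case: (s) s0 => // s' _; rewrite exprS ler_pMr// exprn_ege1//; lra.
by move: h5 p0; move: (pr A) ((4 ^+ 6) ^+ (4 * s)) (4 ^+ s) (exprn_ge0 (4 * s) (exprn_ge0 6 (ler0n R 4))) => x y t y0 h5 x0 t4; nra.
Qed.

End isotropic_moments.

(** * Paouris' inequality *)

Section geometry_aux.
Context {R : realType}.

Lemma lattice_round k N (u : 'I_k -> R) : (forall i, `|u i| <= N%:R) ->
  exists w : {ffun 'I_k -> 'I_(2 * N).+1}, sqdist (lat w) u <= 1 ^+ 2 * k%:R.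
Proof.
move=> hu; have h i : exists j : 'I_(2 * N).+1, (j%:R - N%:R - u i) ^+ 2 <= 1.
  have := hu i; rewrite ler_norml => /andP[u1 u2].
  have u0 : 0 <= u i + N%:R by lra.
  have /andP[t1 t2] := truncn_itv u0.
  have jN : (Num.truncn (u i + N%:R) < (2 * N).+1)%N.
    rewrite ltnS -(ler_nat R); apply: le_trans t1 _; rewrite natrM; lra.
  exists (Ordinal jN) => /=; move: t1 t2; rewrite -natr1; move: (_%:R : R) => t t1 t2; nra.
have [f hf] := choice h; exists [ffun i => f i].
rewrite /sqdist expr1n mul1r -[k in k%:R]card_ord -sumr_const; apply: ler_sum => i _.
by rewrite /lat ffunE; exact: hf.
Qed.

Lemma sqdist_conv k (x y u v : 'I_k -> R) (th : R) : 0 <= th <= 1 ->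
  sqdist (fun i => th * x i + (1 - th) * y i) (fun i => th * u i + (1 - th) * v i) <=
  th * sqdist x u + (1 - th) * sqdist y v.
Proof.
move=> /andP[t0 t1]; rewrite /sqdist !mulr_sumr -big_split; apply: ler_sum => i _ /=.
move: (x i) (y i) (u i) (v i) => {}x {}y {}u {}v.
have : 0 <= th * (1 - th) * ((x - u) - (y - v)) ^+ 2.
  by rewrite mulr_ge0 ?sqr_ge0// mulr_ge0//; lra.
by move=> *; nra.
Qed.

Lemma sqdist0 k (u : 'I_k -> R) : sqdist u (fun=> 0) = dot u u.
Proof. by apply: eq_bigr => i _; rewrite subr0 expr2. Qed.

Lemma sqr_le_dot k (u : 'I_k -> R) i : u i ^+ 2 <= dot u u.
Proof.
by rewrite /dot (bigD1 i)//= -expr2 lerDl sumr_ge0// => j _; rewrite -expr2 sqr_ge0.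
Qed.

Lemma coord_bound k (u : 'I_k -> R) (b : nat) i : dot u u <= b%:R ^+ 2 * k%:R ->
  `|u i| <= (b * k)%:R.
Proof.
move=> h; have k1 : 1 <= k%:R :> R by rewrite ler1n; case: (k) i => [[]|].
rewrite -(@ler_pXn2r _ 2)// ?nnegrE// real_normK ?num_real//.
apply: le_trans (sqr_le_dot u i) (le_trans h _); rewrite natrM exprMn ler_wpM2l ?sqr_ge0//.
by rewrite expr2; move: (k%:R) k1 => x x1; nra.
Qed.

Lemma sum_le_card (I : finType) (Q : pred I) (f : I -> R) (c : R) : 0 <= c ->
  (forall i, Q i -> f i <= c) -> \sum_(i | Q i) f i <= #|Q|%:R * c.
Proof.
move=> c0 h; apply: le_trans (_ : \sum_(i | Q i) c <= _); first exact: ler_sum.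
by rewrite sumr_const mulr_natl.
Qed.

(** The factor 8 compensates the mass 1/2 at the origin, since 8 (1/2)^3 = 1. *)
Lemma quarter_num (th a b : R) : 0 <= th -> 8 * th ^+ 4 <= a -> 1 / 2 <= b ->
  th <= a `^ 4^-1 * b `^ (1 - 4^-1).
Proof.
move=> th0 ha hb; have e : th = (8 * th ^+ 4) `^ 4^-1 * (1 / 2) `^ (1 - 4^-1).
  have -> : (1 / 2) `^ (1 - 4^-1) = (1 / 8) `^ 4^-1 :> R.
    have -> : 1 / 8 = (1 / 2) `^ 3 :> R by rewrite powR_mulrn//; field.
    by rewrite -powRrM; congr (_ `^ _); field.
  have q0 : 0 <= 8 * th ^+ 4 by rewrite mulr_ge0// exprn_ge0.
  have q1 : 0 <= 1 / 8 :> R by lra.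
  rewrite -(powRM _ q0 q1).
  have -> : 8 * th ^+ 4 * (1 / 8) = th `^ 4%:R by rewrite powR_mulrn//; field.
  by rewrite -powRrM divff ?powRr1// pnatr_eq0.
rewrite [leLHS]e; apply: ler_pM; rewrite ?powR_ge0//; apply: ler_powRl => //.
- by rewrite mulr_ge0// exprn_ge0.
- lra.
Qed.

Lemma lin_shift k (x u t : 'I_k -> R) (L : R) : 1 <= L ->
  L ^+ 2 * k%:R * dot t t <= dot x t ^+ 2 -> sqdist x u <= 1 ^+ 2 * k%:R ->
  (L - 1) ^+ 2 * k%:R * dot t t <= dot u t ^+ 2.
Proof.
move=> L1 h1 h2; have t0 : 0 <= dot t t by apply: sumr_ge0 => i _; rewrite -expr2 sqr_ge0.
have cs := cauchy_schwarz (fun i => x i - u i) t.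
have e1 : dot (fun i => x i - u i) t = dot x t - dot u t.
  by rewrite /dot -sumrB; apply: eq_bigr => i _; rewrite mulrBl.
have e2 : dot (fun i => x i - u i) (fun i => x i - u i) = sqdist x u.
  by apply: eq_bigr => i _; rewrite expr2.
rewrite e1 e2 in cs; have {}cs : (dot x t - dot u t) ^+ 2 <= k%:R * dot t t.
  by apply: le_trans cs _; rewrite ler_wpM2r//; lra.
set A := Num.sqrt (k%:R * dot t t).
have A0 : 0 <= A := sqrtr_ge0 _.
have AE : A ^+ 2 = k%:R * dot t t by rewrite sqr_sqrtr// mulr_ge0.
have {}h1 : (L * A) ^+ 2 <= dot x t ^+ 2 by rewrite exprMn AE mulrA.
rewrite -AE in cs; suff : ((L - 1) * A) ^+ 2 <= dot u t ^+ 2 by rewrite exprMn AE mulrA.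
move: h1 cs; move: (dot x t) (dot u t) => a b.
rewrite -[a ^+ 2]real_normK ?num_real// -[(a - b) ^+ 2]real_normK ?num_real// -[b ^+ 2]real_normK ?num_real//.
rewrite !ler_pXn2r ?nnegrE ?mulr_ge0//; try lra.
by move=> h1 h3; have := lerB_dist a b; rewrite -subr_ge0; move: `|a - b| `|a| `|b| h1 h3 => d c e; lra.
Qed.

End geometry_aux.

(** * Heavy points and the lattice points near them *)

Section geometry.
Context {R : realType} {d : measure_display} {T : measurableType d}.
Variable P : probability T R.
Notation Ex := (Ex P).
Notation pr := (pr P).
Variables (n : nat) (Z : {RV P >-> borel_rV R n}).
Hypothesis HL : log_concave Z.
Variables (k : nat) (g : 'I_k -> 'I_n -> R).
Hypothesis k0 : (0 < k)%N.

Definition proj (w : T) : 'I_k -> R := fun i => ell Z (g i) w.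

Definition ball (u : 'I_k -> R) (r : R) : set T := [set w | sqdist (proj w) u <= r].

Lemma cont_sqdist u : continuous (fun x : 'rV[R]_n => sqdist (fun i => lf (g i) x) u).
Proof.
apply: cont_sum => i x.
apply: (cvg_comp (fun x : 'rV[R]_n => lf (g i) x) (fun y => (y - u i) ^+ 2)).
  exact: cont_lf.
by apply: exprn_continuous || (apply: (cvg_comp (fun y => y - u i) (fun y => y ^+ 2)); [apply: cvgB; [exact: cvg_id|exact: cvg_cst]|exact: exprn_continuous]).
Qed.

Lemma meas_ball u r : measurable (ball u r).
Proof. exact: meas_event (closed_le (@cont_sqdist u)). Qed.

Lemma ball_lc u v r (th : R) : 0 < th < 1 ->
  pr (ball u r) `^ th * pr (ball v r) `^ (1 - th) <=
  pr (ball (fun i => th * u i + (1 - th) * v i) r).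
Proof.
move=> th01; apply: (lc_closed HL (closed_le (@cont_sqdist u)) (closed_le (@cont_sqdist v)) (closed_le (@cont_sqdist _))) => //.
move=> x y /= hx hy; have /andP[t0 t1] := th01.
have := sqdist_conv (fun i => lf (g i) x) (fun i => lf (g i) y) u v (_ : 0 <= th <= 1).
rewrite (ltW t0) (ltW t1) => /(_ isT) h; apply: (@le_trans _ _ (th * r + (1 - th) * r)); last first.
  by rewrite -mulrDl subrKC mul1r.
apply: (@le_trans _ _ (th * sqdist (fun i => lf (g i) x) u + (1 - th) * sqdist (fun i => lf (g i) y) v)).
  by apply: le_trans h; apply: eq_ler; congr sqdist; apply/funext => i; rewrite lfD !lfZ.
by apply: lerD; rewrite ler_wpM2l// ?subr_ge0 ltW.
Qed.

Lemma sum_pr_le (I : finType) (A : I -> set T) (B : set T) (c : R) : 0 <= c ->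
  (forall i, measurable (A i)) -> measurable B ->
  (forall w, B w -> \sum_i \1_(A i) w <= c) -> \sum_i pr (B `&` A i) <= c.
Proof.
move=> c0 mA mB h.
rewrite (eq_bigr (fun i => Ex (fun w => \1_B w * \1_(A i) w))); last first.
  by move=> i _; rewrite Ex_indicM.
rewrite -Ex_sum; last by move=> i; apply: allLM; exact: allL_indic.
rewrite -[leRHS](Ex_cst P); apply: Ex_le => [||w].
- by apply: allL_sum => i; apply: allLM; exact: allL_indic.
- exact: allL_cst.
rewrite -mulr_sumr indicE; case: (boolP (w \in B)) => [|_]; last by rewrite mul0r.
by rewrite inE mul1r => /h.
Qed.

Lemma pr_cover (I : finType) (Q : pred I) (A : I -> set T) (B : set T) :
  (forall i, measurable (A i)) -> measurable B ->
  (forall w, B w -> exists2 i, Q i & A i w) -> pr B <= \sum_(i | Q i) pr (B `&` A i).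
Proof.
move=> mA mB h.
rewrite big_mkcond (eq_bigr (fun i => Ex (fun w => (Q i)%:R * (\1_B w * \1_(A i) w)))); last first.
  move=> i _; rewrite ExZ; last by apply: allLM; exact: allL_indic.
  by rewrite Ex_indicM//; case: (Q i); rewrite ?mul1r ?mul0r.
rewrite -Ex_sum; last by move=> i; apply: allLZ; apply: allLM; exact: allL_indic.
rewrite -Ex_indic//; apply: Ex_le => [||w]; first exact: allL_indic.
  by apply: allL_sum => i; apply: allLZ; apply: allLM; exact: allL_indic.
rewrite indicE; case: (boolP (w \in B)) => [|_]; last first.
  by apply: sumr_ge0 => i _; rewrite mul0r mulr0.
rewrite inE => /h[i Qi Ai]; rewrite (bigD1 i)//= Qi mul1r indicE mem_set// mulr1 lerDl.
by apply: sumr_ge0 => j _; rewrite mulr_ge0// mulr_ge0//; case/andP: (indic_bounds (R := R) (A j) w).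
Qed.

(* By log-concavity the heavy points form a convex set, and by disjointness of far away balls
   few lattice points are close to it. *)
Definition heavy (th : R) (b : nat) (u : 'I_k -> R) :=
  th <= pr (ball u (1 ^+ 2 * k%:R)) /\ dot u u <= b%:R ^+ 2 * k%:R.

Lemma heavy_convex (th : R) b u v (l : R) : 0 <= l <= 1 -> 0 <= th -> heavy th b u -> heavy th b v ->
  heavy th b (fun i => (1 - l) * u i + l * v i).
Proof.
move=> /andP[l0 l1] th0 [u1 u2] [v1 v2]; split; last first.
  have := sqdist_conv v u (fun=> 0) (fun=> 0) (_ : 0 <= l <= 1); rewrite l0 l1 => /(_ isT).
  rewrite !sqdist0 => h.
  apply: (@le_trans _ _ (l * (b%:R ^+ 2 * k%:R) + (1 - l) * (b%:R ^+ 2 * k%:R))); last first.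
    by rewrite -mulrDl subrKC mul1r.
  apply: (@le_trans _ _ (l * dot v v + (1 - l) * dot u u)); last first.
    by apply: lerD; rewrite ler_wpM2l// subr_ge0.
  apply: le_trans h; apply: eq_ler; apply: eq_bigr => i _; rewrite expr2 mulr0 mulr0 addr0 subr0.
  by rewrite [l * _ + _]addrC.
move: l0; rewrite le_eqVlt => /predU1P[<-|l0].
  by under eq_fun do rewrite subr0 mul1r mul0r addr0.
move: l1; rewrite le_eqVlt => /predU1P[->|l1].
  by under eq_fun do rewrite subrr mul1r mul0r add0r.
have := @ball_lc v u (1 ^+ 2 * k%:R) l; rewrite l0 l1 => /(_ isT) h.
have -> : (fun i => (1 - l) * u i + l * v i) = (fun i => l * v i + (1 - l) * u i).
  by apply/funext => i; rewrite addrC.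
apply: le_trans h; have {1}-> : th = th `^ l * th `^ (1 - l).
  by rewrite -powRD subrKC ?powRr1// oner_eq0.
apply: ler_pM; rewrite ?powR_ge0//; apply: ler_powRl => //; [exact: ltW|].
by rewrite subr_ge0 ltW.
Qed.

Lemma origin_lat N : exists c : {ffun 'I_k -> 'I_(2 * N).+1}, forall i, lat c i = 0 :> R.
Proof.
have h : (N < (2 * N).+1)%N by rewrite ltnS leq_pmull.
by exists [ffun=> Ordinal h] => i; rewrite /lat ffunE /= subrr.
Qed.

Lemma sqdist_lat0 N (c w : {ffun 'I_k -> 'I_(2 * N).+1}) : (forall i, lat c i = 0 :> R) ->
  sqdist (lat w) (lat c) = dot (lat w) (lat w) :> R.
Proof. by move=> h; apply: eq_bigr => i _; rewrite h subr0 expr2. Qed.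

Lemma card_r (I : finType) (Q : pred I) : #|Q|%:R = \sum_i (Q i)%:R :> R.
Proof. rewrite -sum1_card natr_sum big_mkcond; apply: eq_bigr => i _; rewrite unfold_in; by case: (Q i). Qed.

(** The balls of squared radius 4 k around the counted lattice points have mass at least [th], and
    by [lattice_count] a given point lies in at most 64^k of them. *)
Lemma count_heavy (th : R) b N : 0 < th ->
  (\sum_(w : {ffun 'I_k -> 'I_(2 * N).+1})
     `[< exists2 u, heavy th b u & sqdist (lat w) u <= 1 ^+ 2 * k%:R >]%:R) * th <= (4 ^+ 3) ^+ k :> R.
Proof.
move=> th0; rewrite mulr_suml.
have mB (w : {ffun 'I_k -> 'I_(2 * N).+1}) : measurable (ball (lat w) (2 ^+ 2 * k%:R)).
  exact: meas_ball.
apply: le_trans (_ : \sum_(w : {ffun 'I_k -> 'I_(2 * N).+1}) pr (setT `&` ball (lat w) (2 ^+ 2 * k%:R)) <= _).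
  apply: ler_sum => w _; case: asboolP => [[u [hu _] wu]|_]; last by rewrite mul0r pr_ge0.
  rewrite mul1r; apply: le_trans hu _; rewrite setTI; apply: pr_le => //; first exact: meas_ball.
  move=> x /= hx; rewrite /ball /= (_ : 2 = 1 + 1) //; apply: sqdist_trans hx _ => //.
  by rewrite sqdistC.
apply: sum_pr_le => // x _.
rewrite (eq_bigr (fun w : {ffun 'I_k -> 'I_(2 * N).+1} => (sqdist (proj x) (lat w) <= 2 ^+ 2 * k%:R)%R%:R)); last first.
  by move=> w _; rewrite indicE; congr (nat_of_bool _)%:R; apply/idP/idP; rewrite inE.
rewrite -card_r; have [|c0] := posnP #|fun w : {ffun 'I_k -> 'I_(2 * N).+1} => (sqdist (proj x) (lat w) <= 2 ^+ 2 * k%:R)%R|.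
  by move=> ->; rewrite exprn_ge0// exprn_ge0.
have [c hc] := card_gt0P c0; rewrite unfold_in in hc.
have := lattice_count (R := R) c 4; rewrite (_ : 8 * (4%:R + 2) = 48) //; last by ring.
move=> h; apply: le_trans (_ : _ <= (8 * (4 + 2)) ^+ k) _; last first.
  by rewrite lerXn2r ?nnegrE ?exprn_ge0 ?mulr_ge0 ?addr_ge0//; lra.
apply: le_trans (lattice_count (R := R) c 4); rewrite ler_nat; apply: subset_leq_card.
apply/fintype.subsetP => w; rewrite !unfold_in => hw; rewrite (_ : 4%:R = 2 + 2); last by ring.
by apply: sqdist_trans hc => //; rewrite sqdistC.
Qed.

(** By pigeonhole some lattice cell carries mass at least [8 * th ^+ 4] of the slab. Its centre,
    contracted by 1/4 towards the origin, is heavy by log-concavity, and the factor 4 in the slab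
    makes up for the contraction. *)
Lemma heavy_dense (th c1 : R) (b M : nat) (t : 'I_k -> R) : (0 < b)%N -> 0 < c1 ->
  1 / 2 <= pr (ball (fun=> 0) (1 ^+ 2 * k%:R)) ->
  0 <= th -> th ^+ 4 * (128 * (b.+2.+1)%:R) ^+ k <= c1 ^+ k ->
  c1 ^+ k <= pr ([set w | (4 * M%:R + 1) ^+ 2 * k%:R * dot t t <= dot (proj w) t ^+ 2] `&`
                 ball (fun=> 0) (b%:R ^+ 2 * k%:R)) ->
  exists2 u, heavy th b.+1 u & M%:R ^+ 2 * k%:R * dot t t <= dot u t ^+ 2.
Proof.
move=> b0 c10 h0 th0 hth hF; set F := _ `&` _ in hF.
have mp : measurable_fun [set: T] (fun w => dot (proj w) t).
  apply: measurable_sum => i; apply: measurable_funM => //; exact: meas_ell.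
have mF : measurable F.
  apply: measurableI; last exact: meas_ball.
  by apply: meas_ge; exact: measurable_funX.
pose N := (b * k)%N.
have [c hc] := origin_lat N.
pose Q (w : {ffun 'I_k -> 'I_(2 * N).+1}) := (sqdist (lat w) (lat c) <= b.+1%:R ^+ 2 * k%:R :> R)%R.
pose A (w : {ffun 'I_k -> 'I_(2 * N).+1}) := ball (lat w) (1 ^+ 2 * k%:R).
have mA w : measurable (A w) by exact: meas_ball.
have cov w : F w -> exists2 i, Q i & A i w.
  move=> [_]; rewrite /ball /= sqdist0 => pb.
  have [i hi] := @lattice_round R k N (proj w) (fun i => coord_bound i pb).
  exists i; last by rewrite /A /ball /= sqdistC.
  rewrite /Q -natr1 addrC; apply: sqdist_trans hi _ => //; first by rewrite ltr0n.
  by rewrite -sqdist0 in pb; apply: le_trans pb; apply: eq_ler; apply: eq_bigr => j _; rewrite hc.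
have hcov := pr_cover mA mF cov.
have [w Qw hw] : exists2 w, Q w & 8 * th ^+ 4 < pr (F `&` A w).
  apply: contrapT => hn.
  have : \sum_(w | Q w) pr (F `&` A w) <= #|Q|%:R * (8 * th ^+ 4).
    apply: sum_le_card; first by rewrite mulr_ge0 ?exprn_ge0.
    by move=> w Qw; rewrite leNgt; apply/negP => hw; apply: hn; exists w.
  have cQ : #|Q|%:R <= (8 * (b.+2.+1)%:R) ^+ k :> R.
    by have := lattice_count (R := R) c b.+1; rewrite -(natrD _ b.+1 2) addn2.
  have p128 : (128 * (b.+2.+1)%:R) ^+ k = (4 ^+ 2) ^+ k * (8 * (b.+2.+1)%:R) ^+ k :> R.
    by rewrite -exprMn; congr (_ ^+ k); ring.
  have p16 : 16 <= (4 ^+ 2) ^+ k :> R.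
    by rewrite -[leLHS]expr1 (_ : 16 = 4 ^+ 2); [rewrite ler_eXn2l//; lra|ring].
  have ck : 0 < c1 ^+ k by rewrite exprn_gt0.
  move: hth; rewrite p128; have := exprn_ge0 4 th0.
  have : 0 <= (8 * (b.+2.+1)%:R) ^+ k :> R by rewrite exprn_ge0// mulr_ge0.
  move: cQ p16 ck hcov hF; move: (#|Q|%:R) (pr F) (\sum_(_ | _) _) (th ^+ 4) (_ ^+ k) (_ ^+ k) (_ ^+ k) => q pF S t4 x y z.
  move=> h1 h2 h3 h4 h5 h6 h7 h8 h9.
  have : q * t4 <= z * t4 by rewrite ler_wpM2r.
  have : 16 * (z * t4) <= y * (z * t4) by rewrite ler_wpM2r// mulr_ge0.
  by rewrite [z * t4]mulrC [y * (t4 * z)]mulrCA; lra.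
have ww : exists w0, (F `&` A w) w0.
  apply: contrapT => hn; have : F `&` A w = set0 by rewrite -subset0 => x hx; apply: hn; exists x.
  move=> e; move: hw; rewrite e /pr measure0 /= ltNge => /negP; apply.
  by rewrite mulr_ge0// exprn_ge0.
have [w0 [[Ft Fb] Aw]] := ww.
have Aw' : 8 * th ^+ 4 <= pr (A w).
  by apply: le_trans (ltW hw) _; apply: (pr_le _ (measurableI _ _ mF (mA w)) (mA w)) => x [].
have sh : (4 * M%:R) ^+ 2 * k%:R * dot t t <= dot (lat w) t ^+ 2.
  have := lin_shift (_ : 1 <= 4 * M%:R + 1) Ft Aw; rewrite addrK; apply.
  by rewrite lerDr mulr_ge0.
exists (fun i => 4^-1 * lat w i + (1 - 4^-1) * 0).
  split.
    apply: le_trans (ball_lc _ _ _ _); last by lra.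
    exact: quarter_num.
  rewrite /Q (sqdist_lat0 _ hc) in Qw; apply: le_trans (_ : dot (lat w) (lat w) <= _) => //.
  apply: ler_sum => i _; rewrite mulr0 addr0; move: (lat w i) => x; nra.
have -> : dot (fun i => 4^-1 * lat w i + (1 - 4^-1) * 0) t = 4^-1 * dot (lat w) t.
  by rewrite /dot mulr_sumr; apply: eq_bigr => i _; rewrite mulr0 addr0 mulrA.
rewrite exprMn -[leLHS](_ : 4^-1 ^+ 2 * ((4 * M%:R) ^+ 2 * k%:R * dot t t) = _); last by field.
by rewrite ler_wpM2l// exprn_ge0// invr_ge0.
Qed.

(** Taking k-th roots: the two counts give [X * c2 ^+ 2 <= 4 ^+ 9], where [c2 ^+ 2] is the square
    root of [c1 / (128 * b3)]. *)
Lemma geometry_num (c1 b3 c2 S X : R) : 0 < c1 -> 0 < b3 -> 0 < c2 -> c2 ^+ 4 * (128 * b3) = c1 ->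
  0 <= S -> S * c2 ^+ k <= (4 ^+ 3) ^+ k -> 0 <= X -> X ^+ k <= S ^+ 2 * (4 ^+ 3) ^+ k ->
  X ^+ 2 * c1 <= 4 ^+ 22 * b3.
Proof.
move=> c10 b0 c20 cE S0 hS X0 hX.
have h : X * c2 ^+ 2 <= 4 ^+ 9.
  have Y0 : 0 <= X * c2 ^+ 2 by rewrite mulr_ge0// exprn_ge0// ltW.
  rewrite -(@ler_pXn2r _ k) ?nnegrE//.
  rewrite exprMn; apply: le_trans (_ : (S * c2 ^+ k) ^+ 2 * (4 ^+ 3) ^+ k <= _).
    rewrite [(S * c2 ^+ k) ^+ 2]exprMn -[(c2 ^+ k) ^+ 2]exprM [(k * 2)%N]mulnC exprM mulrAC ler_wpM2r//.
    by rewrite exprn_ge0// exprn_ge0// ltW.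
  have -> : 4 ^+ 9 = (4 ^+ 3) ^+ 2 * 4 ^+ 3 :> R by rewrite -exprM -exprD.
  rewrite [leRHS]exprMn ler_wpM2r//.
  rewrite -[leRHS]exprM mulnC exprM; rewrite lerXn2r ?nnegrE ?exprn_ge0//.
  by rewrite mulr_ge0// exprn_ge0// ltW.
have : (X * c2 ^+ 2) ^+ 2 <= (4 ^+ 9) ^+ 2.
  by rewrite lerXn2r ?nnegrE ?exprn_ge0// mulr_ge0// exprn_ge0// ltW.
rewrite exprMn -!exprM -cE => h2.
have -> : X ^+ 2 * (c2 ^+ 4 * (128 * b3)) = X ^+ 2 * c2 ^+ (2 * 2) * (128 * b3) by rewrite mulrA.
apply: le_trans (ler_wpM2r _ h2) _; first by rewrite mulr_ge0// ltW.
have -> : 4 ^+ 22 * b3 = 4 ^+ (9 * 2) * (4 ^+ 4 * b3) :> R by rewrite mulrA -exprD.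
rewrite ler_wpM2l ?exprn_ge0// ler_wpM2r//; first exact: ltW.
have -> : 4 ^+ 4 = 256 :> R by ring.
by lra.
Qed.

(** Every integer point of the cube of half-side [M] is within sqrt(k) of a difference of two heavy
    points, hence within 3 sqrt(k) of a difference of two lattice points near heavy ones. So (2 M +
    1)^k is at most 64^k times the square of the number of the latter. *)
Lemma paouris_geometry (c1 : R) (b M : nat) : (0 < b)%N -> 0 < c1 <= 1 ->
  1 / 2 <= pr (ball (fun=> 0) (1 ^+ 2 * k%:R)) ->
  (forall t, 0 < dot t t -> c1 ^+ k <=
     pr ([set w | (4 * M%:R + 1) ^+ 2 * k%:R * dot t t <= dot (proj w) t ^+ 2] `&`
         ball (fun=> 0) (b%:R ^+ 2 * k%:R))) ->
  (2 * M%:R + 1) ^+ 2 * c1 <= 4 ^+ 22 * (b.+2.+1)%:R.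
Proof.
move=> b0 /andP[c10 c11] h0 hF.
have b3 : 1 <= (b.+2.+1)%:R :> R by rewrite ler1n.
have D0 : 0 < 128 * (b.+2.+1)%:R :> R by rewrite mulr_gt0 ?ltr0n.
(* Makes [th = c2 ^+ k] satisfy with equality the mass condition of [heavy_dense]. *)
pose c2 := Num.sqrt (Num.sqrt (c1 / (128 * (b.+2.+1)%:R))).
have q0 : 0 < c1 / (128 * (b.+2.+1)%:R) by rewrite divr_gt0.
have c20 : 0 < c2 by rewrite !sqrtr_gt0.
have c24 : c2 ^+ 4 = c1 / (128 * (b.+2.+1)%:R).
  rewrite (_ : 4%N = (2 * 2)%N)// exprM sqr_sqrtr ?sqrtr_ge0// sqr_sqrtr// ltW//.
have cE : c2 ^+ 4 * (128 * (b.+2.+1)%:R) = c1 by rewrite c24 divfK// gt_eqF.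
set th := c2 ^+ k.
have th0 : 0 < th by rewrite exprn_gt0.
have th4 : th ^+ 4 = (c2 ^+ 4) ^+ k by rewrite /th -!exprM mulnC.
have hth : th ^+ 4 * (128 * (b.+2.+1)%:R) ^+ k <= c1 ^+ k by rewrite th4 -exprMn cE.
have thh : th <= 1 / 2.
  rewrite -(@ler_pXn2r _ 4)// ?nnegrE ?(ltW th0)//.
  rewrite th4; have c41 : c2 ^+ 4 <= (1 / 2) ^+ 4.
    rewrite c24 ler_pdivrMr//; have -> : (1 / 2) ^+ 4 = 1 / 16 :> R by field.
    by lra.
  apply: le_trans (_ : c2 ^+ 4 <= _) => //.
  rewrite -[leRHS]expr1; apply: ler_wiXn2l => //; first by rewrite exprn_ge0// ltW.
  by apply: le_trans c41 _; rewrite exprn_ile1//; lra.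
have heavy0 : heavy th b.+1 (fun=> 0).
  split; first exact: le_trans h0.
  by rewrite /dot big1 ?mulr_ge0 ?exprn_ge0// => i _; rewrite mulr0.
have hd t : exists2 u, heavy th b.+1 u & M%:R ^+ 2 * k%:R * dot t t <= dot u t ^+ 2.
  have : 0 <= dot t t by apply: sumr_ge0 => i _; rewrite -expr2 sqr_ge0.
  rewrite le_eqVlt => /predU1P[<-|t0]; first by exists (fun=> 0) => //; rewrite mulr0 sqr_ge0.
  by apply: heavy_dense (hF t t0); rewrite // ltW.
(* The differences form a symmetric set, so its support function is large in every direction; for a
   single heavy point only the absolute value of the functional is known. *)
pose E : set ('I_k -> R) := [set e | exists u1 u2, [/\ heavy th b.+1 u1, heavy th b.+1 u2 &
   e = fun i => u1 i - u2 i]].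
pose rho : R := M%:R * Num.sqrt k%:R.
have rho2 : rho ^+ 2 = M%:R ^+ 2 * k%:R by rewrite exprMn sqr_sqrtr.
have kR : 0 < k%:R :> R by rewrite ltr0n.
have sep (v : {ffun 'I_k -> 'I_(2 * M).+1}) : exists2 e, E e & sqdist (lat v) e <= k%:R.
  apply: (@separation R k E rho (4 * (b.+1%:R ^+ 2 * k%:R)) k%:R (lat v)) => //.
  - move=> _ _ l l01 [u1 [u2 [hu1 hu2 ->]]] [v1 [v2 [hv1 hv2 ->]]].
    exists (fun i => (1 - l) * u1 i + l * v1 i), (fun i => (1 - l) * u2 i + l * v2 i).
    split; try (by apply: heavy_convex => //; exact: ltW).
    by apply/funext => i; ring.
  - by exists (fun=> 0), (fun=> 0), (fun=> 0); split=> //; apply/funext => i; rewrite subrr.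
  - move=> _ [u1 [u2 [[_ h1] [_ h2] ->]]].
    apply: le_trans (_ : 2 * dot u1 u1 + 2 * dot u2 u2 <= _); last by move: h1 h2; move: (dot _ _) (dot _ _) => x y; lra.
    rewrite /dot !mulr_sumr -big_split; apply: ler_sum => i _ /=.
    by have := sqr_ge0 (u1 i + u2 i); nra.
  - by rewrite mulr_ge0// sqrtr_ge0.
  - move=> t; have [u hu ht] := hd t; rewrite rho2.
    case: (leP 0 (dot u t)) => ut.
      exists u; last by split.
      by exists u, (fun=> 0); split=> //; apply/funext => i; rewrite subr0.
    have e : dot (fun i => 0 - u i) t = - dot u t.
      by rewrite /dot -sumrN; apply: eq_bigr => i _; rewrite sub0r mulNr.
    exists (fun i => 0 - u i); first by exists (fun=> 0), u.
    by rewrite e sqrrN; split=> //; rewrite oppr_ge0 ltW.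
  rewrite rho2 (_ : M%:R ^+ 2 * k%:R = \sum_(i < k) M%:R ^+ 2); last by rewrite sumr_const card_ord mulr_natr.
  apply: ler_sum => i _.
  rewrite -expr2 -[leLHS]real_normK ?num_real// lerXn2r ?nnegrE//.
  rewrite /lat ler_norml; have : (v i)%:R <= (2 * M)%:R :> R by rewrite ler_nat -ltnS.
  by rewrite natrM; have : 0 <= (v i)%:R :> R by []; move: ((v i)%:R : R) => x; lra.
pose N := (b.+1 * k)%N.
pose h (w : {ffun 'I_k -> 'I_(2 * N).+1}) : R :=
  `[< exists2 u, heavy th b.+1 u & sqdist (lat w) u <= 1 ^+ 2 * k%:R >]%:R.
pose cl (v : {ffun 'I_k -> 'I_(2 * M).+1}) (w1 w2 : {ffun 'I_k -> 'I_(2 * N).+1}) : R :=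
  (sqdist (lat v) (fun i => lat w1 i - lat w2 i) <= 3 ^+ 2 * k%:R :> R)%R%:R.
have h_ge0 w : 0 <= h w by [].
have hcl v : 1 <= \sum_w1 \sum_w2 h w1 * h w2 * cl v w1 w2.
  have [_ [u1 [u2 [hu1 hu2 ->]]] ve] := sep v.
  have [w1 hw1] := @lattice_round R k N u1 (fun i => coord_bound i (proj2 hu1)).
  have [w2 hw2] := @lattice_round R k N u2 (fun i => coord_bound i (proj2 hu2)).
  have nn w1' w2' : 0 <= h w1' * h w2' * cl v w1' w2' by rewrite !mulr_ge0.
  rewrite (bigD1 w1)//= (bigD1 w2)//= -addrA -[leLHS]addr0; apply: lerD; last first.
    by rewrite addr_ge0// ?sumr_ge0// => w' _; apply: sumr_ge0.
  have -> : h w1 = 1 by rewrite /h asboolT//; exists u1.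
  have -> : h w2 = 1 by rewrite /h asboolT//; exists u2.
  rewrite /cl (_ : sqdist _ _ <= _) ?mul1r//.
  have k1 : k%:R = 1 ^+ 2 * k%:R :> R by rewrite expr1n mul1r.
  rewrite k1 in ve; rewrite (_ : 3 = 1 + (1 + 1)); last by ring.
  apply: sqdist_trans ve _ => //; apply: (@sqdist_trans _ _ _ (fun i => lat w1 i - u2 i)) => //.
    rewrite sqdistC in hw1; apply: le_trans hw1; apply: eq_ler; apply: eq_bigr => i _; congr (_ ^+ 2).
    by ring.
  rewrite sqdistC in hw2; apply: le_trans hw2; apply: eq_ler; apply: eq_bigr => i _.
  by rewrite -[in RHS]sqrrN; congr (_ ^+ 2); ring.
have hfib w1 w2 : \sum_v cl v w1 w2 <= (4 ^+ 3) ^+ k.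
  pose Q : pred {ffun 'I_k -> 'I_(2 * M).+1} := [pred v | sqdist (lat v) (fun i => lat w1 i - lat w2 i) <= 3 ^+ 2 * k%:R :> R].
  have -> : \sum_v cl v w1 w2 = #|Q|%:R by rewrite card_r.
  have [->|c0] := posnP #|Q|; first by rewrite exprn_ge0// exprn_ge0.
  have [c hc] := card_gt0P c0; rewrite unfold_in in hc.
  apply: le_trans (_ : _ <= (8 * (6%:R + 2)) ^+ k) _; last first.
    by rewrite lerXn2r ?nnegrE ?exprn_ge0 ?mulr_ge0 ?addr_ge0//; lra.
  apply: le_trans (lattice_count (R := R) c 6); rewrite ler_nat; apply: subset_leq_card.
  apply/fintype.subsetP => w; rewrite !unfold_in => hw; rewrite (_ : 6%:R = 3 + 3); last by ring.
  by apply: sqdist_trans hw _ => //; rewrite sqdistC.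
have ch := @count_heavy th b.+1 N th0; rewrite -/(\sum_w h w) in ch.
apply: (@geometry_num c1 (b.+2.+1)%:R c2 (\sum_w h w)) => //.
- by apply: sumr_ge0.
have -> : (2 * M%:R + 1) ^+ k = \sum_(v : {ffun 'I_k -> 'I_(2 * M).+1}) 1 :> R.
  by rewrite sumr_const card_ffun !card_ord natrX -[(2 * M).+1]addn1 natrD natrM.
apply: le_trans (_ : \sum_v \sum_w1 \sum_w2 h w1 * h w2 * cl v w1 w2 <= _).
  by apply: ler_sum => v _; exact: hcl.
rewrite exchange_big /= expr2 mulr_suml mulr_suml; apply: ler_sum => w1 _.
rewrite exchange_big /= mulr_sumr mulr_suml; apply: ler_sum => w2 _.
by rewrite -mulr_sumr ler_wpM2l// mulr_ge0.
Qed.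

End geometry.

(** * Norms given by even moments *)

Section moment_norm.
Context {R : realType} {d : measure_display} {T : measurableType d}.
Variable P : probability T R.
Notation Ex := (Ex P).
Variable s : nat.
Hypothesis s0 : (0 < s)%N.

Lemma expr_convex (th a b : R) k : 0 <= th <= 1 -> 0 <= a -> 0 <= b ->
  (th * a + (1 - th) * b) ^+ k <= th * a ^+ k + (1 - th) * b ^+ k.
Proof.
move=> /andP[t0 t1] a0 b0; elim: k => [|k IH]; first by rewrite !expr0 !mulr1 subrKC.
rewrite !exprS; apply: le_trans (ler_wpM2l _ IH) _.
  by rewrite addr_ge0// mulr_ge0// subr_ge0.
have h : 0 <= (a - b) * (a ^+ k - b ^+ k).
  case: (leP a b) => ab; first by rewrite mulr_le0// subr_le0//; apply: lerXn2r.
  by rewrite mulr_ge0// subr_ge0 ?(ltW ab)//; apply: lerXn2r => //; exact: ltW.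
have : 0 <= th * (1 - th) * ((a - b) * (a ^+ k - b ^+ k)).
  by rewrite mulr_ge0// mulr_ge0// subr_ge0.
move: (a ^+ k) (b ^+ k) => A B; nra.
Qed.

Lemma even_convex (th a b : R) : 0 <= th <= 1 ->
  (th * a + (1 - th) * b) ^+ (2 * s) <= th * a ^+ (2 * s) + (1 - th) * b ^+ (2 * s).
Proof.
move=> th01; rewrite !exprM; apply: le_trans (expr_convex s th01 (sqr_ge0 a) (sqr_ge0 b)).
have /andP[t0 t1] := th01.
apply: lerXn2r; rewrite ?nnegrE ?sqr_ge0//.
  by rewrite addr_ge0// mulr_ge0 ?sqr_ge0// subr_ge0.
have : 0 <= th * (1 - th) * (a - b) ^+ 2 by rewrite mulr_ge0 ?sqr_ge0// mulr_ge0// subr_ge0.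
by move=> *; nra.
Qed.

Definition moment_norm (f : T -> R) : R := (Ex (fun w => f w ^+ (2 * s))) `^ (2 * s)%:R^-1.

Lemma exprM2_ge0 (x : R) : 0 <= x ^+ (2 * s).
Proof. by rewrite exprM exprn_ge0// sqr_ge0. Qed.

Lemma moment_norm_ge0 f : 0 <= moment_norm f.
Proof. exact: powR_ge0. Qed.

Lemma moment_normX f : moment_norm f ^+ (2 * s) = Ex (fun w => f w ^+ (2 * s)).
Proof.
have E0 : 0 <= Ex (fun w => f w ^+ (2 * s)) by apply: Ex_ge0 => w; exact: exprM2_ge0.
rewrite -powR_mulrn ?moment_norm_ge0// /moment_norm -powRrM mulVf ?powRr1//.
by rewrite pnatr_eq0 -lt0n muln_gt0.
Qed.

Lemma moment_norm_le f a : 0 <= a -> Ex (fun w => f w ^+ (2 * s)) <= a ^+ (2 * s) -> moment_norm f <= a.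
Proof. by move=> a0; rewrite -moment_normX ler_pXn2r ?nnegrE ?moment_norm_ge0// muln_gt0. Qed.

Lemma moment_norm_ge f a : 0 <= a -> a ^+ (2 * s) <= Ex (fun w => f w ^+ (2 * s)) -> a <= moment_norm f.
Proof. by move=> a0; rewrite -moment_normX ler_pXn2r ?nnegrE ?moment_norm_ge0// muln_gt0. Qed.

Lemma moment_normZ c f : allL P f -> moment_norm (fun w => c * f w) = `|c| * moment_norm f.
Proof.
move=> hf; have e (g : R) : `|g| ^+ (2 * s) = g ^+ (2 * s) by rewrite !exprM real_normK ?num_real.
apply/eqP; rewrite eq_le; apply/andP; split.
  apply: moment_norm_le; first by rewrite mulr_ge0// moment_norm_ge0.
  rewrite exprMn moment_normX e -ExZ; last exact: allLX.
  by apply: eq_ler; apply: (f_equal Ex); apply/funext => w; rewrite exprMn.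
apply: moment_norm_ge; first by rewrite mulr_ge0// moment_norm_ge0.
rewrite exprMn moment_normX e -ExZ; last exact: allLX.
by apply: eq_ler; apply: (f_equal Ex); apply/funext => w; rewrite exprMn.
Qed.

(** Minkowski's inequality from the convexity of the even power; [e] keeps both norms positive so
    that [f] and [g] can be normalized. *)
Lemma moment_normD f g : allL P f -> allL P g -> moment_norm (fun w => f w + g w) <= moment_norm f + moment_norm g.
Proof.
move=> hf hg; apply/ler_addgt0Pr => e e0.
set a := moment_norm f + e / 2; set b := moment_norm g + e / 2.
have a0 : 0 < a by rewrite ltr_wpDl ?moment_norm_ge0// divr_gt0.
have b0 : 0 < b by rewrite ltr_wpDl ?moment_norm_ge0// divr_gt0.
have -> : moment_norm f + moment_norm g + e = a + b by rewrite /a /b; field.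
have ab0 : 0 < a + b by exact: addr_gt0.
apply: moment_norm_le; first exact: ltW.
have hfa : Ex (fun w => f w ^+ (2 * s)) <= a ^+ (2 * s).
  by rewrite -moment_normX lerXn2r ?nnegrE ?moment_norm_ge0 ?(ltW a0)// lerDl divr_ge0// ltW.
have hgb : Ex (fun w => g w ^+ (2 * s)) <= b ^+ (2 * s).
  by rewrite -moment_normX lerXn2r ?nnegrE ?moment_norm_ge0 ?(ltW b0)// lerDl divr_ge0// ltW.
set th := a / (a + b).
have th01 : 0 <= th <= 1.
  apply/andP; split; first exact: divr_ge0 (ltW a0) (ltW ab0).
  by rewrite ler_pdivrMr// mul1r lerDl ltW.
have th1 : 1 - th = b / (a + b) by rewrite /th; field; rewrite gt_eqF.
pose F w := (a + b) ^+ (2 * s) * (th * (a ^- (2 * s) * f w ^+ (2 * s)) +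
   (1 - th) * (b ^- (2 * s) * g w ^+ (2 * s))).
have hF : allL P F.
  by apply: allLZ; apply: allLD; apply: allLZ; apply: allLZ; exact: allLX.
apply: (@le_trans _ _ (Ex F)).
  apply: Ex_le => // [|w]; first by apply: allLX; exact: allLD.
  have {1}-> : f w + g w = (a + b) * (th * (a^-1 * f w) + (1 - th) * (b^-1 * g w)).
    by rewrite th1 /th; field; rewrite !gt_eqF.
  rewrite /F exprMn ler_wpM2l ?exprM2_ge0// -[a ^- _]exprVn -[b ^- _]exprVn -!exprMn.
  exact: even_convex.
rewrite ExZ; last first.
  by apply: allLD; apply: allLZ; apply: allLZ; exact: allLX.
rewrite ExD; [|by apply: allLZ; apply: allLZ; exact: allLX..].
rewrite !ExZ; [|by do ?apply: allLZ; exact: allLX..].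
rewrite -[leRHS]mulr1 ler_wpM2l ?exprM2_ge0//.
have /andP[t0 t1] := th01.
apply: (@le_trans _ _ (th * 1 + (1 - th) * 1)); last by rewrite !mulr1 subrKC.
by apply: lerD; rewrite ler_wpM2l ?subr_ge0// mulrC ler_pdivrMr ?exprn_gt0// mul1r.
Qed.

End moment_norm.

Section averages.
Context {R : realType} {d : measure_display} {T : measurableType d}.
Variable P : probability T R.
Notation Ex := (Ex P).

Lemma cube_avg_Ex N (f : (nat -> R) -> T -> R) x : (forall z, allL P (f z)) ->
  allL P (fun w => cube_avg N (fun z => f z w) x) /\
  cube_avg N (fun z => Ex (f z)) x = Ex (fun w => cube_avg N (fun z => f z w) x).
Proof.
move=> hf; elim: N x => [|N IH] x /=; first by split.
have [h1 e1] := IH (set_coord x N 1); have [h2 e2] := IH (set_coord x N (-1)).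
rewrite e1 e2; split.
  by apply: allLM; [exact: allLD|exact: allL_cst].
transitivity (Ex (fun w => 2^-1 * (cube_avg N (fun z => f z w) (set_coord x N 1) +
    cube_avg N (fun z => f z w) (set_coord x N (-1))))).
  by rewrite ExZ ?ExD//; [rewrite mulrC|exact: allLD].
by apply: (f_equal Ex); apply/funext => w; rewrite mulrC.
Qed.

End averages.

(** * The random sign matrix *)

Section signs_matrix.
Context {R : realType}.
Variables (s n : nat) (J : {set 'I_n}).
Hypothesis s0 : (0 < s)%N.
Implicit Types (t : 'I_s -> R) (y : 'I_n -> R) (z : nat -> R).

Definition rs : R := (Num.sqrt s%:R)^-1.

Lemma rs2 : rs ^+ 2 = s%:R^-1.
Proof. by rewrite /rs exprVn sqr_sqrtr. Qed.

(** Each entry averages [s] separate signs, normalized to variance 1, and so imitates a Gaussian up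
    to order [2 * s]: moments of linear forms grow like s^s even for a form with one coefficient,
    which a single sign per entry would not give. *)
Definition sign_coef z (i : 'I_s) (j : 'I_n) : R :=
  (j \in J)%:R * (rs * \sum_(l < s) z (l * (s * n) + (i * n + j))%N).

Definition extn m (f : 'I_m -> R) (i : nat) : R := if insub i is Some i' then f i' else 0.

Lemma extnE m (f : 'I_m -> R) (i : 'I_m) : extn f i = f i.
Proof. by rewrite /extn valK. Qed.

(** The bilinear form in [t] and [y], read as a linear form in the [s * (s * n)] signs. Division
    with remainder recovers the row and the column from the flat index; the coefficients repeat from
    block to block. *)
Definition coefs t y (m : nat) : R :=
  rs * (extn t ((m %% (s * n)) %/ n) * extn (fun j => (j \in J)%:R * y j) (m %% n)).

Lemma sum_mul A B (F : nat -> R) :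
  \sum_(m < A * B) F m = \sum_(l < A) \sum_(i < B) F (l * B + i)%N.
Proof.
elim: A => [|A IH]; first by rewrite mul0n !big_ord0.
rewrite big_ord_recr /= -IH mulSnr -(big_mkord xpredT F) (@big_cat_nat _ _ _ (A * B)%N)//=; last exact: leq_addr.
rewrite big_mkord; congr (_ + _).
rewrite -[X in \sum_(X <= _ < _) _]add0n big_addn addKn big_mkord.
by apply: eq_bigr => i _; rewrite addnC.
Qed.

Lemma coefsE t y l (i : 'I_s) (j : 'I_n) :
  coefs t y (l * (s * n) + (i * n + j)) = rs * (t i * ((j \in J)%:R * y j)).
Proof.
have n0 : (0 < n)%N by apply: leq_ltn_trans (ltn_ord j).
have lt : (i * n + j < s * n)%N.
  apply: (@leq_trans (i * n + n)); first by rewrite ltn_add2l.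
  by rewrite -mulSnr leq_mul2r ltn_ord orbT.
rewrite /coefs modnMDl (modn_small lt) divnMDl// (divn_small (ltn_ord j)) addn0 extnE.
by rewrite mulnA addnA -mulnDl modnMDl (modn_small (ltn_ord j)) extnE.
Qed.

Definition mass y : R := \sum_(j in J) y j ^+ 2.

Lemma lin_coefs t y z : lin (coefs t y) (s * (s * n)) z = \sum_j (\sum_i t i * sign_coef z i j) * y j.
Proof.
rewrite /lin (@sum_mul s (s * n)%N (fun m => coefs t y m * z m)).
transitivity (\sum_(l < s) \sum_(i < s) \sum_(j < n)
    rs * (t i * ((j \in J)%:R * y j)) * z (l * (s * n) + (i * n + j))%N).
  apply: eq_bigr => l _.
  rewrite (@sum_mul s n (fun m => coefs t y (l * (s * n) + m)%N * z (l * (s * n) + m)%N)).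
  by apply: eq_bigr => i _; apply: eq_bigr => j _; rewrite coefsE.
rewrite exchange_big /=; under eq_bigr do rewrite exchange_big /=.
rewrite exchange_big /=; apply: eq_bigr => j _; rewrite mulr_suml; apply: eq_bigr => i _.
rewrite /sign_coef -mulr_sumr; ring.
Qed.

Lemma block_coefs t y l : \sum_(m < s * n) coefs t y (l * (s * n) + m)%N ^+ 2 =
  s%:R^-1 * (dot t t * mass y).
Proof.
rewrite (@sum_mul s n (fun m => coefs t y (l * (s * n) + m)%N ^+ 2)).
rewrite /dot mulr_suml mulr_sumr; apply: eq_bigr => i _.
rewrite /mass [in RHS]big_mkcond !mulr_sumr; apply: eq_bigr => j _; rewrite coefsE !exprMn rs2.
by case: (j \in J); rewrite ?expr1n ?expr0n /= ?mul1r ?mul0r ?mulr0// expr2.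
Qed.

Lemma sum_coefs t y : \sum_(m < s * (s * n)) coefs t y m ^+ 2 = dot t t * mass y.
Proof.
rewrite (@sum_mul s (s * n)%N (fun m => coefs t y m ^+ 2)).
under eq_bigr do rewrite block_coefs.
by rewrite sumr_const card_ord -mulrnAl -[s%:R^-1 *+ s]mulr_natr mulVf ?mul1r// pnatr_eq0 -lt0n.
Qed.

Lemma mass_ge0 y : 0 <= mass y.
Proof. by apply: sumr_ge0 => j _; exact: sqr_ge0. Qed.

Lemma cube_avg_upper t y x k : (0 < k)%N ->
  cube_avg (s * (s * n)) (fun z => (\sum_j (\sum_i t i * sign_coef z i j) * y j) ^+ (2 * k)) x <=
  (128 * k%:R * (dot t t * mass y)) ^+ k.
Proof.
move=> k0; rewrite -sum_coefs; apply: le_trans (cube_avg_lin_moment _ _ x k0).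
by apply: eq_ler; apply: cube_avg_eq => z _; rewrite lin_coefs.
Qed.

(** Each of the [s] blocks carries the fraction 1/s of the square sum, so [cube_avg_lin_lower]
    applies, and s! >= (s / 4)^s. *)
Lemma cube_avg_lower t y x : 0 <= dot t t ->
  (s%:R / 16 * (dot t t * mass y)) ^+ s <=
  cube_avg (s * (s * n)) (fun z => (\sum_j (\sum_i t i * sign_coef z i j) * y j) ^+ (2 * s)) x.
Proof.
move=> t0; set v := s%:R^-1 * (dot t t * mass y).
have v0 : 0 <= v by rewrite mulr_ge0 ?invr_ge0// mulr_ge0// mass_ge0.
have := @cube_avg_lin_lower R (coefs t y) (s * n) s v x (fun l _ => eq_ler (esym (block_coefs t y l))) v0.
move=> h; apply: le_trans (_ : _ <= cube_avg (s * (s * n)) (fun z => lin (coefs t y) (s * (s * n)) z ^+ (2 * s)) x) _; last first.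
  by apply: eq_ler; apply: cube_avg_eq => z _; rewrite lin_coefs.
apply: le_trans h; have sn : s%:R != 0 :> R by rewrite pnatr_eq0 -lt0n.
have -> : s%:R / 16 * (dot t t * mass y) = (s%:R / 4) ^+ 2 * v.
  by rewrite /v; field.
rewrite exprMn ler_wpM2r ?exprn_ge0//.
rewrite -exprM mulnC exprM lerXn2r ?nnegrE ?exprn_ge0 ?divr_ge0//.
by rewrite expr_div_n; exact: fact_ge.
Qed.

(** Cauchy-Schwarz twice: over [i] against [t], and over the [s] signs of an entry, where the
    normalization [rs] cancels their number. *)
Lemma sign_coef_lip t z z' : 0 <= dot t t ->
  dot (fun j => \sum_i t i * (sign_coef z i j - sign_coef z' i j)) (fun j => \sum_i t i * (sign_coef z i j - sign_coef z' i j)) <=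
  dot t t * \sum_(m < s * (s * n)) (z m - z' m) ^+ 2.
Proof.
move=> t0; set S := \sum_(m < _) _.
have -> : S = \sum_(j < n) \sum_(i < s) \sum_(l < s)
   (z (l * (s * n) + (i * n + j))%N - z' (l * (s * n) + (i * n + j))%N) ^+ 2.
  rewrite /S (@sum_mul s (s * n)%N (fun m => (z m - z' m) ^+ 2)).
  under eq_bigr => l _ do rewrite (@sum_mul s n (fun m => (z (l * (s * n) + m)%N - z' (l * (s * n) + m)%N) ^+ 2)).
  rewrite exchange_big /=; under eq_bigr do rewrite exchange_big /=.
  by rewrite exchange_big.
rewrite mulr_sumr; apply: ler_sum => j _; rewrite -expr2.
pose del i l := z (l * (s * n) + (i * n + j))%N - z' (l * (s * n) + (i * n + j))%N.
have e (i : 'I_s) : sign_coef z i j - sign_coef z' i j = (j \in J)%:R * (rs * \sum_(l < s) del i l).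
  by rewrite /sign_coef -mulrBr -mulrBr -sumrB.
have b (i : 'I_s) : (sign_coef z i j - sign_coef z' i j) ^+ 2 <= \sum_(l < s) del i l ^+ 2.
  rewrite e !exprMn rs2; case: (j \in J); last first.
    by rewrite expr0n /= mul0r sumr_ge0// => l _; exact: sqr_ge0.
  rewrite expr1n mul1r mulrC ler_pdivrMr ?ltr0n//.
  have := cauchy_schwarz (fun l : 'I_s => del i l) (fun=> 1).
  rewrite /dot => h; apply: le_trans (_ : (\sum_(l < s) del i l * 1) ^+ 2 <= _).
    by apply: eq_ler; congr (_ ^+ 2); apply: eq_bigr => l _; rewrite mulr1.
  apply: le_trans h _; apply: eq_ler; congr (_ * _).
  by rewrite sumr_const card_ord mulr1.
apply: le_trans (cauchy_schwarz t (fun i => sign_coef z i j - sign_coef z' i j)) _.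
rewrite ler_wpM2l//; apply: ler_sum => i _; rewrite -expr2; exact: b.
Qed.

Lemma sign_coef_avg x : cube_avg (s * (s * n)) (fun z => \sum_i \sum_j sign_coef z i j ^+ 2) x <=
  128 * s%:R * #|J|%:R.
Proof.
rewrite cube_avg_sum.
have h i j : cube_avg (s * (s * n)) (fun z => sign_coef z i j ^+ 2) x <= 128 * (j \in J)%:R.
  have := @cube_avg_upper (fun i' => (i' == i)%:R) (fun j' => (j' == j)%:R) x 1 isT.
  rewrite expr1 mulr1 => H; apply: le_trans (le_trans H _).
    apply: eq_ler; apply: cube_avg_eq => z _; rewrite (bigD1 j)//= eqxx mulr1 [X in _ + X]big1 => [|j' /negbTE ->]; last by rewrite mulr0.
    rewrite addr0 (bigD1 i)//= eqxx mul1r [X in _ + X]big1 => [|i' /negbTE ->]; last by rewrite mul0r.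
    by rewrite addr0.
  rewrite ler_wpM2l//; have -> : dot (fun i' => (i' == i)%:R) (fun i' => (i' == i)%:R) = 1 :> R.
    by rewrite /dot (bigD1 i)//= eqxx mulr1 big1 ?addr0// => i' /negbTE ->; rewrite mulr0.
  rewrite mul1r /mass big_mkcond (bigD1 j)//= eqxx expr1n big1 ?addr0.
    by case: (j \in J).
  by move=> j' /negbTE ->; case: (_ \in J); rewrite // expr0n.
apply: le_trans (_ : \sum_(i < s) \sum_(j < n) 128 * (j \in J)%:R <= _).
  by apply: ler_sum => i _; rewrite cube_avg_sum; apply: ler_sum => j _; exact: h.
rewrite sumr_const card_ord -mulr_sumr -[_ *+ s]mulr_natr mulrAC; apply: eq_ler; congr (_ * _).
by rewrite -sum1_card natr_sum [RHS]big_mkcond; apply: eq_bigr => j _; case: (j \in J).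
Qed.

End signs_matrix.

(** Round the multiple of [v] of length 4 sqrt(k) to the lattice; rounding costs 1 of the 4, which
    leaves 9 = 3^2. *)
Lemma net_pointwise (R : realType) k (v : 'I_k -> R) : (0 < k)%N ->
  exists w : {ffun 'I_k -> 'I_(2 * (5 * k)).+1},
    dot (lat w) (lat w) <= 5 ^+ 2 * k%:R :> R /\
    9 * k%:R * dot v v <= dot (lat w) v ^+ 2.
Proof.
move=> k0; have kR : 0 < k%:R :> R by rewrite ltr0n.
have : 0 <= dot v v by apply: sumr_ge0 => i _; rewrite -expr2 sqr_ge0.
rewrite le_eqVlt => /predU1P[v0|v0].
  have [c hc] := @origin_lat R k (5 * k)%N; exists c; split.
    by rewrite /dot big1 ?mulr_ge0 ?exprn_ge0// => i _; rewrite hc mul0r.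
  by rewrite -v0 mulr0 sqr_ge0.
set a := 4 * Num.sqrt k%:R / Num.sqrt (dot v v).
have a2 : a ^+ 2 * dot v v = 4 ^+ 2 * k%:R.
  by rewrite /a !exprMn exprVn !sqr_sqrtr// ?ltW// divfK// gt_eqF.
pose u i := a * v i.
have uu : dot u u = 4 ^+ 2 * k%:R.
  by rewrite -a2 /dot mulr_sumr; apply: eq_bigr => i _; rewrite /u; ring.
have uv : dot u v = a * dot v v.
  by rewrite /dot mulr_sumr; apply: eq_bigr => i _; rewrite /u mulrA.
have ub i : `|u i| <= (5 * k)%:R.
  apply: le_trans (@coord_bound R k u 4 i (eq_ler uu)) _.
  by rewrite ler_nat leq_mul2r orbT.
have [w hw] := lattice_round ub; exists w; split.
  rewrite -sqdist0 (_ : 5 = 1 + 4); last by ring.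
  by apply: sqdist_trans hw _ => //; rewrite sqdist0 uu.
have h : 4 ^+ 2 * k%:R * dot v v <= dot u v ^+ 2.
  by rewrite uv exprMn expr2 mulrA -expr2 a2.
have := lin_shift (_ : 1 <= 4) h; rewrite sqdistC in hw.
move=> /(_ (lat w)); rewrite (_ : 4 - 1 = 3); last by ring.
rewrite (_ : 3 ^+ 2 = 9); last by ring.
by apply=> //; rewrite ler1n.
Qed.

Lemma net_sphere (R : realType) k (D : nat) (t : 'I_k -> R) : (0 < k)%N -> (1 <= D)%N ->
  0 < dot t t -> exists (a : R) (w : {ffun 'I_k -> 'I_(2 * (D.+1 * k)).+1}),
    [/\ 0 < a, a ^+ 2 * dot t t = D%:R ^+ 2 * k%:R,
     (D%:R - 1) ^+ 2 * k%:R <= dot (lat w) (lat w) :> R,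
     dot (lat w) (lat w) <= (D.+1)%:R ^+ 2 * k%:R :> R &
     sqdist (lat w) (fun i => a * t i) <= k%:R].
Proof.
move=> k0 D1 t0; have kR : 0 < k%:R :> R by rewrite ltr0n.
have DR : 1 <= D%:R :> R by rewrite ler1n.
set a := D%:R * Num.sqrt k%:R / Num.sqrt (dot t t).
have a2 : a ^+ 2 * dot t t = D%:R ^+ 2 * k%:R.
  by rewrite /a !exprMn exprVn !sqr_sqrtr// ?ltW// divfK// gt_eqF.
have a0 : 0 < a by rewrite divr_gt0 ?mulr_gt0 ?sqrtr_gt0//; lra.
pose u i := a * t i.
have uu : dot u u = D%:R ^+ 2 * k%:R.
  by rewrite -a2 /dot mulr_sumr; apply: eq_bigr => i _; rewrite /u; ring.
have ub i : `|u i| <= (D.+1 * k)%:R.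
  apply: le_trans (@coord_bound R k u D i (eq_ler uu)) _.
  by rewrite ler_nat leq_mul2r leqnSn orbT.
have [w hw] := lattice_round ub; exists a, w.
have uu0 : 0 < dot u u by rewrite uu mulr_gt0// exprn_gt0//; lra.
split=> //.
- have h : D%:R ^+ 2 * k%:R * dot u u <= dot u u ^+ 2 by rewrite -uu expr2.
  have := lin_shift DR h (_ : sqdist u (lat w) <= _); rewrite sqdistC => /(_ hw) h2.
  by rewrite -(ler_pM2r uu0); apply: le_trans h2 (cauchy_schwarz _ _).
- have -> : D.+1%:R = 1 + D%:R :> R by rewrite -natr1 addrC.
  rewrite -sqdist0.
  by apply: sqdist_trans hw _ => //; rewrite ?sqdist0 ?uu// ; lra.
by rewrite expr1n mul1r in hw.
Qed.

(** * Existence of a good sign matrix *)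

Section good_signs.
Context {R : realType} {d : measure_display} {T : measurableType d}.
Variable P : probability T R.
Notation Ex := (Ex P).
Notation pr := (pr P).
Variables (n : nat) (Z : {RV P >-> borel_rV R n}).
Hypothesis HL : log_concave Z.
Hypothesis HI : isotropic Z.
Variables (s D : nat) (J : {set 'I_n}) (Rsq : R).
Hypotheses (s0 : (0 < s)%N) (D3 : (3 <= D)%N)
  (hD : 4 ^+ 19 * (8 * (D%:R + 3)) <= (D%:R - 1) ^+ 2 :> R).
Notation W w := (mass J (fun j => Z w 0 j)).
Hypotheses (R0 : 0 < Rsq) (RE : Rsq ^+ s = Ex (fun w => W w ^+ s)).
Hypothesis (hR : s%:R ^+ 2 * (D%:R + 1) ^+ 2 <= Rsq).
Notation N := (s * (s * n))%N.

Let sR : 1 <= s%:R :> R. Proof. by rewrite ler1n. Qed.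
Let s_gt0 : 0 < s%:R :> R. Proof. by rewrite ltr0n. Qed.

Definition G (z : nat -> R) (t : 'I_s -> R) (w : T) : R :=
  ell Z (fun j => \sum_i t i * sign_coef J z i j) w.

Lemma G_dot z t w : G z t w = dot (proj Z (@sign_coef R s n J z) w) t.
Proof.
rewrite /G /ell /lf; under eq_bigr do rewrite mulr_suml.
rewrite exchange_big /=; apply: eq_bigr => i _; rewrite mulr_suml; apply: eq_bigr => j _.
by rewrite [t i * _]mulrC mulrAC.
Qed.

Lemma allL_G z t : allL P (G z t).
Proof. exact: allL_ell. Qed.

Lemma allL_W : allL P (fun w => W w).
Proof.
rewrite (_ : (fun w => _) = (fun w => \sum_j (j \in J)%:R * ell Z (unitv j) w ^+ 2)).
  by apply: allL_sum => j; apply: allLZ; apply: allLX; exact: allL_ell.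
apply/funext => w; rewrite /mass big_mkcond; apply: eq_bigr => j _; rewrite ell_unit.
by case: (j \in J); rewrite ?mul1r ?mul0r.
Qed.

Lemma Ex_massX (c : R) : Ex (fun w => (c * W w) ^+ s) = (c * Rsq) ^+ s.
Proof.
rewrite exprMn RE -ExZ; last by apply: allLX; exact: allL_W.
by apply: (f_equal Ex); apply/funext => w; rewrite exprMn.
Qed.

Lemma dot_ge0 k (t : 'I_k -> R) : 0 <= dot t t.
Proof. by apply: sumr_ge0 => i _; rewrite -expr2 sqr_ge0. Qed.

Lemma avg_upper t x : cube_avg N (fun z => Ex (fun w => G z t w ^+ (2 * s))) x <=
  (128 * s%:R * dot t t * Rsq) ^+ s.
Proof.
have h z : allL P (fun w => G z t w ^+ (2 * s)) by apply: allLX; exact: allL_G.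
have [h1 ->] := cube_avg_Ex N x h; rewrite -Ex_massX; apply: Ex_le => // [|w].
  by apply: allLX; apply: allLZ; exact: allL_W.
by rewrite -[128 * _ * _ * _]mulrA; exact: cube_avg_upper.
Qed.

Lemma avg_lower t x : (s%:R / 16 * dot t t * Rsq) ^+ s <=
  cube_avg N (fun z => Ex (fun w => G z t w ^+ (2 * s))) x.
Proof.
have h z : allL P (fun w => G z t w ^+ (2 * s)) by apply: allLX; exact: allL_G.
have [h1 ->] := cube_avg_Ex N x h; rewrite -Ex_massX; apply: Ex_le => // [|w].
  by apply: allLX; apply: allLZ; exact: allL_W.
by rewrite -[s%:R / 16 * _ * _]mulrA; apply: cube_avg_lower => //; exact: dot_ge0.
Qed.

(** On vectors of length about D sqrt(s) this makes [lam] times the moment norm of order D s, while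
    its variation in the signs still fits the quadratic allowance of [cube_concentration]; the
    latter uses [hR]. *)
Definition lam : R := (4 ^+ 5 * Num.sqrt Rsq)^-1.

Lemma lam_gt0 : 0 < lam.
Proof. by rewrite invr_gt0 mulr_gt0 ?exprn_gt0// sqrtr_gt0. Qed.

Lemma lam2 : lam ^+ 2 * Rsq = (4 ^+ 10)^-1.
Proof.
rewrite /lam exprVn exprMn sqr_sqrtr; last exact: ltW.
by rewrite -exprM invfM -mulrA mulVf ?mulr1// gt_eqF.
Qed.

Notation h z t := (moment_norm P s (G z t)).

Lemma GD z t w : forall th y, G (fun i => (1 - th) * z i + th * y i) t w =
  (1 - th) * G z t w + th * G y t w.
Proof.
move=> th y; rewrite /G /ell /lf !mulr_sumr -big_split; apply: eq_bigr => j _ /=.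
rewrite -[RHS](_ : ((1 - th) * (\sum_i t i * sign_coef J z i j) + th * (\sum_i t i * sign_coef J y i j)) * Z w 0 j = _); last by ring.
congr (_ * _); rewrite !mulr_sumr -big_split; apply: eq_bigr => i _ /=.
rewrite /sign_coef; have -> : \sum_(l < s) ((1 - th) * z (l * (s * n) + (i * n + j))%N + th * y (l * (s * n) + (i * n + j))%N) =
  (1 - th) * (\sum_(l < s) z (l * (s * n) + (i * n + j))%N) + th * (\sum_(l < s) y (l * (s * n) + (i * n + j))%N).
  by rewrite !mulr_sumr -big_split.
by ring.
Qed.

Lemma h_cvx t : cvx (fun z => lam * h z t).
Proof.
move=> x y th /andP[t0 t1].
have -> : G (fun i => (1 - th) * x i + th * y i) t = (fun w => (1 - th) * G x t w + th * G y t w).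
  by apply/funext => w; rewrite GD.
rewrite mulrCA [th * (_ * _)]mulrCA -mulrDr ler_wpM2l ?(ltW lam_gt0)//.
apply: le_trans (moment_normD s0 _ _) _; try (by apply: allLZ; exact: allL_G).
rewrite !moment_normZ ?(ger0_norm t0) ?ger0_norm ?subr_ge0//; exact: allL_G.
Qed.

(** The two marginals differ by a marginal along a vector of length at most |t| |z - y|, whose
    moment norm is at most of order s times that length. AM-GM splits the product into a multiple of
    s and a quadratic term. *)
Lemma h_lip t z y : 0 < dot t t -> dot t t <= (D%:R + 1) ^+ 2 * s%:R ->
  lam * h z t <= lam * h y t + (s%:R + 1) + (\sum_(i < N) (z i - y i) ^+ 2) / 64.
Proof.
move=> t0 tD; set S := \sum_(i < N) _.
have S0 : 0 <= S by apply: sumr_ge0 => i _; exact: sqr_ge0.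
pose u j := \sum_i t i * (sign_coef J z i j - sign_coef J y i j).
have e w : G z t w = G y t w + ell Z u w.
  rewrite /G /ell -[RHS]/(lf _ _ + lf _ _) /lf -big_split; apply: eq_bigr => j _ /=.
  rewrite -mulrDl; congr (_ * _); rewrite /u -big_split; apply: eq_bigr => i _ /=; ring.
have h1 : h z t <= h y t + moment_norm P s (ell Z u).
  have -> : G z t = (fun w => G y t w + ell Z u w) by apply/funext => w; exact: e.
  by apply: moment_normD; [exact: s0|exact: allL_G|exact: allL_ell].
have uu : dot u u <= dot t t * S by apply: sign_coef_lip => //; exact: ltW.
pose M := Num.sqrt (dot t t * (S + 1)).
have M2 : M ^+ 2 = dot t t * (S + 1) by rewrite sqr_sqrtr// mulr_ge0 ?addr_ge0// ltW.
have M0 : 0 < M by rewrite sqrtr_gt0 mulr_gt0// ltr_wpDl.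
have h2 : moment_norm P s (ell Z u) <= 4 ^+ 4 * s%:R * M.
  apply: moment_norm_le => //; first by rewrite mulr_ge0 ?(ltW M0)// mulr_ge0.
  have := @moment_bound _ _ _ P n Z HL HI u M (2 * s) M0 _.
  have -> : (fun w => `|ell Z u w| ^+ (2 * s)) = (fun w => ell Z u w ^+ (2 * s)).
    by apply/funext => w; rewrite !exprM real_normK ?num_real.
  move=> H; apply: le_trans (H _) _.
    by rewrite M2; apply: le_trans uu _; rewrite ler_wpM2l ?(ltW t0)// lerDl.
  have X0 : 0 <= 10 * (2 * s)%:R * M by rewrite mulr_ge0 ?(ltW M0)// mulr_ge0.
  have le5 : 5 * (10 * (2 * s)%:R * M) <= 4 ^+ 4 * s%:R * M.
    have -> : 5 * (10 * (2 * s)%:R * M) = (5 * 20) * (s%:R * M) by rewrite natrM; ring.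
    have -> : 4 ^+ 4 * s%:R * M = (16 * 16) * (s%:R * M) by ring.
    by rewrite ler_wpM2r ?mulr_ge0// ?(ltW M0)//; lra.
  apply: (@le_trans _ _ ((5 * (10 * (2 * s)%:R * M)) ^+ (2 * s))); last first.
    by apply: lerXn2r le5; rewrite nnegrE ?mulr_ge0// ltW.
  rewrite [in leRHS]exprMn ler_wpM2r//.
    by rewrite exprn_ge0// mulr_ge0 ?(ltW M0)// mulr_ge0.
  by apply: ler_eXnr; rewrite ?muln_gt0//; lra.
have key : lam * (4 ^+ 4 * s%:R * M) <= s%:R + 1 + S / 64.
  have a1 : lam * (4 ^+ 4 * s%:R * M) <= 16 * dot t t * (4 ^+ 4 * s%:R * lam) ^+ 2 + M ^+ 2 / (64 * dot t t).
    rewrite -subr_ge0 (_ : _ - _ = (4 * Num.sqrt (dot t t) * (4 ^+ 4 * s%:R * lam) - M / (8 * Num.sqrt (dot t t))) ^+ 2) ?sqr_ge0//.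
    have q0 : Num.sqrt (dot t t) != 0 by rewrite gt_eqF// sqrtr_gt0.
    have {1 2}-> : dot t t = Num.sqrt (dot t t) ^+ 2 by rewrite sqr_sqrtr// ltW.
    by field.
  apply: le_trans a1 _; rewrite M2.
  have -> : dot t t * (S + 1) / (64 * dot t t) = (S + 1) / 64 by field; rewrite gt_eqF.
  have a2 : 16 * dot t t * (4 ^+ 4 * s%:R * lam) ^+ 2 <= s%:R.
    apply: (@le_trans _ _ (16 * ((D%:R + 1) ^+ 2 * s%:R) * (4 ^+ 4 * s%:R * lam) ^+ 2)).
      by rewrite ler_wpM2r ?sqr_ge0// ler_wpM2l.
    have -> : 16 * ((D%:R + 1) ^+ 2 * s%:R) * (4 ^+ 4 * s%:R * lam) ^+ 2 =
      s%:R * (4 ^+ 10 * (lam ^+ 2 * (s%:R ^+ 2 * (D%:R + 1) ^+ 2))) by ring.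
    rewrite -[leRHS]mulr1 ler_pM2l//; apply: (@le_trans _ _ (4 ^+ 10 * (lam ^+ 2 * Rsq))).
      by rewrite ler_wpM2l ?exprn_ge0// ler_wpM2l ?sqr_ge0.
    by rewrite lam2 divff// expf_neq0.
  by lra.
apply: le_trans (ler_wpM2l (ltW lam_gt0) h1) _; rewrite mulrDr -!addrA lerD2l.
by rewrite addrA; apply: le_trans key; rewrite ler_wpM2l// ltW// lam_gt0.
Qed.

(** A negative exponential moment from a positive one: the average of the exponential of [lam * h]
    is large because the average of the moment is, and concentration bounds the product of the two.
    By [hD] the result is small enough for a union over the lattice points of radius (D + 1)
    sqrt(s), at most (8 (D + 3))^s in number. *)
Lemma lower_tail t x : (D%:R - 1) ^+ 2 * s%:R <= dot t t -> dot t t <= (D%:R + 1) ^+ 2 * s%:R ->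
  cube_avg N (fun z => expR (4 * s%:R - lam * h z t)) x <= (8 * (D%:R + 3)) ^- s.
Proof.
move=> tl tu; have DR : 3 <= D%:R :> R by rewrite (ler_nat R 3).
have d1 : 0 < (D%:R - 1) ^+ 2 :> R by rewrite exprn_gt0//; lra.
have t0 : 0 < dot t t by apply: lt_le_trans tl; rewrite mulr_gt0.
have := @cube_concentration R N (fun z => lam * h z t) (s%:R + 1) x (h_cvx t) (fun z y => h_lip z y t0 tu).
set A := cube_avg N (_ \o _) x; set B := cube_avg N _ x => AB.
have A_ge : ((D%:R - 1) ^+ 2 / 4 ^+ 13) ^+ s <= A.
  have : (lam ^+ 2) ^+ s * (s%:R / 16 * dot t t * Rsq) ^+ s <= (2 * s)%:R ^+ (2 * s) * A.
    apply: le_trans (ler_wpM2l _ (avg_lower t x)) _; first by rewrite exprn_ge0// sqr_ge0.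
    rewrite -!cube_avgZ; apply: cube_avg_le => z _ /=; rewrite -exprM -(moment_normX P s0) -exprMn.
    by apply: expr_le_exp; rewrite mulr_ge0 ?moment_norm_ge0// ltW// lam_gt0.
  have p2 : 0 < (2 * s)%:R ^+ (2 * s) :> R by rewrite exprn_gt0// ltr0n muln_gt0.
  rewrite -ler_pdivrMl// => h1; apply: le_trans h1.
  rewrite ler_pdivlMl// exprM -!exprMn; apply: lerXn2r; rewrite ?nnegrE.
  - by apply: mulr_ge0; [exact: sqr_ge0|apply: divr_ge0; [exact: ltW|exact: exprn_ge0]].
  - by apply: mulr_ge0; [exact: sqr_ge0|apply: mulr_ge0; [apply: mulr_ge0; [exact: divr_ge0|exact: dot_ge0]|exact: ltW]].
  rewrite [lam ^+ 2 * _]mulrC -[s%:R / 16 * _ * _ * _]mulrA [Rsq * _]mulrC lam2.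
  have -> : (2 * s)%:R ^+ 2 * ((D%:R - 1) ^+ 2 / 4 ^+ 13) =
     s%:R / 16 * ((D%:R - 1) ^+ 2 * s%:R) * (4 ^+ 10)^-1 :> R by rewrite natrM; field.
  rewrite ler_wpM2r ?invr_ge0 ?exprn_ge0// ler_wpM2l// divr_ge0//.
have -> : cube_avg N (fun z => expR (4 * s%:R - lam * h z t)) x = expR (4 * s%:R) * B.
  by rewrite -cube_avgZ; apply: cube_avg_eq => z _; rewrite expRD.
have B0 : 0 <= B by apply: cube_avg_ge0 => z; exact: expR_ge0.
have h1 : ((D%:R - 1) ^+ 2 / 4 ^+ 13) ^+ s * B <= expR (s%:R + 1).
  by apply: le_trans AB; rewrite ler_wpM2r.
have p8 : 0 < (8 * (D%:R + 3)) ^+ s :> R by rewrite exprn_gt0// mulr_gt0//; lra.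
rewrite -(ler_pM2l p8) divff ?gt_eqF//.
have e6 : expR (4 * s%:R) * expR (s%:R + 1) <= (4 ^+ 6) ^+ s :> R.
  rewrite -expRD; apply: (@le_trans _ _ (expR (6 * s%:R))); first by rewrite ler_expR; have := sR; lra.
  have -> : 6 * s%:R = (6 * s)%:R * 1 :> R by rewrite natrM mulr1.
  rewrite expRM_natl -exprM lerXn2r ?nnegrE ?expR_ge0//; exact: expR1_le4.
have q0 : 0 < ((D%:R - 1) ^+ 2 / 4 ^+ 13) ^+ s :> R by rewrite exprn_gt0// divr_gt0// exprn_gt0.
rewrite -(ler_pM2l q0) mulr1.
have -> : ((D%:R - 1) ^+ 2 / 4 ^+ 13) ^+ s * ((8 * (D%:R + 3)) ^+ s * (expR (4 * s%:R) * B)) =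
   (8 * (D%:R + 3)) ^+ s * (expR (4 * s%:R) * (((D%:R - 1) ^+ 2 / 4 ^+ 13) ^+ s * B)).
  by ring.
apply: (@le_trans _ _ ((8 * (D%:R + 3)) ^+ s * (4 ^+ 6) ^+ s)).
  rewrite ler_wpM2l ?(ltW p8)//; apply: le_trans e6; rewrite ler_wpM2l ?expR_ge0//.
rewrite -exprMn; apply: lerXn2r; rewrite ?nnegrE.
- by rewrite mulr_ge0 ?exprn_ge0// mulr_ge0//; lra.
- by apply: divr_ge0; [exact: ltW|exact: exprn_ge0].
rewrite ler_pdivlMr ?exprn_gt0//; apply: le_trans hD.
by have -> : 8 * (D%:R + 3) * 4 ^+ 6 * 4 ^+ 13 = 4 ^+ 19 * (8 * (D%:R + 3)) :> R by ring.
Qed.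

Notation V z w := (proj Z (@sign_coef R s n J z) w).

Lemma allL_V z : allL P (fun w => dot (V z w) (V z w)).
Proof. by apply: allL_sum => i; apply: allLM; exact: allL_ell. Qed.

Lemma lattice_card N' (b : nat) : #|[pred w : {ffun 'I_s -> 'I_(2 * N').+1} |
  dot (lat w) (lat w) <= b%:R ^+ 2 * s%:R :> R]|%:R <= (8 * (b%:R + 2)) ^+ s :> R.
Proof.
have [c hc] := @origin_lat R s N'.
apply: le_trans (lattice_count (R := R) c b); rewrite ler_nat; apply: subset_leq_card.
by apply/fintype.subsetP => w; rewrite !unfold_in (sqdist_lat0 _ hc).
Qed.

Lemma avg_sq x : cube_avg N (fun z => Ex (fun w => dot (V z w) (V z w) ^+ s)) x <=
  (4 ^+ 8 * s%:R * Rsq) ^+ s.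
Proof.
pose Q := [pred w : {ffun 'I_s -> 'I_(2 * (5 * s)).+1} | dot (lat w) (lat w) <= 5%:R ^+ 2 * s%:R :> R].
have p9 : 0 < (9 * s%:R) ^+ s :> R by rewrite exprn_gt0// mulr_gt0.
have pt z : (9 * s%:R) ^+ s * Ex (fun w => dot (V z w) (V z w) ^+ s) <=
    \sum_u (Q u)%:R * Ex (fun w => G z (lat u) w ^+ (2 * s)).
  rewrite -ExZ; last by apply: allLX; exact: allL_V.
  have hG u : allL P (fun w => (Q u)%:R * G z (lat u) w ^+ (2 * s)).
    by apply: allLZ; apply: allLX; exact: allL_G.
  rewrite (eq_bigr (fun u => Ex (fun w => (Q u)%:R * G z (lat u) w ^+ (2 * s)))); last first.
    by move=> u _; rewrite ExZ//; apply: allLX; exact: allL_G.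
  rewrite -Ex_sum//; apply: Ex_le => [||w].
  - by apply: allLZ; apply: allLX; exact: allL_V.
  - exact: allL_sum.
  have [u [u1 u2]] := net_pointwise (V z w) s0.
  rewrite (bigD1 u)//= u1 mul1r -exprMn G_dot dotC exprM; apply: le_trans (_ : _ <= (dot (lat u) (V z w) ^+ 2) ^+ s) _.
    by apply: lerXn2r; rewrite ?nnegrE ?sqr_ge0// mulr_ge0 ?dot_ge0// mulr_ge0.
  rewrite lerDl; apply: sumr_ge0 => i _; rewrite mulr_ge0//.
  by rewrite exprM exprn_ge0// sqr_ge0.
rewrite -(ler_pM2l p9) -cube_avgZ; apply: le_trans (cube_avg_le (fun z _ => pt z)) _.
rewrite cube_avg_sum; apply: (@le_trans _ _ (\sum_u (Q u)%:R * (128 * s%:R * (5%:R ^+ 2 * s%:R) * Rsq) ^+ s)).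
  apply: ler_sum => u _; rewrite cube_avgZ; case: (boolP (Q u)) => Qu; last by rewrite !mul0r.
  rewrite !mul1r; apply: le_trans (avg_upper _ _) _; apply: lerXn2r; rewrite ?nnegrE.
  - by rewrite mulr_ge0 ?(ltW R0)// mulr_ge0 ?dot_ge0// mulr_ge0.
  - by rewrite mulr_ge0 ?(ltW R0)// mulr_ge0// ?mulr_ge0// exprn_ge0.
  by rewrite ler_wpM2r ?(ltW R0)// ler_wpM2l// mulr_ge0.
rewrite -mulr_suml -(card_r (R := R)).
apply: (@le_trans _ _ ((8 * (5%:R + 2)) ^+ s * (128 * s%:R * (5%:R ^+ 2 * s%:R) * Rsq) ^+ s)).
  rewrite ler_wpM2r ?exprn_ge0// ?mulr_ge0 ?(ltW R0)//.
  exact: lattice_card.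
rewrite -!exprMn; apply: lerXn2r; rewrite ?nnegrE.
- by rewrite !mulr_ge0 ?(ltW R0)// exprn_ge0.
- by rewrite !mulr_ge0 ?(ltW R0)// exprn_ge0.
have -> : 9 * s%:R * (4 ^+ 8 * s%:R * Rsq) = ((9 * (16 * 16)) * (16 * 16)) * (s%:R ^+ 2 * Rsq) by ring.
have -> : 8 * (5%:R + 2) * (128 * s%:R * (5%:R ^+ 2 * s%:R) * Rsq) = ((56 * 25) * 128) * (s%:R ^+ 2 * Rsq) by ring.
rewrite ler_wpM2r ?mulr_ge0 ?sqr_ge0 ?(ltW R0)//.
by apply: ler_pM => //; lra.
Qed.

Hypothesis J0 : (0 < #|J|)%N.

(** Three nonnegative quantities whose averages are at most 1 after normalization; for some [z]
    their sum is below 4. *)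
Lemma good_signs : exists z, [/\
  Ex (fun w => dot (V z w) (V z w) ^+ s) <= 4 * (4 ^+ 8 * s%:R * Rsq) ^+ s,
  \sum_(i < s) \sum_j sign_coef J z i j ^+ 2 <= 4 * (128 * s%:R * #|J|%:R) &
  forall u : {ffun 'I_s -> 'I_(2 * (D.+1 * s)).+1},
    (D%:R - 1) ^+ 2 * s%:R <= dot (lat u) (lat u) :> R ->
    dot (lat u) (lat u) <= (D.+1)%:R ^+ 2 * s%:R :> R ->
    2 * s%:R <= lam * h z (lat u)].
Proof.
set a := (4 ^+ 8 * s%:R * Rsq) ^+ s; set b := 128 * s%:R * #|J|%:R.
have a0 : 0 < a by rewrite exprn_gt0// mulr_gt0// mulr_gt0// exprn_gt0.
have b0 : 0 < b by rewrite mulr_gt0 ?ltr0n// mulr_gt0.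
pose Q (u : {ffun 'I_s -> 'I_(2 * (D.+1 * s)).+1}) :=
  ((D%:R - 1) ^+ 2 * s%:R <= dot (lat u) (lat u) :> R) && (dot (lat u) (lat u) <= (D.+1)%:R ^+ 2 * s%:R :> R).
pose F z := a^-1 * Ex (fun w => dot (V z w) (V z w) ^+ s) +
  (b^-1 * (\sum_(i < s) \sum_j sign_coef J z i j ^+ 2) +
  \sum_u (Q u)%:R * expR (4 * s%:R - lam * h z (lat u))).
have hF : cube_avg N F (fun=> 0) < 4.
  rewrite /F !cube_avgD !cube_avgZ.
  have h1 : a^-1 * cube_avg N (fun z => Ex (fun w => dot (V z w) (V z w) ^+ s)) (fun=> 0) <= 1.
    by rewrite ler_pdivrMl// mulr1; exact: avg_sq.
  have h2 : b^-1 * cube_avg N (fun z => \sum_(i < s) \sum_j sign_coef J z i j ^+ 2) (fun=> 0) <= 1.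
    by rewrite ler_pdivrMl// mulr1; exact: sign_coef_avg.
  have D8 : 0 < 8 * (D%:R + 3) :> R by rewrite mulr_gt0// ltr_wpDl.
  have h3 : cube_avg N (fun z => \sum_u (Q u)%:R * expR (4 * s%:R - lam * h z (lat u))) (fun=> 0) <= 1.
    rewrite cube_avg_sum.
    apply: (@le_trans _ _ (\sum_u (Q u)%:R * (8 * (D%:R + 3)) ^- s)).
      apply: ler_sum => u _; rewrite cube_avgZ; case: (boolP (Q u)) => Qu; last by rewrite !mul0r.
      rewrite !mul1r; have /andP[q1 q2] := Qu; apply: lower_tail => //.
      by rewrite natr1.
    rewrite -mulr_suml -(card_r (R := R)) ler_pdivrMr ?exprn_gt0// mul1r.
    apply: le_trans (_ : _ <= (8 * ((D.+1)%:R + 2)) ^+ s) _; last first.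
      by apply: eq_ler; congr ((8 * _) ^+ s); rewrite -natr1; ring.
    apply: le_trans (lattice_card _ _); rewrite ler_nat; apply: subset_leq_card.
    by apply/fintype.subsetP => u; rewrite !unfold_in => /andP[].
  by lra.
have [z _ hz] := cube_avg_exists hF; exists z.
set A := Ex _ in hz *; set B := \sum_(i < s) _ in hz *.
have A0 : 0 <= a^-1 * A.
  by rewrite mulr_ge0 ?invr_ge0 ?(ltW a0)//; apply: Ex_ge0 => w; rewrite exprn_ge0// dot_ge0.
have B0 : 0 <= b^-1 * B.
  by rewrite mulr_ge0 ?invr_ge0 ?(ltW b0)//; apply: sumr_ge0 => i _; apply: sumr_ge0 => j _; exact: sqr_ge0.
have c0 u : 0 <= (Q u)%:R * expR (4 * s%:R - lam * h z (lat u)) by rewrite mulr_ge0// expR_ge0.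
have C0 : 0 <= \sum_u (Q u)%:R * expR (4 * s%:R - lam * h z (lat u)) by apply: sumr_ge0.
have {}hz : a^-1 * A + (b^-1 * B + \sum_u (Q u)%:R * expR (4 * s%:R - lam * h z (lat u))) < 4 by exact: hz.
split.
- by rewrite mulrC -ler_pdivrMl//; move: hz A0 B0 C0; lra.
- by rewrite mulrC -ler_pdivrMl//; move: hz A0 B0 C0; lra.
move=> u q1 q2; rewrite leNgt; apply/negP => lt.
have : expR (4 * s%:R - lam * h z (lat u)) < 4.
  have : (Q u)%:R * expR (4 * s%:R - lam * h z (lat u)) <= \sum_u (Q u)%:R * expR (4 * s%:R - lam * h z (lat u)).
    by rewrite [leRHS](bigD1 u)//= lerDl sumr_ge0.
  have -> : Q u = true by rewrite /Q q1 q2.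
  by rewrite mul1r; move: hz A0 B0 C0; lra.
rewrite ltNge => /negP; apply; apply: (@le_trans _ _ (expR (1 + 1))); last first.
  by rewrite ler_expR; move: sR lt; lra.
by rewrite expRD; have := @expR_ge1Dx R 1; nra.
Qed.

(** From lattice points to all directions: the error vector has length at most sqrt(s), and by the
    bound on the full length of the projection it costs at most [s] of the [2 * s] available at the
    lattice point. *)
Lemma good_lower z :
  Ex (fun w => dot (V z w) (V z w) ^+ s) <= 4 * (4 ^+ 8 * s%:R * Rsq) ^+ s ->
  (forall u : {ffun 'I_s -> 'I_(2 * (D.+1 * s)).+1},
    (D%:R - 1) ^+ 2 * s%:R <= dot (lat u) (lat u) :> R ->
    dot (lat u) (lat u) <= (D.+1)%:R ^+ 2 * s%:R :> R ->
    2 * s%:R <= lam * h z (lat u)) ->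
  forall t, 0 < dot t t ->
  (4 ^+ 10 * s%:R * Rsq / D%:R ^+ 2 * dot t t) ^+ s <= Ex (fun w => G z t w ^+ (2 * s)).
Proof.
move=> h1 h2 t t0; have D1 : (1 <= D)%N by exact: leq_trans D3.
have [a [w [a0 at2 wl wu wt]]] := net_sphere s0 D1 t0.
have hw := h2 w wl wu.
pose de i := lat w i - a * t i.
have Ge x : G z (lat w) x = a * G z t x + G z de x.
  rewrite !G_dot /dot mulr_sumr -big_split; apply: eq_bigr => i _ /=; rewrite /de; ring.
have tri : h z (lat w) <= a * h z t + h z de.
  have -> : G z (lat w) = (fun x => a * G z t x + G z de x) by apply/funext => x; exact: Ge.
  rewrite -[X in X * h z t](gtr0_norm a0) -moment_normZ//; last exact: allL_G.
  by apply: moment_normD; [exact: s0|apply: allLZ; exact: allL_G|exact: allL_G].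
have sq0 : 0 < Num.sqrt Rsq by rewrite sqrtr_gt0.
have hde : h z de <= 4 ^+ 5 * s%:R * Num.sqrt Rsq.
  apply: moment_norm_le => //.
  apply: (@le_trans _ _ (s%:R ^+ s * Ex (fun x => dot (V z x) (V z x) ^+ s))).
    rewrite -ExZ; last by apply: allLX; exact: allL_V.
    apply: Ex_le => [||x]; [by apply: allLX; exact: allL_G|by apply: allLZ; apply: allLX; exact: allL_V|].
    rewrite G_dot exprM -exprMn; apply: lerXn2r; rewrite ?nnegrE ?sqr_ge0//.
      by rewrite mulr_ge0// dot_ge0.
    apply: le_trans (cauchy_schwarz _ _) _; by rewrite [leLHS]mulrC ler_wpM2r ?dot_ge0.
  apply: (@le_trans _ _ (s%:R ^+ s * (4 ^+ s * (4 ^+ 8 * s%:R * Rsq) ^+ s))).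
    rewrite ler_wpM2l ?exprn_ge0//; apply: le_trans h1 _; rewrite ler_wpM2r//.
      by rewrite exprn_ge0// !mulr_ge0 ?exprn_ge0// ltW.
    by apply: ler_eXnr => //; lra.
  rewrite -!exprMn exprM; apply: lerXn2r; rewrite ?nnegrE ?sqr_ge0//.
    by rewrite !mulr_ge0 ?exprn_ge0// ltW.
  rewrite [leRHS]exprMn sqr_sqrtr ?(ltW R0)// -[leRHS](_ : 4 * (s%:R * (4 * (4 ^+ 8 * s%:R * Rsq))) = _); last by ring.
  rewrite ler_peMl//; last by lra.
  by rewrite !mulr_ge0 ?exprn_ge0// ltW.
have lamE : lam * (4 ^+ 5 * s%:R * Num.sqrt Rsq) = s%:R.
  rewrite /lam -[4 ^+ 5 * _ * _](_ : (4 ^+ 5 * Num.sqrt Rsq) * s%:R = _); last by ring.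
  by rewrite mulKf// gt_eqF// mulr_gt0// exprn_gt0.
have l0 := lam_gt0.
have key : s%:R <= lam * (a * h z t).
  have := ler_wpM2l (ltW l0) tri; rewrite mulrDr.
  have := ler_wpM2l (ltW l0) hde; rewrite lamE; move: hw; lra.
have la0 : 0 < lam * a by rewrite mulr_gt0.
rewrite -(moment_normX P s0) exprM; apply: lerXn2r; rewrite ?nnegrE ?sqr_ge0//.
  by rewrite mulr_ge0 ?dot_ge0// divr_ge0 ?sqr_ge0// !mulr_ge0 ?exprn_ge0// ltW.
have h3 : s%:R / (lam * a) <= h z t by rewrite ler_pdivrMr// mulrC -mulrA.
apply: (@le_trans _ _ ((s%:R / (lam * a)) ^+ 2)); last first.
  by apply: lerXn2r => //; rewrite nnegrE ?moment_norm_ge0// divr_ge0// ltW.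
rewrite expr_div_n exprMn ler_pdivlMr ?mulr_gt0 ?exprn_gt0//.
have D20 : D%:R ^+ 2 != 0 :> R by rewrite expf_neq0// pnatr_eq0 -lt0n.
rewrite -[leLHS](_ : 4 ^+ 10 * s%:R * (lam ^+ 2 * Rsq) / D%:R ^+ 2 * (a ^+ 2 * dot t t) = _); last by ring.
rewrite lam2 at2; apply: eq_ler; field.
by rewrite pnatr_eq0 -lt0n.
Qed.

End good_signs.

(** * Paouris' inequality from the geometry of the projection *)

Section paouris.
Context {R : realType} {d : measure_display} {T : measurableType d}.
Variable P : probability T R.
Notation Ex := (Ex P).
Notation pr := (pr P).
Variables (n : nat) (Z : {RV P >-> borel_rV R n}).
Hypothesis HL : log_concave Z.
Hypothesis HI : isotropic Z.
Notation W J w := (mass J (fun j => Z w 0 j)).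

(** [M] is of order x / D and [b] of order x, while the geometry keeps M^2 at most of order b; this
    bounds x by a multiple of D^2. *)
Lemma paouris_num (x D M b : R) : 1 <= D -> 0 <= M -> x / (5 * D) < M + 1 -> b <= 4 ^+ 18 * x + 1 ->
  (2 * M + 1) ^+ 2 / 4 ^+ 26 <= 4 ^+ 22 * (b + 3) -> x <= 4 ^+ 70 * D ^+ 2.
Proof.
move=> D1 M0 hM hb h; rewrite leNgt; apply/negP => hx.
have D2 : 1 <= D ^+ 2 by rewrite exprn_ege1.
have D0 : 0 < 5 * D by lra.
have p4 m : 1 <= 4 ^+ m :> R by rewrite exprn_ege1//; lra.
have x1 : 4 <= x.
  apply: le_trans (ltW hx); have := p4 69%N; rewrite [4 ^+ 70]exprS.
  by move: (4 ^+ 69) => y; nra.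
have hb2 : b + 3 <= 4 ^+ 19 * x.
  by have := p4 18%N; rewrite [4 ^+ 19]exprS; move: (4 ^+ 18) hb => y; nra.
have xp : 0 < x by lra.
have h1 : x / (5 * D) < 2 * M + 1 by lra.
have h2 : (x / (5 * D)) ^+ 2 < (2 * M + 1) ^+ 2.
  have a0 : 0 <= x / (5 * D) by rewrite divr_ge0// ltW.
  have a1 : 0 <= 2 * M + 1 by lra.
  by rewrite (@ltr_pXn2r _ 2) ?nnegrE.
have h3 : (2 * M + 1) ^+ 2 <= 4 ^+ 67 * x.
  rewrite ler_pdivrMr ?exprn_gt0// in h; apply: le_trans h _.
  apply: (@le_trans _ _ (4 ^+ 22 * (4 ^+ 19 * x) * 4 ^+ 26)).
    by rewrite ler_wpM2r ?exprn_ge0// ler_wpM2l ?exprn_ge0.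
  by rewrite [4 ^+ 22 * _]mulrA -exprD mulrAC -exprD.
have h4 : (x / (5 * D)) ^+ 2 < 4 ^+ 67 * x by exact: lt_le_trans h2 h3.
rewrite expr_div_n ltr_pdivrMr ?exprn_gt0// expr2 mulrAC ltr_pM2r// in h4.
have : 4 ^+ 67 * (5 * D) ^+ 2 <= 4 ^+ 70 * D ^+ 2.
  rewrite (_ : 70%N = (67 + 3)%N)// exprD -mulrA ler_wpM2l ?exprn_ge0//.
  rewrite exprMn ler_wpM2r ?sqr_ge0//.
  by rewrite !exprS expr0; lra.
by move=> h5; have := lt_le_trans h4 h5; rewrite ltNge (ltW hx).
Qed.

Section fixed.
Variables (s D : nat) (J : {set 'I_n}) (Rsq : R).
Hypotheses (s0 : (0 < s)%N) (D3 : (3 <= D)%N)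
  (hD : 4 ^+ 19 * (8 * (D%:R + 3)) <= (D%:R - 1) ^+ 2 :> R).
Hypotheses (R0 : 0 < Rsq) (RE : Rsq ^+ s = Ex (fun w => W J w ^+ s)).
Hypothesis (hR : s%:R ^+ 2 * (D%:R + 1) ^+ 2 <= Rsq).
Hypothesis J0 : (0 < #|J|)%N.

Lemma paouris_ratio : Num.sqrt (Rsq / #|J|%:R) <= 4 ^+ 70 * D%:R ^+ 2.
Proof.
have [z [z1 z2 z3]] := good_signs HL HI s0 D3 hD R0 RE hR J0.
have low := good_lower HL HI s0 D3 R0 z1 z3.
have dR : 0 < #|J|%:R :> R by rewrite ltr0n.
have sR : 0 < s%:R :> R by rewrite ltr0n.
have DR : 3 <= D%:R :> R by rewrite (ler_nat R 3).
have DR0 : 0 < D%:R :> R by lra.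
set r := Rsq / #|J|%:R; set x := Num.sqrt r.
have r0 : 0 < r by rewrite divr_gt0.
have x0 : 0 < x by rewrite sqrtr_gt0.
have x2 : x ^+ 2 = r by rewrite sqr_sqrtr// ltW.
rewrite leNgt; apply/negP => hx.
(* Dividing by [q2] makes the expected squared length of the projection at most s / 2, so the ball
   of squared radius [s] has mass at least 1/2. *)
pose q2 : R := 4 ^+ 5 * #|J|%:R.
have q20 : 0 < q2 by rewrite mulr_gt0// exprn_gt0.
pose ka := (Num.sqrt q2)^-1.
have ka0 : 0 < ka by rewrite invr_gt0 sqrtr_gt0.
have ka2 : ka ^+ 2 = q2^-1 by rewrite exprVn sqr_sqrtr// ltW.
pose g (i : 'I_s) (j : 'I_n) : R := ka * sign_coef J z i j.
pose V w := proj Z (@sign_coef R s n J z) w.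
have gV w : proj Z g w = (fun i => ka * V w i).
  by apply/funext => i; rewrite /proj /ell /lf mulr_sumr; apply: eq_bigr => j _; rewrite mulrA.
have gVV w : dot (proj Z g w) (proj Z g w) = dot (V w) (V w) / q2.
  rewrite gV mulrC -ka2 /dot mulr_sumr; apply: eq_bigr => i _; ring.
have gVt w t : dot (proj Z g w) t = ka * G Z J z t w.
  by rewrite gV G_dot /dot mulr_sumr; apply: eq_bigr => i _; rewrite mulrA.
have aVV : allL P (fun w => dot (V w) (V w)) by exact: allL_V.
have mball c : measurable (ball Z g (fun=> 0) c) by exact: meas_ball.
have ball_compl c : pr (~` ball Z g (fun=> 0) c) <= pr [set w | c * q2 <= dot (V w) (V w)].
  apply: pr_le; [exact: measurableC|by apply: meas_ge; case: aVV|].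
  move=> w; rewrite /ball /= sqdist0 gVV => /negP; rewrite -ltNge => lt.
  by rewrite -ler_pdivlMr// ltW.
have compl c : 1 - pr [set w | c * q2 <= dot (V w) (V w)] <= pr (ball Z g (fun=> 0) c).
  have := prD P measurableT (mball c); rewrite prT !setTI.
  by have := ball_compl c; lra.
have h0 : 1 / 2 <= pr (ball Z g (fun=> 0) (1 ^+ 2 * s%:R)).
  have -> : 1 ^+ 2 * s%:R = s%:R :> R by rewrite expr1n mul1r.
  apply: le_trans (compl _).
  have c0 : 0 < s%:R * q2 by rewrite mulr_gt0.
  have VV0 w : 0 <= dot (V w) (V w) by exact: dot_ge0.
  have := ex_markov aVV VV0 c0.
  have -> : Ex (fun w => dot (V w) (V w)) = \sum_(i < s) \sum_j sign_coef J z i j ^+ 2.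
    rewrite Ex_sum; last by move=> i; apply: allLM; exact: allL_ell.
    apply: eq_bigr => i _; transitivity (dot (sign_coef J z i) (sign_coef J z i)); last by apply: eq_bigr => j _; rewrite expr2.
    by rewrite -(Ex_ell2 HL HI); apply: (f_equal Ex); apply/funext => w; rewrite expr2.
  move=> h; have := le_trans h z2.
  have -> : 4 * (128 * s%:R * #|J|%:R) = s%:R * q2 * (1 / 2) by rewrite /q2 !exprS expr0; field.
  by rewrite ler_pM2l//; lra.
pose M := Num.truncn (x / (5 * D%:R)).
pose b := (Num.truncn (4 ^+ 18 * x)).+1.
have p18 : 0 <= 4 ^+ 18 * x by rewrite mulr_ge0 ?exprn_ge0// ltW.
have /andP[b1 b2] := truncn_itv p18.
have xD0 : 0 <= x / (5 * D%:R) by rewrite divr_ge0 ?(ltW x0)// mulr_ge0.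
have /andP[M1 M2] := truncn_itv xD0.
have hM : (4 * M%:R + 1) ^+ 2 <= r / D%:R ^+ 2 :> R.
  have x5 : 1 <= x / (5 * D%:R).
    rewrite ler_pdivlMr ?mulr_gt0// mul1r; apply: le_trans (ltW hx).
    apply: (@le_trans _ _ (5 * D%:R ^+ 2)).
      by rewrite ler_wpM2l// expr2 ler_peMl//; lra.
    rewrite ler_wpM2r ?sqr_ge0//; rewrite (_ : 70%N = (2 + 68)%N)// exprD.
    have : 1 <= 4 ^+ 68 :> R by rewrite exprn_ege1//; lra.
    by move: (4 ^+ 68) => y; rewrite !exprS expr0; lra.
  have M3 : 1 <= M%:R :> R.
    by rewrite (ler_nat R 1) /M -truncn_gt0 // in x5 *.
  have -> : r / D%:R ^+ 2 = (x / D%:R) ^+ 2 by rewrite expr_div_n x2.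
  apply: lerXn2r; rewrite ?nnegrE ?addr_ge0 ?mulr_ge0 ?divr_ge0 ?(ltW x0)//.
  apply: (@le_trans _ _ (5 * M%:R)); first by lra.
  by rewrite -/M in M1; rewrite ler_pdivlMr//; rewrite ler_pdivlMr ?mulr_gt0// in M1; move: M1; rewrite mulrA [M%:R * 5]mulrC.
have b0 : (0 < b)%N by [].
have c1 : 0 < (4 ^+ 26 : R)^-1 <= 1.
  by rewrite invr_gt0 exprn_gt0//= invf_le1 ?exprn_gt0// exprn_ege1//; lra.
(* The slab has mass at least 4^(-25 s) by [small_ball], and [b] is so large that Markov at order
   [s] leaves at most 4^(-26 s) outside the ball; the difference is still at least 4^(-26 s). *)
have hF t : 0 < dot t t -> ((4 ^+ 26 : R)^-1) ^+ s <=
    pr ([set w | (4 * M%:R + 1) ^+ 2 * s%:R * dot t t <= dot (proj Z g w) t ^+ 2] `&`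
        ball Z g (fun=> 0) (b%:R ^+ 2 * s%:R)).
  move=> t0; pose rho2 := 4 ^+ 9 * s%:R * Rsq / D%:R ^+ 2 * dot t t.
  have rho20 : 0 < rho2 by rewrite mulr_gt0// divr_gt0 ?exprn_gt0// !mulr_gt0// exprn_gt0.
  pose rho := Num.sqrt rho2.
  have rhoE : rho ^+ 2 = rho2 by rewrite sqr_sqrtr// ltW.
  have lowt := low t t0.
  have e4 : (2 * rho) ^+ (2 * s) = (4 ^+ 10 * s%:R * Rsq / D%:R ^+ 2 * dot t t) ^+ s.
    by rewrite exprM [(2 * rho) ^+ 2]exprMn rhoE /rho2; congr (_ ^+ s); rewrite [4 ^+ 10]exprS; ring.
  have H0 : 0 < Ex (fun w => G Z J z t w ^+ (2 * s)).
    by apply: lt_le_trans lowt; rewrite -e4 exprn_gt0// mulr_gt0// sqrtr_gt0.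
  have := @small_ball _ _ _ P n Z HL HI (fun j => \sum_i t i * sign_coef J z i j) s rho s0 (sqrtr_ge0 _) H0.
  rewrite e4 => /(_ lowt) sb.
  set A := [set w | (4 * M%:R + 1) ^+ 2 * _ * _ <= _]; set B := ball _ _ _ _.
  have mA : measurable A.
    apply: meas_ge; apply: measurable_funX; apply: measurable_sum => i.
    by apply: measurable_funM => //; exact: meas_ell.
  have mB : measurable B by exact: mball.
  have hA : ((4 ^+ 25)^-1) ^+ s <= pr A.
    rewrite exprVn; apply: le_trans sb _; apply: pr_le => //.
      apply: meas_ge; apply: measurableT_comp => //; exact: meas_ell.
    move=> w /= hw; rewrite /A /= gVt exprMn ka2.
    apply: (@le_trans _ _ (q2^-1 * rho2)); last first.
      rewrite ler_wpM2l ?invr_ge0 ?(ltW q20)// -rhoE -[leRHS]real_normK ?num_real//.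
      by apply: lerXn2r; rewrite ?nnegrE// sqrtr_ge0.
    apply: (@le_trans _ _ (r / D%:R ^+ 2 * s%:R * dot t t)).
      by rewrite (ler_wpM2r (ltW t0))// (ler_wpM2r (ltW sR)).
    have -> : q2^-1 * rho2 = 4 ^+ 4 * (r / D%:R ^+ 2 * s%:R * dot t t).
      rewrite /rho2 /q2 /r (_ : 9%N = (4 + 5)%N)// exprD; field.
      by rewrite !gt_eqF ?exprn_gt0.
    rewrite ler_peMl//; first by rewrite !mulr_ge0 ?invr_ge0 ?sqr_ge0// ltW.
    by rewrite exprn_ege1//; lra.
  have hB : pr (~` B) <= ((4 ^+ 26)^-1) ^+ s.
    apply: le_trans (ball_compl _) _.
    have c0 : 0 < b%:R ^+ 2 * s%:R * q2 by rewrite !mulr_gt0// exprn_gt0// ltr0n.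
    have VV0 w : 0 <= dot (V w) (V w) ^+ s by rewrite exprn_ge0// dot_ge0.
    have mk := ex_markov (allLX s aVV) VV0 (exprn_gt0 s c0).
    set E := [set w | _]; have mE : measurable E by apply: meas_ge; case: aVV.
    have le1 : pr E <= pr [set w | (b%:R ^+ 2 * s%:R * q2) ^+ s <= dot (V w) (V w) ^+ s].
      apply: pr_le => //; first by apply: meas_ge; case: (allLX s aVV).
      by move=> w /= hw; apply: lerXn2r hw; rewrite nnegrE ?dot_ge0// ltW.
    have := le_trans (ler_wpM2l (exprn_ge0 s (ltW c0)) le1) (le_trans mk z1).
    move=> h; rewrite -(ler_pM2l (exprn_gt0 s c0)); apply: le_trans h _.
    apply: (@le_trans _ _ (4 ^+ s * (4 ^+ 8 * s%:R * Rsq) ^+ s)).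
      rewrite ler_wpM2r ?exprn_ge0 ?mulr_ge0 ?exprn_ge0 ?(ltW R0)//.
      by apply: ler_eXnr => //; lra.
    rewrite -!exprMn; apply: lerXn2r; rewrite ?nnegrE.
    - by rewrite !mulr_ge0 ?exprn_ge0 ?(ltW R0).
    - by rewrite mulr_ge0 ?(ltW c0)// invr_ge0 exprn_ge0.
    have bx : 4 ^+ 36 * r <= b%:R ^+ 2.
      have -> : 4 ^+ 36 * r = (4 ^+ 18 * x) ^+ 2 by rewrite exprMn x2 -exprM.
      by apply: lerXn2r; rewrite ?nnegrE//; exact: ltW b2.
    rewrite ler_pdivlMr ?exprn_gt0//.
    have -> : 4 * (4 ^+ 8 * s%:R * Rsq) * 4 ^+ 26 = 4 ^+ 35 * (r * s%:R * #|J|%:R).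
      have -> : Rsq = r * #|J|%:R by rewrite /r divfK// gt_eqF.
      ring.
    have -> : b%:R ^+ 2 * s%:R * q2 = b%:R ^+ 2 * (4 ^+ 5 * (s%:R * #|J|%:R)) by rewrite /q2; ring.
    apply: (@le_trans _ _ (4 ^+ 36 * r * (4 ^+ 5 * (s%:R * #|J|%:R)))).
      have -> : 4 ^+ 36 * r * (4 ^+ 5 * (s%:R * #|J|%:R)) = 4 ^+ 6 * (4 ^+ 35 * (r * s%:R * #|J|%:R)) by ring.
      have Y0 : 0 <= 4 ^+ 35 * (r * s%:R * #|J|%:R).
        by apply: mulr_ge0; [exact: exprn_ge0|rewrite !mulr_ge0// ltW].
      by apply: ler_peMl => //; apply: exprn_ege1; lra.
    by rewrite ler_wpM2r// !mulr_ge0 ?exprn_ge0.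
  have := prD P mA mB.
  have le2 : pr (A `&` ~` B) <= pr (~` B).
    by apply: pr_le; [apply: measurableI => //; exact: measurableC|exact: measurableC|move=> w []].
  have e25 : ((4 ^+ 25)^-1) ^+ s = 4 ^+ s * ((4 ^+ 26)^-1) ^+ s :> R.
    rewrite -exprMn; congr (_ ^+ s); have n4 : 4 ^+ 25 != 0 :> R by rewrite expf_neq0.
    by rewrite [4 ^+ 26]exprS; move: (4 ^+ 25) n4 => y y0; field.
  have e26 : 2 * ((4 ^+ 26)^-1) ^+ s <= ((4 ^+ 25)^-1) ^+ s :> R.
    rewrite e25 ler_wpM2r ?exprn_ge0 ?invr_ge0 ?exprn_ge0//.
    by apply: (@le_trans _ _ 4); [lra|apply: ler_eXnr => //; lra].
  move: hA hB le2 e26; move: (pr _) (pr _) (pr _) (pr _) (_ ^+ s) (_ ^+ s) => p1 p2 p3 p4 y1 y2.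
  lra.
have geo := paouris_geometry HL s0 b0 c1 h0 hF.
move: hx; rewrite ltNge => /negP; apply.
apply: (@paouris_num x D%:R M%:R b%:R).
- by lra.
- by [].
- by rewrite natr1.
- by rewrite /b -natr1 lerD2r.
by move: geo; rewrite -[b.+3]addn3 natrD.
Qed.

End fixed.

(** If [Rsq] exceeded the bound, the second summand of the constant would yield the hypothesis [hR],
    and the first would contradict [paouris_ratio]. *)
Lemma paouris_aux (D : nat) : (3 <= D)%N ->
  4 ^+ 19 * (8 * (D%:R + 3)) <= (D%:R - 1) ^+ 2 :> R ->
  forall s J, (0 < s)%N -> Ex (fun w => W J w ^+ s) <=
    (((4 ^+ 70 * D%:R ^+ 2) ^+ 2 + (D%:R + 1) ^+ 2) * (#|J|%:R + s%:R ^+ 2)) ^+ s.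
Proof.
move=> D3 hD s J s0; set C := _ + _.
have sR : 1 <= s%:R :> R by rewrite ler1n.
have C1 : 0 <= (4 ^+ 70 * D%:R ^+ 2) ^+ 2 :> R by rewrite exprn_ge0// mulr_ge0 ?exprn_ge0.
have C2 : 0 <= (D%:R + 1) ^+ 2 :> R by rewrite exprn_ge0.
have C0 : 0 <= C by rewrite addr_ge0.
have B0 : 0 <= C * (#|J|%:R + s%:R ^+ 2) by rewrite mulr_ge0// addr_ge0// exprn_ge0.
have [J0|J0] := posnP #|J|.
  apply: le_trans (_ : 0 <= _); last exact: exprn_ge0.
  rewrite -(Ex_cst P 0); apply: eq_ler; apply: (f_equal Ex); apply/funext => w.
  by rewrite (cards0_eq J0) /mass big_set0 expr0n -[s]prednK.
have E0 : 0 <= Ex (fun w => W J w ^+ s) by apply: Ex_ge0 => w; rewrite exprn_ge0// mass_ge0.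
set Rsq := (Ex (fun w => W J w ^+ s)) `^ s%:R^-1.
have RE : Rsq ^+ s = Ex (fun w => W J w ^+ s).
  by rewrite -powR_mulrn ?powR_ge0// /Rsq -powRrM mulVf ?powRr1// pnatr_eq0 -lt0n.
rewrite -RE; apply: lerXn2r; rewrite ?nnegrE ?powR_ge0// leNgt; apply/negP => hR.
have Rp : 0 < Rsq by exact: le_lt_trans hR.
have dR : 0 < #|J|%:R :> R by rewrite ltr0n.
have h1 : s%:R ^+ 2 * (D%:R + 1) ^+ 2 <= Rsq.
  apply: le_trans (ltW hR); rewrite mulrC; apply: ler_pM; rewrite ?exprn_ge0//.
    by rewrite lerDr.
  by rewrite lerDr.
have := paouris_ratio s0 D3 hD Rp RE h1 J0; apply/negP; rewrite -ltNge.
have h2 : (4 ^+ 70 * D%:R ^+ 2) ^+ 2 < Rsq / #|J|%:R.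
  rewrite ltr_pdivlMr//; apply: le_lt_trans hR; apply: ler_pM => //.
    by rewrite lerDl.
  by rewrite lerDl exprn_ge0.
have p0 : 0 <= 4 ^+ 70 * D%:R ^+ 2 :> R by rewrite mulr_ge0 ?exprn_ge0.
by rewrite -[ltLHS](ger0_norm p0) -sqrtr_sqr ltr_sqrt// (le_lt_trans C1).
Qed.

End paouris.

Lemma paouris (R : realType) : exists2 C : R, 1 <= C &
  forall d (T : measurableType d) (P : probability T R) n (Z : {RV P >-> borel_rV R n}),
  log_concave Z -> isotropic Z -> forall s (J : {set 'I_n}), (0 < s)%N ->
  Ex P (fun w => mass J (fun j => Z w 0 j) ^+ s) <= (C * (#|J|%:R + s%:R ^+ 2)) ^+ s.
Proof.
(* Large enough for the quadratic side of [hD] to dominate the linear one. *)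
pose D := (Num.truncn (4 ^+ 23 : R)).+1.
have D1 : 4 ^+ 23 <= D%:R :> R by apply/ltW; exact: truncnS_gt.
have D8 : 4 ^+ 22 * 4 <= D%:R :> R by rewrite -exprSr.
have q1 : 1 <= 4 ^+ 21 :> R by rewrite exprn_ege1//; lra.
have D4 : 16 <= D%:R :> R.
  by apply: le_trans D1; rewrite (_ : 23%N = (2 + 21)%N)// exprD !exprS expr0; move: (4 ^+ 21) q1 => y; lra.
have D3 : (3 <= D)%N by rewrite -(ler_nat R); apply: le_trans D4; lra.
have hD : 4 ^+ 19 * (8 * (D%:R + 3)) <= (D%:R - 1) ^+ 2 :> R.
  have e22 : 4 ^+ 22 = 64 * 4 ^+ 19 :> R by rewrite (_ : 22%N = (3 + 19)%N)// exprD !exprS expr0; lra.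
  have : 0 <= 4 ^+ 19 :> R by rewrite exprn_ge0.
  by move: D8; rewrite e22; move: (4 ^+ 19) (D%:R : R) D4 => y z z16 h y0; nra.
exists ((4 ^+ 70 * D%:R ^+ 2) ^+ 2 + (D%:R + 1) ^+ 2).
  have : 0 <= (4 ^+ 70 * D%:R ^+ 2) ^+ 2 :> R by rewrite exprn_ge0// mulr_ge0 ?exprn_ge0.
  by move: ((4 ^+ 70 * D%:R ^+ 2) ^+ 2 : R) => y h; nra.
by move=> d T P n Z HL HI s J s0; exact: paouris_aux.
Qed.

Lemma sum_powR_le (R : realType) (I : finType) (Q : pred I) (v : I -> R) (th : R) : 1 <= th ->
  (forall i, 0 <= v i) -> \sum_(i | Q i) v i `^ th <= (\sum_(i | Q i) v i) `^ th.
Proof.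
move=> th1 v0; set S := \sum_(i | Q i) v i.
have S0 : 0 <= S by apply: sumr_ge0.
have split x : 0 <= x -> x `^ th = x * x `^ (th - 1).
  move=> x0; have [->|xn] := eqVneq x 0; first by rewrite mul0r powR0// gt_eqF//; lra.
  by rewrite -{2}[x]powRr1// -powRD ?xn ?implybT// addrC subrK.
rewrite split// mulr_suml; apply: ler_sum => i Qi; rewrite split// ler_wpM2l//.
by apply: ler_powRl => //; [lra|rewrite /S (bigD1 i)//= lerDl sumr_ge0].
Qed.

Lemma powR_le_nat (R : realType) (p x : R) (k : nat) : 0 <= p -> p <= k%:R -> 0 <= x ->
  x `^ p <= 1 + x ^+ k.
Proof.
move=> p0 pk x0; have [x1|x1] := leP 1 x.
  apply: (@le_trans _ _ (x `^ k%:R)); first exact: ler_powR.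
  by rewrite powR_mulrn// lerDr.
apply: (@le_trans _ _ 1); last by rewrite lerDl exprn_ge0.
by rewrite -(powR_1l p); apply: ler_powRl => //; exact: ltW.
Qed.

(** * Tails of row norms *)

Section greedy.
Context {R : realType} {d : measure_display} {T : measurableType d}.
Variable P : probability T R.
Notation Ex := (Ex P).
Notation pr := (pr P).
Variables (n : nat) (Z : {RV P >-> borel_rV R n}).
Hypothesis HL : log_concave Z.
Hypothesis HI : isotropic Z.
Variable C : R.
Hypotheses (C1 : 1 <= C) (HP : forall s (J : {set 'I_n}), (0 < s)%N ->
  Ex (fun w => mass J (fun j => Z w 0 j) ^+ s) <= (C * (#|J|%:R + s%:R ^+ 2)) ^+ s).
Notation Y j := (ell Z (unitv j)).
Notation event := (event Z).

Lemma pow_split (W b : R) s : (0 < s)%N -> 0 <= W -> 0 < b -> W <= b + b * (W / b) ^+ s.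
Proof.
move=> s0 W0 b0; have [Wb|bW] := leP W b.
  by apply: le_trans Wb _; rewrite lerDl mulr_ge0 ?(ltW b0)// exprn_ge0// divr_ge0// ltW.
have h : 1 <= W / b by rewrite ler_pdivlMr// mul1r ltW.
have : W / b <= (W / b) ^+ s by apply: ler_eXnr.
move/(ler_wpM2l (ltW b0)); rewrite mulrCA divff ?gt_eqF// mulr1; lra.
Qed.

(* Above the level [4 * K], the moment of order [s] contributes at most [4 ^- s], which is below
   [pr (event A)]. *)
Lemma cond_trace A s (J : {set 'I_n}) : closed A -> (0 < s)%N -> expR (- s%:R) <= pr (event A) ->
  \sum_(j in J) Ex (fun w => \1_(event A) w * Y j w ^+ 2) <=
  8 * C * (#|J|%:R + s%:R ^+ 2) * pr (event A).
Proof.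
move=> cA s0 hA; have mA := meas_event Z cA.
pose W w := mass J (fun j => Z w 0 j).
have aW : allL P W by exact: (allL_W HL HI).
set K := C * (#|J|%:R + s%:R ^+ 2).
have sR : 1 <= s%:R :> R by rewrite ler1n.
have c1 := C1; have K0 : 0 < K by rewrite mulr_gt0//; [lra|rewrite ltr_wpDl// exprn_gt0//; lra].
have p0 := pr_ge0 P (event A).
have -> : \sum_(j in J) Ex (fun w => \1_(event A) w * Y j w ^+ 2) = Ex (fun w => \1_(event A) w * W w).
  rewrite big_mkcond (eq_bigr (fun j => Ex (fun w => (j \in J)%:R * (\1_(event A) w * Y j w ^+ 2)))); last first.
    move=> j _; rewrite ExZ; first by case: (j \in J); rewrite ?mul1r ?mul0r.
    by apply: allLM; [exact: allL_indic|apply: allLX; exact: allL_ell].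
  rewrite -Ex_sum; last first.
    by move=> j; apply: allLZ; apply: allLM; [exact: allL_indic|apply: allLX; exact: allL_ell].
  apply: (f_equal Ex); apply/funext => w; rewrite /W /mass [in RHS]big_mkcond mulr_sumr.
  by apply: eq_bigr => j _; rewrite ell_unit; case: (j \in J); rewrite ?mul1r ?mul0r ?mulr0.
pose b := 4 * K; have b0 : 0 < b by rewrite mulr_gt0.
have h1 : Ex (fun w => \1_(event A) w * W w) <= b * pr (event A) + b * (b ^- s * Ex (fun w => W w ^+ s)).
  have -> : b * pr (event A) + b * (b ^- s * Ex (fun w => W w ^+ s)) =
      Ex (fun w => b * \1_(event A) w + b * (b ^- s * W w ^+ s)).
    rewrite ExD; [|by apply: allLZ; exact: allL_indic|by apply: allLZ; apply: allLZ; exact: allLX].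
    rewrite (ExZ b (allL_indic P mA)) Ex_indic// (ExZ b (allLZ (b ^- s) (allLX s aW))).
    by rewrite (ExZ _ (allLX s aW)).
  apply: Ex_le => [||w].
  - by apply: allLM => //; exact: allL_indic.
  - by apply: allLD; [apply: allLZ; exact: allL_indic|apply: allLZ; apply: allLZ; exact: allLX].
  rewrite -exprVn -exprMn [b^-1 * _]mulrC.
  have W0 : 0 <= W w by exact: mass_ge0.
  rewrite indicE; case: (w \in _); first by rewrite mul1r mulr1; exact: pow_split.
  by rewrite mul0r mulr0 add0r mulr_ge0 ?(ltW b0)// exprn_ge0// divr_ge0// ltW.
apply: le_trans h1 _.
have h2 : b ^- s * Ex (fun w => W w ^+ s) <= pr (event A).
  apply: le_trans hA; rewrite ler_pdivrMl ?exprn_gt0//.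
  apply: le_trans (HP J s0) _; rewrite -/K.
  have -> : b ^+ s * expR (- s%:R) = (4 ^+ s * expR (- s%:R)) * K ^+ s by rewrite /b exprMn mulrAC.
  rewrite ler_peMl ?exprn_ge0 ?(ltW K0)//.
  rewrite expRN ler_pdivlMr ?expR_gt0// mul1r -[X in expR X](mulr1 s%:R) expRM_natl.
  by rewrite lerXn2r ?nnegrE ?expR_ge0//; exact: expR1_le4.
have := ler_wpM2l (ltW b0) h2; rewrite /b /K; lra.
Qed.

(** The maximum with 1 keeps the scale of every coordinate positive. *)
Definition cond_var A j : R := Num.max 1 (Ex (fun w => \1_(event A) w * Y j w ^+ 2) / pr (event A)).

Lemma cond_var_ge1 A j : 1 <= cond_var A j.
Proof. by rewrite /cond_var le_max lexx. Qed.

Variables (p : R) (a : 'I_n -> R) (amx : R).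
Hypotheses (p2 : 2 <= p) (ha : forall j, `|a j| <= amx).
Notation na := (\sum_j `|a j| `^ p).

Lemma amx_ge0 (j : 'I_n) : 0 <= amx. Proof. exact: le_trans (ha j). Qed.

(** On the set J of coordinates with conditional variance above [16 * C], [cond_trace] forces |J| <=
    s^2, hence a total variance of at most 16 C s^2; and a sum of powers is at most the power of the
    sum. *)
Lemma sum_cond_var A s : closed A -> (0 < s)%N -> expR (- s%:R) <= pr (event A) ->
  \sum_j `|a j| `^ p * cond_var A j `^ (p / 2) <=
  (16 * C) `^ (p / 2) * (na + s%:R `^ p * amx `^ p).
Proof.
move=> cA s0 hA; have pA : 0 < pr (event A) by exact: lt_le_trans (expR_gt0 _) hA.
have c1 := C1; have pp2 := p2; have C16 : 1 <= 16 * C by lra.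
have ph : 1 <= p / 2 by lra.
have sR : 1 <= s%:R :> R by rewrite ler1n.
pose J : {set 'I_n} := [set j | 16 * C < cond_var A j]%SET.
have cJ j : j \in J -> cond_var A j = Ex (fun w => \1_(event A) w * Y j w ^+ 2) / pr (event A).
  rewrite inE /cond_var; set e := _ / _; case: (leP e 1) => h //.
  by rewrite ltNge C16.
have SJ : \sum_(j in J) cond_var A j <= 8 * C * (#|J|%:R + s%:R ^+ 2).
  rewrite (eq_bigr (fun j => Ex (fun w => \1_(event A) w * Y j w ^+ 2) / pr (event A))); last by move=> j /cJ.
  by rewrite -mulr_suml ler_pdivrMr//; exact: cond_trace.
have cardJ : #|J|%:R <= s%:R ^+ 2 :> R.
  have : #|J|%:R * (16 * C) <= \sum_(j in J) cond_var A j.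
    by rewrite mulr_natl -sumr_const; apply: ler_sum => j; rewrite inE => /ltW.
  move=> h; have := le_trans h SJ; move: (#|J|%:R : R) (s%:R ^+ 2 : R) => x y.
  move=> hh; have C0 : 0 < 8 * C by lra.
  by rewrite -(ler_pM2l C0); lra.
have SJ2 : \sum_(j in J) cond_var A j <= 16 * C * s%:R ^+ 2.
  by apply: le_trans SJ _; move: (#|J|%:R : R) (s%:R ^+ 2 : R) cardJ => x y; nra.
rewrite (bigID [in J])/= mulrDr addrC; apply: lerD.
  rewrite mulr_sumr [leRHS](bigID (fun j => j \notin J))/=; apply: ler_wpDr.
    by apply: sumr_ge0 => j _; rewrite mulr_ge0// powR_ge0.
  apply: ler_sum => j; rewrite inE -leNgt => h; rewrite mulrC ler_wpM2r ?powR_ge0//.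
  by apply: ler_powRl => //; [lra|exact: le_trans (cond_var_ge1 A j)].
have [j0|nJ] := pickP [in J]; last first.
  by rewrite big_pred0 ?mulr_ge0 ?powR_ge0// => j; exact: nJ.
move=> j0J; have am0 : 0 <= amx := amx_ge0 j0.
apply: (@le_trans _ _ (amx `^ p * \sum_(j in J) cond_var A j `^ (p / 2))).
  rewrite mulr_sumr; apply: ler_sum => j _; rewrite ler_wpM2r ?powR_ge0//.
  by apply: ler_powRl => //; lra.
rewrite [leRHS]mulrA [leRHS]mulrC ler_wpM2l ?powR_ge0//.
apply: le_trans (sum_powR_le _ ph _) _ => [j|]; first exact: le_trans (cond_var_ge1 A j).
have S0 : 0 <= \sum_(j in J) cond_var A j.
  by apply: sumr_ge0 => j _; exact: le_trans (cond_var_ge1 A j).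
apply: le_trans (ler_powRl (_ : 0 <= p / 2) S0 SJ2) _; first by lra.
rewrite powRM; [|lra|by rewrite exprn_ge0//; lra].
rewrite ler_wpM2l ?powR_ge0// -powR_mulrn; last by lra.
by rewrite -powRrM; apply: eq_ler; congr (_ `^ _); field.
Qed.

Definition rowsum w : R := \sum_j `|a j * Z w 0 j| `^ p.

Lemma allL_rowsum : allL P rowsum.
Proof.
apply: allL_sum => j; apply: allL_powR; first by have := p2; lra.
rewrite (_ : (fun w => _) = (fun w => a j * Y j w)); first by apply: allLZ; exact: allL_ell.
by apply/funext => w; rewrite ell_unit.
Qed.

Definition kp : nat := (Num.truncn p).+1.

(** The first factor bounds the mean of [1 + f ^+ kp] for an [f] with the tails assumed in
    [greedy_step]; 20 = 4 * 5 is the scale of [f] in conditional standard deviations. *)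
Definition greedy_cst : R :=
  (1 + 5 * (2 * kp%:R) ^+ kp) * (20 `^ p) * (16 * C) `^ (p / 2).

(* Otherwise every coordinate has an exponential tail on [A] and [E] at the scale of its
   conditional standard deviation on [A], and the mean of [rowsum] on [A] and [E] is below [tau]. *)
Lemma greedy_step A s tau (E := [set w | tau <= rowsum w]) :
  closed A -> convexC A -> (0 < s)%N -> expR (- s%:R) <= pr (event A) ->
  0 < pr (event A `&` E) -> greedy_cst * (na + s%:R `^ p * amx `^ p) < tau ->
  exists A' l, [/\ closed A', convexC A', (4 <= l)%N,
    expR (- (l%:R / 4)) / 2 * pr (event A `&` E) <= pr (event A' `&` E) &
    expR l%:R * pr (event A') <= pr (event A)].
Proof.
move=> cA xA s0 hA pAE htau.
have mA := meas_event Z cA.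
have mE : measurable E by apply: meas_ge; case: allL_rowsum.
have mAE : measurable (event A `&` E) by exact: measurableI.
have pA : 0 < pr (event A) by exact: lt_le_trans (expR_gt0 _) hA.
have pp2 := p2; have c1 := C1.
pose b j := 5 * Num.sqrt (cond_var A j).
have cv0 j : 0 < cond_var A j by exact: lt_le_trans (cond_var_ge1 A j).
have b0 j : 0 < b j by rewrite mulr_gt0// sqrtr_gt0.
have b2 j : 17 * cond_var A j <= b j ^+ 2.
  rewrite exprMn sqr_sqrtr ?(ltW (cv0 j))//; move: (cond_var A j) (cv0 j) => v v0.
  by rewrite !exprS expr0; lra.
have btail j u : 1 <= u -> pr (event A `&` [set w | u * b j <= `|Y j w|]) <= pr (event A) * expR (- u).
  apply: (cond_tail HL HI cA xA (b0 j) (b2 j)).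
  by rewrite -ler_pdivrMr// /cond_var le_max lexx orbT.
have mY j c : measurable [set w | c <= `|Y j w|].
  by apply: meas_ge; apply: measurableT_comp => //; exact: meas_ell.
(* The rate 1/4 becomes 1 at the scale [4 * b j], so only multiples of 4 are tested. A level of at
   least 4 also makes [2 * expR (- (l / 4)) <= 1], which later absorbs the factor lost to the two
   half-spaces. *)
have [j [l [l4 hl]]] : exists j l, (4 <= l)%N /\
    expR (- (l%:R / 4)) * pr (event A `&` E) < pr ((event A `&` E) `&` [set w | l%:R * b j <= `|Y j w|]).
  apply: contrapT => hn.
  have tl j l : pr ((event A `&` E) `&` [set w | l%:R <= `|Y j w| / (4 * b j)]) <= pr (event A `&` E) * expR (- l%:R).
    have eqs : [set w | l%:R <= `|Y j w| / (4 * b j)] = [set w | (4 * l)%:R * b j <= `|Y j w|].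
      have e : (4 * l)%:R * b j = l%:R * (4 * b j) by rewrite natrM; ring.
      have p4 : 0 < 4 * b j by rewrite mulr_gt0.
      by apply/seteqP; split=> w /=; rewrite (ler_pdivlMr _ _ p4) e.
    rewrite eqs; case: l {eqs} => [|l].
      by rewrite oppr0 expR0 mulr1; apply: pr_le => //; exact: measurableI.
    rewrite leNgt; apply/negP => h; apply: hn; exists j, (4 * l.+1)%N.
    split; first by rewrite leq_pmulr.
    apply: (le_lt_trans _ h); apply: eq_ler; rewrite mulrC; congr (_ * expR (- _)).
    by rewrite natrM; field.
  have f0 j w : 0 <= `|Y j w| / (4 * b j) by rewrite divr_ge0// mulr_ge0// ltW.
  have hk j : Ex (fun w => \1_(event A `&` E) w * (`|Y j w| / (4 * b j)) ^+ kp) <=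
      5 * pr (event A `&` E) * (2 * kp%:R) ^+ kp.
    by have [] := tail_moment mAE (meas_scaled _ _ _) (f0 j) (tl j) kp.
  have pk : p <= kp%:R by apply/ltW; exact: truncnS_gt.
  have aI : allL P \1_(event A `&` E) by exact: allL_indic.
  have af j : allL P (fun w => `|Y j w| / (4 * b j)).
    by apply: allLM; [apply: allL_abs; exact: allL_ell|exact: allL_cst].
  have h1 : tau * pr (event A `&` E) <= Ex (fun w => \1_(event A `&` E) w * rowsum w).
    rewrite -Ex_indic// -ExZ//; apply: Ex_le => [||w].
    - exact: allLZ.
    - by apply: allLM => //; exact: allL_rowsum.
    rewrite mulrC indicE; case: (boolP (w \in _)) => [|_]; last by rewrite !mul0r.
    by rewrite inE => -[_ hE]; rewrite !mul1r.
  have h2 : Ex (fun w => \1_(event A `&` E) w * rowsum w) <=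
      \sum_j `|a j| `^ p * (4 * b j) `^ p * (pr (event A `&` E) * (1 + 5 * (2 * kp%:R) ^+ kp)).
    apply: (@le_trans _ _ (Ex (fun w => \sum_j `|a j| `^ p * (4 * b j) `^ p *
        (\1_(event A `&` E) w + \1_(event A `&` E) w * (`|Y j w| / (4 * b j)) ^+ kp)))).
      apply: Ex_le => [||w].
      - by apply: allLM => //; exact: allL_rowsum.
      - by apply: allL_sum => j; apply: allLZ; apply: allLD => //; apply: allLM => //; exact: allLX.
      rewrite mulr_sumr; apply: ler_sum => j _.
      rewrite -ell_unit normrM powRM//.
      have -> : `|Y j w| = 4 * b j * (`|Y j w| / (4 * b j)) by field; rewrite gt_eqF.
      set f := `|Y j w| / (4 * b j) in f0 *.
      have ff : 0 <= f by rewrite divr_ge0// mulr_ge0// ltW.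
      have fE : 4 * b j * f / (4 * b j) = f by field; rewrite gt_eqF.
      have hI : 0 <= \1_(event A `&` E) w :> R by rewrite indicE; case: (_ \in _).
      have hf : f `^ p <= 1 + f ^+ kp by apply: powR_le_nat => //; lra.
      have b4 : 0 <= 4 * b j by rewrite mulr_ge0// ltW.
      rewrite fE powRM//.
      have := powR_ge0 (4 * b j) p; have := powR_ge0 `|a j| p.
      move: (\1_ _ w) hI (f `^ p) (f ^+ kp) hf (`|a j| `^ p) ((4 * b j) `^ p) => I I0 F G FG A0 B0 a0' b0'.
      have -> : I * (A0 * (B0 * F)) = I * (A0 * B0) * F by ring.
      have -> : A0 * B0 * (I + I * G) = I * (A0 * B0) * (1 + G) by ring.
      by rewrite ler_wpM2l ?mulr_ge0.
    rewrite Ex_sum; last by move=> j; apply: allLZ; apply: allLD => //; apply: allLM => //; exact: allLX.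
    apply: ler_sum => j _; rewrite ExZ; last by apply: allLD => //; apply: allLM => //; exact: allLX.
    rewrite ler_wpM2l ?mulr_ge0 ?powR_ge0// ExD//; last by apply: allLM => //; exact: allLX.
    by rewrite Ex_indic// mulrDr mulr1 lerD2l; apply: le_trans (hk j) _; apply: eq_ler; ring.
  have bE j : (4 * b j) `^ p = 20 `^ p * cond_var A j `^ (p / 2).
    have -> : 4 * b j = 20 * Num.sqrt (cond_var A j) by rewrite /b; ring.
    rewrite powRM ?sqrtr_ge0//; congr (_ * _).
    by rewrite -powR12_sqrt ?(ltW (cv0 j))// -powRrM; congr (_ `^ _); field.
  have h3 : \sum_j `|a j| `^ p * (4 * b j) `^ p * (pr (event A `&` E) * (1 + 5 * (2 * kp%:R) ^+ kp)) =
      pr (event A `&` E) * (((1 + 5 * (2 * kp%:R) ^+ kp) * 20 `^ p) * \sum_j `|a j| `^ p * cond_var A j `^ (p / 2)).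
    by rewrite !mulr_sumr; apply: eq_bigr => j _; rewrite bE; ring.
  have := le_trans h1 h2; rewrite h3 mulrC ler_pM2l// leNgt => /negP; apply.
  apply: le_lt_trans htau; rewrite /greedy_cst -[leRHS]mulrA ler_wpM2l//.
  exact: sum_cond_var.
have lR : 1 <= l%:R :> R by rewrite ler1n; exact: leq_trans l4.
(* The set where |Y_j| is large is not convex; one of its two half-spaces keeps at least half of the
   mass. *)
pose H1 := A `&` [set x | l%:R * b j <= lf (unitv j) x].
pose H2 := A `&` [set x | lf (unitv j) x <= - (l%:R * b j)].
have cH1 : closed H1 by apply: closedI => //; apply/closed_ge/cont_lf.
have cH2 : closed H2 by apply: closedI => //; apply/closed_le/cont_lf.
have xH1 : convexC H1.
  move=> x y th t01 [Ax /= hx] [Ay /= hy]; split; first exact: xA.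
  by rewrite /= lfD !lfZ; case/andP: t01 => t0 t1; nra.
have xH2 : convexC H2.
  move=> x y th t01 [Ax /= hx] [Ay /= hy]; split; first exact: xA.
  by rewrite /= lfD !lfZ; case/andP: t01 => t0 t1; nra.
have bl0 : 0 <= l%:R * b j by rewrite mulr_ge0// ltW.
have sub H : closed H -> event H `<=` event A `&` [set w | l%:R * b j <= `|Y j w|] ->
    expR l%:R * pr (event H) <= pr (event A).
  move=> cH hsub; rewrite -ler_pdivlMl ?expR_gt0// mulrC -expRN; apply: le_trans (btail j _ lR).
  by apply: pr_le => //; [exact: meas_event|exact: measurableI].
have s1 : event H1 `<=` event A `&` [set w | l%:R * b j <= `|Y j w|].
  by move=> w [Aw /= h]; split=> //=; apply: le_trans h (ler_norm _).
have s2 : event H2 `<=` event A `&` [set w | l%:R * b j <= `|Y j w|].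
  move=> w [Aw /= h]; split=> //=; rewrite -normrN; apply: le_trans (ler_norm _).
  by rewrite lerNr.
have mH1 := meas_event Z cH1; have mH2 := meas_event Z cH2.
have cov : pr ((event A `&` E) `&` [set w | l%:R * b j <= `|Y j w|]) <=
    pr (event H1 `&` E) + pr (event H2 `&` E).
  apply: le_trans (prU_le _ (measurableI _ _ mH1 mE) (measurableI _ _ mH2 mE)).
  apply: pr_le; [exact: measurableI|by apply: measurableU; exact: measurableI|].
  move=> w [[Aw Ew] /= h]; case: (leP 0 (Y j w)) => y0.
    by left; split=> //; split=> //=; rewrite ger0_norm in h.
  by right; split=> //; split=> //=; rewrite ltr0_norm// in h; rewrite lerNr.
have big : expR (- (l%:R / 4)) * pr (event A `&` E) < pr (event H1 `&` E) + pr (event H2 `&` E).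
  exact: lt_le_trans hl cov.
have [h|h] := leP (expR (- (l%:R / 4)) / 2 * pr (event A `&` E)) (pr (event H1 `&` E)).
  by exists H1, l; split=> //; exact: sub.
exists H2, l; split=> //; last exact: sub.
move: big h; rewrite mulrAC.
by move: (expR _ * pr _) (pr (event H1 `&` E)) (pr (event H2 `&` E)) => x y z; lra.
Qed.

(* In [L] units of restriction the mass of [A] shrinks by [expR (- L)] but that of its part in [E]
   only by [expR (- L / 2)], which is impossible once [L] exceeds [2 * r]. *)
Lemma row_tail r tau : (0 < r)%N -> greedy_cst * (na + (2 * r)%:R `^ p * amx `^ p) < tau ->
  pr [set w | tau <= rowsum w] <= expR (- r%:R).
Proof.
move=> r0 htau; set E := [set w | _]; rewrite leNgt; apply/negP => hE.
have mE : measurable E by apply: meas_ge; case: allL_rowsum.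
have e0 := expR_gt0 (- r%:R : R); have pE : 0 < pr E by exact: lt_trans hE.
have key N : exists A L, [/\ closed A, convexC A, (N <= L)%N,
    expR (- (L%:R / 2)) * pr E <= pr (event A `&` E) &
    expR (L%:R / 2) * pr E * pr (event A) <= pr (event A `&` E)].
  elim: N => [|N [A [L [cA xA NL h1 h2]]]].
    exists setT, 0%N; split; rewrite ?mul0r ?oppr0 ?expR0 ?mul1r ?eventT ?setTI ?prT ?mulr1//.
  have mA := meas_event Z cA.
  have pAE : 0 < pr (event A `&` E) by apply: lt_le_trans h1; rewrite mulr_gt0 ?expR_gt0.
  have AEle : pr (event A `&` E) <= pr (event A).
    by apply: pr_le => //; exact: measurableI.
  have pA : 0 < pr (event A) by exact: lt_le_trans AEle.
  (* The second invariant keeps [L] at most [2 * r], so the mass of [A] stays above exp(-2 r), as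
     [greedy_step] requires with [s = 2 * r]. *)
  have L2 : L%:R <= (2 * r)%:R :> R.
    have : expR (L%:R / 2) * pr E <= 1.
      by rewrite -(ler_pM2r pA) mul1r; exact: le_trans AEle.
    move=> h; have h' : expR (L%:R / 2) * expR (- r%:R) <= 1 :> R.
      by apply: (le_trans _ h); rewrite ler_wpM2l ?expR_ge0// ltW.
    by move: h'; rewrite -expRD -[leRHS]expR0 ler_expR natrM; lra.
  have hA : expR (- (2 * r)%:R) <= pr (event A).
    apply: le_trans AEle; apply: le_trans h1.
    apply: (@le_trans _ _ (expR (- (L%:R / 2)) * expR (- r%:R))); last first.
      by rewrite ler_wpM2l ?expR_ge0// ltW.
    by rewrite -expRD ler_expR; move: L2; rewrite natrM; lra.
  have r2 : (0 < 2 * r)%N by rewrite muln_gt0.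
  have [A' [l [cA' xA' l4 g1 g2]]] := greedy_step cA xA r2 hA pAE htau.
  have l4R : 4 <= l%:R :> R by rewrite (ler_nat R 4).
  have two : 2 * expR (- (l%:R / 4)) <= 1 :> R.
    have : 2 <= expR (l%:R / 4) :> R by apply: le_trans (expR_ge1Dx _); lra.
    have : expR (l%:R / 4) * expR (- (l%:R / 4)) = 1 :> R by rewrite -expRD subrr expR0.
    by have := expR_gt0 (- (l%:R / 4) : R); nra.
  exists A', (L + l)%N; split=> //.
  - by apply: leq_trans (_ : N + 1 <= _)%N; [rewrite addn1|apply: leq_add => //; exact: leq_trans l4].
  - apply: le_trans g1; apply: le_trans (_ : expR (- (l%:R / 4)) / 2 * (expR (- (L%:R / 2)) * pr E) <= _); last first.
      by rewrite ler_wpM2l// divr_ge0// expR_ge0.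
    have -> : - ((L + l)%:R / 2) = - (l%:R / 4) + (- (l%:R / 4)) - L%:R / 2 :> R by rewrite natrD; field.
    rewrite !expRD -!mulrA ler_wpM2l ?expR_ge0//.
    have : 0 <= expR (- (L%:R / 2)) * pr E by rewrite mulr_ge0 ?expR_ge0// ltW.
    by move: (_ * pr E) (expR (- (l%:R / 4))) two => x y; nra.
  apply: le_trans g1; apply: (@le_trans _ _ (expR (- (l%:R / 4)) / 2 * (expR (L%:R / 2) * pr E * pr (event A)))); last first.
    by rewrite ler_wpM2l// divr_ge0// expR_ge0.
  have eq1 : (L + l)%:R / 2 = L%:R / 2 + (l%:R - l%:R / 4 - l%:R / 4) :> R by rewrite natrD; field.
  apply: (@le_trans _ _ (expR (- (l%:R / 4)) / 2 * (expR (L%:R / 2) * pr E * (expR l%:R * pr (event A'))))); last first.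
    by rewrite ler_wpM2l ?divr_ge0 ?expR_ge0// ler_wpM2l// mulr_ge0 ?expR_ge0// ltW.
  rewrite eq1 !expRD.
  have : 0 <= expR (L%:R / 2) * pr E * (expR l%:R * pr (event A')) * expR (- (l%:R / 4)).
    by rewrite !mulr_ge0 ?expR_ge0 ?pr_ge0// ltW.
  move: (expR (L%:R / 2)) (pr E) (expR l%:R) (pr (event A')) (expR (- (l%:R / 4))) two => x1 x2 x3 x4 y hy h.
  have -> : x1 * (x3 * y * y) * x2 * x4 = (x1 * x2 * (x3 * x4) * y) * y by ring.
  have -> : y / 2 * (x1 * x2 * (x3 * x4)) = (x1 * x2 * (x3 * x4) * y) * 2^-1 by ring.
  by rewrite ler_wpM2l//; lra.
have [A [L [cA xA NL h1 h2]]] := key (2 * r).+1.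
have mA := meas_event Z cA.
have pAE : 0 < pr (event A `&` E) by apply: lt_le_trans h1; rewrite mulr_gt0 ?expR_gt0.
have AEle : pr (event A `&` E) <= pr (event A).
  by apply: pr_le => //; exact: measurableI.
have pA : 0 < pr (event A) by exact: lt_le_trans AEle.
have h3 : expR (L%:R / 2) * expR (- r%:R) <= 1 :> R.
  apply: (@le_trans _ _ (expR (L%:R / 2) * pr E)); first by rewrite ler_wpM2l ?expR_ge0// ltW.
  by rewrite -(ler_pM2r pA) mul1r; exact: le_trans AEle.
move: h3; rewrite -expRD -[leRHS]expR0 ler_expR.
have : (2 * r).+1%:R <= L%:R :> R by rewrite ler_nat.
by rewrite -natr1 natrM; lra.
Qed.

End greedy.

Lemma meas_bigmax (R : realType) d (T : measurableType d) (I : Type) (r : seq I) (f : I -> T -> R) :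
  (forall i, measurable_fun [set: T] (f i)) ->
  measurable_fun [set: T] (fun w => \big[Num.max/0]_(i <- r) f i w).
Proof.
move=> mf; elim: r => [|i r IH].
  by under eq_fun do rewrite big_nil; exact: measurable_cst.
by under eq_fun do rewrite big_cons; exact: measurable_maxr.
Qed.

(** * Symmetrization *)

Section rows_law.
Context {R : realType}.
Variables (n m : nat).
Notation rV := (borel_rV R n).
Notation D := (bool * 'I_m)%type.

(* The sigma-algebra on the [2 * m] rows is generated by rectangles, a pi-system on which laws
   can be compared. *)
Definition rects : set (set (D -> rV)) := [set S | exists B : D -> set rV,
  (forall i, measurable (B i)) /\ S = [set y | forall i, B i (y i)]].

Definition rows := g_sigma_algebraType rects.
HB.instance Definition _ := Measurable.on rows.

Lemma rectsT : rects setT.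
Proof. by exists (fun=> setT); split=> //; apply/seteqP; split. Qed.

Lemma rectsI : setI_closed rects.
Proof.
move=> _ _ [B [mB ->]] [B' [mB' ->]]; exists (fun i => B i `&` B' i); split.
  by move=> i; exact: measurableI.
by apply/seteqP; split=> [y [h h'] i|y h]; [split|split=> i; case: (h i)].
Qed.

Lemma meas_row_coord (i : D) (j : 'I_n) : measurable_fun [set: rows] (fun y : rows => (y i : 'rV[R]_n) 0 j : R).
Proof.
apply: (measurability (@RGenCInfty.G R)) => [|/= _ [_] [r] -> <-].
  exact: RGenCInfty.measurableE.
rewrite setTI; apply: sub_sigma_algebra.
exists (fun k => if k == i then [set x : 'rV[R]_n | r <= x 0 j] else setT); split.
  move=> k; case: ifP => // _.
  rewrite -[X in measurable X]setCK; apply: measurableC; apply: sub_sigma_algebra.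
  by apply: closed_openC; apply: closed_ge; exact: coord_continuous.
apply/seteqP; split=> y /=.
  by rewrite in_itv/= andbT => h k; case: eqP => // ->.
by move/(_ i); rewrite eqxx /= in_itv/= andbT.
Qed.

Context {d : measure_display} {T : measurableType d}.
Variable P : probability T R.
Variable Y : 'I_m -> {RV P >-> rV}.

(* The two samples of row [i] are exchanged when [s i] holds. *)
Definition mix (s : {ffun 'I_m -> bool}) (z : T * T) : rows :=
  fun i => Y i.2 (if i.1 (+) s i.2 then z.2 else z.1).

Lemma mix_rect s (B : D -> set rV) : mix s @^-1` [set y | forall i, B i (y i)] =
  (\bigcap_(i in [set` [set: 'I_m]%SET]) (Y i @^-1` B (s i, i))) `*`
  (\bigcap_(i in [set` [set: 'I_m]%SET]) (Y i @^-1` B (~~ s i, i))).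
Proof.
apply/seteqP; split=> -[w w'].
  rewrite /mix /= => h; split=> /= i _ /=.
    by have := h (s i, i); rewrite /= addbb.
  by have := h (~~ s i, i); rewrite /= addNb addbb.
move=> [/= h h'] [b i]; rewrite /mix /=.
have iT : [set` [set: 'I_m]%SET] i by rewrite /= inE.
have hi := h i iT; have hi' := h' i iT.
by move: hi hi' => /=; case: b; case: (s i).
Qed.

Lemma meas_inter (B : 'I_m -> set rV) : (forall i, measurable (B i)) ->
  measurable (\bigcap_(i in [set` [set: 'I_m]%SET]) (Y i @^-1` B i)).
Proof.
move=> mB; apply: fin_bigcap_measurable => // i _.
by rewrite -[X in measurable X]setTI; exact: measurable_funPT.
Qed.

Lemma meas_mix s : measurable_fun [set: T * T] (mix s).
Proof.
apply: (@measurability _ _ (T * T)%type rows _ _ rects) => // _ [_ [B [mB ->]] <-].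
by rewrite setTI mix_rect; apply: measurableX; exact: meas_inter.
Qed.

Hypothesis ind : independent Y.

(** On a rectangle both laws equal the product over the rows of the masses for the two copies, and
    each factor is symmetric under the exchange of the copies. *)
Lemma mix_law s (f : rows -> R) : measurable_fun [set: rows] f -> (forall y, 0 <= f y) ->
  (\int[P \x P]_z (f (mix s z))%:E = \int[P \x P]_z (f (mix [ffun=> false] z))%:E)%E.
Proof.
move=> mf f0.
have mf' : measurable_fun [set: rows] (EFin \o f) by exact/measurable_EFinP.
have f0' : {in [set: rows], forall y, (0 <= (EFin \o f) y)%E} by move=> y _; rewrite lee_fin.
have := ge0_integral_pushforward (meas_mix s) (P \x P)%E measurableT mf' f0'.
have := ge0_integral_pushforward (meas_mix [ffun=> false]) (P \x P)%E measurableT mf' f0'.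
move=> e1 e2; apply: etrans (esym e2) _; apply: etrans _ e1.
pose m1 : {measure set rows -> \bar R} := distribution (P \x P)%E (mfun_Sub (mem_set (meas_mix s))).
pose m2 : {measure set rows -> \bar R} := distribution (P \x P)%E (mfun_Sub (mem_set (meas_mix [ffun=> false]))).
have pp s' (B : D -> set rV) : (forall i, measurable (B i)) ->
    (P \x P)%E (mix s' @^-1` [set y | forall i, B i (y i)]) =
    (\prod_(i in [set: 'I_m]%SET) (P (Y i @^-1` B (false, i)) * P (Y i @^-1` B (true, i))))%E.
  move=> mB; rewrite mix_rect product_measure1E; [|exact: meas_inter|exact: meas_inter].
  have i1 := ind [set: 'I_m]%SET (B := fun i => B (s' i, i)) (fun i => mB _).
  have i2 := ind [set: 'I_m]%SET (B := fun i => B (~~ s' i, i)) (fun i => mB _).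
  apply: etrans (congr2 (fun u v => u * v)%E i1 i2) _.
  rewrite -big_split/=; apply: eq_bigr => i _.
  by case: (s' i) => //=; rewrite muleC.
apply: (@eq_measure_integral _ rows R setT m2 m1) => A mA _.
apply: (@g_sigma_algebra_measure_unique _ R rows rects _ (fun=> setT) _ _ m1 m2) => //.
- by move=> B; exact: sub_sigma_algebra.
- by move=> _; exact: rectsT.
- by rewrite bigcup_const.
- exact: rectsI.
- by move=> _ [B [mB ->]]; rewrite /m1 /m2 /distribution /pushforward/= !pp.
- by move=> _; rewrite -ge0_fin_numE ?measure_ge0//; exact: fin_num_measure.
Qed.

End rows_law.

(** * Excess of one sample over the exchanged one *)

Section gain.
Context {R : realType}.
Variables (p p' q : R) (m : nat) (J K : finType) (t : K -> J -> R).
Hypotheses (p2 : 2 <= p) (pp' : p^-1 + p'^-1 = 1) (q2 : 2 <= q) (m2 : (2 <= m)%N).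
Hypothesis t1 : forall k, nrm p' (t k) <= 1.

Definition gain_cst : R := 6 * (2 `^ q * 2 `^ q).

(** Subtracting the exchanged sample makes the supremum over [t] controllable on average over the
    exchanges, by [swap_finite_unit]. *)
Definition gain (x : bool * 'I_m -> J -> R) s : R :=
  \big[Num.max/0]_k (power_sum q x s (t k) - gain_cst * power_sum q x (flip s) (t k)).

Lemma power_sum_ge0 (x : bool * 'I_m -> J -> R) s u : 0 <= power_sum q x s u.
Proof. by apply: sumr_ge0 => i _; exact: powR_ge0. Qed.

Lemma gain_ge0 x s : 0 <= gain x s.
Proof. exact: bigmax_ge_id. Qed.

Lemma gain_cst_ge0 : 0 <= gain_cst.
Proof. by rewrite !mulr_ge0 ?powR_ge0. Qed.

Lemma gain_le x s : gain x s <= \sum_k power_sum q x s (t k).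
Proof.
apply: bigmax_le => [|k _]; first by apply: sumr_ge0 => k _; exact: power_sum_ge0.
rewrite (bigD1 k)//=; apply: (@le_trans _ _ (power_sum q x s (t k))).
  by rewrite gerBl mulr_ge0 ?gain_cst_ge0 ?power_sum_ge0.
by rewrite lerDl sumr_ge0// => i _; exact: power_sum_ge0.
Qed.

Lemma power_sumZ (c : R) (x : bool * 'I_m -> J -> R) s u : 0 <= c ->
  power_sum q (fun i j => c * x i j) s u = c `^ q * power_sum q x s u.
Proof.
move=> c0; rewrite /power_sum mulr_sumr; apply: eq_bigr => i _.
by rewrite dotZl normrM ger0_norm// powRM.
Qed.

Lemma gain_sum_le x kap : (forall i, nrm p (x i) <= kap) ->
  \sum_s gain x s <= kap `^ q * (2 ^+ m * (swap_cst q p * ln m%:R)).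
Proof.
move=> xk; have qq := q2; have pp2 := p2.
have p0 : 0 < p by lra.
have i0 : 'I_m by exists 0%N; exact: leq_trans m2.
have k0 : 0 <= kap := le_trans (nrm_ge0 _ _) (xk (true, i0)).
move: k0; rewrite le_eqVlt => /predU1P[k00|k0].
  have x0 i j : x i j = 0.
    by apply: (nrm_eq0 p0); apply/eqP; rewrite eq_le nrm_ge0 andbT k00.
  have ps s u : power_sum q x s u = 0.
    rewrite /power_sum big1// => i _; rewrite /dot big1 => [|j _]; last by rewrite x0 mul0r.
    by rewrite normr0 powR0// gt_eqF//; lra.
  rewrite -k00 powR0; last by rewrite gt_eqF//; lra.
  rewrite mul0r big1// => s _; apply/eqP; rewrite eq_le gain_ge0 andbT.
  by apply: bigmax_le => // k _; rewrite !ps mulr0 subrr.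
have [//|B [B0 hB sB]] := @swap_finite_unit R q q2 p p' m J (fun i j => kap^-1 * x i j) p2 pp' m2 _.
  by move=> i; rewrite (nrmZ p2) gtr0_norm ?invr_gt0// ler_pdivrMl// mulr1.
apply: le_trans (_ : \sum_s kap `^ q * B s <= _); last first.
  by rewrite -mulr_sumr ler_wpM2l ?powR_ge0.
apply: ler_sum => s _; apply: bigmax_le => [|k _]; first by rewrite mulr_ge0 ?powR_ge0.
have := hB s (t k) (t1 k); rewrite !power_sumZ ?invr_ge0 ?(ltW k0)// => h.
have kk : kap `^ q * kap^-1 `^ q = 1 by rewrite -powRM ?invr_ge0 ?(ltW k0)// mulfV ?gt_eqF// powR1.
have := ler_wpM2l (powR_ge0 kap q) h; rewrite mulrDr [X in X <= _]mulrA kk mul1r => {}h.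
rewrite lerBlDl; apply: le_trans h _; rewrite lerD2r /gain_cst.
move: kk; move: (kap `^ q) (kap^-1 `^ q) (6 * _) (power_sum _ _ _ _) => a b c e ab.
have -> : a * (c * (b * e)) = a * b * (c * e) by ring.
by rewrite ab mul1r.
Qed.

End gain.

(** * Expectations over two independent samples *)

Section product_expectation.
Context {R : realType} {d : measure_display} {T : measurableType d}.
Variable P : probability T R.
Local Notation P2 := (P \x P)%E.

Lemma int_fst (f : T -> R) : measurable_fun [set: T] f -> (forall w, 0 <= f w) ->
  (\int[P2]_z (f z.1)%:E = \int[P]_w (f w)%:E)%E.
Proof.
move=> mf f0; rewrite fubini_tonelli1; last 2 first.
- by apply/measurable_EFinP; exact: (measurableT_comp mf).
- by move=> z; rewrite lee_fin.
apply: eq_integral => w _; rewrite /fubini_F /= integral_cst//=.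
by rewrite probability_setT mule1.
Qed.

Lemma int_snd (f : T -> R) : measurable_fun [set: T] f -> (forall w, 0 <= f w) ->
  (\int[P2]_z (f z.2)%:E = \int[P]_w (f w)%:E)%E.
Proof.
move=> mf f0; rewrite fubini_tonelli2; last 2 first.
- by apply/measurable_EFinP; exact: (measurableT_comp mf).
- by move=> z; rewrite lee_fin.
apply: eq_integral => w _; rewrite /fubini_G /= integral_cst//=.
by rewrite probability_setT mule1.
Qed.

Lemma allL_fst f : allL P f -> allL P2 (fun z => f z.1).
Proof.
move=> [mf hf]; split=> [|k]; first exact: (measurableT_comp mf).
apply/integrableP; split.
  by apply/measurable_EFinP; apply: (measurableT_comp (meas_absX k mf)).
have /integrableP[_] := hf k.
under eq_integral do rewrite gee0_abs ?lee_fin ?exprn_ge0//.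
under [X in _ -> (X < _)%E]eq_integral do rewrite gee0_abs ?lee_fin ?exprn_ge0//.
by rewrite (int_fst (meas_absX k mf))// => w; rewrite exprn_ge0.
Qed.

Lemma allL_snd f : allL P f -> allL P2 (fun z => f z.2).
Proof.
move=> [mf hf]; split=> [|k]; first exact: (measurableT_comp mf).
apply/integrableP; split.
  by apply/measurable_EFinP; apply: (measurableT_comp (meas_absX k mf)).
have /integrableP[_] := hf k.
under eq_integral do rewrite gee0_abs ?lee_fin ?exprn_ge0//.
under [X in _ -> (X < _)%E]eq_integral do rewrite gee0_abs ?lee_fin ?exprn_ge0//.
by rewrite (int_snd (meas_absX k mf))// => w; rewrite exprn_ge0.
Qed.

Lemma Ex_fst f : allL P f -> (forall w, 0 <= f w) -> Ex P2 (fun z => f z.1) = Ex P f.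
Proof.
move=> hf f0; apply/EFin_inj; rewrite !ExE; [|exact: allL_int|exact/allL_int/allL_fst].
by apply: int_fst => //; case: hf.
Qed.

Lemma Ex_snd f : allL P f -> (forall w, 0 <= f w) -> Ex P2 (fun z => f z.2) = Ex P f.
Proof.
move=> hf f0; apply/EFin_inj; rewrite !ExE; [|exact: allL_int|exact/allL_int/allL_snd].
by apply: int_snd => //; case: hf.
Qed.

Lemma Ex_prod_ge (f : T -> R) (g : T * T -> R) (c : R) : allL P f -> allL P2 g ->
  (forall z, 0 <= g z) -> (forall w, 0 <= f w) -> 0 <= c ->
  (forall w, ((f w)%:E <= \int[P]_w' (g (w, w'))%:E + c%:E)%E) -> Ex P f <= Ex P2 g + c.
Proof.
move=> hf hg g0 f0 c0 h.
rewrite -lee_fin EFinD !ExE; [|exact: allL_int|exact: allL_int].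
have mg : measurable_fun [set: T * T] (EFin \o g) by apply/measurable_EFinP; case: hg.
rewrite fubini_tonelli1//.
have mF : measurable_fun [set: T] (fubini_F P (EFin \o g)).
  by apply: measurable_fun_fubini_tonelli_F => // z; rewrite /= lee_fin.
have -> : c%:E = (\int[P]_w c%:E)%E by rewrite integral_cst//= probability_setT mule1.
have F0 w : (0 <= fubini_F P (EFin \o g) w)%E by apply: integral_ge0 => w' _; rewrite lee_fin.
rewrite -ge0_integralD//.
apply: ge0_le_integral => //.
- by move=> w _; rewrite lee_fin.
- by apply/measurable_EFinP; case: hf.
- by apply: emeasurable_funD.
Qed.

Lemma allL_bigmax (K : finType) (f : K -> T -> R) : (forall k, allL P (f k)) ->
  allL P (fun w => \big[Num.max/0]_k f k w).
Proof.
move=> hf; apply: (allL_dom _ _ (allL_sum (fun k => allL_abs (hf k)))).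
  by apply: meas_bigmax => k; case: (hf k).
move=> w; rewrite ger0_norm; last exact: bigmax_ge_id.
apply: bigmax_le => [|k _]; first exact: sumr_ge0.
by rewrite (bigD1 k)//=; apply: le_trans (ler_norm _) _; rewrite lerDl sumr_ge0.
Qed.

End product_expectation.

Section symmetrization.
Context {R : realType} {d : measure_display} {T : measurableType d}.
Variable P : probability T R.
Local Notation P2 := (P \x P)%E.
Variables (n m : nat) (Y : 'I_m -> {RV P >-> borel_rV R n}) (a : 'I_m -> 'I_n -> R).
Variables (p p' q : R) (K : finType) (t : K -> 'I_n -> R).
Hypotheses (p2 : 2 <= p) (pp' : p^-1 + p'^-1 = 1) (q2 : 2 <= q) (m2 : (2 <= m)%N).
Hypothesis t1 : forall k, nrm p' (t k) <= 1.
Hypothesis ind : independent Y.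
Hypothesis hY : forall i j, allL P (fun w => Y i w 0 j).

Definition wrow i w j : R := a i j * Y i w 0 j.

Definition row_sum u w : R := \sum_i `|dot (wrow i w) u| `^ q.

Definition kappa w : R := \big[Num.max/0]_i nrm p (wrow i w).

Let q0 : 0 <= q. Proof. by apply: le_trans q2. Qed.

Lemma allL_dot_wrow i u : allL P (fun w => dot (wrow i w) u).
Proof.
apply: allL_sum => j; apply: allLM; last exact: allL_cst.
by apply: allLZ; exact: hY.
Qed.

Lemma allL_row_sum u : allL P (row_sum u).
Proof. by apply: allL_sum => i; apply: allL_powR => //; exact: allL_dot_wrow. Qed.

Lemma allL_nrm_wrow i : allL P (fun w => nrm p (wrow i w)).
Proof.
apply: (allL_dom _ _ (allL_sum (fun j => allL_abs (allLZ (a i j) (hY i j))))).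
  rewrite (_ : (fun w => _) = (fun w => (\sum_j `|wrow i w j| `^ p) `^ p^-1)); last first.
    by apply/funext => w; rewrite nrmE.
  apply: (measurableT_comp (measurable_powR _)).
  have p0 : 0 <= p by apply: le_trans p2.
  suff : allL P (fun w => \sum_j `|wrow i w j| `^ p) by case.
  by apply: allL_sum => j; apply: allL_powR => //; apply: allLZ; exact: hY.
move=> w; rewrite ger0_norm ?nrm_ge0// nrmE.
have p1 : 1 <= p by have := p2; lra.
have p0 : 0 < p by lra.
have S0 : 0 <= \sum_j `|a i j * Y i w 0 j| by apply: sumr_ge0.
rewrite -[leRHS](powRr1 S0) -[in leRHS](mulfV (lt0r_neq0 p0)) powRrM.
apply: ler_powRl; [by rewrite invr_ge0 ltW|exact: sum_powR_ge0|].
exact: (@sum_powR_le R _ xpredT _ p p1 (fun j => normr_ge0 _)).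
Qed.

Lemma allL_kappa : allL P kappa.
Proof. by apply: allL_bigmax => i; exact: allL_nrm_wrow. Qed.

Definition wrows (y : rows n m) (i : bool * 'I_m) (j : 'I_n) : R := a i.2 j * (y i : 'rV[R]_n) 0 j.

Lemma wrows_mix s z i j : wrows (mix Y s z) i j = wrow i.2 (if i.1 (+) s i.2 then z.2 else z.1) j.
Proof. by []. Qed.

Lemma meas_power_sum s u : measurable_fun [set: rows n m] (fun y => power_sum q (wrows y) s u).
Proof.
apply: measurable_sum => i; apply: (measurableT_comp (measurable_powR _)).
apply: measurableT_comp => //; apply: measurable_sum => j.
apply: measurable_funM => //; apply: measurable_funM => //; exact: meas_row_coord.
Qed.

Lemma meas_gain s : measurable_fun [set: rows n m] (fun y => gain q t (wrows y) s).
Proof.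
apply: meas_bigmax => k; apply: measurable_funB; first exact: meas_power_sum.
by apply: measurable_funM => //; exact: meas_power_sum.
Qed.

Lemma power_sum_mix s s' z u : power_sum q (wrows (mix Y s z)) s' u =
  \sum_i `|dot (wrow i (if s' i (+) s i then z.2 else z.1)) u| `^ q.
Proof. by []. Qed.

Lemma allL_power_sum_mix s s' u : allL P2 (fun z => power_sum q (wrows (mix Y s z)) s' u).
Proof.
apply: allL_sum => i /=; apply: allL_powR => //; rewrite /wrows /mix /=.
case: (s' i (+) s i); [exact: (allL_snd (allL_dot_wrow i u))|exact: (allL_fst (allL_dot_wrow i u))].
Qed.

Lemma allL_gain_mix s s' : allL P2 (fun z => gain q t (wrows (mix Y s z)) s').
Proof.
apply: allL_bigmax => k; apply: allLB; first exact: allL_power_sum_mix.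
by apply: allLZ; exact: allL_power_sum_mix.
Qed.

Notation zero := ([ffun=> false] : {ffun 'I_m -> bool}).

Lemma gain_mix s z : gain q t (wrows (mix Y s z)) zero = gain q t (wrows (mix Y zero z)) s.
Proof.
apply: eq_bigr => k _; rewrite !power_sum_mix; congr (_ - _ * _); apply: eq_bigr => i _.
  by rewrite !ffunE addFb addbF.
by rewrite !ffunE addTb addbF.
Qed.

Lemma Ex_gain s : Ex P2 (fun z => gain q t (wrows (mix Y zero z)) s) =
  Ex P2 (fun z => gain q t (wrows (mix Y zero z)) zero).
Proof.
apply/EFin_inj; rewrite !ExE; [|exact/allL_int/allL_gain_mix|exact/allL_int/allL_gain_mix].
rewrite -(mix_law ind s (meas_gain zero)); last by move=> y; exact: gain_ge0.
by apply: eq_integral => z _; rewrite gain_mix.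
Qed.

Lemma kappa_ge i w : nrm p (wrow i w) <= kappa w.
Proof. exact: (le_bigmax 0 (fun i => nrm p (wrow i w))). Qed.

Lemma kappa_ge0 w : 0 <= kappa w. Proof. exact: bigmax_ge_id. Qed.

Lemma allL_kappaq : allL P (fun w => kappa w `^ q).
Proof.
rewrite (_ : (fun w => _) = (fun w => `|kappa w| `^ q)); first exact/allL_powR/allL_kappa.
by apply/funext => w; rewrite ger0_norm// kappa_ge0.
Qed.

(** All exchanges give the same law, so the expectation equals its average over [s], to which
    [gain_sum_le] applies for each pair of samples. *)
Lemma Ex_gain_le : Ex P2 (fun z => gain q t (wrows (mix Y zero z)) zero) <=
  swap_cst q p * ln m%:R * (2 * Ex P (fun w => kappa w `^ q)).
Proof.
set G := Ex _ _; set c := swap_cst q p * ln m%:R.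
have c0 : 0 <= c.
  have pp2 := p2; have C0 := smooth_cst_gt0 pp2.
  rewrite mulr_ge0 ?ln_ge0 ?ler1n ?(leq_trans _ m2)//.
  by rewrite /swap_cst addr_ge0// mulr_ge0 ?powR_ge0// mulr_ge0//; lra.
have aK1 := allL_fst allL_kappaq; have aK2 := allL_snd allL_kappaq.
have K0 w : 0 <= kappa w `^ q by exact: powR_ge0.
have e1 : 2 ^+ m * G = Ex P2 (fun z => \sum_s gain q t (wrows (mix Y zero z)) s).
  rewrite Ex_sum; last by move=> s; exact: allL_gain_mix.
  rewrite (eq_bigr (fun=> G)) => [|s _]; last exact: Ex_gain.
  by rewrite sumr_const card_ffun card_bool card_ord -[RHS]mulr_natl natrX.
have e2 : 2 ^+ m * G <= 2 ^+ m * (c * (2 * Ex P (fun w => kappa w `^ q))).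
  have -> : 2 ^+ m * (c * (2 * Ex P (fun w => kappa w `^ q))) =
      Ex P2 (fun z => 2 ^+ m * c * (kappa z.1 `^ q + kappa z.2 `^ q)).
    rewrite ExZ; last exact: allLD.
    by rewrite ExD// (Ex_fst allL_kappaq K0) (Ex_snd allL_kappaq K0); ring.
  rewrite e1; apply: Ex_le => [||z].
  - by apply: allL_sum => s; exact: allL_gain_mix.
  - by apply: allLZ; exact: allLD.
  have h : forall i, nrm p (wrows (mix Y zero z) i) <= Num.max (kappa z.1) (kappa z.2).
    move=> [b i]; rewrite (_ : wrows _ _ = wrow i (if b then z.2 else z.1)); last first.
      by apply/funext => j; rewrite wrows_mix /= ffunE addbF.
    by rewrite le_max; case: b; rewrite kappa_ge ?orbT.
  apply: le_trans (gain_sum_le p2 pp' q2 m2 t1 h) _.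
  rewrite mulrC -/c ler_wpM2l//; first by rewrite mulr_ge0 ?exprn_ge0.
  by have [_|_] := leP (kappa z.1) (kappa z.2); rewrite ?lerDl ?lerDr.
by move: e2; rewrite ler_pM2l// exprn_gt0.
Qed.

(** With the first sample fixed, integrate out the second: for each [k] the subtracted term has mean
    at most [gain_cst * M], so the maximum for the first sample is at most the conditional mean of
    [gain] plus [gain_cst * M]. *)
Lemma symmetrization M : 0 <= M -> (forall k, Ex P (row_sum (t k)) <= M) ->
  Ex P (fun w => \big[Num.max/0]_k row_sum (t k) w) <=
  swap_cst q p * ln m%:R * (2 * Ex P (fun w => kappa w `^ q)) + gain_cst q * M.
Proof.
move=> M0 hM; have gc0 := gain_cst_ge0 q.
apply: (@le_trans _ _ (Ex P2 (fun z => gain q t (wrows (mix Y zero z)) zero) + gain_cst q * M)); last first.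
  by rewrite lerD2r; exact: Ex_gain_le.
apply: Ex_prod_ge => [|||w||w].
- by apply: allL_bigmax => k; exact: allL_row_sum.
- exact: allL_gain_mix.
- by move=> z; exact: gain_ge0.
- exact: bigmax_ge_id.
- by rewrite mulr_ge0.
pose g w' := gain q t (wrows (mix Y zero (w, w'))) zero.
have g0 w' : 0 <= g w' by exact: gain_ge0.
have mg : measurable_fun [set: T] g.
  have [mz _] := allL_gain_mix zero zero.
  exact: (measurableT_comp mz (pair1_measurable w)).
have ag : allL P g.
  apply: (allL_dom mg _ (allL_cst P (\sum_k row_sum (t k) w))) => w'.
  rewrite ger0_norm//; apply: le_trans (gain_le _ _ _ _) _; apply: ler_sum => k _.
  rewrite power_sum_mix /row_sum; apply: ler_sum => i _.
  by rewrite !ffunE.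
rewrite -ExE; last exact: allL_int.
rewrite -EFinD lee_fin; apply: bigmax_le => [|k _].
  by rewrite addr_ge0 ?mulr_ge0// Ex_ge0.
rewrite -[leLHS](Ex_cst P).
apply: (@le_trans _ _ (Ex P (fun w' => g w' + gain_cst q * row_sum (t k) w'))).
  apply: Ex_le => [||w'].
  - exact: allL_cst.
  - by apply: allLD => //; apply: allLZ; exact: allL_row_sum.
  rewrite -lerBlDr /g /gain.
  apply: le_trans (le_bigmax 0 (fun k => power_sum q (wrows (mix Y zero (w, w'))) zero (t k) -
    gain_cst q * power_sum q (wrows (mix Y zero (w, w'))) (flip zero) (t k)) k).
  rewrite !power_sum_mix; apply: eq_ler; congr (_ - _ * _); apply: eq_bigr => i _.
    by rewrite !ffunE.
  by rewrite !ffunE.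
rewrite ExD//; last by apply: allLZ; exact: allL_row_sum.
by rewrite lerD2l ExZ; [rewrite ler_wpM2l|exact: allL_row_sum].
Qed.

End symmetrization.

Lemma pr_le_sum (R : realType) d (T : measurableType d) (P : probability T R) (I : finType)
  (S : set T) (E : I -> set T) : measurable S -> (forall i, measurable (E i)) ->
  (forall w, S w -> exists i, E i w) -> pr P S <= \sum_i pr P (E i).
Proof.
move=> mS mE SE; rewrite -Ex_indic// (eq_bigr (fun i => Ex P \1_(E i))); last first.
  by move=> i _; rewrite Ex_indic.
rewrite -Ex_sum; last by move=> i; exact: allL_indic.
apply: Ex_le => [||w]; first exact: allL_indic.
  by apply: allL_sum => i; exact: allL_indic.
have h0 i : 0 <= \1_(E i) w :> R by have /andP[] := indic_bounds (R := R) (E i) w.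
rewrite {1}indicE; case: (boolP (w \in S)) => [|_]; last exact: sumr_ge0.
rewrite inE => /SE[i Ei]; rewrite (bigD1 i)//= indicE mem_set//= lerDl.
by apply: sumr_ge0 => k _; exact: h0.
Qed.

(** * Assembly *)

Section max_moment.
Context {R : realType} {d : measure_display} {T : measurableType d}.
Variable P : probability T R.
Variables (n m : nat) (Y : 'I_m -> {RV P >-> borel_rV R n}) (a : 'I_m -> 'I_n -> R).
Variables (p q C K amx : R).
Hypotheses (p2 : 2 <= p) (q2 : 2 <= q) (m2 : (2 <= m)%N).
Hypothesis HL : forall i, log_concave (Y i).
Hypothesis HI : forall i, isotropic (Y i).
Hypotheses (C1 : 1 <= C) (HP : forall i s (J : {set 'I_n}), (0 < s)%N ->
  Ex P (fun w => mass J (fun j => Y i w 0 j) ^+ s) <= (C * (#|J|%:R + s%:R ^+ 2)) ^+ s).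
Hypotheses (hK : forall i, nrm p (a i) <= K) (ha : forall i j, `|a i j| <= amx) (a0 : 0 < amx).

Definition tail_cst : R := 4 * (1 + greedy_cst C p).

Lemma greedy_cst_ge0 : 0 <= greedy_cst C p.
Proof. by rewrite /greedy_cst !mulr_ge0 ?powR_ge0// addr_ge0// mulr_ge0// exprn_ge0// mulr_ge0. Qed.

Lemma K_ge0 : 0 <= K.
Proof. by apply: le_trans (hK (Ordinal (ltnW m2))); exact: nrm_ge0. Qed.

Lemma nrm_tail i r : (0 < r)%N ->
  pr P [set w | tail_cst * (K + r%:R * amx) <= nrm p (wrow Y a i w)] <= expR (- r%:R).
Proof.
move=> r0; have pp := p2; have p0 : 0 < p by lra.
have rR : 1 <= r%:R :> R by rewrite ler1n.
have ra0 : 0 < r%:R * amx by rewrite mulr_gt0//; lra.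
have k0 := K_ge0; set V := K + r%:R * amx.
have V0 : 0 < V by rewrite /V; lra.
have g0 := greedy_cst_ge0.
have B1 : 1 <= 1 + greedy_cst C p by lra.
have B0 : 0 <= tail_cst by rewrite /tail_cst; lra.
have mr : measurable_fun [set: T] (rowsum (Y i) p (a i)).
  by have [] := allL_rowsum (HL i) (HI i) (a i) p2.
apply: le_trans (@row_tail _ _ _ P n (Y i) (HL i) (HI i) C C1 (HP i) p (a i) amx p2 (ha i) r
  ((tail_cst * V) `^ p) r0 _).
  have -> : [set w | tail_cst * V <= nrm p (wrow Y a i w)] =
      [set w | (tail_cst * V) `^ p <= rowsum (Y i) p (a i) w]; last by [].
  apply/seteqP; split => w /=.
    move=> h; have := ler_powRl (ltW p0) (_ : 0 <= tail_cst * V) h.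
    by rewrite nrm_powR//; apply; rewrite mulr_ge0// ltW.
  move=> h; have pi0 : 0 <= p^-1 by rewrite invr_ge0 ltW.
  have := ler_powRl pi0 (powR_ge0 _ _) h.
  have tV : 0 <= tail_cst * V by rewrite mulr_ge0// ltW.
  by rewrite -powRrM mulfV ?gt_eqF// powRr1// nrmE.
have e1 : \sum_j `|a i j| `^ p <= V `^ p.
  rewrite -nrm_powR//; apply: ler_powRl; [exact: ltW|exact: nrm_ge0|].
  by apply: le_trans (hK i) _; rewrite lerDl ltW.
have e2 : (2 * r)%:R `^ p * amx `^ p <= 2 `^ p * V `^ p.
  rewrite -!powRM//; [|exact: ltW|exact: ltW].
  apply: ler_powRl; [exact: ltW|by rewrite mulr_ge0// ltW|].
  by rewrite natrM -mulrA ler_wpM2l// lerDr.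
have Vp : 0 < V `^ p by exact: powR_gt0.
have e3 : 4 <= 2 `^ p :> R.
  have -> : 4 = 2 `^ 2%:R :> R by rewrite powR_mulrn// -natrX.
  by apply: ler_powR => //; rewrite ler1n.
have e4 : 2 `^ p * 2 `^ p * (1 + greedy_cst C p) * V `^ p <= (tail_cst * V) `^ p.
  rewrite powRM ?(ltW V0)// ler_wpM2r ?(ltW Vp)// /tail_cst powRM//; last by lra.
  rewrite (_ : 4 = 2 * 2 :> R) ?powRM//; last by rewrite -natrM.
  rewrite ler_wpM2l ?mulr_ge0 ?powR_ge0//.
  by rewrite -[leLHS]powRr1; [apply: ler_powR => //; lra|lra].
apply: lt_le_trans e4; apply: le_lt_trans (_ : greedy_cst C p * (2 * (2 `^ p * V `^ p)) < _).
  rewrite ler_wpM2l//; apply: le_trans (lerD e1 e2) _.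
  by move: (2 `^ p) (V `^ p) e3 Vp => x y; nra.
move: (2 `^ p) (V `^ p) (greedy_cst C p) e3 Vp g0 => x y g x4 y0 g0'.
have xy : 0 < x * y by apply: mulr_gt0 => //; lra.
have -> : x * x * (1 + g) * y = (x * (1 + g)) * (x * y) by ring.
have -> : g * (2 * (x * y)) = (2 * g) * (x * y) by ring.
rewrite ltr_pM2r//; nra.
Qed.

Notation r0 := (Num.truncn (ln m%:R : R)).+1.
Notation U := (tail_cst * (K + r0%:R * amx)).

Lemma U_gt0 : 0 < U.
Proof.
have k0 := K_ge0; have g0 := greedy_cst_ge0.
by rewrite mulr_gt0// /tail_cst; [lra|rewrite ltr_wpDl// mulr_gt0].
Qed.

Lemma ln_m_le : ln m%:R <= r0%:R :> R.
Proof. by apply/ltW; exact: truncnS_gt. Qed.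

Lemma allL_coord i j : allL P (fun w => Y i w 0 j).
Proof.
rewrite (_ : (fun w => _) = ell (Y i) (unitv j)); first exact: allL_ell.
by apply/funext => w; rewrite ell_unit.
Qed.

(** [l] units of [U] correspond to the exponent [l * r0] in [nrm_tail]; one of these units pays for
    the union over the [m] rows, since [r0 >= ln m]. *)
Lemma kappa_tail l : pr P [set w | l%:R <= kappa Y a p w / U] <= expR 1 * expR (- l%:R).
Proof.
have U0 := U_gt0; have ak := allL_kappa a p2 allL_coord.
have mk c : measurable [set w | c <= kappa Y a p w] by apply: meas_ge; case: ak.
have mn i c : measurable [set w | c <= nrm p (wrow Y a i w)].
  by apply: meas_ge; case: (allL_nrm_wrow a p2 allL_coord i).
have -> : [set w | l%:R <= kappa Y a p w / U] = [set w | l%:R * U <= kappa Y a p w].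
  by apply/seteqP; split=> w /=; rewrite ler_pdivlMr.
case: l => [|l].
  rewrite oppr0 expR0 mulr1; apply: le_trans (pr_le1 P (mk _)) _.
  by rewrite -expR0 ler_expR.
have lR : 1 <= l.+1%:R :> R by rewrite ler1n.
pose E i := [set w | tail_cst * (K + (l.+1 * r0)%:R * amx) <= nrm p (wrow Y a i w)].
apply: (@le_trans _ _ (\sum_i pr P (E i))).
  apply: pr_le_sum => [//|i|w /= h]; first exact: mn.
  have [i hi] : exists i, kappa Y a p w = nrm p (wrow Y a i w).
    rewrite /kappa; set i0 : 'I_m := Ordinal (ltnW m2).
    by rewrite (bigmax_eq_arg 0 i0)// => [|i _]; [eexists|exact: nrm_ge0].
  exists i; rewrite /E /= -hi; apply: le_trans h.
  have k0 := K_ge0; have g0 := greedy_cst_ge0; rewrite mulrCA ler_wpM2l//.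
    by rewrite /tail_cst; lra.
  rewrite natrM; move: (l.+1%:R : R) lR => x x1.
  by rewrite mulrDr -[x * _ * amx]mulrA; have := K_ge0; nra.
apply: (@le_trans _ _ (\sum_(i < m) expR (- (l.+1 * r0)%:R))).
  by apply: ler_sum => i _; apply: nrm_tail; rewrite muln_gt0.
rewrite sumr_const card_ord -[leLHS]mulr_natl -expRD.
have m0 : 0 < m%:R :> R by rewrite ltr0n (leq_trans _ m2).
rewrite -[X in X * _](lnK (x := m%:R)) ?posrE// -expRD ler_expR natrM.
have := ln_m_le; have : 1 <= r0%:R :> R by rewrite ler1n.
move: (r0%:R : R) => x x1; rewrite -natr1; have : 0 <= l%:R :> R by [].
move: (l%:R : R) (ln m%:R) => y z; nra.
Qed.

Definition moment_cst : R :=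
  (3 * tail_cst) `^ q * (1 + 5 * expR 1 * (2 * (Num.truncn q).+1%:R) ^+ (Num.truncn q).+1).

Lemma max_moment : Ex P (fun w => kappa Y a p w `^ q) <= moment_cst * (K + ln m%:R * amx) `^ q.
Proof.
have qq := q2; have q0 : 0 <= q by lra.
have U0 := U_gt0; have ak := allL_kappa a p2 allL_coord; set k := (Num.truncn q).+1.
have qk : q <= k%:R by apply/ltW; exact: truncnS_gt.
have kU w : 0 <= kappa Y a p w / U by rewrite divr_ge0 ?kappa_ge0// ltW.
have af : allL P (fun w => kappa Y a p w / U) by apply: allLM => //; exact: allL_cst.
have tl l : pr P ([set: T] `&` [set w | l%:R <= kappa Y a p w / U]) <= expR 1 * expR (- l%:R).
  by rewrite setTI; exact: kappa_tail.
have [_ hk] := tail_moment measurableT (allL_meas af) kU tl k.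
have {}hk : Ex P (fun w => (kappa Y a p w / U) ^+ k) <= 5 * expR 1 * (2 * k%:R) ^+ k.
  apply: le_trans hk; apply: eq_ler; apply: (f_equal (Ex P)); apply/funext => w.
  by rewrite indicT mul1r.
apply: (@le_trans _ _ (U `^ q * (1 + 5 * expR 1 * (2 * k%:R) ^+ k))).
  apply: (@le_trans _ _ (Ex P (fun w => U `^ q * (1 + (kappa Y a p w / U) ^+ k)))).
    apply: Ex_le => [||w]; first exact: (allL_kappaq a p2 q2 allL_coord).
      by apply: allLZ; apply: allLD; [exact: allL_cst|exact: allLX].
    have -> : kappa Y a p w `^ q = U `^ q * (kappa Y a p w / U) `^ q.
      by rewrite -(powRM q (ltW U0) (kU w)) mulrC (divfK (lt0r_neq0 U0)).
    by rewrite ler_wpM2l ?powR_ge0//; exact: powR_le_nat.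
  rewrite ExZ; last by apply: allLD; [exact: allL_cst|exact: allLX].
  by rewrite ler_wpM2l ?powR_ge0// ExD; [rewrite Ex_cst lerD2l|exact: allL_cst|exact: allLX].
have k0 := K_ge0; have g0 := greedy_cst_ge0.
have B0 : 0 <= tail_cst by rewrite /tail_cst; lra.
have L0 := @ln_ge_half R m m2.
have M0 : 0 <= K + ln m%:R * amx by rewrite addr_ge0// mulr_ge0//; [lra|exact: ltW].
have c0 : 0 <= 1 + 5 * expR 1 * (2 * k%:R) ^+ k :> R.
  by rewrite addr_ge0// mulr_ge0 ?exprn_ge0 ?mulr_ge0 ?expR_ge0.
have rl : r0%:R <= 3 * ln m%:R :> R.
  have L1 : 0 <= ln m%:R :> R by lra.
  by have := Num.Theory.truncn_le (ln m%:R : R); rewrite L1 -natr1; lra.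
have h : U <= 3 * tail_cst * (K + ln m%:R * amx).
  have -> : 3 * tail_cst * (K + ln m%:R * amx) = tail_cst * (3 * (K + ln m%:R * amx)) by ring.
  by apply: ler_wpM2l => //; have := ler_wpM2r (ltW a0) rl; lra.
apply: le_trans (ler_wpM2r c0 (ler_powRl q0 (ltW U0) h)) _.
have B3 : 0 <= 3 * tail_cst by rewrite mulr_ge0.
by rewrite (powRM q B3 M0) /moment_cst mulrAC.
Qed.

End max_moment.

(** * Lower bound for the first absolute moment *)

Section entry_lower.
Context {R : realType} {d : measure_display} {T : measurableType d}.
Variables (P : probability T R) (n : nat) (Z : {RV P >-> borel_rV R n}).
Hypotheses (HL : log_concave Z) (HI : isotropic Z).

(** 10 * 4 is the constant of [moment_bound] at order 4. *)
Definition abs_cst : R := (8 * (10 * 4) ^+ 2)^-1.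

(* [y ^ 2 <= b |y| + y ^ 4 / b ^ 2] and the fourth moment is bounded. *)
Lemma Ex_abs_ge j : abs_cst <= Ex P (fun w => `|ell Z (unitv j) w|).
Proof.
pose h : R := 10 * 4; set e := Ex P _; have aY := allL_ell HL HI (unitv j).
have uu : dot (unitv j) (unitv j) = 1 :> R.
  rewrite /dot (bigD1 j)//= big1 => [|i ij]; last by rewrite /unitv (negbTE ij) mul0r.
  by rewrite /unitv eqxx mulr1 addr0.
have h1 : Ex P (fun w => ell Z (unitv j) w ^+ 2) = 1 by rewrite Ex_ell2.
have h4 : Ex P (fun w => `|ell Z (unitv j) w| ^+ 4) <= 5 * h ^+ 4.
  have u1 : dot (unitv j) (unitv j) <= 1 ^+ 2 :> R by rewrite uu expr1n.
  by have := moment_bound HL HI 4 ltr01 u1; rewrite mulr1.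
have hh : 0 < h ^+ 2 by rewrite exprn_gt0// /h mulr_gt0.
have key : 1 <= 4 * h ^+ 2 * e + (16 * h ^+ 4)^-1 * (5 * h ^+ 4).
  have ab := allL_abs aY; rewrite -{1}h1.
  apply: (@le_trans _ _ (Ex P (fun w => 4 * h ^+ 2 * `|ell Z (unitv j) w| +
      (16 * h ^+ 4)^-1 * `|ell Z (unitv j) w| ^+ 4))).
    apply: Ex_le => [||w]; first exact: allLX.
      by apply: allLD; apply: allLZ => //; exact: allLX.
    rewrite -real_normK ?num_real//; move: (`|_|) (normr_ge0 (ell Z (unitv j) w)) => y y0.
    have -> : 16 * h ^+ 4 = (4 * h ^+ 2) ^+ 2 by ring.
    have : 0 < 4 * h ^+ 2 by rewrite mulr_gt0.
    move: (4 * h ^+ 2) => b b0; have [yb|yb] := leP y b.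
      by apply: ler_wpDr; [rewrite mulr_ge0 ?invr_ge0 ?exprn_ge0// ltW|rewrite expr2 ler_wpM2r].
    apply: ler_wpDl; first by rewrite mulr_ge0// ltW.
    rewrite ler_pdivlMl ?exprn_gt0// (_ : y ^+ 4 = y ^+ 2 * y ^+ 2); last by ring.
    by rewrite ler_wpM2r ?exprn_ge0// lerXn2r ?nnegrE ?(ltW b0)// ltW.
  rewrite ExD; [|exact: allLZ|by apply: allLZ; exact: allLX].
  rewrite (ExZ _ ab) (ExZ _ (allLX 4 ab)) lerD2l ler_wpM2l// invr_ge0 mulr_ge0// exprn_ge0//.
  by rewrite /h mulr_ge0.
have e5 : (16 * h ^+ 4)^-1 * (5 * h ^+ 4) = 5 / 16 by field; rewrite /h gt_eqF// mulr_gt0.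
rewrite e5 in key; rewrite /abs_cst -/h -[leLHS]mulr1 ler_pdivrMl ?mulr_gt0//.
by move: key; move: (h ^+ 2) e => x y; lra.
Qed.

End entry_lower.

(* The tangent line at the weighted mean lies below [x `^ r]. *)
Lemma powR_jensen (R : realType) (I : finType) (lam x : I -> R) (r : R) : 1 <= r ->
  (forall i, 0 <= lam i) -> (forall i, 0 <= x i) -> \sum_i lam i <= 1 ->
  (\sum_i lam i * x i) `^ r <= \sum_i lam i * x i `^ r.
Proof.
move=> r1 l0 x0 L1; set s := \sum_i lam i * x i.
have s0 : 0 <= s by apply: sumr_ge0 => i _; rewrite mulr_ge0.
have rr : 0 < r by lra.
have [->|sn] := eqVneq s 0.
  by rewrite powR0 ?gt_eqF//; apply: sumr_ge0 => i _; rewrite mulr_ge0 ?powR_ge0.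
have s1 : 0 < s by rewrite lt_def sn.
have tang i : s `^ r * (1 + r * (x i / s - 1)) <= x i `^ r.
  have u0 : 0 <= x i / s by rewrite divr_ge0.
  have -> : x i `^ r = s `^ r * (x i / s) `^ r by rewrite -powRM// mulrC divfK.
  rewrite ler_wpM2l ?powR_ge0//.
  have := @powR_bernoulli R r^-1 ((x i / s) `^ r) (powR_ge0 _ _).
  rewrite invr_gt0 rr invf_le1// r1 => /(_ isT).
  rewrite -powRrM mulfV ?gt_eqF// powRr1// => h.
  have := ler_wpM2l (ltW rr) h.
  have -> : r * (1 + r^-1 * ((x i / s) `^ r - 1)) = r + ((x i / s) `^ r - 1) by field; rewrite gt_eqF.
  by lra.
apply: (@le_trans _ _ (\sum_i lam i * (s `^ r * (1 + r * (x i / s - 1))))); last first.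
  by apply: ler_sum => i _; rewrite ler_wpM2l.
have -> : \sum_i lam i * (s `^ r * (1 + r * (x i / s - 1))) =
    s `^ r * ((1 - r) * \sum_i lam i + r / s * s).
  rewrite {4}/s !mulr_sumr -big_split/= mulr_sumr; apply: eq_bigr => i _.
  by ring.
rewrite mulfVK// -[leLHS]mulr1 ler_wpM2l ?powR_ge0//; nra.
Qed.

(** * Mean of the power sum at a fixed vector *)

Section assembly.
Context {R : realType}.
Variables (p p' q : R).
Hypotheses (p2 : 2 <= p) (pp' : p^-1 + p'^-1 = 1) (q2 : 2 <= q).

Lemma conj_bounds : 1 <= p' <= 2.
Proof.
have pp := p2; have p'0 := conj_gt0 p2 pp'.
have h : p'^-1 = 1 - p^-1 by have := pp'; lra.
have pi : 0 <= p^-1 by rewrite invr_ge0; lra.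
have pi2 : p^-1 <= 2^-1 by rewrite lef_pV2 ?posrE//; lra.
by apply/andP; split; rewrite -lef_pV2 ?posrE// h ?invr1; lra.
Qed.

Lemma nrm_le1 (J : finType) (u : J -> R) : nrm p' u <= 1 -> \sum_j `|u j| `^ p' <= 1.
Proof.
move=> u1; rewrite -nrm_powR; last exact: conj_gt0 p2 pp'.
rewrite -(powR_1l p'); apply: ler_powRl => //; last exact: nrm_ge0.
by apply: ltW; exact: conj_gt0 p2 pp'.
Qed.

Lemma coord_le1 (J : finType) (u : J -> R) j : nrm p' u <= 1 -> `|u j| <= 1.
Proof.
move=> /nrm_le1 h; have p'0 := conj_gt0 p2 pp'.
have h1 : `|u j| `^ p' <= 1.
  by apply: le_trans h; rewrite (bigD1 j)//= lerDl sumr_ge0// => i _; exact: powR_ge0.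
rewrite leNgt; apply/negP => h2.
have : `|u j| `^ 1 <= `|u j| `^ p' by apply: ler_powR; [exact: ltW|have /andP[] := conj_bounds].
by rewrite powRr1//; lra.
Qed.

(** All coordinates are at most 1 and [p' <= 2], so squares are at most powers of order [p']. *)
Lemma sum_sqr_le1 (J : finType) (u : J -> R) : nrm p' u <= 1 -> \sum_j u j ^+ 2 <= 1.
Proof.
move=> u1; apply: le_trans (nrm_le1 u1); apply: ler_sum => j _.
rewrite -real_normK ?num_real// -powR_mulrn//.
have := coord_le1 j u1; have := normr_ge0 (u j); move: `|u j| => x x0 x1.
have [->|xn] := eqVneq x 0; first by rewrite powR0 ?powR_ge0// pnatr_eq0.
have x00 : 0 < x by rewrite lt_def xn.
rewrite !powR_expR// ler_expR.
have l0 : ln x <= 0 by rewrite ln_le0.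
have /andP[_ h] := conj_bounds; nra.
Qed.

Section row_sum_mean.
Context {d : measure_display} {T : measurableType d}.
Variable P : probability T R.
Variables (n m : nat) (Y : 'I_m -> {RV P >-> borel_rV R n}) (a : 'I_m -> 'I_n -> R) (L : R).
Hypothesis HL : forall i, log_concave (Y i).
Hypothesis HI : forall i, isotropic (Y i).
Hypothesis hL : forall j, nrm q (fun i => a i j) <= L.

Notation k := (Num.truncn q).+1.
Definition mean_cst : R := 1 + 5 * (10 * k%:R) ^+ k.

Lemma dot_wrow i (u : 'I_n -> R) w : dot (wrow Y a i w) u = ell (Y i) (fun j => a i j * u j) w.
Proof. by apply: eq_bigr => j _; rewrite /wrow mulrAC. Qed.

Lemma Ex_powR_ell i z : Ex P (fun w => `|ell (Y i) z w| `^ q) <= mean_cst * (dot z z) `^ (q / 2).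
Proof.
have qq := q2; have q0 : 0 < q by lra.
have qk : q <= k%:R by apply/ltW; exact: truncnS_gt.
have al := allL_ell (HL i) (HI i) z.
have D0 : 0 <= dot z z by apply: sumr_ge0 => j _; rewrite -expr2 sqr_ge0.
have c0 : 0 <= mean_cst by rewrite /mean_cst addr_ge0// mulr_ge0// exprn_ge0// mulr_ge0.
have [Dz|Dn] := eqVneq (dot z z) 0.
  have z0 j : z j = 0.
    move: Dz; rewrite /dot => /eqP; rewrite psumr_eq0 => [/allP/(_ j (mem_index_enum _))|].
      by rewrite mulf_eq0 orbb => /eqP.
    by move=> l _; rewrite -expr2 sqr_ge0.
  rewrite [X in Ex P X](_ : _ = fun=> 0) ?Ex_cst ?mulr_ge0 ?powR_ge0//.
  apply/funext => w; rewrite /ell /lf big1 => [|j _]; last by rewrite z0 mul0r.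
  by rewrite normr0 powR0// gt_eqF.
have D1 : 0 < dot z z by rewrite lt_def Dn.
pose N := Num.sqrt (dot z z); have N0 : 0 < N by rewrite sqrtr_gt0.
have NN : dot z z <= N ^+ 2 by rewrite sqr_sqrtr.
have -> : dot z z `^ (q / 2) = N `^ q.
  by rewrite /N -powR12_sqrt// -powRrM; congr (_ `^ _); field.
have ab := allL_abs al.
have aX : allL P (fun w => (`|ell (Y i) z w| / N) ^+ k).
  by apply: allLX; apply: allLM => //; exact: allL_cst.
apply: (@le_trans _ _ (Ex P (fun w => N `^ q * (1 + (`|ell (Y i) z w| / N) ^+ k)))).
  apply: Ex_le => [||w]; first by apply: allL_powR => //; exact: ltW.
    by apply: allLZ; apply: allLD => //; exact: allL_cst.
  have e0 : 0 <= `|ell (Y i) z w| / N by rewrite divr_ge0// ltW.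
  have -> : `|ell (Y i) z w| `^ q = N `^ q * (`|ell (Y i) z w| / N) `^ q.
    by rewrite -(powRM q (ltW N0) e0) mulrC (divfK (lt0r_neq0 N0)).
  by rewrite ler_wpM2l ?powR_ge0//; apply: powR_le_nat => //; exact: ltW.
rewrite ExZ; last by apply: allLD => //; exact: allL_cst.
rewrite mulrC ler_wpM2r ?powR_ge0// ExD//; last exact: allL_cst.
rewrite Ex_cst /mean_cst lerD2l.
rewrite [X in Ex P X](_ : _ = fun w => N ^- k * `|ell (Y i) z w| ^+ k); last first.
  by apply/funext => w; rewrite expr_div_n mulrC.
rewrite (ExZ _ (allLX k ab)) ler_pdivrMl ?exprn_gt0//.
apply: le_trans (moment_bound (HL i) (HI i) k N0 NN) _.
by apply: eq_ler; rewrite [(10 * k%:R * N) ^+ k]exprMn; ring.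
Qed.

(** Jensen with the weights u_j^2, whose sum is at most 1, bounds the power q / 2 of the variance in
    row i by the weighted sum of |a_ij|^q; summing over i leaves q-th powers of column norms. *)
Lemma Ex_row_sum u : 0 <= L -> nrm p' u <= 1 -> Ex P (row_sum Y a q u) <= mean_cst * L `^ q.
Proof.
move=> L0 u1; have qq := q2; have q0 : 0 < q by lra.
have c0 : 0 <= mean_cst by rewrite /mean_cst addr_ge0// mulr_ge0// exprn_ge0// mulr_ge0.
rewrite /row_sum Ex_sum; last first.
  move=> i; apply: allL_powR; first exact: ltW.
  by under eq_fun do rewrite dot_wrow; exact: allL_ell.
apply: (@le_trans _ _ (\sum_i mean_cst * \sum_j u j ^+ 2 * `|a i j| `^ q)).
  apply: ler_sum => i _; under [X in Ex P X]eq_fun do rewrite dot_wrow.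
  apply: le_trans (Ex_powR_ell i _) _; rewrite ler_wpM2l//.
  have -> : dot (fun j => a i j * u j) (fun j => a i j * u j) = \sum_j u j ^+ 2 * `|a i j| ^+ 2.
    by apply: eq_bigr => j _; rewrite real_normK ?num_real//; ring.
  apply: le_trans (powR_jensen _ _ _ _) _ => //; first by lra.
  - by move=> j; exact: sqr_ge0.
  - exact: sum_sqr_le1.
  apply: ler_sum => j _; rewrite ler_wpM2l ?sqr_ge0// -powR_mulrn// -powRrM.
  by apply: eq_ler; congr (_ `^ _); field.
rewrite -mulr_sumr ler_wpM2l// exchange_big/=.
apply: (@le_trans _ _ (\sum_j u j ^+ 2 * L `^ q)).
  apply: ler_sum => j _; rewrite -mulr_sumr ler_wpM2l ?sqr_ge0//.
  by rewrite -(nrm_powR (fun i => a i j))//; apply: ler_powRl; [exact: ltW|exact: nrm_ge0|].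
by rewrite -mulr_suml -[leRHS]mul1r ler_wpM2r ?powR_ge0// sum_sqr_le1.
Qed.

End row_sum_mean.

End assembly.

(** * Discretization of the unit ball *)

Section grid.
Context {R : realType}.
Variables (p p' q : R) (n m G : nat).
Hypotheses (p2 : 2 <= p) (pp' : p^-1 + p'^-1 = 1) (q2 : 2 <= q) (m0 : (0 < m)%N) (n0 : (0 < n)%N).
Hypothesis GE : G = (n * m)%N.

Definition grid_point (k : {ffun 'I_n -> 'I_(2 * G).+1}) (j : 'I_n) : R :=
  ((k j)%:R - G%:R) / G%:R.

(** Points outside the ball are replaced by 0, so that every index is admissible. *)
Definition grid k : 'I_n -> R := if nrm p' (grid_point k) <= 1 then grid_point k else fun=> 0.

Let p'0 : 0 < p'. Proof. exact: conj_gt0 p2 pp'. Qed.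

Let GR : 0 < G%:R :> R. Proof. by rewrite ltr0n GE muln_gt0 n0 m0. Qed.

Lemma grid_le1 k : nrm p' (grid k) <= 1.
Proof.
rewrite /grid; case: ifP => // _; rewrite nrmE big1 => [|j _]; last by rewrite normr0 powR0// gt_eqF.
by rewrite powR0// invr_eq0 gt_eqF.
Qed.

(* Rounding towards 0 keeps the point in the unit ball. *)
Lemma round_coord (x : R) : `|x| <= 1 -> exists c : 'I_(2 * G).+1,
  `|(c%:R - G%:R) / G%:R| <= `|x| /\ `|x - (c%:R - G%:R) / G%:R| <= G%:R^-1 :> R.
Proof.
move=> x1; pose r := Num.truncn (`|x| * G%:R); have G0 := GR.
have xG : 0 <= `|x| * G%:R by rewrite mulr_ge0// ltW.
have r1 : r%:R <= `|x| * G%:R by rewrite truncn_le.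
have r2 : `|x| * G%:R < r%:R + 1 by rewrite natr1 truncnS_gt.
have rG : (r <= G)%N by rewrite -(ler_nat R); apply: le_trans r1 _; nra.
have rd : 0 <= r%:R / G%:R :> R by rewrite divr_ge0// ltW.
have h1 : r%:R / G%:R <= `|x| by rewrite ler_pdivrMr.
have h2 : `|x| - r%:R / G%:R <= G%:R^-1.
  have -> : `|x| - r%:R / G%:R = (`|x| * G%:R - r%:R) * G%:R^-1 by field; rewrite gt_eqF.
  by rewrite -[leRHS]mul1r ler_wpM2r ?invr_ge0 ?(ltW G0)//; lra.
have [x0|x0] := leP 0 x.
  have cb : (G + r < (2 * G).+1)%N by rewrite ltnS mul2n -addnn leq_add2l.
  exists (Ordinal cb) => /=; rewrite natrD addrAC subrr add0r.
  rewrite [X in X <= _ /\ _]ger0_norm//; split=> //.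
  by rewrite ger0_norm//; move: h1 h2; rewrite ger0_norm//; lra.
have cb : (G - r < (2 * G).+1)%N by rewrite ltnS; apply: leq_trans (leq_subr _ _) _; rewrite leq_pmull.
exists (Ordinal cb) => /=; rewrite natrB// addrAC subrr add0r mulNr.
rewrite normrN [X in X <= _ /\ _]ger0_norm//; split=> //.
move: h1 h2; rewrite ltr0_norm// => h1 h2.
by rewrite opprK ler0_norm; lra.
Qed.

Lemma round_vec (t : 'I_n -> R) : nrm p' t <= 1 -> exists k, forall j, `|t j - grid k j| <= G%:R^-1.
Proof.
move=> t1; have /choice[c hc] : forall j, exists c : 'I_(2 * G).+1,
  `|(c%:R - G%:R) / G%:R| <= `|t j| /\ `|t j - (c%:R - G%:R) / G%:R| <= G%:R^-1 :> R.
  by move=> j; apply: round_coord; exact: (coord_le1 p2 pp').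
exists [ffun j => c j] => j; rewrite /grid ifT; first by rewrite /grid_point ffunE; case: (hc j).
apply: le_trans t1; rewrite !nrmE; apply: ler_powRl; [by rewrite invr_ge0 ltW|exact: sum_powR_ge0|].
apply: ler_sum => i _; apply: ler_powRl => //; first exact: ltW.
by rewrite /grid_point ffunE; case: (hc i).
Qed.

Lemma unit_grid (j : 'I_n) : exists k, grid k = unitv j.
Proof.
have G0 := GR; have cb : (2 * G < (2 * G).+1)%N by [].
have cG : (G < (2 * G).+1)%N by rewrite ltnS leq_pmull.
pose k : {ffun 'I_n -> 'I_(2 * G).+1} := [ffun i => if i == j then Ordinal cb else Ordinal cG].
have e : grid_point k = unitv j.
  apply/funext => i; rewrite /grid_point ffunE /unitv.
  case: (i == j) => /=; last by rewrite subrr mul0r.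
  by rewrite natrM; field; rewrite gt_eqF.
exists k; rewrite /grid e ifT// nrmE (bigD1 j)//= big1 => [|i ij]; last first.
  by rewrite /unitv (negbTE ij) normr0 powR0// gt_eqF.
by rewrite /unitv eqxx normr1 addr0 !powR1.
Qed.

Lemma powR_le_id (x r : R) : 0 <= x <= 1 -> 1 <= r -> x `^ r <= x.
Proof.
move=> /andP[x0 x1] r1; have [->|xn] := eqVneq x 0; first by rewrite powR0// gt_eqF//; lra.
have x00 : 0 < x by rewrite lt_def xn.
rewrite powR_expR// -[leRHS]lnK ?posrE// ler_expR.
by have : ln x <= 0 by [rewrite ln_le0|]; nra.
Qed.

(** The grid contains the unit vectors, so every entry of [X] is at most M^(1/q). With mesh 1 / (n
    m) the rounding error in a row is then at most M^(1/q) / m, and the q-th powers of these errors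
    sum to at most M. *)
Lemma grid_sum (X : 'I_m -> 'I_n -> R) (M : R) :
  (forall k, \sum_i `|dot (X i) (grid k)| `^ q <= M) ->
  forall t, nrm p' t <= 1 -> \sum_i `|dot (X i) t| `^ q <= 2 * 2 `^ q * M.
Proof.
move=> hM t t1; have qq := q2; have q0 : 0 < q by lra.
have G0 := GR; have mR : 1 <= m%:R :> R by rewrite ler1n.
have [k hk] := round_vec t1.
have M0 : 0 <= M by apply: le_trans (hM k); apply: sumr_ge0 => i _; exact: powR_ge0.
pose mu := M `^ q^-1; have mu0 : 0 <= mu by exact: powR_ge0.
have hX i j : `|X i j| <= mu.
  have [k' ek] := unit_grid j; have := hM k'; rewrite ek (bigD1 i)//= => h.
  have {}h : `|X i j| `^ q <= M.
    have e : dot (X i) (unitv j) = X i j.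
      rewrite /dot (bigD1 j)//= big1 => [|l lj]; last by rewrite /unitv (negbTE lj) mulr0.
      by rewrite /unitv eqxx mulr1 addr0.
    by apply: le_trans h; rewrite e lerDl; apply: sumr_ge0 => l _; exact: powR_ge0.
  have qi : 0 <= q^-1 by rewrite invr_ge0 ltW.
  by have := ler_powRl qi (powR_ge0 _ _) h; rewrite -powRrM mulfV ?gt_eqF// powRr1.
pose v j := t j - grid k j.
have dv i : `|dot (X i) v| <= mu / m%:R.
  apply: le_trans (ler_norm_sum _ _ _) _.
  apply: (@le_trans _ _ (\sum_(j < n) mu * G%:R^-1)).
    by apply: ler_sum => j _; rewrite normrM; apply: ler_pM; [by []|by []|exact: hX|exact: hk].
  rewrite sumr_const card_ord -[leLHS]mulr_natl GE natrM; apply: eq_ler; field.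
  by rewrite !pnatr_eq0 -!lt0n n0 m0.
have dvq i : `|dot (X i) v| `^ q <= M / m%:R.
  apply: le_trans (ler_powRl (ltW q0) (normr_ge0 _) (dv i)) _.
  have mi : 0 <= (m%:R^-1 : R) <= 1 by rewrite invr_ge0 ler0n invf_le1//; lra.
  have /andP[mi0 _] := mi.
  rewrite powRM// /mu -powRrM mulVf ?gt_eqF// powRr1// ler_wpM2l//.
  by apply: powR_le_id => //; lra.
have split i : `|dot (X i) t| `^ q <= 2 `^ q * (`|dot (X i) (grid k)| `^ q + M / m%:R).
  have -> : dot (X i) t = dot (X i) (grid k) + dot (X i) v.
    by rewrite /dot -big_split/=; apply: eq_bigr => j _; rewrite /v; ring.
  apply: le_trans (ler_powRl (ltW q0) (normr_ge0 _) (ler_normD _ _)) _.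
  apply: le_trans (powR_addl (normr_ge0 _) (normr_ge0 _) _) _; first by lra.
  by rewrite ler_wpM2l ?powR_ge0// lerD2l.
apply: le_trans (ler_sum _ (fun i _ => split i)) _.
rewrite -mulr_sumr big_split/= sumr_const card_ord.
have -> : (M / m%:R) *+ m = M by rewrite -mulr_natr divfK// gt_eqF//; lra.
rewrite [2 * _]mulrC -mulrA ler_wpM2l ?powR_ge0//.
by have := hM k; lra.
Qed.

Lemma opnorm_le (X : 'M[R]_(m, n)) (M : R) : 0 <= M ->
  (forall k, \sum_i `|dot (X i) (grid k)| `^ q <= M) ->
  0 <= opnorm p' q X <= (2 * 2 `^ q * M) `^ q^-1.
Proof.
move=> M0 hM; have qq := q2; have q0 : 0 < q by lra.
have ub : ubound [set lnorm q (t *m X^T) | t in [set t : 'rV[R]_n | lnorm p' t <= 1]]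
    ((2 * 2 `^ q * M) `^ q^-1).
  move=> _ [t /= t1 <-]; rewrite /lnorm.
  have qi : 0 <= q^-1 by rewrite invr_ge0 ltW.
  apply: ler_powRl => //; first by apply: sumr_ge0 => i _; exact: powR_ge0.
  have t1' : nrm p' (fun j => t 0 j) <= 1 by rewrite nrmE.
  apply: le_trans (grid_sum hM t1'); apply: eq_ler; apply: eq_bigr => i _.
  rewrite /dot mxE; congr (`|_| `^ _); apply: eq_bigr => j _.
  by rewrite mxE mulrC.
have ne : [set lnorm q (t *m X^T) | t in [set t : 'rV[R]_n | lnorm p' t <= 1]] (lnorm q (0 *m X^T)).
  exists 0 => //=; rewrite /lnorm big1 => [|j _]; last by rewrite mxE normr0 powR0// gt_eqF.
  by rewrite powR0// invr_eq0 gt_eqF.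
apply/andP; split; last by apply: ge_sup => //; exists (lnorm q (0 *m X^T)).
apply: le_trans (_ : lnorm q (0 *m X^T) <= _); first exact: powR_ge0.
by apply: ub_le_sup => //; exists ((2 * 2 `^ q * M) `^ q^-1).
Qed.

End grid.

(** The integral of a nonnegative function is a supremum over the simple functions below it, hence
    monotone without measurability of [f]. This applies to the operator norm, a supremum over
    uncountably many vectors. *)
Lemma expectation_le (R : realType) d (T : measurableType d) (P : probability T R) (f g : T -> R) :
  allL P g -> (forall w, 0 <= f w <= g w) -> ('E_P[f] <= (Ex P g)%:E)%E.
Proof.
move=> hg fg; rewrite unlock ExE; last exact: allL_int.
rewrite !ge0_integralTE; last 2 first.
- by move=> w; rewrite lee_fin; case/andP: (fg w) => h1 h2; exact: le_trans h2.
- by move=> w; rewrite lee_fin; case/andP: (fg w).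
apply: ge_ereal_sup => _ [h /= hf <-]; apply: ereal_sup_ubound; exists h => //= w.
by apply: le_trans (hf w) _; rewrite lee_fin; case/andP: (fg w).
Qed.

Lemma expectation_Ex (R : realType) d (T : measurableType d) (P : probability T R) (f : T -> R) :
  allL P f -> ('E_P[f] = (Ex P f)%:E)%E.
Proof. by move=> hf; rewrite unlock ExE//; exact: allL_int. Qed.

(** * The weighted matrix *)

Section weighted.
Context {R : realType} {d : measure_display} {T : measurableType d}.
Variable P : probability T R.
Variables (p p' q C : R) (n m : nat) (A : 'M[R]_(m, n)) (Y : 'I_m -> {RV P >-> borel_rV R n}).
Hypotheses (p2 : 2 <= p) (q2 : 2 <= q) (pp' : p^-1 + p'^-1 = 1) (m2 : (2 <= m)%N) (n1 : (1 <= n)%N).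
Hypotheses (ind : independent Y) (HI : forall i, isotropic (Y i)) (HL : forall i, log_concave (Y i)).
Hypotheses (C1 : 1 <= C) (HP : forall i s (J : {set 'I_n}), (0 < s)%N ->
  Ex P (fun w => mass J (fun j => Y i w 0 j) ^+ s) <= (C * (#|J|%:R + s%:R ^+ 2)) ^+ s).
Notation W := (weighted_matrix A Y).
Notation K := (max_row_lnorm p A).
Notation L := (max_col_lnorm q A).
Notation amx := (max_entry A).

Lemma weighted_row w i : W w i = wrow Y A i w.
Proof. by apply/funext => j; rewrite mxE. Qed.

Lemma nrm_row_le i : nrm p (A i) <= K.
Proof.
apply: le_trans (le_bigmax 0 (fun i => lnorm p (row i A)) i).
by rewrite nrmE /lnorm; under [in leRHS]eq_bigr do rewrite mxE.
Qed.

Lemma nrm_col_le j : nrm q (fun i => A i j) <= L.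
Proof.
apply: le_trans (le_bigmax 0 (fun j => lnorm q (col j A)^T) j).
by rewrite nrmE /lnorm; under [in leRHS]eq_bigr do rewrite !mxE.
Qed.

Lemma entry_le i j : `|A i j| <= amx.
Proof. exact: (le_bigmax 0 (fun ij : 'I_m * 'I_n => `|A ij.1 ij.2|) (i, j)). Qed.

Lemma allL_max_entry : allL P (fun w => max_entry (W w)).
Proof.
apply: allL_bigmax => -[i j] /=; apply: allL_abs.
under eq_fun do rewrite weighted_row; apply: allLZ; exact: allL_coord.
Qed.

(** The entry at the position of the largest |A_ij| already has an absolute mean of this size. *)
Lemma Ex_max_entry_ge : @abs_cst R * amx <= Ex P (fun w => max_entry (W w)).
Proof.
have i0 : 'I_m * 'I_n := (Ordinal (ltnW m2), Ordinal n1).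
rewrite {1}/max_entry (bigmax_eq_arg 0 i0)//; set ij := [arg max_(_ > _) _]%O.
case: ij => i j /=; rewrite mulrC.
apply: le_trans (ler_wpM2l (normr_ge0 _) (Ex_abs_ge (HL i) (HI i) j)) _.
have al := allL_abs (allL_ell (HL i) (HI i) (unitv j)).
rewrite -(ExZ _ al); apply: Ex_le => [||w]; [exact: allLZ|exact: allL_max_entry|].
apply: le_trans (le_bigmax 0 (fun ij : 'I_m * 'I_n => `|W w ij.1 ij.2|) (i, j)).
by rewrite /= weighted_row normrM ell_unit.
Qed.

Definition main_cst : R :=
  2 * swap_cst q p * moment_cst p q C + gain_cst q * mean_cst q.

Notation b := (ln m%:R `^ q^-1 * K + L + ln m%:R `^ (1 + q^-1) * amx).
Notation Grid := {ffun 'I_n -> 'I_(2 * (n * m)).+1}.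
Notation gr := (@grid R p' n (n * m)).
Notation F w := (\big[Num.max/0]_(k : Grid) row_sum Y A q (gr k) w).

Lemma Ex_F_le : 0 < amx -> Ex P (fun w => F w) <= main_cst * b `^ q.
Proof.
move=> a0; have qq := q2; have q0 : 0 < q by lra.
have K0 : 0 <= K by exact: bigmax_ge_id.
have L0 : 0 <= L by exact: bigmax_ge_id.
have l0 : 0 < ln m%:R :> R by have := @ln_ge_half R m m2; lra.
set l := ln m%:R in l0 *.
have t1 : forall k : Grid, nrm p' (gr k) <= 1 by move=> k; exact: (grid_le1 p2 pp').
have mc0 : 0 <= mean_cst q by rewrite /mean_cst addr_ge0// mulr_ge0// exprn_ge0// mulr_ge0.
have M0 : 0 <= mean_cst q * L `^ q by rewrite mulr_ge0// powR_ge0.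
have hM (k : Grid) : Ex P (row_sum Y A q (gr k)) <= mean_cst q * L `^ q.
  exact: (Ex_row_sum p2 pp' q2 HL HI nrm_col_le L0 (t1 k)).
apply: le_trans (symmetrization p2 pp' q2 m2 t1 ind (allL_coord HL HI) M0 hM) _.
have mm := max_moment p2 q2 m2 HL HI C1 HP nrm_row_le entry_le a0.
rewrite -/l in mm *; rewrite /main_cst [leRHS]mulrDl; apply: lerD.
  have sc : 0 <= swap_cst q p.
    have C0 := smooth_cst_gt0 p2.
    by rewrite /swap_cst addr_ge0// mulr_ge0 ?powR_ge0// mulr_ge0//; lra.
  have mo : 0 <= moment_cst p q C.
    rewrite /moment_cst mulr_ge0 ?powR_ge0// addr_ge0// mulr_ge0 ?mulr_ge0 ?expR_ge0//.
  (* The factor [l] moved inside the q-th power gives l^(1/q) in front of the row norms and l^(1 +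
     1/q) in front of the largest entry. *)
  have ll : l * (K + l * amx) `^ q <= b `^ q.
    have e : l * (K + l * amx) `^ q = (l `^ q^-1 * (K + l * amx)) `^ q.
      rewrite powRM ?powR_ge0//; last by rewrite addr_ge0// mulr_ge0// ltW.
      by rewrite -powRrM mulVf ?gt_eqF// powRr1// ltW.
    rewrite e; apply: ler_powRl; first exact: ltW.
      by rewrite mulr_ge0 ?powR_ge0// addr_ge0// mulr_ge0// ltW.
    rewrite powRD; last by rewrite (lt0r_neq0 l0) implybT.
    by rewrite powRr1 ?(ltW l0)// -/l mulrDr mulrA [l `^ q^-1 * l]mulrC; lra.
  apply: (@le_trans _ _ (2 * swap_cst q p * moment_cst p q C * (l * (K + l * amx) `^ q))); last first.
    by apply: ler_wpM2l => //; exact: (mulr_ge0 (mulr_ge0 (ler0n R 2) sc) mo).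
  have h0 : 0 <= swap_cst q p * l * 2 := mulr_ge0 (mulr_ge0 sc (ltW l0)) (ler0n R 2).
  have := ler_wpM2l h0 mm; move: (Ex P _) (_ `^ q) (swap_cst q p) (moment_cst _ _ _) => x y z t h.
  by lra.
rewrite -mulrA ler_wpM2l ?gain_cst_ge0// ler_wpM2l//; apply: ler_powRl => //; first exact: ltW.
have x0 : 0 <= l `^ q^-1 * K by rewrite mulr_ge0 ?powR_ge0.
have y0 : 0 <= l `^ (1 + q^-1) * amx by rewrite mulr_ge0 ?powR_ge0// ltW.
by lra.
Qed.

Lemma opnorm_F w : 0 <= opnorm p' q (W w) <= (2 * 2 `^ q * F w) `^ q^-1.
Proof.
apply: (opnorm_le p2 pp' q2 (ltnW m2) n1 erefl) => [|k]; first exact: bigmax_ge_id.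
apply: le_trans (le_bigmax 0 (fun k => row_sum Y A q (gr k) w) k).
by apply: eq_ler; apply: eq_bigr => i _; rewrite weighted_row.
Qed.

Lemma expectation_opnorm : 0 < amx ->
  ('E_P[fun w => opnorm p' q (W w)] <= ((1 + 2 * 2 `^ q * main_cst) * b)%:E)%E.
Proof.
move=> a0; have qq := q2; have q0 : 0 < q by lra.
have K0 : 0 <= K by exact: bigmax_ge_id.
have L0 : 0 <= L by exact: bigmax_ge_id.
have l0 : 0 < ln m%:R :> R by have := @ln_ge_half R m m2; lra.
have FE := Ex_F_le a0; have b0 : 0 < b.
  by rewrite ltr_wpDl ?mulr_gt0 ?powR_gt0// addr_ge0// mulr_ge0// powR_ge0.
move: (b) FE b0 => b FE b0.
have aF : allL P (fun w => F w).
  by apply: allL_bigmax => k; apply: allL_row_sum => //; exact: allL_coord.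
(* In place of Jensen for the q-th root: pointwise x^(1/q) <= b + b (x^(1/q) / b)^q, which is linear
   in x. *)
pose g w := b + b * b^-1 `^ q * (2 * 2 `^ q) * F w.
have ag : allL P g by apply: allLD; [exact: allL_cst|exact: allLZ].
apply: (le_trans (expectation_le ag _)) => [w|].
  have /andP[-> h] := opnorm_F w; apply: le_trans h _.
  have F0 : 0 <= 2 * 2 `^ q * F w by rewrite mulr_ge0 ?mulr_ge0 ?powR_ge0// bigmax_ge_id.
  rewrite /g; move: (2 * 2 `^ q) (F w) F0 => c f; rewrite -mulrA; move: (c * f) => x x0.
  have qi : 0 <= q^-1 by rewrite invr_ge0 ltW.
  have [xb|bx] := leP (x `^ q^-1) b.
    by apply: le_trans xb _; rewrite lerDl !mulr_ge0 ?powR_ge0// ltW.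
  apply: ler_wpDl; first exact: ltW.
  have y1 : 1 <= b^-1 * x `^ q^-1 by rewrite ler_pdivlMl// mulr1 ltW.
  have e : x = (x `^ q^-1) `^ q by rewrite -powRrM mulVf ?gt_eqF// powRr1.
  rewrite {2}e -mulrA -powRM ?powR_ge0 ?invr_ge0 ?(ltW b0)//.
  rewrite -[leLHS](mulVKf (lt0r_neq0 b0)) ler_wpM2l ?(ltW b0)//.
  by rewrite -[leLHS]powRr1; [apply: ler_powR => //; lra|exact: le_trans y1].
rewrite lee_fin /g ExD; [|exact: allL_cst|exact: allLZ].
rewrite Ex_cst (ExZ _ aF) [leRHS]mulrDl mul1r lerD2l.
have c0 : 0 <= b * b^-1 `^ q * (2 * 2 `^ q) by rewrite !mulr_ge0 ?powR_ge0// ltW.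
apply: le_trans (ler_wpM2l c0 FE) _.
have bb : b^-1 `^ q * b `^ q = 1.
  by rewrite -powRM ?invr_ge0 ?(ltW b0)// mulVf ?gt_eqF// powR1.
have -> : b * b^-1 `^ q * (2 * 2 `^ q) * (main_cst * b `^ q) =
  2 * 2 `^ q * main_cst * b * (b^-1 `^ q * b `^ q) by ring.
by rewrite bb mulr1.
Qed.

Lemma opnorm_eq0 w : amx = 0 -> opnorm p' q (W w) = 0.
Proof.
move=> a0; have qq := q2; have q0 : 0 < q by lra.
have A0 i j : A i j = 0 by apply/eqP; rewrite -normr_le0 -a0; exact: entry_le.
have F0 : F w = 0.
  apply/eqP; rewrite eq_le bigmax_ge_id andbT; apply: bigmax_le => // k _.
  rewrite /row_sum big1// => i _; rewrite /dot big1 => [|j _]; last by rewrite /wrow A0 !mul0r.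
  by rewrite normr0 powR0// gt_eqF.
have := opnorm_F w; rewrite F0 mulr0 powR0 ?invr_eq0 ?gt_eqF// => h.
by apply/eqP; rewrite eq_le andbC.
Qed.

End weighted.

Theorem theorem1p1 (R : realType) (p q : R) (hp : 2 <= p) (hq : 2 <= q) :
  exists C : R,
    forall (p' : R), p^-1 + p'^-1 = 1 ->
    forall (m n : nat), (2 <= m)%N -> (1 <= n)%N ->
    forall (d : measure_display) (T : measurableType d) (P : probability T R)
      (Y : 'I_m -> {RV P >-> borel_rV R n}) (A : 'M[R]_(m, n)),
    independent Y -> identically_distributed Y ->
    (forall i, isotropic (Y i)) -> (forall i, log_concave (Y i)) ->
    ('E_P[fun w => opnorm p' q (weighted_matrix A Y w)] <=
     C%:E * ((ln m%:R `^ q^-1 * max_row_lnorm p A)%:E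
             + (max_col_lnorm q A)%:E
             + (ln m%:R `^ (1 + q^-1))%:E
               * 'E_P[fun w => max_entry (weighted_matrix A Y w)]))%E.
Proof.
have [Cp Cp1 HP] := paouris R.
set M := main_cst p q Cp.
(* The absolute value makes the first factor nonnegative; the second pays for replacing the largest
   |A_ij| by the expected largest entry of X. *)
exists ((1 + 2 * 2 `^ q * `|M|) * (1 + (@abs_cst R)^-1)) => p' pp' m n m2 n1 d T P Y A ind _ HI HL.
have HPi i s (J : {set 'I_n}) : (0 < s)%N ->
  Ex P (fun w => mass J (fun j => Y i w 0 j) ^+ s) <= (Cp * (#|J|%:R + s%:R ^+ 2)) ^+ s.
  by move=> s0; exact: (HP _ _ _ _ _ (HL i) (HI i)).
rewrite (expectation_Ex (allL_max_entry A HI HL)).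
set E := Ex P _; rewrite [X in (_ <= X)%E](_ : _ = ((1 + 2 * 2 `^ q * `|M|) * (1 + abs_cst^-1) *
  (ln m%:R `^ q^-1 * max_row_lnorm p A + max_col_lnorm q A + ln m%:R `^ (1 + q^-1) * E))%:E)//.
have E0 : 0 <= E by apply: Ex_ge0 => w; exact: bigmax_ge_id.
have K0 : 0 <= max_row_lnorm p A by exact: bigmax_ge_id.
have L0 : 0 <= max_col_lnorm q A by exact: bigmax_ge_id.
have ac0 : 0 < @abs_cst R by rewrite invr_gt0 mulr_gt0// exprn_gt0// mulr_gt0.
have c1 : 0 <= 1 + 2 * 2 `^ q * `|M| by rewrite addr_ge0// !mulr_ge0 ?powR_ge0.
have ac1 : 0 < (@abs_cst R)^-1 by rewrite invr_gt0.
have x0 : 0 <= ln m%:R `^ q^-1 * max_row_lnorm p A by rewrite mulr_ge0 ?powR_ge0.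
have y0 : 0 <= ln m%:R `^ (1 + q^-1) :> R by exact: powR_ge0.
(* For the zero matrix the scale [b] by which [expectation_opnorm] divides would vanish. *)
have [a0|an] := eqVneq (max_entry A) 0.
  rewrite (_ : (fun w => _) = fun=> 0); last first.
    by apply/funext => w; exact: (opnorm_eq0 Y hp hq pp' m2 n1).
  rewrite (expectation_Ex (allL_cst P 0)) Ex_cst lee_fin.
  apply: mulr_ge0; first by rewrite mulr_ge0//; lra.
  by rewrite addr_ge0 ?mulr_ge0// addr_ge0.
have a0 : 0 < max_entry A by rewrite lt_def an bigmax_ge_id.
apply: le_trans (expectation_opnorm hp hq pp' m2 n1 ind HI HL Cp1 HPi a0) _.
rewrite lee_fin -/M -[leRHS]mulrA.
have Ea : max_entry A <= (@abs_cst R)^-1 * E.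
  by rewrite ler_pdivlMl//; exact: Ex_max_entry_ge.
have b0 : 0 <= ln m%:R `^ q^-1 * max_row_lnorm p A + max_col_lnorm q A +
    ln m%:R `^ (1 + q^-1) * max_entry A by rewrite !addr_ge0// mulr_ge0// ltW.
apply: (@le_trans _ _ ((1 + 2 * 2 `^ q * `|M|) * (ln m%:R `^ q^-1 * max_row_lnorm p A + max_col_lnorm q A +
    ln m%:R `^ (1 + q^-1) * max_entry A))).
  rewrite ler_wpM2r// lerD2l ler_wpM2l ?ler_norm// mulr_ge0// powR_ge0.
rewrite ler_wpM2l//; have h := ler_wpM2l y0 Ea; have yE : 0 <= ln m%:R `^ (1 + q^-1) * E by rewrite mulr_ge0.
move: h yE; rewrite mulrCA; move: (_ * max_entry A) (_ * E) (_ * max_row_lnorm p A) x0 (max_col_lnorm q A) L0 ((@abs_cst R)^-1) ac1.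
by move=> u v x x0' L L0' r r0 h v0; nra.
Qed.
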